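(* Let $k',k$ be non-negative integers with $k'\geqslant k$ and $k'>0$, let $\Delta=\Delta_{k,k'}$ be the kite with vertices $(0,0),(\pm1,k),(0,k+k')$, and let $(X,\mathcal{L})$ be the corresponding polarized toric surface. Then for any integer $g\geqslant 1$, the number of irreducible components of the Severi variety $V^{\mathrm{irr}}_{g,\mathcal{L}}$ is bounded from below by $\#_{k,k',g}$.
   Context: Everything is over the field $\mathbb{C}$. For a lattice polygon $\Delta\subset\mathbb{R}^2$, $\Delta^\circ$ and $\partial\Delta$ denote its interior and boundary. The polarized toric surface $(X,\mathcal{L})$ associated to $\Delta$ is the projective toric surface $X$ with lattice of monomials $\mathbb{Z}^2$ whose fan is the dual (normal) fan of $\Delta$, together with the ample line bundle $\mathcal{L}$ whose global sections are the Laurent polynomials $\sum_{m\in\Delta\cap\mathbb{Z}^2}c_mx^m$. The Severi variety $V^{\mathrm{irr}}_{g,\mathcal{L}}\subset|\mathcal{L}|$ is the locus of integral nodal curves of geometric genus $g$ that contain no zero-dimensional torus orbits of $X$. For a sublattice $M\subseteq\mathbb{Z}^2$ set $\delta_M(\Delta,g):=|\Delta^\circ\cap M|-g$. The number $\#_{k,k',g}$ is the number of sublattices $M\subseteq\mathbb{Z}^2$ satisfying (a) $\partial\Delta\cap M=\partial\Delta\cap\mathbb{Z}^2$ and (b) $|\Delta^\circ\cap M|\geqslant g$, for $\Delta=\Delta_{k,k'}$, counted with the following multiplicities: if the index of $M$ in $\mathbb{Z}^2$ is odd, the multiplicity is the number of integers $0\leqslant\kappa\leqslant\min\{\delta_M(\Delta,g),g\}$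 that are congruent to $\delta_M(\Delta,g)$ modulo $2$; if the index is even, the multiplicity is one. (For $k=0$ the polygon $\Delta_{0,k'}$ is the triangle with vertices $(\pm1,0),(0,k')$.) *)

(* Defs.v *)
From HB Require Import structures.
From mathcomp Require Import all_boot all_order all_algebra finmap.
From mathcomp Require Import all_classical all_reals all_analysis.
(* the notations of mpoly clash with those of all_analysis *)
From mathcomp Require mpoly.
Import (canonicals, coercions) mpoly.
From mathcomp Require Import complex.
Set Implicit Arguments.
Unset Strict Implicit.
Unset Printing Implicit Defensive.
Import Order.TTheory GRing.Theory Num.Theory.
Import numFieldNormedType.Exports.
Local Open Scope classical_set_scope.
Local Open Scope ring_scope.

Notation Z2 := (int * int)%type.

Definition pairing (u m : Z2) : int := u.1 * m.1 + u.2 * m.2.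

(** * Lattice polygons and sublattices *)

Section Polygons.
Variable R : realType.

Definition real_point (m : Z2) : R * R := (m.1%:~R, m.2%:~R).

Definition convex_hull (vs : seq Z2) : set (R * R) :=
  [set p | exists2 w : 'I_(size vs) -> R,
     (forall i, 0 <= w i) /\ \sum_i w i = 1 &
     p = (\sum_i w i * (vs`_i).1%:~R, \sum_i w i * (vs`_i).2%:~R)].

Definition lattice_points (A : set (R * R)) : set Z2 := real_point @^-1` A.

Definition boundary (A : set (R * R)) : set (R * R) := closure A `\` interior A.

Definition kite (k k' : nat) : set (R * R) :=
  convex_hull [:: (0, 0); (1, k%:Z); (-1, k%:Z); (0, (k + k')%:Z)].

Definition sublattice (M : set Z2) : Prop :=
  M 0 /\ forall a b, M a -> M b -> M (a - b).

(* [fset_set] is empty on infinite sets, so an infinite index is read as 0;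
   a sublattice containing the boundary lattice points of a polygon with 0 on
   its boundary has finite index. *)
Definition lattice_index (M : set Z2) : nat :=
  #|` fset_set (range (fun a : Z2 => [set b | M (b - a)]))|.

Definition interior_count (D : set (R * R)) (M : set Z2) : nat :=
  #|` fset_set (lattice_points (interior D) `&` M)|.

Definition delta_ (D : set (R * R)) (g : nat) (M : set Z2) : nat :=
  (interior_count D M - g)%N.

Definition admissible_sublattice (D : set (R * R)) (g : nat) (M : set Z2) :=
  [/\ sublattice M,
      lattice_points (boundary D) `&` M = lattice_points (boundary D) &
      (g <= interior_count D M)%N].

Definition multiplicity (D : set (R * R)) (g : nat) (M : set Z2) : nat :=
  if odd (lattice_index M) then
    (\sum_(kappa < (minn (delta_ D g M) g).+1 |
            kappa == delta_ D g M %[mod 2]) 1)%N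
  else 1%N.

Definition sharp (k k' g : nat) : nat :=
  \big[addn/0%N]_(M \in admissible_sublattice (kite k k') g)
    multiplicity (kite k k') g M.

End Polygons.

Arguments kite : clear implicits.

(** * Projective space with its Zariski topology *)

Section Irreducibility.
Variables (T : Type) (closed : set (set T)).

Definition irreducible_subset (A : set T) : Prop :=
  A !=set0 /\
  forall Z1 Z2, closed Z1 -> closed Z2 -> A `<=` Z1 `|` Z2 ->
    A `<=` Z1 \/ A `<=` Z2.

Definition irreducible_components (V : set T) : set (set T) :=
  [set A | [/\ A `<=` V, irreducible_subset A &
     forall B, B `<=` V -> irreducible_subset B -> A `<=` B -> A = B]].

End Irreducibility.

Section ProjectiveSpace.
Variables (F : fieldType) (I : finType).

Definition proj : Type := {L : {vspace {ffun I -> F^o}} | (\dim L == 1)%N}.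

(* The zero vector of a line does no harm below: a homogeneous polynomial that
   vanishes at the nonzero vectors of the line also vanishes at 0. *)
Definition zariski_closed : set (set proj) :=
  [set Z | exists S : set (mpoly.mpoly #|I| F),
     (forall p, S p -> exists d, p \is mpoly.ishomog1 d mpoly.mdeg) /\
     Z = [set L : proj | forall p (v : {ffun I -> F^o}), S p -> v \in val L ->
                    mpoly.meval (fun i => v (enum_val i)) p = 0]].

End ProjectiveSpace.

(** * Laurent polynomials *)

Definition laurent (F : fieldType) := {fsfun Z2 -> F with 0}.

Section Laurent.
Variable F : fieldType.
Implicit Types f g h q : laurent F.

Definition lmul f g (m : Z2) : F := \sum_(a <- finsupp f) f a * g (m - a).

Definition lone (m : Z2) : F := (m == 0)%:R.

(* g lies in the ideal (f) *)
Definition ldvd f (g : Z2 -> F) : Prop := exists q, g =1 lmul q f.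

Definition leval (K : fieldType) (iota : {rmorphism F -> K}) (x y : K) f : K :=
  \sum_(m <- finsupp f) iota (f m) * x ^ m.1 * y ^ m.2.

End Laurent.

(** * Genus of a function field *)

Section Genus.
Variables (F K : fieldType) (iota : {rmorphism F -> K}).

(* Normalized discrete valuations of K that are trivial on F; the value at 0,
   which should be infinite, is set to 0 so that distinct functions are
   distinct valuations. *)
Definition place : set (K -> int) :=
  [set v | [/\ v 0 = 0,
     {in [pred z | z != 0] &, {morph v : a b / a * b >-> a + b}},
     forall a b, a != 0 -> b != 0 -> a + b != 0 ->
       Num.min (v a) (v b) <= v (a + b),
     forall c, c != 0 -> v (iota c) = 0 &
     exists2 t, t != 0 & v t = 1]].

Definition divisor (D : (K -> int) -> int) : Prop :=
  finite_set (place `&` [set v | D v != 0]).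

(* For F algebraically closed all places have degree one. *)
Definition degree (D : (K -> int) -> int) : int := \sum_(v \in place) D v.

Definition riemann_roch_space (D : (K -> int) -> int) : set K :=
  [set z | z = 0 \/ forall v, place v -> - D v <= v z].

Definition has_dimension (V : set K) (n : nat) : Prop :=
  exists b : 'I_n -> K,
    [/\ forall i, V (b i),
        forall a : 'I_n -> F, \sum_i iota (a i) * b i = 0 -> forall i, a i = 0 &
        forall z, V z -> exists a : 'I_n -> F, z = \sum_i iota (a i) * b i].

(* g = max { deg D - l(D) + 1 : D a divisor } *)
Definition has_genus (g : nat) : Prop :=
  (exists D l, [/\ divisor D, has_dimension (riemann_roch_space D) l &
                   degree D - l%:Z + 1 = g%:Z]) /\
  (forall D l, divisor D -> has_dimension (riemann_roch_space D) l ->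
               degree D - l%:Z + 1 <= g%:Z).

End Genus.

(** * Curves on the polarized toric surface of a polygon, Severi varieties *)

Section Toric.
Variables (R : realType) (D : set (R * R)).
Local Notation C := (R[i]).

Definition monomials : {fset Z2} := fset_set (lattice_points D).

Definition linear_system : Type := proj C monomials.

Definition section_poly (c : {ffun monomials -> C^o}) : laurent C :=
  [fsfun m : monomials => c m | 0].

(* The zero-dimensional orbits of X correspond to the vertices v of D. The
   orbit of v is the point m |-> [m = 0] of Spec C[cone(D - v) /\ Z^2], and
   x^{-v} f is an equation of the curve of f on this chart. *)
Definition vertex (v : Z2) : Prop :=
  v \in monomials /\
  exists u, forall m, m \in monomials -> m != v -> pairing u v < pairing u m.

Definition fixed_point (m : Z2) : C := (m == 0)%:R.

Definition contains_orbit_of (f : laurent C) (v : Z2) : Prop :=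
  \sum_(m <- finsupp f) f m * fixed_point (m - v) = 0.

Definition avoids_fixed_points (f : laurent C) : Prop :=
  forall v, vertex v -> ~ contains_orbit_of f v.

(* The complement of the zero-dimensional orbits in X is smooth, and covered
   by the charts A^1 x G_m of the edges of D: u is the primitive inner normal
   of an edge, (u, w) a basis of the dual lattice, h the minimum of u on D, and
   x^m = s^<u,m> t^<w,m> in the coordinates (s, t) on the chart. *)
Definition edge_chart (u w : Z2) (h : int) : Prop :=
  [/\ u.1 * w.2 - u.2 * w.1 = 1,
      forall m, m \in monomials -> h <= pairing u m &
      exists m m', [/\ m \in monomials, m' \in monomials, m != m',
                       pairing u m = h & pairing u m' = h]].

Definition ffactz (a : int) (i : nat) : int := \prod_(l < i) (a - l%:Z).

(* Partial derivative (d/ds)^i (d/dt)^j of the local equation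
   sum_m f_m s^(<u,m> - h) t^<w,m> of the curve, at (s, t). Terms with a
   negative exponent of s have coefficient 0. *)
Definition local_eq (f : laurent C) (u w : Z2) (h : int) (i j : nat) (s t : C)
    : C :=
  \sum_(m <- finsupp f) f m *
    (ffactz (pairing u m - h) i * ffactz (pairing w m) j)%:~R *
    s ^ (pairing u m - h - i%:Z) * t ^ (pairing w m - j%:Z).

(* For curves that avoid the zero-dimensional orbits: every singular point is
   an ordinary double point. *)
Definition nodal (f : laurent C) : Prop :=
  forall u w h, edge_chart u w h ->
  forall s t, t != 0 ->
    let d := fun i j => local_eq f u w h i j s t in
    d 0%N 0%N = 0 -> d 1%N 0%N = 0 -> d 0%N 1%N = 0 ->
    d 1%N 1%N ^+ 2 - d 2%N 0%N * d 0%N 2%N != 0.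

(* A curve that avoids the zero-dimensional orbits contains no boundary divisor
   of X, so it is the closure of its intersection with the torus, and it is
   integral iff C[Z^2]/(f) is an integral domain. *)
Definition integral_curve (f : laurent C) : Prop :=
  [/\ exists m, f m != 0,
      ~ ldvd f (@lone C) &
      forall g h : laurent C, ldvd f (lmul g h) -> ldvd f g \/ ldvd f h].

(* K, with the images x, y of the coordinates, is the fraction field of
   C[Z^2]/(f). *)
Definition function_field (f : laurent C) (K : fieldType)
    (iota : {rmorphism C -> K}) (x y : K) : Prop :=
  [/\ x != 0, y != 0,
      forall g, leval iota x y g = 0 <-> ldvd f g &
      forall z, exists g h : laurent C,
        leval iota x y h != 0 /\ z = leval iota x y g / leval iota x y h].

Definition geometric_genus (f : laurent C) (g : nat) : Prop :=
  exists (K : fieldType) (iota : {rmorphism C -> K}) (x y : K),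
    function_field f iota x y /\ has_genus iota g.

Definition severi (g : nat) : set linear_system :=
  [set L : linear_system | exists c : {ffun monomials -> C^o}, [/\ c \in val L, c != 0 &
     let f := section_poly c in
     [/\ avoids_fixed_points f, integral_curve f, nodal f &
         geometric_genus f g]]].

Definition severi_components (g : nat) : set (set linear_system) :=
  irreducible_components (@zariski_closed C monomials) (severi g).

End Toric.

Arguments monomials {R} D.
Arguments linear_system {R} D.
Arguments severi {R} D g.
Arguments severi_components {R} D g.

(* Main.v *)
From HB Require Import structures.
From mathcomp Require Import all_boot all_order all_algebra finmap.
From mathcomp Require Import all_classical all_reals all_analysis.
From mathcomp Require mpoly generic_quotient.
Import (canonicals, coercions) mpoly.
From mathcomp Require Import complex.
From mathcomp Require Import fieldext separable polyrcf fraction.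
From mathcomp Require Import ring lra zify.
Require Import Defs.
Set Implicit Arguments.
Unset Strict Implicit.
Unset Printing Implicit Defensive.
Import Order.TTheory GRing.Theory Num.Theory.
Import numFieldNormedType.Exports.
Local Open Scope classical_set_scope.
Local Open Scope ring_scope.

(** A curve of the linear system is f = a x y^k + b y^k / x + p(y), a double
    cover of the y-line with discriminant p^2 - 4 a b y^(2k).  If f is integral,
    nodal and of geometric genus g, the discriminant is sg^2 h with sg h separable
    and deg h = 2 g + 2: a Pell equation, the normalization being the
    hyperelliptic curve s^2 = h(y).  Two invariants are constant on irreducible
    families of solutions: the set of d such that p + sg s is, up to a constant,
    a d-th power in the ring C[y] + C[y] s, and, writing sg = u v with
    u | p - 2 c y^k and v | p + 2 c y^k, c^2 = a b, the integer
    kappa = |deg u - deg v|.  The first one is the solvability of a linear system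
    of differential equations with coefficients h and sg, whose local constancy
    follows from Nakayama's lemma; the second one is read off a linear system
    for an interpolating polynomial.  The sublattices in the definition of
    sharp are the M_d = { (i, j) : d | j - k i } with d a common divisor
    of k + k' and 2 k.  Each pair (M_d, kappa) that is counted is realized by
    a real polynomial p which is a d-th Dickson polynomial in a polynomial q of
    degree (k + k') / d with prescribed double points on the graphs of
    +- 2 y^(k / d).  *)

(** * Discrete valuations *)

(** Write W = p + sg s. A d-th root z of W, up to a constant, satisfies d X z' / z = X W' / W = k +
    tau / s with tau a polynomial: a nonlinear condition becomes a linear system. Its unsolvability
    is open because injectivity of a matrix is. The crux is that solvability is open too: a solution
    could be lost under a deformation, but the d-th power of an approximate solution shows that the
    obstruction lies in the image of the operator, hence vanishes. Open conditions suffice since two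
    nonempty open subsets of an irreducible set meet; so functions on the set of solutions,
    polynomial in the coefficients, replace a scheme or an analytic topology. The genus is a
    supremum over divisors of an abstract field, so all places of the curve s^2 = h(y) and Riemann's
    inequality are built by hand. That the real example has no d'-th root unless d' divides d is
    seen on one band, where q / (2 y^(K/2)), with K = 2k/d, runs from -1 to 1: the argument of W
    varies by d pi, that of a d'-th root by d pi / d', and the root is real at both ends. *)

Section DiscreteValuation.
Variables (F K : fieldType) (iota : {rmorphism F -> K}) (U m : K -> Prop).
Variable t : K.
Hypotheses (U1 : U 1) (UM : forall a b, U a -> U b -> U (a * b)).
Hypothesis mM : forall a b, m a -> U b \/ m b -> m (a * b).
Hypothesis Um_add :
  forall a b, U a \/ m a -> U b \/ m b -> U (a + b) \/ m (a + b).
Hypotheses (Um : forall a, U a -> ~ m a) (m0 : m 0).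
Hypothesis Uiota : forall c, c != 0 -> U (iota c).
Hypotheses (mt : m t) (t0 : t != 0).
Hypothesis frac : forall z, exists a b,
  [/\ U a \/ m a, U b \/ m b, b != 0 & z * b = a].
Hypothesis factor : forall a, U a \/ m a -> a != 0 ->
  exists (k : nat) u u', [/\ U u, U u' & a * u = t ^+ k * u'].

Let U0 u : U u -> u != 0.
Proof. by move=> hu; apply/eqP => u0; apply: (Um hu); rewrite u0. Qed.

(** In the application [U \/ m] is the coordinate ring of an affine curve, [m] the ideal of a point
    and [U] its complement, whose elements need not be invertible in the ring. The valuation ring is
    the localization, so an order [k] is witnessed by a fraction over [U]. *)
Let val (z : K) (k : int) :=
  exists u u', [/\ U u, U u' & z * u = t ^ k * u'].

Let val_ex z : z != 0 -> exists k, val z k.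
Proof.
move=> z0; have [a [b [ha hb b0 zb]]] := frac z.
have a0 : a != 0 by rewrite -zb mulf_neq0.
have [k [u [u' [hu hu' e]]]] := factor ha a0.
have [l [w [w' [hw hw' f]]]] := factor hb b0.
exists (k%:Z - l%:Z), (u * w'), (u' * w); split; [exact: UM|exact: UM|].
have tl : t ^ (k%:Z - l%:Z) * t ^+ l = t ^+ k.
  by rewrite !exprnP -expfzDr // subrK.
apply: (mulIf (expf_neq0 l t0)).
have -> : z * (u * w') * t ^+ l = z * u * (t ^+ l * w') by ring.
have -> : t ^ (k%:Z - l%:Z) * (u' * w) * t ^+ l =
    t ^ (k%:Z - l%:Z) * t ^+ l * u' * w by ring.
rewrite -f tl -e -zb; ring.
Qed.

Let t_nat k : m (t ^+ k.+1).
Proof.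
elim: k => [|k IH]; first by rewrite expr1.
by rewrite exprS; apply: mM => //; right.
Qed.

Let val_ge0 z k : val z k -> (exists a b, [/\ U a \/ m a, U b & z * b = a]) ->
  0 <= k.
Proof.
move=> [u [u' [hu hu' e]]] [a [b [ha hb f]]].
case: k e => k // e; exfalso.
have tk : t ^+ k.+1 != 0 by rewrite expf_neq0.
have : a * u * t ^+ k.+1 = b * u'.
  have -> : a * u * t ^+ k.+1 = z * u * b * t ^+ k.+1 by rewrite -f; ring.
  by rewrite e NegzE -exprnN; move: tk; move: (t ^+ k.+1) => A A0; field.
move=> h; apply: (Um (UM hb hu')); rewrite -h mulrC.
apply: mM; first exact: t_nat.
case: ha => ha; [left; exact: UM|right; apply: mM => //; by left].
Qed.

Let val_int z k : val z k -> 0 <= k ->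
  exists a b, [/\ U a \/ m a, U b & z * b = a].
Proof.
move=> [u [u' [hu hu' e]]]; case: k e => k // e _.
exists (t ^+ k * u'), u; split=> //.
case: k e => [|k] e; first by left; rewrite expr0 mul1r.
by right; apply: mM; [exact: t_nat|left].
Qed.

Let valM z w k l : val z k -> val w l -> val (z * w) (k + l).
Proof.
move=> [u [u' [hu hu' e]]] [x [x' [hx hx' f]]].
exists (u * x), (u' * x'); split; [exact: UM|exact: UM|].
by rewrite expfzDr // mulrACA e f mulrACA.
Qed.

Let valV z k : z != 0 -> val z k -> val z^-1 (- k).
Proof.
move=> z0 [u [u' [hu hu' e]]]; exists u', u; split=> //.
apply: (mulfI z0); rewrite mulrA mulfV // mul1r mulrCA e mulrA.
by rewrite -expfzDr // addNr mul1r.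
Qed.

Let val_uniq z k l : z != 0 -> val z k -> val z l -> k = l.
Proof.
have le k' l' : z != 0 -> val z k' -> val z l' -> k' <= l'.
  move=> z0 hk hl; rewrite -subr_ge0; apply: (@val_ge0 1).
    by rewrite -(mulfV z0); apply: valM => //; exact: valV.
  by exists 1, 1; split=> //; [left|rewrite mulr1].
by move=> z0 hk hl; apply/eqP; rewrite eq_le !le.
Qed.

Lemma dvr_place : exists v : K -> int,
  [/\ place iota v, v t = 1, forall u, U u -> v u = 0,
      forall a, m a -> a != 0 -> 0 < v a &
      forall z, z != 0 -> 0 <= v z ->
        exists a b, [/\ U a \/ m a, U b & z * b = a]].
Proof.
have ex z : exists k, if z == 0 then k = 0 else val z k.
  by case: eqP => [_|/eqP/val_ex//]; exists 0.
have [v hv] := choice ex.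
have vP z : z != 0 -> val z (v z).
  by move=> z0; move: (hv z); rewrite (negPf z0).
have vE z k : z != 0 -> val z k -> v z = k.
  by move=> z0 h; apply: (val_uniq z0 _ h); exact: vP.
have valU u : U u -> val u 0.
  by move=> hu; exists 1, u; split=> //; rewrite mulr1 expr0z mul1r.
have vU u : U u -> v u = 0 by move=> hu; apply: vE; [exact: U0|exact: valU].
have vt : v t = 1.
  by apply: vE => //; exists 1, 1; split=> //; rewrite !mulr1 expr1z.
exists v; split => //.
- split.
  + by have := hv 0; rewrite eqxx.
  + move=> a b; rewrite !inE => a0 b0; apply: vE; first exact: mulf_neq0.
    by apply: valM; exact: vP.
  + move=> a b a0 b0 ab0.
    wlog le : a b a0 b0 ab0 / v a <= v b.
      move=> W; have /orP[h|h] := le_total (v a) (v b); first exact: W.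
      by rewrite minC addrC; apply: W => //; rewrite addrC.
    rewrite (min_idPl le).
    have [c [d [hc hd e]]] : exists c d, [/\ U c \/ m c, U d & (b / a) * d = c].
      apply: (@val_int _ (v b - v a)); last by rewrite subr_ge0.
      by apply: valM; [exact: vP|apply: valV => //; exact: vP].
    have q0 : 1 + b / a != 0.
      by rewrite -(mulfV a0) -mulrDl mulf_neq0 ?invr_eq0.
    have ge0 : 0 <= v (1 + b / a).
      apply: (val_ge0 (vP _ q0)); exists (d + c), d; split=> //.
        by apply: Um_add => //; left.
      by rewrite mulrDl mul1r e.
    have -> : v (a + b) = v a + v (1 + b / a).
      apply: vE => //; have {1}-> : a + b = a * (1 + b / a).
        by rewrite mulrDr mulr1 mulrCA mulfV // mulr1.
      by apply: valM; exact: vP.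
    by rewrite lerDl.
  + by move=> c c0; apply: vU; exact: Uiota.
  + by exists t.
- move=> a ma a0; rewrite lt_neqAle; apply/andP; split.
    apply/eqP => va; have [u [u' [hu hu' e]]] := vP a a0.
    by apply: (Um hu'); rewrite -[u']mul1r -(expr0z t) va -e; apply: mM => //; left.
  apply: (val_ge0 (vP _ a0)); exists a, 1; split=> //; first by right.
  by rewrite mulr1.
- by move=> z z0 h; exact: (val_int (vP z z0) h).
Qed.

(** As [w] vanishes on [U], it equals [k * w t] on elements of order [k]. A place takes the value 1,
    so [w t] divides 1. *)
Lemma dvr_place_unique (v w : K -> int) : place iota v -> place iota w ->
  v t = 1 -> (forall u, U u -> v u = 0) -> (forall u, U u -> w u = 0) ->
  0 <= w t -> v = w.
Proof.
move=> [v0 vM _ _ _] [w0 wM _ _ [x x0 wx]] vt vU wU wt.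
have pw (f : K -> int) : {in [pred z | z != 0] &, {morph f : a b / a * b >-> a + b}} ->
    forall k : int, f (t ^ k) = k * f t.
  move=> fM; have f1 : f 1 = 0.
    have := fM 1 1; rewrite !inE oner_eq0 mulr1 => /(_ isT isT) /eqP.
    by rewrite -[X in X == _]addr0 (inj_eq (addrI _)) => /eqP.
  have fn k : f (t ^+ k) = k%:Z * f t.
    elim: k => [|k IH]; first by rewrite expr0 f1 mul0r.
    by rewrite exprS fM ?inE ?expf_neq0 // IH intS mulrDl mul1r.
  case=> k; first by rewrite -exprnP fn.
  have := fM (t ^+ k.+1) (t ^ Negz k); rewrite !inE expf_neq0 // expfz_neq0 //.
  move=> /(_ isT isT); rewrite exprnP -expfzDr // NegzE addrN expr0z f1 fn.
  by move=> /eqP; rewrite eq_sym addrC addr_eq0 mulNr => /eqP.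
have E (f : K -> int) : {in [pred z | z != 0] &, {morph f : a b / a * b >-> a + b}} ->
    (forall u, U u -> f u = 0) -> forall z k, z != 0 -> val z k -> f z = k * f t.
  move=> fM fU z k z0 [u [u' [hu hu' e]]].
  have := congr1 f e.
  rewrite (fM z u) ?(fM (t ^ k) u') // ?inE ?expfz_neq0 ?(U0 hu) ?(U0 hu') //.
  rewrite (fU _ hu) (fU _ hu') !addr0 => ->.
  exact: pw.
have wt1 : w t = 1.
  have [k hk] := val_ex x0; have := E w wM wU _ _ x0 hk; rewrite wx => h.
  have : (`|k| * `|w t|)%N = 1%N by rewrite -abszM -h.
  by move/eqP; rewrite muln_eq1 => /andP[_ /eqP]; move: wt; lia.
apply: funext => z; have [->|z0] := eqVneq z 0; first by rewrite v0 w0.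
have [k hk] := val_ex z0.
by rewrite (E v vM vU _ _ z0 hk) (E w wM wU _ _ z0 hk) vt wt1.
Qed.

End DiscreteValuation.

Section PlaceTheory.
Variables (F K : fieldType) (iota : {rmorphism F -> K}).
Variables (v : K -> int) (hv : place iota v).

Lemma placeM a b : a != 0 -> b != 0 -> v (a * b) = v a + v b.
Proof. by case: hv => _ h _ _ _ a0 b0; rewrite h. Qed.

Lemma place_iota c : v (iota c) = 0.
Proof.
have [v0 _ _ vc _] := hv.
by have [->|c0] := eqVneq c 0; [rewrite rmorph0|exact: vc].
Qed.

Lemma place1 : v 1 = 0.
Proof. by rewrite -(rmorph1 iota) place_iota. Qed.

Lemma placeV a : v a^-1 = - v a.
Proof.
have [->|a0] := eqVneq a 0; first by case: hv => v0 *; rewrite invr0 v0 oppr0.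
have := placeM a0; move=> /(_ a^-1); rewrite invr_eq0 a0 mulfV // place1.
by move=> /(_ isT) /eqP; rewrite eq_sym addrC addr_eq0 => /eqP.
Qed.

Lemma placeN a : v (- a) = v a.
Proof.
have [->|a0] := eqVneq a 0; first by rewrite oppr0.
rewrite -mulN1r placeM ?oppr_eq0 ?oner_eq0 //.
by rewrite -(rmorph1 iota) -rmorphN place_iota add0r.
Qed.

Lemma placeX a n : a != 0 -> v (a ^+ n) = n%:Z * v a.
Proof.
move=> a0; elim: n => [|n IH]; first by rewrite expr0 place1 mul0r.
by rewrite exprS placeM ?expf_neq0 // IH intS mulrDl mul1r.
Qed.

(* [v 0 = 0] forces the disjunction with [a = 0] *)
Definition vge (k : int) (a : K) := a = 0 \/ k <= v a.

Lemma vge0 k : vge k 0. Proof. by left. Qed.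

Lemma vgeD k a b : vge k a -> vge k b -> vge k (a + b).
Proof.
move=> [->|ha] [->|hb]; rewrite ?add0r ?addr0; [by left|by right|by right|].
have [a0|a0] := eqVneq a 0; first by rewrite a0 add0r; right.
have [b0|b0] := eqVneq b 0; first by rewrite b0 addr0; right.
have [|ab0] := eqVneq (a + b) 0; first by left.
right; have [_ _ h _ _] := hv.
by apply: (le_trans _ (h _ _ a0 b0 ab0)); rewrite le_min ha.
Qed.

Lemma vgeN k a : vge k a -> vge k (- a).
Proof. by move=> [->|h]; [rewrite oppr0; left|right; rewrite placeN]. Qed.

Lemma vgeM k l a b : vge k a -> vge l b -> vge (k + l) (a * b).
Proof.
have [->|a0] := eqVneq a 0; first by rewrite mul0r; left.
have [->|b0] := eqVneq b 0; first by rewrite mulr0; left.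
case=> [h|ha]; first by rewrite h eqxx in a0.
case=> [h|hb]; first by rewrite h eqxx in b0.
by right; rewrite placeM // lerD.
Qed.

Lemma vge_le k l a : l <= k -> vge k a -> vge l a.
Proof. by move=> h [->|h2]; [left|right; exact: le_trans h2]. Qed.

Lemma vge_iota c : vge 0 (iota c).
Proof. by right; rewrite place_iota. Qed.

Lemma vge_sum k (I : Type) (r : seq I) (P : pred I) (f : I -> K) :
  (forall i, vge k (f i)) -> vge k (\sum_(i <- r | P i) f i).
Proof.
move=> h; apply: big_ind => //; [exact: vge0|exact: vgeD].
Qed.

Lemma placeD_lt a b : a != 0 -> vge (v a + 1) b -> a + b != 0 /\ v (a + b) = v a.
Proof.
move=> a0 hb; have ab0 : a + b != 0.
  apply/eqP => /eqP; rewrite addr_eq0 => /eqP E; move: a0 hb; rewrite E => b0.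
  rewrite oppr_eq0 in b0; move=> [b1|]; first by rewrite b1 eqxx in b0.
  by rewrite placeN; lia.
split=> //; apply/le_anti/andP; split; last first.
  have [] // : vge (v a) (a + b).
    by apply: vgeD; [right|apply: vge_le hb; lia].
  by move=> /eqP; rewrite (negPf ab0).
rewrite leNgt; apply/negP => lt.
have E : a = (a + b) + - b by rewrite addrK.
have [] : vge (v a + 1) a.
- by rewrite [X in vge _ X]E; apply: vgeD; [right; lia|exact: vgeN].
- by move/eqP; rewrite (negPf a0).
- by lia.
Qed.

End PlaceTheory.

(** * Places of a hyperelliptic function field *)

Section PolyEval.
Variables (F K : fieldType) (iota : {rmorphism F -> K}) (y : K).

Definition ev (A : {poly F}) : K := (map_poly iota A).[y].

Lemma evD A B : ev (A + B) = ev A + ev B.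
Proof. by rewrite /ev rmorphD hornerD. Qed.
Lemma evN A : ev (- A) = - ev A.
Proof. by rewrite /ev rmorphN hornerN. Qed.
Lemma evM A B : ev (A * B) = ev A * ev B.
Proof. by rewrite /ev rmorphM hornerM. Qed.
Lemma evX_n A n : ev (A ^+ n) = ev A ^+ n.
Proof. by rewrite /ev rmorphXn /= horner_exp. Qed.
Lemma evC c : ev c%:P = iota c.
Proof. by rewrite /ev map_polyC hornerC. Qed.
Lemma evX : ev 'X = y.
Proof. by rewrite /ev map_polyX hornerX. Qed.
Lemma ev0 : ev 0 = 0.
Proof. by rewrite /ev rmorph0 horner0. Qed.
Lemma ev1 : ev 1 = 1.
Proof. by rewrite /ev rmorph1 hornerC. Qed.
Lemma evZ c A : ev (c *: A) = iota c * ev A.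
Proof. by rewrite -mul_polyC evM evC. Qed.

End PolyEval.

Section Hyperelliptic.
Variables (F : numClosedFieldType) (K : fieldType) (iota : {rmorphism F -> K}).

(* K = F(y)(s), where s is a square root of h(y) *)
Record hyper (y s : K) (h : {poly F}) : Prop := Hyper {
  hyper_sq : s ^+ 2 = ev iota y h;
  hyper_free : forall A B, ev iota y A + ev iota y B * s = 0 -> A = 0 /\ B = 0;
  hyper_gen : forall z, exists A B D, D != 0 /\
    z * ev iota y D = ev iota y A + ev iota y B * s }.

Variables (y s : K) (h : {poly F}).
Hypothesis H : hyper y s h.
Local Notation ev := (ev iota y).
Local Notation e A B := (ev A + ev B * s).
Implicit Types A B : {poly F}.

Lemma ev_eq0 A : (ev A == 0) = (A == 0).
Proof.
apply/eqP/eqP => [hA|->]; last exact: ev0.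
by have [] : A = 0 /\ (0 : {poly F}) = 0 by apply: (hyper_free H); rewrite ev0 mul0r addr0.
Qed.

Lemma hyper_eq0 A B : (e A B == 0) = (A == 0) && (B == 0).
Proof.
apply/eqP/andP => [/(hyper_free H)[-> ->]|[/eqP-> /eqP->]]; first by rewrite eqxx.
by rewrite !ev0 mul0r addr0.
Qed.

Lemma hyper_s0 : s != 0.
Proof.
have := hyper_eq0 0 1; rewrite ev0 ev1 mul1r add0r => ->.
by rewrite oner_eq0 andbF.
Qed.

Lemma hyperM A B A' B' :
  e A B * e A' B' = e (A * A' + B * B' * h) (A * B' + B * A').
Proof. by rewrite !evD !evM -(hyper_sq H); ring. Qed.

Lemma pair_root_factor c A B : (A != 0) || (B != 0) -> exists j A0 B0,
  [/\ A = ('X - c%:P) ^+ j * A0, B = ('X - c%:P) ^+ j * B0 &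
      (A0.[c] != 0) || (B0.[c] != 0)].
Proof.
have [n] := ubnP (size A + size B); elim: n A B => // n IH A B lt n0.
have [h0|h0] := boolP ((A.[c] != 0) || (B.[c] != 0)).
  by exists 0%N, A, B; rewrite !expr0 !mul1r.
move: h0; rewrite negb_or !negbK => /andP[rA rB].
have /factor_theorem[A1 hA] : root A c by [].
have /factor_theorem[B1 hB] : root B c by [].
have sz (P Q : {poly F}) : P = Q * ('X - c%:P) -> (size Q <= (size P).-1)%N.
  move=> ->; have [->|Q0] := eqVneq Q 0; first by rewrite size_poly0.
  by rewrite size_Mmonic ?monicXsubC // size_XsubC addn2.
have [j [A0 [B0 [e1 e2 e3]]]] : exists j A0 B0,
  [/\ A1 = ('X - c%:P) ^+ j * A0, B1 = ('X - c%:P) ^+ j * B0 &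
      (A0.[c] != 0) || (B0.[c] != 0)].
  apply: IH; last first.
    case/orP: n0 => [A0|B0]; apply/orP; [left|right].
      by apply: contraNneq A0 => A1z; rewrite hA A1z mul0r.
    by apply: contraNneq B0 => B1z; rewrite hB B1z mul0r.
  have := sz _ _ hA; have := sz _ _ hB.
  move: n0 lt; rewrite -!size_poly_gt0.
  move: (size A) (size B) (size A1) (size B1) => a b a1 b1.
  by case/orP; lia.
by exists j.+1, A0, B0; split=> //; rewrite exprSr mulrAC; [rewrite -e1|rewrite -e2].
Qed.

(** * The place at a point of the affine curve *)

Section AtPoint.
Variables (c s0 : F).
Hypotheses (hs0 : s0 ^+ 2 = h.[c]) (hsep : h.[c] = 0 -> h^`().[c] != 0).

Let rho A B := A.[c] + B.[c] * s0.
Let U z := exists A B, z = e A B /\ rho A B != 0.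
Let m z := exists A B, z = e A B /\ rho A B = 0.

Let ring z : U z \/ m z -> exists A B, z = e A B.
Proof. by case=> [] [A [B [-> _]]]; exists A, B. Qed.

Let ring_e A B : U (e A B) \/ m (e A B).
Proof. by have [r0|r0] := eqVneq (rho A B) 0; [right|left]; exists A, B. Qed.

Let rhoM A B A' B' :
  rho (A * A' + B * B' * h) (A * B' + B * A') = rho A B * rho A' B'.
Proof. by rewrite /rho !hornerE -hs0; ring. Qed.

Let e_inj A B A' B' : e A B = e A' B' -> A = A' /\ B = B'.
Proof.
move=> E; have : e (A - A') (B - B') == 0.
  rewrite !evD !evN mulrDl mulNr.
  have -> : ev A - ev A' + (ev B * s - ev B' * s) = e A B - e A' B' by ring.
  by rewrite E subrr.
by rewrite hyper_eq0 !subr_eq0 => /andP[/eqP-> /eqP->].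
Qed.

Let UM a b : U a -> U b -> U (a * b).
Proof.
move=> [A [B [-> r]]] [A' [B' [-> r']]]; rewrite hyperM.
by eexists; eexists; split; first by []; rewrite rhoM mulf_neq0.
Qed.

Let mM a b : m a -> U b \/ m b -> m (a * b).
Proof.
move=> [A [B [-> r]]] /ring[A' [B' ->]]; rewrite hyperM.
by eexists; eexists; split; first by []; rewrite rhoM r mul0r.
Qed.

Let eD A B A' B' : e A B + e A' B' = e (A + A') (B + B').
Proof. by rewrite !evD; ring. Qed.

Let Um_add a b : U a \/ m a -> U b \/ m b -> U (a + b) \/ m (a + b).
Proof. by move=> /ring[A [B ->]] /ring[A' [B' ->]]; rewrite eD. Qed.

Let Um a : U a -> ~ m a.
Proof.
by move=> [A [B [-> r]]] [A' [B' [/e_inj[<- <-] r']]]; rewrite r' eqxx in r.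
Qed.

Let m0 : m 0.
Proof. by exists 0, 0; rewrite /rho !ev0 !horner0 !mul0r !addr0. Qed.

Let e0 A : ev A = e A 0.
Proof. by rewrite ev0 mul0r addr0. Qed.

Let Uiota a : a != 0 -> U (iota a).
Proof.
move=> a0; exists a%:P, 0; rewrite -e0 evC; split=> //.
by rewrite /rho hornerC horner0 mul0r addr0.
Qed.

Let U1 : U 1.
Proof. by rewrite -(rmorph1 iota); apply: Uiota; rewrite oner_eq0. Qed.

Let frac z : exists a b, [/\ U a \/ m a, U b \/ m b, b != 0 & z * b = a].
Proof.
have [A [B [D [D0 E]]]] := hyper_gen H z.
exists (e A B), (ev D); split=> //; last by rewrite ev_eq0.
by rewrite e0.
Qed.

(** Over a root of [h] the projection to the [y]-line is ramified: [s] is a uniformizer and [y - c]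
    has order 2. *)
Let t := if s0 == 0 then s else ev ('X - c%:P).

Let ramified : s0 = 0 -> exists2 h1, h = ('X - c%:P) * h1 & h1.[c] != 0.
Proof.
move=> s00; have hc : h.[c] = 0 by rewrite -hs0 s00 expr0n.
have /factor_theorem[h1 E] : root h c by apply/eqP.
exists h1; first by rewrite mulrC.
have := hsep hc.
by rewrite E derivM derivXsubC !hornerE /= subrr mulr0 add0r.
Qed.

Let mt : m t.
Proof.
rewrite /t; case: eqP => [s00|_].
  by exists 0, 1; rewrite ev0 ev1 /rho !hornerE s00; split=> //; ring.
by exists ('X - c%:P), 0; rewrite -e0 /rho !hornerE; split=> //; ring.
Qed.

Let t0 : t != 0.
Proof.
rewrite /t; case: (eqVneq s0 0) => _; first exact: hyper_s0.
by rewrite ev_eq0 polyXsubC_eq0.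
Qed.

Let factor a : U a \/ m a -> a != 0 ->
  exists (k : nat) u u', [/\ U u, U u' & a * u = t ^+ k * u'].
Proof.
move=> /ring[A [B ->]]; rewrite hyper_eq0 negb_and => n0.
have [j [A0 [B0 [-> -> nz]]]] := pair_root_factor c n0.
rewrite !evM !evX_n; set y0 := ev ('X - c%:P).
have -> : y0 ^+ j * ev A0 + y0 ^+ j * ev B0 * s = y0 ^+ j * e A0 B0 by ring.
rewrite /t; case: eqP => [s00|/eqP s0n]; last first.
  rewrite -/y0; have [r0|r0] := eqVneq (rho A0 B0) 0; last first.
    by exists j, 1, (e A0 B0); split=> //; [exists A0, B0|rewrite mulr1].
  (* The conjugate of [e A0 B0] does not vanish at the point, so multiplying by it moves the whole
     order of vanishing into the norm, a polynomial in [y]. *)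
  have r' : rho A0 (- B0) != 0.
    apply/eqP => r'; move: r0 r'; rewrite /rho !hornerE => r0 r'.
    have A00 : A0.[c] = 0.
      apply/eqP; have : A0.[c] *+ 2 = 0.
        by have := congr2 +%R r0 r'; rewrite addr0 => <-; ring.
      by move/eqP; rewrite mulrn_eq0.
    have := r0; rewrite A00 add0r => /eqP; rewrite mulf_eq0 (negPf s0n) orbF => /eqP B00.
    by rewrite A00 B00 eqxx in nz.
  have N0 : A0 ^+ 2 - B0 ^+ 2 * h != 0.
    have : e A0 B0 * e A0 (- B0) != 0.
      have n1 : (A0 != 0) || (B0 != 0).
        by case/orP: nz => nz; apply/orP; [left|right]; apply: contraNneq nz => ->; rewrite horner0.
      by rewrite mulf_neq0 ?hyper_eq0 ?oppr_eq0 ?negb_and.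
    rewrite hyperM; apply: contraNneq => N0.
    have -> : A0 * A0 + B0 * - B0 * h = 0 by rewrite -[RHS]N0; ring.
    have -> : A0 * - B0 + B0 * A0 = 0 by ring.
    by rewrite !ev0 mul0r addr0.
  have [i [N1 [Z [E _ nz1]]]] : exists i N1 (Z : {poly F}),
      [/\ A0 ^+ 2 - B0 ^+ 2 * h = ('X - c%:P) ^+ i * N1, 0 = ('X - c%:P) ^+ i * Z &
      N1.[c] != 0].
    have [|i [N1 [Z [E E0 nz1]]]] := @pair_root_factor c (A0 ^+ 2 - B0 ^+ 2 * h) 0.
      by rewrite N0.
    exists i, N1, Z; split=> //; case/orP: nz1 => // Z0.
    move: E0 => /eqP; rewrite eq_sym mulf_eq0 expf_eq0 polyXsubC_eq0 andbF /= => /eqP Zz.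
    by rewrite Zz horner0 eqxx in Z0.
  exists (j + i)%N, (e A0 (- B0)), (ev N1); split.
  - by exists A0, (- B0).
  - by exists N1, 0; rewrite -e0 /rho horner0 mul0r addr0.
  - rewrite exprD -!mulrA hyperM.
    have -> : A0 * - B0 + B0 * A0 = 0 by ring.
    have -> : A0 * A0 + B0 * - B0 * h = A0 ^+ 2 - B0 ^+ 2 * h by ring.
    by rewrite -e0 E evM evX_n.
have [h1 hE h10] := ramified s00.
have sE : y0 * ev h1 = s ^+ 2 by rewrite (hyper_sq H) hE evM.
have Uh1 k : U (ev h1 ^+ k).
  by exists (h1 ^+ k), 0; rewrite -e0 evX_n /rho s00 mulr0 addr0 horner_exp expf_neq0.
have yj : y0 ^+ j * ev h1 ^+ j = s ^+ (j * 2) by rewrite -exprMn sE -exprM mulnC.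
have [A00|A00] := eqVneq A0.[c] 0; last first.
  exists (j * 2)%N, (ev h1 ^+ j), (e A0 B0); split=> //.
    by exists A0, B0; rewrite /rho s00 mulr0 addr0.
  by rewrite mulrAC yj.
(* Here [A0] is divisible by [y - c], which is [s ^+ 2] up to a unit; as [B0.[c]] is nonzero,
   exactly one factor [s] comes out of [e A0 B0]. *)
have B00 : B0.[c] != 0 by rewrite A00 eqxx in nz.
have /factor_theorem[A1 EA] : root A0 c by apply/eqP.
exists (j * 2).+1, (ev h1 ^+ j.+1), (e (h1 * B0) A1); split=> //.
  exists (h1 * B0), A1; split=> //.
  by rewrite /rho s00 mulr0 addr0 hornerM mulf_neq0.
rewrite EA !evM -/y0 exprSr.
have -> : y0 ^+ j * (ev A1 * y0 + ev B0 * s) * (ev h1 ^+ j * ev h1) =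
  y0 ^+ j * ev h1 ^+ j * (ev A1 * (y0 * ev h1) + ev B0 * s * ev h1) by ring.
rewrite yj sE [s ^+ (j * 2).+1]exprS.
by move: (s ^+ (j * 2)) (ev A1) (ev B0) (ev h1) => a1 a2 a3 a4; ring.
Qed.

Definition centered (v : K -> int) := [/\ 0 <= v (ev ('X - c%:P)), 0 <= v s &
  forall A B, A.[c] + B.[c] * s0 != 0 -> v (e A B) = 0].

Lemma place_at : exists v, [/\ place iota v, centered v,
    forall A B, A.[c] + B.[c] * s0 = 0 -> vge v 1 (e A B),
    v (ev ('X - c%:P)) = if s0 == 0 then 2 else 1 &
    (s0 = 0 -> v s = 1) /\ 
    ((forall z, vge v 0 z -> exists a, vge v 1 (z - iota a)) /\
    forall w, place iota w -> centered w -> v = w)].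
Proof.
have [v [pv vt vU vm vO]] :=
  dvr_place U1 UM mM Um_add Um m0 Uiota mt t0 frac factor.
have vm' A B : rho A B = 0 -> vge v 1 (e A B).
  move=> r; have [->|n0] := eqVneq (e A B) 0; first exact: vge0.
  by right; rewrite -gtz0_ge1; apply: vm => //; exists A, B.
have sv : s0 = 0 -> v s = 1 by move=> s00; rewrite -vt /t s00 eqxx.
have vy : v (ev ('X - c%:P)) = if s0 == 0 then 2 else 1.
  case: (eqVneq s0 0) => [s00|s0n]; last by rewrite -vt /t (negPf s0n).
  have [h1 hE h10] := ramified s00.
  have h1n : h1 != 0 by apply: contraNneq h10 => ->; rewrite horner0.
  have := congr1 v (hyper_sq H); rewrite hE evM (placeX pv) ?hyper_s0 // sv // mulr1.
  rewrite (placeM pv) ?ev_eq0 ?polyXsubC_eq0 // (vU (ev h1)) ?addr0 //.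
  by exists h1, 0; rewrite -e0 /rho horner0 mul0r addr0.
exists v; split=> //.
- split; first by rewrite vy; case: ifP.
    case: (eqVneq s0 0) => [s00|s0n]; first by rewrite sv.
    by rewrite vU //; exists 0, 1; rewrite ev0 ev1 mul1r add0r /rho !hornerE.
  by move=> A B r; apply: vU; exists A, B.
- split=> //; split=> [z|w pw [w1 w2 w3]]; last first.
    apply: (@dvr_place_unique F K iota U m t) => //; last by rewrite /t; case: ifP.
    by move=> u [A [B [-> r]]]; exact: w3.
  have [->|z0] := eqVneq z 0; first by exists 0; rewrite rmorph0 subrr; exact: vge0.
  case=> [zz|zO]; first by rewrite zz eqxx in z0.
  have [a [b [ha hb zb]]] := vO z z0 zO.
  have b0 : b != 0 by apply/eqP => b0; apply: (Um hb); rewrite b0; exact: m0.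
  have vb := vU _ hb.
  case/ring: ha => A [B EA]; case: hb => A' [B' [EB rb]].
  exists (rho A B / rho A' B').
  have -> : z - iota (rho A B / rho A' B') =
      e (A - (rho A B / rho A' B') *: A') (B - (rho A B / rho A' B') *: B') * b^-1.
    apply: (mulIf b0); rewrite mulrBl zb mulfVK // EA EB !evD !evN !evZ; ring.
  rewrite -[1]addr0; apply: (vgeM pv); last by right; rewrite (placeV pv) vb.
  apply: vm'; rewrite /rho !hornerE.
  rewrite -!/(rho _ _); apply/eqP; move: rb; rewrite /rho => rb; apply/eqP; field.
  by rewrite rb.
Qed.

End AtPoint.

Lemma vge_ev v A : place iota v -> vge v 0 y -> vge v 0 (ev A).
Proof.
move=> pv vy; elim/poly_ind: A => [|A c IH]; first by rewrite ev0; exact: vge0.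
rewrite evD evM evC evX; apply: (vgeD pv); last exact: (vge_iota pv).
by rewrite -(addr0 0); exact: (vgeM pv).
Qed.

Lemma vge_s v : place iota v -> vge v 0 y -> 0 <= v s.
Proof.
move=> pv vy; have := vge_ev h pv vy; rewrite -(hyper_sq H).
case=> [/eqP|]; first by rewrite expf_eq0 (negPf hyper_s0).
by rewrite (placeX pv) ?hyper_s0 //; lia.
Qed.

Lemma vgeM_or (v : K -> int) a b : place iota v -> vge v 0 a -> vge v 0 b ->
  vge v 1 (a * b) -> vge v 1 a \/ vge v 1 b.
Proof.
move=> pv [->|ha]; first by left; left.
case=> [->|hb]; first by right; left.
have [->|a0] := eqVneq a 0; first by left; left.
have [->|b0] := eqVneq b 0; first by right; left.
case=> [/eqP|]; first by rewrite mulf_eq0 (negPf a0) (negPf b0).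
rewrite (placeM pv) // => h2; have [h3|h3] := lerP 1 (v a); first by left; right.
by right; right; lia.
Qed.

(** The product of [s - s0] and [s + s0] is h(y) - h(c), of positive value, so one of the two square
    roots of [h.[c]] is the residue of [s]. *)
Lemma place_centered v c : place iota v -> 0 < v (ev ('X - c%:P)) ->
  exists2 s0, s0 ^+ 2 = h.[c] & centered c s0 v.
Proof.
move=> pv vc.
have v1 : vge v 1 (ev ('X - c%:P)) by right; rewrite -gtz0_ge1.
have vy : vge v 0 y.
  have -> : y = ev ('X - c%:P) + iota c by rewrite evD evN evC evX subrK.
  by apply: (vgeD pv); [apply: vge_le v1|exact: (vge_iota pv)].
have vs := vge_s pv vy.
have hs (A : {poly F}) : vge v 1 (ev (A - A.[c]%:P)).
  have /factor_theorem[q ->] : root (A - A.[c]%:P) c.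
    by rewrite /root !hornerE subrr.
  by rewrite evM -(add0r 1); apply: (vgeM pv) => //; exact: vge_ev.
have vs' : vge v 0 s by right.
have [s0 hs0 v2] : exists2 s0, s0 ^+ 2 = h.[c] & vge v 1 (s - iota s0).
  have E : (s - iota (sqrtC h.[c])) * (s - iota (- sqrtC h.[c])) = ev (h - h.[c]%:P).
    have E2 : iota h.[c] = iota (sqrtC h.[c]) ^+ 2 by rewrite -rmorphXn /= sqrtCK.
    by rewrite rmorphN evD evN evC -(hyper_sq H) E2; ring.
  have := hs h; rewrite -E => /(vgeM_or pv); case.
  - by apply: (vgeD pv) => //; apply: (vgeN pv); exact: (vge_iota pv).
  - by apply: (vgeD pv) => //; apply: (vgeN pv); exact: (vge_iota pv).
  - by move=> h1; exists (sqrtC h.[c]) => //; exact: sqrtCK.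
  - by move=> h1; exists (- sqrtC h.[c]) => //; rewrite sqrrN sqrtCK.
exists s0 => //; split=> //; first exact: ltW.
move=> A B r.
have -> : e A B = iota (A.[c] + B.[c] * s0) +
    (ev (A - A.[c]%:P) + (ev (B - B.[c]%:P) * s + iota B.[c] * (s - iota s0))).
  rewrite !evD !evN !evC rmorphD rmorphM; ring.
have i0 : iota (A.[c] + B.[c] * s0) != 0 by rewrite fmorph_eq0.
have [|_ ->] := placeD_lt pv i0 (b := ev (A - A.[c]%:P) + (ev (B - B.[c]%:P) * s + iota B.[c] * (s - iota s0))); last exact: place_iota pv _.
rewrite (place_iota pv) add0r; apply: (vgeD pv) => //; apply: (vgeD pv).
  by rewrite -(addr0 1); apply: (vgeM pv).
by rewrite -(add0r 1); apply: (vgeM pv) => //; exact: (vge_iota pv).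
Qed.

(** Otherwise [v] vanishes on every [y - c], hence on every nonzero polynomial because [F] is
    algebraically closed, hence, through norms, on all of K: but a place takes the value 1. *)
Lemma place_finite v : place iota v -> vge v 0 y -> exists c, 0 < v (ev ('X - c%:P)).
Proof.
move=> pv vy; apply: contrapT => /forallNP no.
have vs := vge_s pv vy.
have vc c : v (ev ('X - c%:P)) = 0.
  have := vge_ev ('X - c%:P) pv vy; case=> [/eqP|h1].
    by rewrite ev_eq0 polyXsubC_eq0.
  by have := no c; lia.
have vA A : A != 0 -> v (ev A) = 0.
  move=> A0; have [r Er] := closed_field_poly_normal A.
  rewrite Er evZ (placeM pv) ?fmorph_eq0 ?lead_coef_eq0 // ?ev_eq0 ?monic_neq0 ?monic_prod_XsubC //.
  rewrite (place_iota pv) add0r; elim: r {Er} => [|a r IH].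
    by rewrite big_nil ev1 (place1 pv).
  rewrite big_cons evM (placeM pv) ?ev_eq0 ?polyXsubC_eq0 // ?vc ?IH //.
  by rewrite monic_neq0 ?monic_prod_XsubC.
have ve A B : e A B != 0 -> v (e A B) = 0.
  move=> n0; have n1 : e A (- B) != 0.
    by move: n0; rewrite !hyper_eq0 oppr_eq0.
  have ge0 C D : vge v 0 (e C D).
    apply: (vgeD pv); first exact: vge_ev.
    by rewrite -(addr0 0); apply: (vgeM pv); [exact: vge_ev|right].
  have := mulf_neq0 n0 n1; have E := hyperM A B A (- B).
  have Z : A * - B + B * A = 0 by ring.
  rewrite E Z ev0 mul0r addr0 ev_eq0 => /vA.
  have -> : ev (A * A + B * - B * h) = e A B * e A (- B).
    by rewrite E Z ev0 mul0r addr0.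
  rewrite (placeM pv) //; have := ge0 A B; have := ge0 A (- B).
  move=> [/eqP|h1]; first by rewrite (negPf n1).
  by move=> [/eqP|h2]; [rewrite (negPf n0)|lia].
have [_ _ _ _ [z z0 vz]] := pv.
have [A [B [D [D0 E]]]] := hyper_gen H z.
have n0 : e A B != 0 by rewrite -E mulf_neq0 // ev_eq0.
have := congr1 v E; rewrite (placeM pv) ?ev_eq0 // vz vA // ve //.
Qed.

(** * The places over a point of the line *)

Section Above.
Variable c : F.
Hypothesis hsep : h.[c] = 0 -> h^`().[c] != 0.

(** The sum is the degree of [K] over the field of rational functions in [y]: two places of order 1,
    or a single place of order 2 over a root of [h]. *)
Lemma places_above : exists vs : seq (K -> int), [/\ uniq vs,
  forall v, v \in vs <-> place iota v /\ 0 < v (ev ('X - c%:P)) &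
  \sum_(v <- vs) v (ev ('X - c%:P)) = 2].
Proof.
have [v1 [p1 c1 m1 y1 [s1 [r1 u1]]]] := place_at (sqrtCK h.[c]) hsep.
have sN : (- sqrtC h.[c]) ^+ 2 = h.[c] by rewrite sqrrN sqrtCK.
have [v2 [p2 c2 m2 y2 [s2 [r2 u2]]]] := place_at sN hsep.
rewrite oppr_eq0 in y2.
have all v : place iota v /\ 0 < v (ev ('X - c%:P)) -> v = v1 \/ v = v2.
  move=> [pv vc]; have [s0 hs0 cv] := place_centered pv vc.
  have : (s0 == sqrtC h.[c]) || (s0 == - sqrtC h.[c]) by rewrite -eqf_sqr hs0 sqrtCK.
  by case/orP=> /eqP E; rewrite E in cv; [left; rewrite (u1 v)|right; rewrite (u2 v)].
have [s0|s0] := eqVneq (sqrtC h.[c]) 0.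
  have v12 : v1 = v2 by apply: u1 => //; rewrite s0 -oppr0 -s0.
  exists [:: v1]; split=> //; last by rewrite big_seq1 y1 s0 eqxx.
  move=> v; split=> [|/all]; last by rewrite -v12 mem_seq1 => -[] ->.
  by rewrite mem_seq1 => /eqP ->; rewrite y1 s0 eqxx.
rewrite (negPf s0) in y1 y2.
have v12 : v1 != v2.
  apply/eqP => E; have := m1 (- sqrtC h.[c])%:P 1.
  rewrite !hornerE addNr => /(_ erefl); rewrite E.
  have [_ _ cc] := c2; case=> [/eqP|].
    by rewrite hyper_eq0 oner_eq0 andbF.
  rewrite cc // !hornerE -mulr2n mulrn_eq0 /= oppr_eq0 //.
exists [:: v1; v2]; split.
- by rewrite /= mem_seq1 v12.
- move=> v; split=> [|/all[] ->]; last 2 first.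
  + by rewrite mem_head.
  + by rewrite mem_behead // mem_head.
  by rewrite in_cons mem_seq1 => /orP[]/eqP->; rewrite ?y1 ?y2.
- by rewrite big_cons big_seq1 y1 y2.
Qed.

(** The ring generated by [y] and [s] is integrally closed over [c], because [c] is at most a simple
    root of [h]. This serves to clear denominators. *)
Lemma integral_at A B :
  (forall v, place iota v -> 0 < v (ev ('X - c%:P)) ->
     vge v (v (ev ('X - c%:P))) (e A B)) -> A.[c] = 0 /\ B.[c] = 0.
Proof.
move=> hv.
have [v1 [p1 c1 m1 y1 [s1 [r1 u1]]]] := place_at (sqrtCK h.[c]) hsep.
have sN : (- sqrtC h.[c]) ^+ 2 = h.[c] by rewrite sqrrN sqrtCK.
have [v2 [p2 c2 m2 y2 [s2 [r2 u2]]]] := place_at sN hsep.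
have rho0 v s0 C D : centered c s0 v -> vge v 1 (e C D) -> C.[c] + D.[c] * s0 = 0.
  move=> [_ _ cv] v1e; apply/eqP; apply: contraT => r.
  move: (cv _ _ r) v1e => E [/eqP|]; last by rewrite E.
  rewrite hyper_eq0 => /andP[/eqP C0 /eqP D0].
  by rewrite C0 D0 !horner0 mul0r addr0 eqxx in r.
have ge1 v : 0 < v (ev ('X - c%:P)) -> vge v (v (ev ('X - c%:P))) (e A B) -> vge v 1 (e A B).
  by move=> lt; apply: vge_le; rewrite -gtz0_ge1.
have y1p : 0 < v1 (ev ('X - c%:P)) by rewrite y1; case: ifP.
have y2p : 0 < v2 (ev ('X - c%:P)) by rewrite y2; case: ifP.
have E1 := rho0 _ _ _ _ c1 (ge1 _ y1p (hv v1 p1 y1p)).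
have E2 := rho0 _ _ _ _ c2 (ge1 _ y2p (hv v2 p2 y2p)).
have A0 : A.[c] = 0.
  apply/eqP; have : A.[c] *+ 2 == 0 by rewrite mulr2n -[X in _ == X]addr0 -{1}E1 -{1}E2; apply/eqP; ring.
  by rewrite mulrn_eq0.
split=> //; rewrite A0 add0r in E1.
have [s0|s0] := eqVneq (sqrtC h.[c]) 0; last first.
  by move/eqP: E1; rewrite mulf_eq0 (negPf s0) orbF => /eqP.
(* In the ramified case the only condition on residues gives [A.[c] = 0]. But [y - c] has order 2,
   so the hypothesis is of second order and, [s] having order 1, also forces [B] to vanish at
   [c]. *)
have := hv v1 p1 y1p; rewrite y1 s0 eqxx => v2e.
have /factor_theorem[A1 EA] : root A c by apply/eqP.
have cy1 : vge v1 0 y.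
  have -> : y = ev ('X - c%:P) + iota c by rewrite evD evN evC evX subrK.
  by apply: (vgeD p1); [right; apply: ltW|exact: (vge_iota p1)].
have vA : vge v1 2 (ev A).
  by rewrite EA evM -(add0r 2); apply: (vgeM p1); [exact: vge_ev|right; rewrite y1 s0 eqxx].
have vB : vge v1 1 (ev B).
  have [->|B0] := eqVneq (ev B) 0; first exact: vge0.
  have : vge v1 2 (ev B * s).
    have -> : ev B * s = e A B + - ev A by ring.
    by apply: (vgeD p1) => //; exact: (vgeN p1).
  case=> [/eqP|]; first by rewrite mulf_eq0 (negPf B0) (negPf hyper_s0).
  by rewrite (placeM p1) ?hyper_s0 // s1 //; right; lia.
have := rho0 _ _ B 0 c1; rewrite ev0 mul0r addr0 horner0 mul0r addr0.
by apply.
Qed.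

Lemma place_residue v z : place iota v -> 0 < v (ev ('X - c%:P)) ->
  vge v 0 z -> exists a, vge v 1 (z - iota a).
Proof.
move=> pv vc; have [s0 hs0 cv] := place_centered pv vc.
have [v1 [p1 c1 m1 y1 [s1 [r1 u1]]]] := place_at hs0 hsep.
by rewrite -(u1 v) //; exact: r1.
Qed.

End Above.

End Hyperelliptic.

(** * Riemann's inequality and the genus of a hyperelliptic function field *)

Section Reversal.
Variables (F K : fieldType) (iota : {rmorphism F -> K}) (y : K).
Implicit Types A B : {poly F}.

(** This is X^m A(1/X), the effect of the change of chart from y to 1/y. *)
Definition prev m A : {poly F} := \poly_(i < m.+1) A`_(m - i).

Lemma evE n A : (size A <= n)%N -> ev iota y A = \sum_(i < n) iota A`_i * y ^+ i.
Proof.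
move=> h; rewrite /ev (@horner_coef_wide _ n).
  by apply: eq_bigr => i _; rewrite coef_map.
by rewrite size_map_poly.
Qed.

Lemma ev_prev m A : y != 0 -> (size A <= m.+1)%N ->
  ev iota y^-1 (prev m A) = ev iota y A * y ^- m.
Proof.
move=> y0 h; rewrite (evE h) /ev (@horner_coef_wide _ m.+1); last first.
  by rewrite size_map_poly size_poly.
rewrite (reindex_inj rev_ord_inj) /= mulr_suml; apply: eq_bigr => i _.
have im : (i <= m)%N by rewrite -ltnS.
rewrite coef_map coef_poly subSS ltnS leq_subr subKn // -mulrA; congr (_ * _).
have -> : y ^+ m = y ^+ (m - i) * y ^+ i by rewrite -exprD subnK.
by rewrite exprVn; field; rewrite !expf_neq0.
Qed.

Lemma prev_eq0 m A : (size A <= m.+1)%N -> (prev m A == 0) = (A == 0).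
Proof.
move=> h; apply/eqP/eqP => [E|->]; last first.
  by apply/polyP => i; rewrite coef_poly !coef0; case: ifP.
apply/polyP => i; rewrite coef0; have [hi|hi] := ltnP i m.+1; last first.
  by rewrite nth_default // (leq_trans h).
have := congr1 (fun p : {poly F} => p`_(m - i)) E.
by rewrite coef_poly coef0 ltnS leq_subr subKn.
Qed.

Lemma prev_horner0 m A : (prev m A).[0] = A`_m.
Proof. by rewrite horner_coef0 coef_poly subn0. Qed.

End Reversal.

Section RiemannRoch.
Variables (F : numClosedFieldType) (K : fieldType) (iota : {rmorphism F -> K}).
Variables (y s : K) (h : {poly F}) (g : nat).
Hypotheses (H : hyper iota y s h) (sh : size h = (2 * g).+3).
Hypothesis hsep : forall c, h.[c] = 0 -> h^`().[c] != 0.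
Local Notation evy := (ev iota y).
Local Notation e A B := (evy A + evy B * s).
Implicit Types A B : {poly F}.

Let y0 : y != 0.
Proof. by rewrite -(evX iota y) (ev_eq0 H) polyX_eq0. Qed.

(** The degree of [h] is even, so the chart at infinity has the same form, and its polynomial takes
    the value [lead_coef h] at 0: infinity is unramified and consists of two places. *)
Lemma hyper_infinity : hyper iota y^-1 (s * y ^- g.+1) (prev (2 * g).+2 h).
Proof.
split.
- rewrite ev_prev ?sh // exprMn (hyper_sq H); congr (_ * _).
  by rewrite exprVn -exprM mulnC mulnS.
- move=> A B E; set m := (size A + size B + g).+1.
  have : e (prev m A) (prev (m - g.+1) B) = 0.
    have E1 := ev_prev iota (m := m) (A := A); have E2 := ev_prev iota (m := m - g.+1) (A := B).
    move: E1 => /(_ y^-1); move: E2 => /(_ y^-1); rewrite invr_eq0 invrK => E2 E1.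
    rewrite E1 // ?E2 //; try by rewrite /m; lia.
    have -> : ev iota y^-1 B * (y^-1) ^- (m - g.+1) * s =
        ev iota y^-1 B * (s * y ^- g.+1) * (y^-1) ^- m.
      rewrite !exprVn !invrK -{2}(@subnK g.+1 m) ?exprD; last by rewrite /m; lia.
      by field; rewrite expf_neq0.
    by rewrite -mulrDl E mul0r.
  move/eqP; rewrite (hyper_eq0 H) !prev_eq0 ?/m; try lia.
  by case/andP => /eqP-> /eqP->.
- move=> z; have [A [B [D [D0 E]]]] := hyper_gen H z.
  set m := (size A + size B + size D + g).+1.
  exists (prev m A), (prev (m - g.+1) B), (prev m D); split.
    by rewrite prev_eq0 // /m; lia.
  rewrite !ev_prev //; try by rewrite /m; lia.
  rewrite mulrA E -[in y ^- m](@subnK g.+1 m) ?exprD; last by rewrite /m; lia.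
  by field; rewrite !expf_neq0.
Qed.

Let hinf := hyper_infinity.

Let hsep_inf : (prev (2 * g).+2 h).[0] = 0 -> (prev (2 * g).+2 h)^`().[0] != 0.
Proof.
rewrite prev_horner0 => /eqP; have -> : (2 * g).+2 = (size h).-1 by rewrite sh.
by rewrite -/(lead_coef h) lead_coef_eq0 -size_poly_eq0 sh.
Qed.


Let evX0 : ev iota y^-1 ('X - 0%:P) = y^-1.
Proof. by rewrite evD evN evC evX rmorph0 subr0. Qed.

Lemma place_fin_inf v : place iota v -> vge v 0 y \/ 0 < v y^-1.
Proof.
move=> pv; rewrite (placeV pv); have [|] := lerP 0 (v y); first by left; right.
by right; rewrite oppr_gt0.
Qed.

Lemma place_residue_field v z : place iota v -> vge v 0 z ->
  exists a, vge v 1 (z - iota a).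
Proof.
move=> pv; case: (place_fin_inf pv) => [/(place_finite H pv)[c vc]|vc].
  exact: (place_residue H (@hsep c) pv vc).
by apply: (place_residue hinf hsep_inf pv); rewrite evX0.
Qed.

Lemma places_infinity : exists vs : seq (K -> int), [/\ uniq vs,
  forall v, v \in vs <-> place iota v /\ 0 < v y^-1 &
  \sum_(v <- vs) v y^-1 = 2].
Proof. by have := places_above hinf hsep_inf; rewrite evX0. Qed.

Let size_coef (A : {poly F}) m : (size A <= m.+1)%N -> A`_m = 0 -> (size A <= m)%N.
Proof.
rewrite leq_eqVlt => /orP[/eqP E|//] Am.
by move: E; have /eqP := Am; rewrite -[m]/(m.+1.-1) => /[swap] <-; rewrite -/(lead_coef A) lead_coef_eq0 => /eqP ->; rewrite size_poly0.
Qed.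

(** This is [integral_at] at the point 0 of the chart at infinity; divisibility by 1/y there reads
    as a degree bound lowered by one. *)
Lemma integral_infinity A B m : (size A <= m.+2)%N -> (size B <= m.+1 - g)%N ->
  (g <= m)%N ->
  (forall v, place iota v -> 0 < v y^-1 ->
    vge v (v y^-1) (e A B * y ^- m.+1)) -> (size A <= m.+1)%N /\ (size B <= m - g)%N.
Proof.
move=> sA sB gm hv.
have [] := integral_at hinf hsep_inf (A := prev m.+1 A) (B := prev (m - g) B).
  rewrite evX0 => v pv vc; have := hv v pv vc.
  rewrite !ev_prev //; last by move: sB gm; move: (size B) => b; lia.
  have -> : m.+1 = (m - g + g.+1)%N by lia.
  suff -> : e A B * y ^- (m - g + g.+1) =
    evy A * y ^- (m - g + g.+1) + evy B * y ^- (m - g) * (s * y ^- g.+1) by [].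
  by rewrite exprD; field; rewrite !expf_neq0.
rewrite !prev_horner0 => Am Bm; split; apply: size_coef => //; lia.
Qed.

Local Notation L D := (riemann_roch_space iota D).

Lemma rr_spaceP D z : L D z <-> forall v, place iota v -> vge v (- D v) z.
Proof.
split=> [[->|hz] v pv|hz]; [exact: vge0|by right; exact: hz|].
have [->|z0] := eqVneq z 0; first by left.
by right=> v /hz[/eqP|//]; rewrite (negPf z0).
Qed.

Definition pole (v : K -> int) : int := Num.max 0 (- v y).

Let pole_ge0 v : 0 <= pole v.
Proof. by rewrite le_max lexx. Qed.

Lemma vge_poleX v (n r : nat) : place iota v -> (n <= r)%N ->
  vge v (- (r%:Z * pole v)) (y ^+ n).
Proof.
move=> pv nr; right; rewrite (placeX pv) // /pole.
by case: (lerP 0 (- v y)) => h1; [rewrite mulrN opprK|]; nia.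
Qed.

Let vge_pole_s v : place iota v -> vge v (- (g.+1%:Z * pole v)) s.
Proof.
move=> pv; right; case: (place_fin_inf pv) => [vy|vc].
  by rewrite (@le_trans _ _ 0) ?(vge_s H pv vy) // oppr_le0 mulr_ge0.
have /(vge_s hinf pv) : vge v 0 y^-1 by right; apply: ltW.
rewrite (placeM pv) ?(hyper_s0 H) ?invr_eq0 ?expf_neq0 //.
rewrite (placeV pv) (placeX pv) //; move: vc; rewrite (placeV pv) /pole => vc.
by rewrite max_r; lia.
Qed.

(** Regularity at finite places removes the roots of a denominator one at a time; the pole order at
    infinity then lowers the degrees one at a time. The bound r - g on the size of [B] comes from
    the pole of order g + 1 of [s]. *)
Lemma L_poleP r z : (g <= r)%N -> L (fun v => r%:Z * pole v) z <->
  exists A B, [/\ (size A <= r.+1)%N, (size B <= r - g)%N & z = e A B].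
Proof.
move=> gr; rewrite rr_spaceP; split=> [hz|[A [B [sA sB ->]]] v pv]; last first.
  apply: (vgeD pv).
    rewrite (evE iota y sA); apply: (vge_sum pv) => i.
    rewrite -[X in vge v X]add0r; apply: (vgeM pv); first exact: (vge_iota pv).
    by apply: vge_poleX => //; rewrite -ltnS.
  rewrite (evE iota y sB) mulr_suml; apply: (vge_sum pv) => i.
  rewrite -mulrA -[X in vge v X]add0r; apply: (vgeM pv); first exact: (vge_iota pv).
  have -> : - (r%:Z * pole v) = - ((r - g.+1)%N%:Z * pole v) + - (g.+1%:Z * pole v).
    have E : (r%:Z = (r - g.+1)%N%:Z + g.+1%:Z) by have := ltn_ord i; lia.
    by rewrite E mulrDl opprD.
  apply: (vgeM pv) => //; last exact: vge_pole_s.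
  by apply: vge_poleX => //; have := ltn_ord i; lia.
have hzf v : place iota v -> vge v 0 y -> vge v 0 z.
  move=> pv vy; have := hz v pv; rewrite /pole max_l ?mulr0 ?oppr0 //.
  by case: vy => [/eqP|]; rewrite ?(negPf y0) // oppr_le0.
have [A [B Ez]] : exists A B, z = e A B.
  have [A [B [D [D0]]]] := hyper_gen H z.
  have [n] := ubnP (size D); elim: n A B D D0 => // n IH A B D D0 lt E.
  have [/size_poly1P[c c0 Ec]|/closed_rootP[c rc]] := boolP (size D == 1%N).
    exists (c^-1 *: A), (c^-1 *: B); move: E; rewrite Ec evC !evZ => E.
    have ic : iota c != 0 by rewrite fmorph_eq0.
    by apply: (mulIf ic); rewrite E fmorphV; field.
  have /factor_theorem[D1 ED] := rc.
  have D10 : D1 != 0 by apply: contraNneq D0 => D10; rewrite ED D10 mul0r.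
  have yc v : place iota v -> 0 < v (evy ('X - c%:P)) -> vge v 0 y.
    move=> pv vc; have -> : y = evy ('X - c%:P) + iota c.
      by rewrite evD evN evC evX subrK.
    by apply: (vgeD pv); [right; apply: ltW|exact: (vge_iota pv)].
  have [] := integral_at H (@hsep c) (A := A) (B := B).
    move=> v pv vc; rewrite -E ED evM -[X in vge v X]add0r.
    apply: (vgeM pv); first by apply: hzf => //; exact: yc.
    rewrite -[X in vge v X]add0r; apply: (vgeM pv); last by right.
    by apply: vge_ev => //; exact: yc.
  move=> /eqP/factor_theorem[A1 EA] /eqP/factor_theorem[B1 EB].
  apply: (IH A1 B1 D1) => //.
    move: lt; rewrite ED size_Mmonic ?monicXsubC // size_XsubC addn2 /=; lia.
  apply: (@mulIf _ (evy ('X - c%:P))); first by rewrite (ev_eq0 H) polyXsubC_eq0.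
  by rewrite -mulrA -evM -ED E EA EB !evM; ring.
have red m : (r <= m)%N -> (size A <= m.+2)%N -> (size B <= m.+1 - g)%N ->
    (size A <= m.+1)%N /\ (size B <= m - g)%N.
  move=> rm sA sB; apply: integral_infinity => //; first by lia.
  move=> v pv vc; rewrite -Ez; have := hz v pv; rewrite (placeV pv) in vc *.
  rewrite /pole max_r; last by lia.
  move=> hzv; have -> : - v y = - (r%:Z * - v y) + - (r.+1%:Z * v y) by lia.
  apply: (vgeM pv) => //; right; rewrite (placeV pv) (placeX pv) //; nia.
exists A, B.
suff : (size A <= r.+1)%N /\ (size B <= r - g)%N by case.
have : (size A <= (r + (size A + size B + g)).+1)%N /\
       (size B <= r + (size A + size B + g) - g)%N by lia.
elim: (size A + size B + g)%N => [|n IH]; first by rewrite addn0.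
by rewrite addnS => -[sA sB]; apply: IH; apply: red => //; lia.
Qed.

Definition indep n (V : set K) := exists b : 'I_n -> K, (forall i, V (b i)) /\
  forall a : 'I_n -> F, \sum_i iota (a i) * b i = 0 -> forall i, a i = 0.

Let splitl m n (i : 'I_m) : fintype.split (lshift n i) = inl i.
Proof. by rewrite -[lshift n i]/(unsplit (inl i)) unsplitK. Qed.

Let splitr m n (i : 'I_n) : fintype.split (rshift m i) = inr i.
Proof. by rewrite -[rshift m i]/(unsplit (inr i)) unsplitK. Qed.

Lemma L_pole_dim r : (g <= r)%N ->
  has_dimension iota (L (fun v => r%:Z * pole v)) (r.+1 + (r - g)).
Proof.
move=> gr.
pose b (i : 'I_(r.+1 + (r - g))) : K :=
  match fintype.split i with inl j => y ^+ j | inr j => y ^+ j * s end.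
pose pl n (a : 'I_n -> F) : {poly F} := rVpoly (\row_i a i).
have plE n (a : 'I_n -> F) : evy (pl n a) = \sum_i iota (a i) * y ^+ i.
  rewrite (@evE _ _ _ _ n) ?size_poly //.
  by apply: eq_bigr => i _; rewrite coef_rVpoly_ord mxE.
have sumE (a : 'I_(r.+1 + (r - g)) -> F) : \sum_i iota (a i) * b i =
    e (pl _ (fun i => a (lshift _ i))) (pl _ (fun i => a (rshift _ i))).
  rewrite big_split_ord /= !plE mulr_suml; congr (_ + _).
    by apply: eq_bigr => i _; rewrite /b splitl.
  by apply: eq_bigr => i _; rewrite /b splitr mulrA.
exists b; split.
- move=> i; apply/(L_poleP _ gr); rewrite /b; case: (fintype.split i) => j.
    exists 'X^j, 0; rewrite ev0 mul0r addr0 evX_n evX size_polyXn size_poly0.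
    by split=> //; rewrite ltn_ord.
  exists 0, 'X^j; rewrite ev0 add0r evX_n evX size_polyXn size_poly0.
  by split=> //; rewrite ltn_ord.
- move=> a; rewrite sumE => /(hyper_free H)[E1 E2] i.
  case: (split_ordP i) => j ->.
    by have := congr1 (fun p : {poly F} => p`_j) E1; rewrite coef_rVpoly_ord mxE coef0.
  by have := congr1 (fun p : {poly F} => p`_j) E2; rewrite coef_rVpoly_ord mxE coef0.
- move=> z /(L_poleP _ gr)[A [B [sA sB ->]]].
  exists (fun i => match fintype.split i with inl j => A`_j | inr j => B`_j end).
  rewrite sumE; congr (evy _ + evy _ * s).
    rewrite -{1}(poly_rV_K sA); congr rVpoly; apply/rowP => i.
    by rewrite !mxE splitl.
  rewrite -{1}(poly_rV_K sB); congr rVpoly; apply/rowP => i.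
  by rewrite !mxE splitr.
Qed.

Lemma has_dim_indep V n : has_dimension iota V n -> indep n V.
Proof. by move=> [b [h1 h2 _]]; exists b. Qed.

Lemma indep_sub n (V W : set K) : (forall z, V z -> W z) -> indep n V -> indep n W.
Proof. by move=> VW [b [h1 h2]]; exists b; split=> // i; apply: VW. Qed.

Lemma has_dim_le V l m : has_dimension iota V l -> indep m V -> (m <= l)%N.
Proof.
move=> [b [hb fb gb]] [c [hc fc]].
have [a ha] := choice (fun i => gb (c i) (hc i)).
rewrite leqNgt; apply/negP => lm.
pose M := \matrix_(i < m, j < l) a i j.
have : kermx M != 0.
  rewrite -mxrank_eq0 mxrank_ker -lt0n subn_gt0.
  exact: leq_ltn_trans (rank_leq_col M) lm.
case/rowV0Pn => u /sub_kermxP uM u0; case/eqP: u0.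
apply/rowP => i; rewrite mxE; move: i; apply: fc.
under eq_bigr do rewrite ha mulr_sumr.
rewrite exchange_big /= big1 // => j _.
have := congr1 (fun N : 'rV_l => iota (N 0 j)) uM; rewrite !mxE rmorph0 rmorph_sum /=.
under eq_bigr do rewrite mxE rmorphM.
move=> E; have <- : (\sum_i iota (u 0 i) * iota (a i j)) * b j =
    \sum_i iota (u 0 i) * (iota (a i j) * b j).
  by rewrite mulr_suml; apply: eq_bigr => i _; rewrite mulrA.
by rewrite E mul0r.
Qed.

(** Lowering [D] by one at a place costs at most one dimension, since the residue field is [F]: if
    some [b j] has the extreme order - D v, the other elements are corrected by multiples of it. *)
Lemma indep_step n D v : place iota v -> indep n.+1 (L D) ->
  indep n (L (fun w => if w == v then D w - 1 else D w)).
Proof.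
move=> pv [b [hb fb]].
have hbP i : forall w, place iota w -> vge w (- D w) (b i) by apply/rr_spaceP.
have lin (j : 'I_n.+1) (c : 'I_n -> F) :
    (forall i, vge v (1 - D v) (b (lift j i) - iota (c i) * b j)) ->
    indep n (L (fun w => if w == v then D w - 1 else D w)).
  move=> hv; exists (fun i => b (lift j i) - iota (c i) * b j); split.
    move=> i; apply/rr_spaceP => w pw; case: eqP => [->|_].
      by rewrite opprB; exact: hv.
    apply: (vgeD pw); [exact: hbP|apply: (vgeN pw)].
    by rewrite -[X in vge w X]add0r; apply: (vgeM pw); [exact: (vge_iota pw)|exact: hbP].
  move=> a E i.
  pose a' k := if unlift j k is Some l then a l else - \sum_l a l * c l.
  have := fb a' _ (lift j i); rewrite /a' liftK; apply.
  rewrite (bigD1_ord j) //= unlift_none -[RHS]E.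
  rewrite rmorphN rmorph_sum /= mulNr mulr_suml addrC -sumrB.
  apply: eq_bigr => k _; rewrite liftK rmorphM; ring.
have [[j hj]|no] := pselect (exists j, ~ vge v (1 - D v) (b j)); last first.
  apply: (lin ord0 (fun=> 0)) => i; rewrite rmorph0 mul0r subr0.
  by apply: contrapT => h1; apply: no; exists (lift ord0 i).
have bj0 : b j != 0 by apply/eqP => bj0; apply: hj; left.
have vj : v (b j) = - D v.
  have [/eqP|] := hbP j v pv; first by rewrite (negPf bj0).
  move=> h1; apply/eqP; rewrite eq_le h1 andbT leNgt; apply/negP => h2.
  by apply: hj; right; lia.
have ex (i : 'I_n) : exists c, vge v (1 - D v) (b (lift j i) - iota c * b j).
  have [|c hc] := @place_residue_field v (b (lift j i) / b j) pv.
    rewrite -(subrr (- D v)); apply: (vgeM pv); first exact: hbP.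
    by right; rewrite (placeV pv) vj.
  exists c; have -> : b (lift j i) - iota c * b j = (b (lift j i) / b j - iota c) * b j.
    by rewrite mulrBl mulfVK.
  by apply: (vgeM pv) => //; right; rewrite vj.
by have [c hc] := choice ex; apply: (lin j c).
Qed.

Lemma indep_chain (T : seq (K -> int)) n (D D' : (K -> int) -> int) :
  uniq T -> (forall v, v \in T -> place iota v) ->
  (forall v, place iota v -> D v <= D' v) ->
  (forall v, place iota v -> v \notin T -> D v = D' v) ->
  indep n (L D') -> indep (n - \sum_(v <- T) `|D' v - D v|%N) (L D).
Proof.
move=> uT pT; move Em : (\sum_(v <- T) _)%N => m.
elim: m n D' Em => [|m IH] n D' Em le eq.
  rewrite subn0; apply: indep_sub => z /rr_spaceP hz; apply/rr_spaceP => v pv.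
  suff -> : D v = D' v by exact: hz.
  have [vT|] := boolP (v \in T); last exact: eq.
  move/eqP: Em; rewrite (big_rem v) //= addn_eq0 absz_eq0 subr_eq0 => /andP[/eqP].
  by [].
case: n => [|n]; first by move=> _; exists (fun i => 0); split; [case|move=> a _; case].
have [v vT vn] : exists2 v, v \in T & `|D' v - D v|%N != 0%N.
  apply: contrapT => no; move: Em; rewrite big1_seq // => v /= vT.
  by apply/eqP; apply: contraT => h1; exfalso; apply: no; exists v.
move=> /(indep_step (pT v vT)) h1; rewrite subSS; apply: IH h1.
- move: Em; rewrite !(bigD1_seq v) //= eqxx => Em.
  under eq_bigr => i iv do rewrite (negPf iv).
  by have := le v (pT v vT); move: Em vn; move: (\sum_(_ <- _ | _) _)%N => q; lia.
- move=> w pw; case: eqP => [->|_]; last exact: le.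
  by have := le v (pT v vT); lia.
- move=> w pw wT; case: eqP => [wv|_]; last exact: eq.
  by rewrite wv vT in wT.
Qed.

Lemma degree_seq (T : seq (K -> int)) D : uniq T ->
  (forall v, v \in T -> place iota v) ->
  (forall v, place iota v -> v \notin T -> D v = 0) ->
  degree iota D = \sum_(v <- T) D v.
Proof.
move=> uT pT DT; rewrite /degree (@fsbigE _ _ _ _ _ T) //.
rewrite big_seq_cond [RHS]big_seq_cond; apply: eq_bigl => v.
apply/andP/andP => [[vT _]|[vT _]]; split=> //.
by rewrite inE; exact: pT.
Qed.

Lemma sum_supp (T vs : seq (K -> int)) (f : (K -> int) -> int) : uniq T -> uniq vs ->
  (forall v, v \in vs -> v \in T) -> (forall v, v \in T -> v \notin vs -> f v = 0) ->
  \sum_(v <- T) f v = \sum_(v <- vs) f v.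
Proof.
move=> uT uvs sub f0; rewrite (bigID (mem vs)) /= [X in _ + X]big_seq_cond.
rewrite [X in _ + X]big1 ?addr0; last by move=> v /andP[]; exact: f0.
rewrite -big_filter; apply: perm_big; apply: uniq_perm => // [|v].
  exact: filter_uniq.
by rewrite mem_filter; apply/andP/idP => [[]//|h1]; split=> //; exact: sub.
Qed.

Definition zeros (c : F) (v : K -> int) : int := Num.max 0 (v (evy ('X - c%:P))).

Let pole_sum T : uniq T -> (forall v, v \in T -> place iota v) ->
  (forall v, place iota v -> 0 < v y^-1 -> v \in T) -> \sum_(v <- T) pole v = 2.
Proof.
move=> uT pT hT; have [vs [uvs vsP <-]] := places_infinity.
rewrite (@sum_supp T vs) //.
- apply: eq_big_seq => v /vsP[pv vc]; rewrite (placeV pv) in vc *.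
  by rewrite /pole max_r // ltW.
- by move=> v /vsP[]; exact: hT.
- move=> v /pT pv vn; rewrite /pole max_l // leNgt; apply/negP => h1.
  by case/negP: vn; apply/vsP; rewrite (placeV pv).
Qed.

Let zeros_sum c T : uniq T -> (forall v, v \in T -> place iota v) ->
  (forall v, place iota v -> 0 < v (evy ('X - c%:P)) -> v \in T) ->
  \sum_(v <- T) zeros c v = 2.
Proof.
move=> uT pT hT; have [vs [uvs vsP <-]] := places_above H (@hsep c).
rewrite (@sum_supp T vs) //.
- by apply: eq_big_seq => v /vsP[pv vc]; rewrite /zeros max_r // ltW.
- by move=> v /vsP[]; exact: hT.
- move=> v /pT pv vn; rewrite /zeros max_l // leNgt; apply/negP => h1.
  by case/negP: vn; apply/vsP.
Qed.

(** The divisor of [y - c] is [zeros c] minus [pole], so division by the product of the (y - c)^M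
    turns poles at infinity into poles over [cs]. *)
Lemma L_shift (cs : seq F) (M : nat) n :
  let r := (M + M * size cs)%N in
  indep n (L (fun v => r%:Z * pole v)) ->
  indep n (L (fun v => M%:Z * pole v + M%:Z * \sum_(c <- cs) zeros c v)).
Proof.
move=> r [b [hb fb]]; pose f := evy (\prod_(c <- cs) ('X - c%:P) ^+ M).
have f0 : f != 0.
  rewrite (ev_eq0 H); apply: monic_neq0; apply: monic_prod => c _.
  by rewrite monic_exp ?monicXsubC.
exists (fun i => b i / f); split; last first.
  move=> a E; apply: fb; have := congr1 (fun z => z * f) E.
  rewrite mul0r => E2; rewrite -[RHS]E2 mulr_suml; apply: eq_bigr => i _.
  by rewrite mulrA mulfVK.
move=> i; apply/rr_spaceP => v pv; have /rr_spaceP/(_ v pv) := hb i.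
have pr (k : F -> int) : (forall c, v (evy ('X - c%:P)) = k c) ->
    v f = M%:Z * \sum_(c <- cs) k c.
  rewrite /f => hk; elim: cs {r hb f f0} => [|c l IH].
    by rewrite !big_nil ev1 (place1 pv) mulr0.
  rewrite !big_cons evM (placeM pv); first last.
  - rewrite (ev_eq0 H); apply: monic_neq0; apply: monic_prod => d _.
    by rewrite monic_exp ?monicXsubC.
  - by rewrite (ev_eq0 H) monic_neq0 // monic_exp ?monicXsubC.
  by rewrite IH evX_n (placeX pv) ?(ev_eq0 H) ?polyXsubC_eq0 // hk mulrDr.
move=> hz; have vinv k : v f = k -> vge v (- k) f^-1.
  by move=> <-; right; rewrite (placeV pv).
case: (place_fin_inf pv) => [vy|vc].
  have E : v f = M%:Z * \sum_(c <- cs) zeros c v.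
    apply: (pr (fun c => zeros c v)) => c; rewrite /zeros max_r //.
    by have [/eqP|//] := vge_ev ('X - c%:P) pv vy; rewrite (ev_eq0 H) polyXsubC_eq0.
  rewrite opprD; apply: (vgeM pv); last exact: vinv.
  have pv0 : pole v = 0 by rewrite /pole max_l //; case: vy => [/eqP|]; rewrite ?(negPf y0) // oppr_le0.
  by move: hz; rewrite pv0 !mulr0.
have vc' : v y < 0 by rewrite (placeV pv) oppr_gt0 in vc.
have pvE : pole v = - v y by rewrite /pole max_r // oppr_ge0 ltW.
have vyc c : v (evy ('X - c%:P)) = v y.
  have [//||_ <-] := @placeD_lt _ _ iota v pv y (- iota c).
    by apply: (vgeN pv); apply: vge_le (vge_iota pv c); lia.
  by rewrite evD evN evX evC.
have zer c : zeros c v = 0 by rewrite /zeros vyc max_l // ltW.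
rewrite [\sum_(_ <- _) _]big1 ?mulr0 ?addr0; last by move=> c _; exact: zer.
have E := pr (fun=> v y) vyc.
have {}E : v f = M%:Z * ((size cs)%:Z * v y).
  rewrite E; congr (_ * _); elim: (cs) => [|c l IH]; first by rewrite big_nil mul0r.
  by rewrite big_cons IH /= intS mulrDl mul1r.
have -> : - (M%:Z * pole v) = - (r%:Z * pole v) + - (M%:Z * ((size cs)%:Z * v y)).
  by rewrite pvE /r PoszD PoszM; ring.
by apply: (vgeM pv) => //; exact: vinv.
Qed.

(** Enlarge [D] to a divisor [D'] linearly equivalent to r times [pole]. There the degree is 2 r and
    the dimension at least 2 r + 1 - g; passing back to [D] loses at most one dimension for each
    degree. *)
Lemma riemann D l : divisor iota D ->
  has_dimension iota (L D) l -> degree iota D - l%:Z + 1 <= g%:Z.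
Proof.
move=> /finite_seqP[S0 S0E] hl; pose S := undup S0.
have SP v : v \in S <-> place iota v /\ D v != 0.
  rewrite mem_undup; have := congr1 (fun A : set (K -> int) => A v) S0E.
  by rewrite /setI /= => ->.
have cP v : exists c, place iota v -> vge v 0 y -> 0 < v (evy ('X - c%:P)).
  have [[pv vy]|no] := pselect (place iota v /\ vge v 0 y).
    by have [c hc] := place_finite H pv vy; exists c.
  by exists 0 => pv vy; case: no.
have [cf hcf] := choice cP.
(* Every place in the support of [D] lies over infinity or over some [c] in [cs], and [M] bounds
   each value of [D], so D <= D'. The summand [g] of [M] makes [L_pole_dim] applicable. *)
pose cs := map cf S; pose M := (g + \sum_(v <- S) `|D v|%N)%N.
pose D' v := M%:Z * pole v + M%:Z * \sum_(c <- cs) zeros c v.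
have abv c : exists vs : seq (K -> int), [/\ uniq vs,
  forall v, v \in vs <-> place iota v /\ 0 < v (evy ('X - c%:P)) &
  \sum_(v <- vs) v (evy ('X - c%:P)) = 2] := places_above H (@hsep c).
have [ab abP] := choice abv.
have [vi [uvi viP _]] := places_infinity.
pose T := undup (S ++ vi ++ flatten (map ab cs)).
have uT : uniq T by exact: undup_uniq.
have inT v : v \in T = [|| v \in S, v \in vi | v \in flatten (map ab cs)].
  by rewrite mem_undup !mem_cat.
have pT v : v \in T -> place iota v.
  rewrite inT => /or3P[/SP[]//|/viP[]//|/flatten_mapP[c _]].
  by have [_ h1 _] := abP c => /h1[].
have infT v : place iota v -> 0 < v y^-1 -> v \in T.
  by move=> pv vc; rewrite inT; apply/or3P; constructor 2; apply/viP.
have finT c v : c \in cs -> place iota v -> 0 < v (evy ('X - c%:P)) -> v \in T.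
  move=> cc pv vc; rewrite inT; apply/or3P; constructor 3.
  by apply/flatten_mapP; exists c => //; have [_ h1 _] := abP c; apply/h1.
have zge c v : 0 <= zeros c v by rewrite le_max lexx.
have sge v : 0 <= \sum_(c <- cs) zeros c v by apply: sumr_ge0.
have D'ge v : 0 <= D' v by rewrite addr_ge0 // mulr_ge0.
have DD' v : place iota v -> D v <= D' v.
  move=> pv; have [->//|Dv] := eqVneq (D v) 0.
  have vS : v \in S by apply/SP.
  have DM : D v <= M%:Z.
    by rewrite /M (big_rem v) //=; move: (\sum_(_ <- _) _)%N => q; lia.
  apply: (le_trans DM); rewrite /D' -mulrDr -[X in X <= _]mulr1 ler_wpM2l //.
  case: (place_fin_inf pv) => [vy|vc]; last first.
    by have := sge v; rewrite /pole -(placeV pv) max_r ?(ltW vc) //; lia.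
  have hc := hcf v pv vy.
  have : zeros (cf v) v <= \sum_(c <- cs) zeros c v.
    have cc : cf v \in cs by apply: map_f.
    by rewrite (big_rem _ cc) /= lerDl sumr_ge0.
  have -> : zeros (cf v) v = v (evy ('X - (cf v)%:P)) by rewrite /zeros max_r // ltW.
  by have := pole_ge0 v; move: (pole v) (\sum_(_ <- _) _) (v _) hc; lia.
have D0 v : place iota v -> v \notin T -> D v = 0.
  move=> pv vT; apply/eqP; apply: contraT => Dv; case/negP: vT.
  by rewrite inT; apply/or3P; constructor 1; apply/SP.
have D'0 v : place iota v -> v \notin T -> D' v = 0.
  move=> pv vT; rewrite /D'.
  have -> : pole v = 0.
    rewrite /pole max_l // leNgt; apply/negP => h1; case/negP: vT.
    by apply: infT; rewrite ?(placeV pv).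
  rewrite mulr0 add0r big1_seq ?mulr0 // => c /= cc.
  by rewrite /zeros max_l // leNgt; apply/negP => h1; case/negP: vT; exact: finT h1.
have degD := degree_seq uT pT D0.
have degD' : \sum_(v <- T) D' v = 2 * (M + M * size cs)%N%:Z.
  rewrite /D' big_split /= -!mulr_sumr pole_sum // exchange_big /=.
  have -> : \sum_(c <- cs) \sum_(v <- T) zeros c v = \sum_(c <- cs) 2.
    by apply: eq_big_seq => c cc; apply: zeros_sum => // v; exact: finT.
  have -> : \sum_(c <- cs) 2 = 2 * (size cs)%:Z.
    elim: (cs) => [|c l' IH]; first by rewrite big_nil mulr0.
    by rewrite big_cons IH /= intS; ring.
  by rewrite PoszD PoszM; ring.
have gr : (g <= M + M * size cs)%N by rewrite /M; lia.
have /has_dim_indep/L_shift h1 := L_pole_dim gr.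
have h2 := indep_chain uT pT DD' (fun v pv vT => etrans (D0 v pv vT) (esym (D'0 v pv vT))) h1.
have := has_dim_le hl h2.
have E : (\sum_(v <- T) `|D' v - D v|%N)%N%:Z = \sum_(v <- T) D' v - \sum_(v <- T) D v.
  rewrite -sumrB (big_morph Posz PoszD (erefl _)).
  by apply: eq_big_seq => v /pT/DD'; move: (D v) (D' v); lia.
rewrite degD' -degD in E.
move: E gr; move: (\sum_(v <- T) _)%N (degree _ _) (M + M * size cs)%N => a d r; lia.
Qed.

Theorem hyperelliptic_genus : has_genus iota g.
Proof.
split; last by move=> D l hD; exact: riemann.
have [vs [uvs vsP _]] := places_infinity.
(* The bound is attained here: degree 2 g and dimension g + 1. *)
exists (fun v => g%:Z * pole v), (g.+1 + (g - g))%N.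
have pvs v : v \in vs -> place iota v by case/vsP.
have p0 v : place iota v -> v \notin vs -> pole v = 0.
  move=> pv vn; rewrite /pole max_l // leNgt; apply/negP => h1.
  by case/negP: vn; apply/vsP; rewrite (placeV pv).
split.
- apply/finite_seqP; exists [seq v <- vs | g%:Z * pole v != 0].
  apply/seteqP; split=> v /=; rewrite mem_filter.
    move=> [pv gv]; rewrite gv /=; apply: contraT => vn.
    by rewrite p0 // mulr0 eqxx in gv.
  by move=> /andP[gv /pvs].
- exact: L_pole_dim.
- rewrite (degree_seq uvs) //; last by move=> v pv /p0 ->; rewrite ?mulr0.
  rewrite -mulr_sumr pole_sum //; last by move=> v pv vc; apply/vsP.
  by lia.
Qed.

End RiemannRoch.

Lemma has_genus_unique (F K : fieldType) (iota : {rmorphism F -> K}) g g' :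
  has_genus iota g -> has_genus iota g' -> g = g'.
Proof.
have le a b : has_genus iota a -> has_genus iota b -> (a <= b)%N.
  by move=> [[D [l [hD hl E]]] _] [_ /(_ D l hD hl)]; rewrite E.
by move=> h h'; apply/eqP; rewrite eqn_leq !le.
Qed.

(** * A first-order equation for d-th roots *)

Section PairAlgebra.
Variables (F : numFieldType) (h : {poly F}).
Implicit Types z w a : {poly F} * {poly F}.

(* A pair z = (q, b) stands for q + b s with s^2 = h, and a pair a = (A, B) in
   the position of a derivative for A + B / s; then ddp z is 2 X z'. *)
Definition pmul z w := (z.1 * w.1 + z.2 * w.2 * h, z.1 * w.2 + z.2 * w.1).
Definition pact a z := (a.1 * z.1 + a.2 * z.2, a.1 * z.2 * h + a.2 * z.1).
Definition ddp z :=
  (2%:R * ('X * z.1^`()), 'X * (2%:R * z.2^`() * h + z.2 * h^`())).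
Definition pexp z n := iter n (pmul z) (1, 0).

Lemma ddpM z w : ddp (pmul z w) =
  ((pact (ddp z) w).1 + (pact (ddp w) z).1, (pact (ddp z) w).2 + (pact (ddp w) z).2).
Proof.
by rewrite /ddp /pmul /pact /= !derivD !derivM; congr pair; ring.
Qed.

Lemma pactA a z w : pact (pact a z) w = pact a (pmul z w).
Proof. by rewrite /pact /pmul /=; congr pair; ring. Qed.

Lemma pmulC z w : pmul z w = pmul w z.
Proof. by rewrite /pmul; congr pair; ring. Qed.

Lemma pmulA z w v : pmul z (pmul w v) = pmul (pmul z w) v.
Proof. by rewrite /pmul /=; congr pair; ring. Qed.

Lemma pexpS z n : pexp z n.+1 = pmul z (pexp z n).
Proof. by []. Qed.

Lemma pactZ (c : {poly F}) a z : pact (c * a.1, c * a.2) z =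
  (c * (pact a z).1, c * (pact a z).2).
Proof. by rewrite /pact /=; congr pair; ring. Qed.

Lemma ddp_exp z n : ddp (pexp z n.+1) =
  (n.+1%:R * (pact (ddp z) (pexp z n)).1, n.+1%:R * (pact (ddp z) (pexp z n)).2).
Proof.
elim: n => [|n IH].
  by rewrite /pexp /= /ddp /pmul /pact /=; congr pair; rewrite !(mulr0, mul0r, addr0, mulr1); ring.
rewrite pexpS ddpM IH pactZ.
have -> : pact (pact (ddp z) (pexp z n)) z = pact (ddp z) (pexp z n.+1).
  by rewrite pactA pmulC -pexpS.
by rewrite -(natr1 n.+1) /=; congr pair; ring.
Qed.

Definition pnorm z := z.1 ^+ 2 - z.2 ^+ 2 * h.

Lemma pnormM z w : pnorm (pmul z w) = pnorm z * pnorm w.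
Proof. by rewrite /pnorm /pmul /=; ring. Qed.

Lemma pnormX z n : pnorm (pexp z n) = pnorm z ^+ n.
Proof.
elim: n => [|n IH]; first by rewrite /pnorm /pexp /= expr0; ring.
by rewrite /pexp iterS pnormM -/(pexp z n) IH exprS.
Qed.

Variable tau : {poly F}.

(* d times 2 X z' minus (c + 2 tau / s) z *)
Definition Lam (d : nat) (c : F) z :=
  ((2 * d)%:R * ('X * z.1^`()) - c%:P * z.1 - 2%:R * tau * z.2,
   d%:R * ('X * (2%:R * z.2^`() * h + z.2 * h^`())) - c%:P * z.2 * h
     - 2%:R * tau * z.1).

Lemma LamE d c z :
  (d%:R * (ddp z).1, d%:R * (ddp z).2) =
  ((Lam d c z).1 + (pact (c%:P, 2%:R * tau) z).1,
   (Lam d c z).2 + (pact (c%:P, 2%:R * tau) z).2).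
Proof. by rewrite /Lam /ddp /pact /=; congr pair; ring. Qed.

Lemma Lam_Xn d c j z : Lam d c ('X^j * z.1, 'X^j * z.2) =
  ('X^j * (Lam d (c - (2 * d * j)%:R) z).1,
   'X^j * (Lam d (c - (2 * d * j)%:R) z).2).
Proof.
rewrite /Lam /= !derivM !derivXn polyCB polyC_natr.
case: j => [|j]; first by rewrite !mulr0n !expr0 muln0; congr pair; ring.
by rewrite -mulr_natl /= !exprS; congr pair; ring.
Qed.

(** The lowest coefficients of X^j v satisfy a linear system of size 2 with determinant (c - 2 d
    j)^2 h(0) - 4 tau(0)^2, the indicial polynomial at 0. *)
Lemma Lam_low d c N z :
  (forall i, (i < N)%N ->
    (c - (2 * d * i)%:R) ^+ 2 * h.[0] != 4%:R * tau.[0] ^+ 2) ->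
  'X^N %| (Lam d c z).1 -> 'X^N %| (Lam d c z).2 ->
  exists v, z = ('X^N * v.1, 'X^N * v.2).
Proof.
move=> ind d1 d2.
suff H j : (j <= N)%N -> exists v, z = ('X^j * v.1, 'X^j * v.2) by exact: H.
elim: j => [_|j IH jN]; first by exists z; rewrite expr0 !mul1r; case: z {d1 d2}.
have [v zv] := IH (ltnW jN).
have X0 : 'X^j != 0 :> {poly F} by rewrite monic_neq0 ?monicXn.
have root0 (r : {poly F}) : 'X^N %| 'X^j * r -> r.[0] = 0.
  rewrite -(subnKC (ltnW jN)) exprD dvdp_mul2l // => /dvdpP[q ->].
  by rewrite hornerM hornerXn; case: (N - j)%N (subn_gt0 j N) => [|m]; rewrite ?jN // expr0n mulr0.
rewrite zv Lam_Xn /= in d1 d2; move/root0: d1; move/root0: d2.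
rewrite /Lam /= !hornerE /=.
set c' := c - _; move=> e2 e1; have := ind j jN; rewrite -/c' => nz.
have e1' : c' * v.1.[0] + 2%:R * tau.[0] * v.2.[0] = 0.
  by apply: oppr_inj; rewrite oppr0 -[RHS]e1; ring.
have e2' : c' * v.2.[0] * h.[0] + 2%:R * tau.[0] * v.1.[0] = 0.
  by apply: oppr_inj; rewrite oppr0 -[RHS]e2; ring.
have v1 : v.1.[0] = 0.
  apply/eqP; have : (c' ^+ 2 * h.[0] - 4%:R * tau.[0] ^+ 2) * v.1.[0] == 0.
    have -> : (c' ^+ 2 * h.[0] - 4%:R * tau.[0] ^+ 2) * v.1.[0] =
      c' * h.[0] * (c' * v.1.[0] + 2%:R * tau.[0] * v.2.[0]) -
      2%:R * tau.[0] * (c' * v.2.[0] * h.[0] + 2%:R * tau.[0] * v.1.[0]) by ring.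
    by rewrite e1' e2' !mulr0 subr0.
  by rewrite mulf_eq0 subr_eq0 (negPf nz).
have v2 : v.2.[0] = 0.
  apply/eqP; have : (c' ^+ 2 * h.[0] - 4%:R * tau.[0] ^+ 2) * v.2.[0] == 0.
    have -> : (c' ^+ 2 * h.[0] - 4%:R * tau.[0] ^+ 2) * v.2.[0] =
      c' * (c' * v.2.[0] * h.[0] + 2%:R * tau.[0] * v.1.[0]) -
      2%:R * tau.[0] * (c' * v.1.[0] + 2%:R * tau.[0] * v.2.[0]) by ring.
    by rewrite e1' e2' !mulr0 subr0.
  by rewrite mulf_eq0 subr_eq0 (negPf nz).
move/eqP/factor_theorem: v1 => [u1 E1]; move/eqP/factor_theorem: v2 => [u2 E2].
exists (u1, u2) => /=; rewrite zv E1 E2 subr0 !exprSr; congr pair; ring.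
Qed.

Lemma coef_natM (a : {poly F}) m i : (m%:R * a)`_i = m%:R * a`_i.
Proof. by rewrite mulr_natl coefMn mulr_natl. Qed.

Lemma coefM_top (a b : {poly F}) i j : (size a <= i.+1)%N -> (size b <= j.+1)%N ->
  (a * b)`_(i + j) = a`_i * b`_j.
Proof.
move=> sa sb; rewrite coefM (bigD1 (inord i)) //= inordK ?ltnS ?leq_addr // addKn.
rewrite big1 ?addr0 // => l /eqP li.
have [il|il] := leqP l i; last by rewrite nth_default ?mul0r // (leq_trans sa).
have {}il : (l < i)%N.
  rewrite ltn_neqAle il andbT; apply/eqP => E; apply: li; apply: val_inj => /=.
  by rewrite inordK // ltnS leq_addr.
rewrite [X in _ * X]nth_default ?mulr0 // (leq_trans sb) //.
by have := ltn_ord l; lia.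
Qed.

(** The same argument at infinity: the top coefficients of the two components satisfy a system whose
    determinant is the indicial polynomial there, so excess degree is removed one step at a time. *)
Lemma Lam_top d c g m z : size h = (2 * g).+3 -> (size tau <= g.+2)%N ->
  (g <= m)%N ->
  (forall i, (m < i)%N ->
    ((2 * d * i)%:R - c) ^+ 2 * lead_coef h != 4%:R * tau`_g.+1 ^+ 2) ->
  (size (Lam d c z).1 <= m.+1)%N -> (size (Lam d c z).2 <= m + g.+2)%N ->
  (size z.1 <= m.+1)%N /\ (size z.2 <= m - g)%N.
Proof.
move=> sh st gm ind s1 s2.
have red M : (m <= M)%N -> (size z.1 <= M.+2)%N -> (size z.2 <= (M - g).+1)%N ->
    (size z.1 <= M.+1)%N /\ (size z.2 <= M - g)%N.
  move=> mM sz1 sz2.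
  have e1 : (Lam d c z).1`_M.+1 = 0 by rewrite nth_default // (leq_trans s1).
  have e2 : (Lam d c z).2`_(M + g.+2) = 0.
    by rewrite nth_default // (leq_trans s2) // leq_add2r.
  have E1 : (tau * z.2)`_M.+1 = tau`_g.+1 * z.2`_(M - g).
    have {1}-> : M.+1 = (g.+1 + (M - g))%N by lia.
    exact: coefM_top.
  have E2 : (tau * z.1)`_(M + g.+2) = tau`_g.+1 * z.1`_M.+1.
    have -> : (M + g.+2 = g.+1 + M.+1)%N by lia.
    exact: coefM_top.
  have hl : h`_(2 * g).+2 = lead_coef h by rewrite lead_coefE sh.
  have E3 : (z.2 * h)`_(M + g.+2) = z.2`_(M - g) * lead_coef h.
    have -> : (M + g.+2 = (M - g) + (2 * g).+2)%N by lia.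
    by rewrite coefM_top ?hl // sh.
  have hd : (M + g.+2 = ((M - g) + (2 * g).+1).+1)%N by lia.
  have E4 : ('X * (z.2 * h^`()))`_(M + g.+2) = z.2`_(M - g) * lead_coef h *+ (2 * g).+2.
    rewrite hd coefXM /= coefM_top //; last first.
      by apply/leq_sizeP => j hj; rewrite coef_deriv nth_default ?mul0rn // sh.
    by rewrite coef_deriv hl mulrnAr.
  have E5 : ('X * (z.2^`() * h))`_(M + g.+2) = z.2`_(M - g) * lead_coef h *+ (M - g).
    rewrite mulrA (_ : M + g.+2 = (M - g) + (2 * g).+2)%N; last by lia.
    rewrite coefM_top ?hl ?sh //.
      by rewrite coefXM; case: (M - g)%N => [|i]; rewrite ?mul0r ?mulr0n //= coef_deriv mulrnAl.
    apply/leq_sizeP => j hj; rewrite coefXM; case: j hj => [|j] //= hj.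
    by rewrite coef_deriv nth_default ?mul0rn // (leq_trans sz2).
  have nz := ind M.+1 mM.
  rewrite /Lam /= !coefB mulr_natl coefMn coefXM /= coef_deriv coefCM -mulrA mulr_natl coefMn E1 in e1.
  have e2' : (d * 2)%:R * ('X * (z.2^`() * h))`_(M + g.+2) + d%:R * ('X * (z.2 * h^`()))`_(M + g.+2)
     - c * (z.2 * h)`_(M + g.+2) - 2%:R * (tau * z.1)`_(M + g.+2) = 0.
    rewrite -[RHS]e2 /Lam /= !coefB; congr (_ - _ - _).
    - rewrite coef_natM.
      have -> : 'X * (2%:R * z.2^`() * h + z.2 * h^`()) =
        2%:R * ('X * (z.2^`() * h)) + 'X * (z.2 * h^`()) by ring.
      by rewrite coefD coef_natM natrM; ring.
    - by rewrite -mulrA coefCM.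
    - by rewrite -[2%:R * tau * _]mulrA coef_natM.
  rewrite E2 E3 E4 E5 in e2'.
  set x := z.1`_M.+1 in e1 e2'; set w := z.2`_(M - g) in e1 e2'; set lc := lead_coef h in nz e2'.
  set t := tau`_g.+1 in nz e1 e2'.
  set A := (2 * d * M.+1)%:R - c in nz.
  have e1' : A * x - 2%:R * t * w = 0.
    by rewrite -[RHS]e1 /A; ring.
  have e2'' : A * lc * w - 2%:R * t * x = 0.
    rewrite -[RHS]e2' /A.
    have -> : (2 * d * M.+1)%:R = (d * 2)%:R * (M - g)%:R + d%:R * (2 * g).+2%:R :> F.
      by rewrite -!natrM -natrD; congr (_%:R); lia.
    by ring.
  have x0 : x = 0.
    apply/eqP; have : (A ^+ 2 * lc - 4%:R * t ^+ 2) * x == 0.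
      have -> : (A ^+ 2 * lc - 4%:R * t ^+ 2) * x =
        A * lc * (A * x - 2%:R * t * w) + 2%:R * t * (A * lc * w - 2%:R * t * x) by ring.
      by rewrite e1' e2'' !mulr0 addr0.
    by rewrite mulf_eq0 subr_eq0 (negPf nz).
  have w0 : w = 0.
    apply/eqP; have : (A ^+ 2 * lc - 4%:R * t ^+ 2) * w == 0.
      have -> : (A ^+ 2 * lc - 4%:R * t ^+ 2) * w =
        A * (A * lc * w - 2%:R * t * x) + 2%:R * t * (A * x - 2%:R * t * w) by ring.
      by rewrite e1' e2'' !mulr0 addr0.
    by rewrite mulf_eq0 subr_eq0 (negPf nz).
  have szs (a : {poly F}) j : (size a <= j.+1)%N -> a`_j = 0 -> (size a <= j)%N.
    move=> h1 h2; apply/leq_sizeP => l; rewrite leq_eqVlt => /orP[/eqP<-//|h3].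
    by rewrite nth_default // (leq_trans h1).
  by split; apply: szs.
have : (size z.1 <= (m + (size z.1 + size z.2)).+1)%N /\
       (size z.2 <= m + (size z.1 + size z.2) - g)%N.
  by move: (size z.1) (size z.2); lia.
elim: (size z.1 + size z.2)%N => [|i IH]; first by rewrite addn0.
by rewrite addnS => -[h1 h2]; apply: IH; apply: red; move: (size z.1) (size z.2) h1 h2; lia.
Qed.

Lemma deriv_monomial (E : {poly F}) j : 'X * E^`() = j%:R * E -> E = E`_j *: 'X^j.
Proof.
move=> H; apply/polyP => i; rewrite coefZ coefXn.
have := congr1 (fun p : {poly F} => p`_i) H; rewrite coefXM mulr_natl coefMn.
have [->|ij] := eqVneq i j; first by rewrite mulr1.
rewrite mulr0 => E1; apply/eqP; have : E`_i * (i%:R - j%:R) == 0.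
  rewrite mulrBr !mulr_natr -E1; case: i {ij E1} => [|i]; first by rewrite mulr0n subrr.
  by rewrite coef_deriv subrr.
by rewrite mulf_eq0 subr_eq0 eqr_nat (negPf ij) orbF.
Qed.

(** The equation makes Y^2 h a multiple of the monomial X^(2 j), but [h] vanishes at a nonzero
    point. *)
Lemma odd_part_zero (Y : {poly F}) j r : r != 0 -> root h r -> h != 0 ->
  'X * (2%:R * Y^`() * h + Y * h^`()) = (2 * j)%:R * Y * h -> Y = 0.
Proof.
move=> r0 hr h0 E; have /deriv_monomial E2 : 'X * (Y ^+ 2 * h)^`() = (2 * j)%:R * (Y ^+ 2 * h).
  have -> : (2 * j)%:R * (Y ^+ 2 * h) = Y * ((2 * j)%:R * Y * h) by ring.
  by rewrite -E expr2 !derivM; ring.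
have c0 : (Y ^+ 2 * h)`_(2 * j) = 0.
  have := congr1 (fun p => p.[r]) E2; rewrite hornerM (eqP hr) mulr0 hornerZ hornerXn.
  by move/eqP; rewrite eq_sym mulf_eq0 expf_eq0 (negPf r0) andbF orbF => /eqP.
rewrite c0 scale0r in E2; move/eqP: E2.
by rewrite mulf_eq0 (negPf h0) orbF expf_eq0 => /eqP.
Qed.

End PairAlgebra.

Section Pell.
Variable F : numFieldType.

(** Put s^2 = h and W = p + sg s. Then [pell_tau] is the part without s of X W' = (k + tau / s) W,
    and the other part follows by differentiating [pell_eq]. Hence
    [Lam h tau d (2 * k)%:R z = (0, 0)] says that d X z' / z is the logarithmic derivative X W' /
    W. *)
Record pell (n k g : nat) (p : {poly F}) (e : F) (sg h tau : {poly F}) : Prop :=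
  Pell {
  pell_size : size p = n.+1;
  pell_e : e != 0;
  pell_monic : sg \is monic;
  pell_size_sg : size sg = (n - g)%N;
  pell_size_h : size h = (2 * g).+3;
  pell_eq : p ^+ 2 - (4%:R * e) *: 'X^(2 * k) = sg ^+ 2 * h;
  pell_sep : forall r, root (sg * h) r -> ~~ root (sg * h)^`() r;
  pell_tau : 'X * p^`() - k%:R * p = sg * tau;
  pell_0 : (0 < k)%N -> p.[0] != 0 }.

Variables (n k g : nat) (p : {poly F}) (e : F) (sg h tau : {poly F}).
Hypotheses (H : pell n k g p e sg h tau) (kn : (k < n)%N) (gn : (g < n)%N).

Lemma pell_h_neq0 : h != 0.
Proof. by rewrite -size_poly_eq0 (pell_size_h H). Qed.

Lemma pell_lead : lead_coef h = p`_n ^+ 2.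
Proof.
have := congr1 (fun q : {poly F} => q`_(n + n)) (pell_eq H).
rewrite coefB coefZ coefXn (_ : (n + n == 2 * k)%N = false) ?mulr0 ?subr0; last by apply/eqP; lia.
have -> : (p ^+ 2)`_(n + n) = p`_n ^+ 2.
  by rewrite !expr2; apply: coefM_top; rewrite (pell_size H).
move=> ->.
have ssq : (size (sg ^+ 2) <= (2 * (n - g).-1).+1)%N.
  apply: (leq_trans (size_poly_exp_leq _ _)); rewrite (pell_size_sg H); lia.
have -> : (n + n = 2 * (n - g).-1 + (2 * g).+2)%N by lia.
rewrite coefM_top ?(pell_size_h H) // lead_coefE (pell_size_h H) /=.
have -> : (2 * (n - g).-1 = (n - g).-1 + (n - g).-1)%N by lia.
have sg1 : sg`_(n - g).-1 = 1.
  by rewrite -(pell_size_sg H) -/(lead_coef sg) (monicP (pell_monic H)).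
have -> : (sg ^+ 2)`_((n - g).-1 + (n - g).-1) = 1.
  by rewrite expr2 coefM_top ?sg1 ?mulr1 // (pell_size_sg H); lia.
by rewrite mul1r.
Qed.

Lemma pell_size_tau : (size tau <= g.+2)%N.
Proof.
have [->|t0] := eqVneq tau 0; first by rewrite size_poly0.
have st : size (sg * tau) = ((n - g).-1 + size tau)%N.
  by rewrite size_monicM ?(pell_monic H) // (pell_size_sg H); lia.
have : leq (size (sg * tau)) n.+1.
  rewrite -(pell_tau H); apply/leq_sizeP => j hj; rewrite coefB mulr_natl coefMn.
  rewrite [p`_j]nth_default ?(pell_size H) // mul0rn subr0 coefXM.
  by case: j hj => // j hj; rewrite coef_deriv nth_default ?mul0rn ?(pell_size H).
by rewrite st; move: (size tau); lia.
Qed.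

(** With [pell_lead], this says that tau / s tends to n - k or its opposite at the two places over
    infinity. *)
Lemma pell_tau_top : tau`_g.+1 = (n - k)%:R * p`_n.
Proof.
have := congr1 (fun q : {poly F} => q`_n) (pell_tau H).
have {2}-> : n = ((n - g).-1 + g.+1)%N by lia.
rewrite coefM_top ?(pell_size_sg H) ?pell_size_tau //; try lia.
have -> : sg`_(n - g).-1 = 1.
  by rewrite -(pell_size_sg H) -/(lead_coef sg) (monicP (pell_monic H)).
rewrite mul1r => <-; rewrite coefB mulr_natl coefMn coefXM.
case: n kn gn => [|m] km _ //=; rewrite coef_deriv.
by rewrite natrB ?(ltnW km) // mulrBl !mulr_natl.
Qed.

(** The values of tau / s at the two places over 0 are k and - k. *)
Lemma pell_tau0 : (0 < k)%N -> h.[0] != 0 /\ tau.[0] ^+ 2 = k%:R ^+ 2 * h.[0].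
Proof.
move=> k0; have p0 := pell_0 H k0.
have e1 : p.[0] ^+ 2 = sg.[0] ^+ 2 * h.[0].
  have := congr1 (fun q => q.[0]) (pell_eq H).
  by rewrite !hornerE /= expr0n muln_eq0 (gtn_eqF k0) /= mulr0 subr0.
have nz : sg.[0] ^+ 2 * h.[0] != 0 by rewrite -e1 expf_neq0.
move: (nz); rewrite mulf_eq0 expf_eq0 /= negb_or => /andP[s0 h0]; split=> //.
have e2 : sg.[0] * tau.[0] = - (k%:R * p.[0]).
  have := congr1 (fun q => q.[0]) (pell_tau H).
  rewrite mulr_natl !(hornerD, hornerN, hornerMn, hornerM, hornerX) mul0r sub0r.
  by move=> <-; rewrite -mulr_natl.
apply: (mulfI (expf_neq0 2 s0)); rewrite -exprMn e2.
by rewrite sqrrN exprMn e1; ring.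
Qed.

(** The conjugate p - sg s is 4 e X^(2 k) / W, so X times its logarithmic derivative is k - tau /
    s. *)
Lemma pell_conj : ddp h (p, - sg) = pact h ((2 * k)%:R, - (2%:R * tau)) (p, - sg).
Proof.
have sg0 : sg != 0 by rewrite monic_neq0 ?(pell_monic H).
rewrite /ddp /pact /=; congr pair.
  have -> : 2%:R * ('X * p^`()) = 2%:R * ('X * p^`() - k%:R * p) + (2 * k)%:R * p.
    by rewrite natrM; ring.
  by rewrite (pell_tau H); ring.
apply: (mulfI sg0); rewrite derivN.
have := congr1 (fun q => 'X * q^`()) (pell_eq H) => /=.
rewrite derivB derivZ derivXn !expr2 !derivM => E.
have E2 : 'X * ((4%:R * e) *: ('X^((2 * k).-1) *+ (2 * k))) = (2 * k)%:R * (p * p - sg * sg * h).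
  rewrite -!expr2 -(pell_eq H) -scalerAr mulrnAr.
  have -> : ('X * 'X^((2 * k).-1)) *+ (2 * k) = 'X^(2 * k) *+ (2 * k) :> {poly F}.
    by case: (2 * k)%N => [|m] /=; rewrite ?mulr0n // exprS.
  by rewrite subKr [RHS]mulr_natl scalerMnr.
have E3 : 'X * p^`() = sg * tau + k%:R * p by rewrite -(pell_tau H) subrK.
move: E; rewrite !mulrBr E2 => E.
have E4 : 'X * (p^`() * p + p * p^`()) = 2%:R * p * ('X * p^`()) by ring.
rewrite E4 E3 in E.
have -> : sg * ('X * (2%:R * - sg^`() * h + - sg * h^`())) =
  - ('X * ((sg^`() * sg + sg * sg^`()) * h + sg * sg * h^`())) by ring.
by rewrite -E natrM; ring.
Qed.

Lemma pell_norm : pnorm h (p, - sg) = (4%:R * e) *: 'X^(2 * k).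
Proof. by rewrite /pnorm /= sqrrN -(pell_eq H) opprB addrC subrK. Qed.

(* the equation satisfied by E = z^d (p - sg s) *)
Lemma Lam_power d z : (0 < d)%N ->
  let E := pmul h (pexp h z d) (p, - sg) in
  let r := pact h (Lam h tau d (2 * k)%:R z) (pmul h (pexp h z d.-1) (p, - sg)) in
  2%:R * ('X * E.1^`()) = (4 * k)%:R * E.1 + r.1 /\
  'X * (2%:R * E.2^`() * h + E.2 * h^`()) = (4 * k)%:R * E.2 * h + r.2.
Proof.
case: d => // d _ E r.
have dd : ddp h E = ((4 * k)%:R * E.1 + r.1, (4 * k)%:R * E.2 * h + r.2).
  rewrite /E ddpM pell_conj ddp_exp.
  have L1 := LamE h tau d.+1 (2 * k)%:R z.
  have [l1 l2] : d.+1%:R * (ddp h z).1 = (Lam h tau d.+1 (2 * k)%:R z).1 + (pact h ((2 * k)%:R%:P, 2%:R * tau) z).1 /\ d.+1%:R * (ddp h z).2 = (Lam h tau d.+1 (2 * k)%:R z).2 + (pact h ((2 * k)%:R%:P, 2%:R * tau) z).2.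
    by case: L1.
  rewrite /r -[d.+1.-1]/d [pexp h z d.+1]pexpS.
  move: (pexp h z d) (Lam _ _ _ _ _) (ddp h z) l1 l2 => Z L D.
  rewrite /pact /pmul /= => l1 l2; congr pair; apply/eqP; rewrite -subr_eq0; apply/eqP.
    transitivity ((d.+1%:R * D.1 - (L.1 + ((2 * k)%:R%:P * z.1 + 2%:R * tau * z.2))) *
        (Z.1 * p + Z.2 * - sg * h) +
      (d.+1%:R * D.2 - (L.2 + ((2 * k)%:R%:P * z.2 * h + 2%:R * tau * z.1))) *
        (Z.2 * p + Z.1 * - sg)); first by rewrite polyC_natr !natrM; ring.
    by rewrite l1 l2 !subrr !mul0r addr0.
  transitivity ((d.+1%:R * D.1 - (L.1 + ((2 * k)%:R%:P * z.1 + 2%:R * tau * z.2))) *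
      ((Z.1 * - sg + Z.2 * p) * h) +
    (d.+1%:R * D.2 - (L.2 + ((2 * k)%:R%:P * z.2 * h + 2%:R * tau * z.1))) *
      (Z.2 * - sg * h + Z.1 * p)); first by rewrite polyC_natr !natrM; ring.
  by rewrite l1 l2 !subrr !mul0r addr0.
by move: dd; rewrite /ddp => -[-> ->].
Qed.
End Pell.

(** * Local rings of functions *)

Section LocalFunctions.
Variables (F : numFieldType) (T : Type).

Record fun_ring (A : (T -> F) -> Prop) : Prop := FunRing {
  fr_const : forall c, A (fun=> c);
  fr_add : forall f g, A f -> A g -> A (fun x => f x + g x);
  fr_mul : forall f g, A f -> A g -> A (fun x => f x * g x) }.

Variables (A : (T -> F) -> Prop) (hA : fun_ring A) (x0 : T).
Implicit Types f g : T -> F.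

(* [lz f]: f vanishes near x0; [reg f]: f is a quotient of elements of A near x0 *)
Definition lz f := exists2 D, A D /\ D x0 != 0 & forall x, D x != 0 -> f x = 0.
Definition reg f := exists D Q, [/\ A D, A Q, D x0 != 0 & forall x, D x * f x = Q x].

Lemma reg_fr f : A f -> reg f.
Proof.
move=> hf; exists (fun=> 1), f; split; [exact: (fr_const hA)|by []|exact: oner_neq0|move=> x].
by rewrite mul1r.
Qed.

Lemma reg_const c : reg (fun=> c).
Proof. by apply: reg_fr; exact: (fr_const hA). Qed.

Lemma reg_add f g : reg f -> reg g -> reg (fun x => f x + g x).
Proof.
move=> [D [Q [aD aQ D0 E]]] [D' [Q' [aD' aQ' D0' E']]].
exists (fun x => D x * D' x), (fun x => D' x * Q x + D x * Q' x); split.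
- exact: (fr_mul hA).
- by apply: (fr_add hA); exact: (fr_mul hA).
- exact: mulf_neq0.
- by move=> x; rewrite -E -E'; ring.
Qed.

Lemma reg_mul f g : reg f -> reg g -> reg (fun x => f x * g x).
Proof.
move=> [D [Q [aD aQ D0 E]]] [D' [Q' [aD' aQ' D0' E']]].
exists (fun x => D x * D' x), (fun x => Q x * Q' x); split.
- exact: (fr_mul hA).
- exact: (fr_mul hA).
- exact: mulf_neq0.
- by move=> x; rewrite -E -E'; ring.
Qed.

Lemma reg_opp f : reg f -> reg (fun x => - f x).
Proof.
move=> hf; have := reg_mul (reg_const (-1)) hf.
by congr reg; apply: funext => x; rewrite mulN1r.
Qed.

Lemma reg_inv f : reg f -> f x0 != 0 -> reg (fun x => (f x)^-1).
Proof.
move=> [D [Q [aD aQ D0 E]]] f0.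
exists (fun x => Q x * Q x), (fun x => D x * Q x); split.
- exact: (fr_mul hA).
- exact: (fr_mul hA).
- by rewrite -E !mulf_neq0.
- move=> x; rewrite -E; have [->|fx] := eqVneq (f x) 0; first by rewrite invr0; ring.
  by field.
Qed.

Lemma lz_reg f : lz f -> reg f.
Proof.
move=> [D [aD D0] E]; exists D, (fun=> 0); split=> //; first exact: (fr_const hA).
by move=> x; have [->|/E->] := eqVneq (D x) 0; rewrite ?mul0r ?mulr0.
Qed.

Lemma lz0 : lz (fun=> 0).
Proof. by exists (fun=> 1) => //; split; [exact: (fr_const hA)|exact: oner_neq0]. Qed.

Lemma lz_add f g : lz f -> lz g -> lz (fun x => f x + g x).
Proof.
move=> [D [aD D0] E] [D' [aD' D0'] E']; exists (fun x => D x * D' x).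
  by split; [exact: (fr_mul hA)|exact: mulf_neq0].
by move=> x; rewrite mulf_eq0 negb_or => /andP[/E-> /E'->]; rewrite addr0.
Qed.

Lemma lz_mul f g : lz g -> lz (fun x => f x * g x).
Proof. by move=> [D hD E]; exists D => // x /E->; rewrite mulr0. Qed.

Lemma reg_near f : reg f -> f x0 != 0 ->
  exists2 D, A D /\ D x0 != 0 & forall x, D x != 0 -> f x != 0.
Proof.
move=> [D [Q [aD aQ D0 E]]] f0; exists Q.
  by split=> //; rewrite -E mulf_neq0.
by move=> x; rewrite -E mulf_eq0 negb_or => /andP[].
Qed.

(** Containing every function that vanishes near [x0] makes these the ideals of the ring of germs at
    [x0]. *)
Record ideal (J : (T -> F) -> Prop) : Prop := Ideal {
  ideal_add : forall f g, J f -> J g -> J (fun x => f x + g x);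
  ideal_mul : forall a f, reg a -> J f -> J (fun x => a x * f x);
  ideal_lz : forall f, lz f -> J f }.

Lemma reg_ideal : ideal reg.
Proof. by split; [exact: reg_add|exact: reg_mul|exact: lz_reg]. Qed.

Section Ideal.
Variables (J : (T -> F) -> Prop) (hJ : ideal J).

Lemma ideal0 : J (fun=> 0). Proof. by apply: (ideal_lz hJ); exact: lz0. Qed.

Lemma ideal_sum (I : Type) (r : seq I) (P : pred I) (f : I -> T -> F) :
  (forall i, P i -> J (f i)) -> J (fun x => \sum_(i <- r | P i) f i x).
Proof.
move=> hf; elim: r => [|i r IH].
  by under eq_fun do rewrite big_nil; exact: ideal0.
case Pi: (P i); under eq_fun do rewrite big_cons Pi; last exact: IH.
by apply: (ideal_add hJ) => //; exact: hf.
Qed.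

Lemma ideal_mulr a f : reg a -> J f -> J (fun x => f x * a x).
Proof.
by move=> ha hf; have := ideal_mul hJ ha hf; congr J; apply: funext => x; rewrite mulrC.
Qed.

Lemma ideal_opp f : J f -> J (fun x => - f x).
Proof.
move=> hf; have := ideal_mul hJ (reg_const (-1)) hf.
by congr J; apply: funext => x; rewrite mulN1r.
Qed.

Lemma ideal_cancel u f : reg u -> u x0 != 0 -> J (fun x => u x * f x) -> J f.
Proof.
move=> hu u0 h; have h1 := ideal_mul hJ (reg_inv hu u0) h.
have h2 : J (fun x => (u x)^-1 * (u x * f x) + (f x - (u x)^-1 * (u x * f x))).
  apply: (ideal_add hJ) => //; apply: (ideal_lz hJ).
  have [D hD E] := reg_near hu u0; exists D => // x /E ux.
  by rewrite mulKf // subrr.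
by move: h2; congr J; apply: funext => x; rewrite addrC subrK.
Qed.

End Ideal.

Lemma reg_sum (I : Type) (r : seq I) (P : pred I) (f : I -> T -> F) :
  (forall i, P i -> reg (f i)) -> reg (fun x => \sum_(i <- r | P i) f i x).
Proof. exact: (ideal_sum reg_ideal). Qed.

Lemma reg_prod (I : Type) (r : seq I) (P : pred I) (f : I -> T -> F) :
  (forall i, P i -> reg (f i)) -> reg (fun x => \prod_(i <- r | P i) f i x).
Proof.
move=> hf; elim: r => [|i r IH].
  by under eq_fun do rewrite big_nil; exact: reg_const.
case Pi: (P i); under eq_fun do rewrite big_cons Pi; last exact: IH.
by apply: reg_mul => //; exact: hf.
Qed.

Definition regm m n (M : T -> 'M[F]_(m, n)) := forall i j, reg (fun x => M x i j).

Lemma regm_mul m n p (M : T -> 'M[F]_(m, n)) (N : T -> 'M[F]_(n, p)) :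
  regm M -> regm N -> regm (fun x => M x *m N x).
Proof.
move=> hM hN i j; under eq_fun do rewrite mxE.
by apply: reg_sum => k _; apply: reg_mul.
Qed.

Lemma regm_const m n (M : 'M[F]_(m, n)) : regm (fun=> M).
Proof. by move=> i j; exact: reg_const. Qed.

Lemma regm_add m n (M N : T -> 'M[F]_(m, n)) :
  regm M -> regm N -> regm (fun x => M x + N x).
Proof. by move=> hM hN i j; under eq_fun do rewrite mxE; exact: reg_add. Qed.

Lemma regm_det n (M : T -> 'M[F]_n) : regm M -> reg (fun x => \det (M x)).
Proof.
move=> hM; apply: reg_sum => s _; apply: reg_mul; first exact: reg_const.
by apply: reg_prod => i _; exact: hM.
Qed.

Lemma regm_adj n (M : T -> 'M[F]_n) : regm M -> regm (fun x => \adj (M x)).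
Proof.
move=> hM i j; under eq_fun do rewrite mxE /cofactor.
apply: reg_mul; first exact: reg_const.
by apply: regm_det => k l; under eq_fun do rewrite !mxE; exact: hM.
Qed.

(** A right inverse of [M x0] makes the matrix square and invertible near [x0]; Cramer's rule then
    expresses [w] through [b]. For the ideal [reg] this is regularity of the solution. *)
Lemma ideal_solve J m n (w : T -> 'rV[F]_m) (M : T -> 'M[F]_(m, n))
    (b : T -> 'rV[F]_n) : ideal J -> regm M -> row_free (M x0) ->
  (forall j, J (fun x => b x 0 j)) -> (forall x, w x *m M x = b x) ->
  forall i, J (fun x => w x 0 i).
Proof.
move=> hJ hM /row_freeP[G MG] hb E i.
have hN : regm (fun x => M x *m G) by apply: regm_mul => //; exact: regm_const.
apply: (ideal_cancel hJ (regm_det hN)); first by rewrite MG det1 oner_neq0.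
have -> : (fun x => \det (M x *m G) * w x 0 i) =
    (fun x => (b x *m (G *m \adj (M x *m G))) 0 i).
  apply: funext => x; rewrite -E -mulmxA (mulmxA (M x)) mul_mx_adj mul_mx_scalar.
  by rewrite mxE.
under eq_fun do rewrite mxE; apply: (ideal_sum hJ) => j _.
apply: (ideal_mulr hJ) => //; apply: regm_mul => //; [exact: regm_const|exact: regm_adj].
Qed.

Section Functional.
Variables (N : nat) (r : 'I_N -> T -> F).
Hypothesis hr : forall j, reg (r j).

Let gen (S : {set 'I_N}) f := exists2 a : 'I_N -> T -> F, forall j, reg (a j) &
  lz (fun x => f x - \sum_(j in S) a j x * r j x).

Let sumD (S : {set 'I_N}) (a b : 'I_N -> T -> F) x :
  \sum_(j in S) (a j x + b j x) * r j x =
  \sum_(j in S) a j x * r j x + \sum_(j in S) b j x * r j x.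
Proof. by rewrite -big_split; apply: eq_bigr => j _; rewrite mulrDl. Qed.

Let gen_ideal (S : {set 'I_N}) : ideal (gen S).
Proof.
split.
- move=> f g [a ha lf] [b hb lg]; exists (fun j x => a j x + b j x).
    by move=> j; exact: reg_add.
  have := lz_add lf lg; congr lz; apply: funext => x.
  by rewrite sumD; ring.
- move=> c f hc [a ha lf]; exists (fun j x => c x * a j x).
    by move=> j; exact: reg_mul.
  have := lz_mul c lf; congr lz; apply: funext => x.
  by rewrite mulrBr mulr_sumr; congr (_ - _); apply: eq_bigr => j _; rewrite mulrA.
- move=> f lf; exists (fun _ => fun=> 0); first by move=> j; exact: reg_const.
  move: lf; congr lz; apply: funext => x; rewrite big1 ?subr0 // => j _.
  by rewrite mul0r.
Qed.

Let gen_mem (S : {set 'I_N}) j : j \in S -> gen S (r j).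
Proof.
move=> jS; exists (fun i => fun=> (i == j)%:R); first by move=> i; exact: reg_const.
have := lz0; congr lz; apply: funext => x; rewrite (bigD1 j) //= eqxx mul1r.
by rewrite big1 ?addr0 ?subrr // => i /andP[_ /negPf->]; rewrite mul0r.
Qed.

Let gen_trans (S : {set 'I_N}) (J : (T -> F) -> Prop) : ideal J -> (forall j, j \in S -> J (r j)) ->
  forall f, gen S f -> J f.
Proof.
move=> hJ hS f [a ha lf].
have h1 : J (fun x => \sum_(j in S) a j x * r j x).
  by apply: (ideal_sum hJ) => j jS; apply: (ideal_mul hJ) => //; exact: hS.
have := ideal_add hJ h1 (ideal_lz hJ lf); congr J; apply: funext => x.
by rewrite addrC subrK.
Qed.

(* Nakayama: the coefficient at x0 with respect to an element of a minimal system
   of generators is well defined. *)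
Lemma ideal_functional : (forall j, lz (r j)) \/ exists J l, [/\ ideal J,
  forall j, J (r j), exists j, l (r j) != 0,
  forall f g, J f -> J g -> l (fun x => f x + g x) = l f + l g :> F &
  forall a f, reg a -> J f -> l (fun x => a x * f x) = a x0 * l f].
Proof.
pose good (S : {set 'I_N}) := `[< forall j, gen S (r j) >].
have gT : good (~: finset.set0) by apply/asboolP => j; apply: gen_mem; rewrite !inE.
case: (arg_minnP (fun S : {set 'I_N} => #|S|) gT) => S /asboolP gS min.
have [S0|/set0Pn[i0 iS]] := eqVneq S finset.set0.
  left=> j; have [a _] := gS j; congr lz; apply: funext => x.
  by rewrite S0 big_set0 subr0.
right; exists (gen S).
(* Were the coefficient of [r i0] invertible at [x0], the other elements of [S] would generate,
   against minimality. *)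
have uniq0 (a : 'I_N -> T -> F) : (forall j, reg (a j)) ->
    lz (fun x => \sum_(j in S) a j x * r j x) -> a i0 x0 = 0.
  move=> ha lsum; apply/eqP; apply: contraT => ai0.
  suff : good (S :\ i0).
    by move/min; rewrite (cardsD1 i0 S) iS add1n ltnn.
  apply/asboolP => j; apply: (gen_trans (gen_ideal (S :\ i0)) _ (gS j)) => i iS'.
  have [->|ii0] := eqVneq i i0; last by apply: gen_mem; rewrite !inE ii0.
  apply: (ideal_cancel (gen_ideal _) (ha i0) ai0).
  have h1 : gen (S :\ i0) (fun x => \sum_(j in S :\ i0) a j x * r j x).
    apply: (ideal_sum (gen_ideal _)) => l lS; apply: (ideal_mul (gen_ideal _)) => //.
    exact: gen_mem.
  have := ideal_add (gen_ideal _) (ideal_lz (gen_ideal (S :\ i0)) lsum) (ideal_opp (gen_ideal _) h1).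
  by congr gen; apply: funext => x; rewrite (big_setD1 i0) //= addrK.
have ex f : exists c, gen S f -> exists2 a : 'I_N -> T -> F, (forall j, reg (a j)) /\
    lz (fun x => f x - \sum_(j in S) a j x * r j x) & c = a i0 x0.
  have [[a ha lf]|no] := pselect (gen S f); last by exists 0.
  by exists (a i0 x0) => _; exists a.
have [l hl] := choice ex.
have lE f a : (forall j, reg (a j)) ->
    lz (fun x => f x - \sum_(j in S) a j x * r j x) -> l f = a i0 x0.
  move=> ha lf; have [//|b [hb lb] ->] := hl f; first by exists a.
  apply/eqP; rewrite -subr_eq0; apply/eqP.
  apply: (uniq0 (fun j x => b j x - a j x)).
    by move=> j; apply: reg_add => //; exact: reg_opp.
  have lb' : lz (fun x => -1 * (f x - \sum_(j in S) b j x * r j x)) by exact: lz_mul.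
  have := lz_add lf lb'; congr lz; apply: funext => x.
  rewrite (sumD S b (fun j x => - a j x)).
  by under [X in _ = _ + X]eq_bigr do rewrite mulNr; rewrite sumrN; ring.
exists l; split=> //.
- exists i0; rewrite (lE _ (fun i => fun=> (i == i0)%:R)); first by rewrite eqxx oner_neq0.
    by move=> j; exact: reg_const.
  have := lz0; congr lz; apply: funext => x; rewrite (bigD1 i0) //= eqxx mul1r.
  by rewrite big1 ?addr0 ?subrr // => i /andP[_ /negPf->]; rewrite mul0r.
- move=> f g /hl[a [ha la] ->] /hl[b [hb lb] ->].
  apply: (lE _ (fun j x => a j x + b j x)); first by move=> j; exact: reg_add.
  have := lz_add la lb; congr lz; apply: funext => x.
  by rewrite sumD; ring.
- move=> c f hc /hl[a [ha la] ->].
  apply: (lE _ (fun j x => c x * a j x)); first by move=> j; exact: reg_mul.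
  have := lz_mul c la; congr lz; apply: funext => x.
  by rewrite mulrBr mulr_sumr; congr (_ - _); apply: eq_bigr => j _; rewrite mulrA.
Qed.

End Functional.

End LocalFunctions.

(** * Families of Pell equations *)

Section PolynomialFamilies.
Variables (F : numClosedFieldType) (T : Type) (A : (T -> F) -> Prop).
Variables (hA : fun_ring A) (x0 : T).
Local Notation reg := (reg A x0).
Local Notation ideal := (ideal A x0).
Implicit Types (P Q : T -> {poly F}) (J : (T -> F) -> Prop).

(** A uniform bound on the degrees makes a family of polynomials a finite vector of functions, to
    which linear algebra applies. *)
Definition bdd P := exists N, forall x, (size (P x) <= N)%N.
Definition idealp J P := bdd P /\ forall i, J (fun x => (P x)`_i).
Definition regp P := idealp reg P.

Let hreg : ideal reg := reg_ideal hA x0.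

Lemma idealp_add J P Q : ideal J -> idealp J P -> idealp J Q ->
  idealp J (fun x => P x + Q x).
Proof.
move=> hJ [[N hN] hP] [[M hM] hQ]; split.
  exists (N + M)%N => x; apply: (leq_trans (size_polyD _ _)).
  by rewrite geq_max (leq_trans (hN x)) ?leq_addr ?(leq_trans (hM x)) ?leq_addl.
by move=> i; under eq_fun do rewrite coefD; apply: (ideal_add hJ).
Qed.

Lemma idealp_mul J P Q : ideal J -> regp P -> idealp J Q ->
  idealp J (fun x => P x * Q x).
Proof.
move=> hJ [[N hN] hP] [[M hM] hQ]; split.
  exists (N + M)%N => x; apply: (leq_trans (size_polyMleq _ _)).
  by apply: (leq_trans (leq_pred _)); exact: leq_add.
move=> i; under eq_fun do rewrite coefM.
by apply: (ideal_sum hA hJ) => j _; apply: (ideal_mul hJ).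
Qed.

Lemma regp_const (p : {poly F}) : regp (fun=> p).
Proof. by split; [exists (size p)|move=> i; exact: reg_const]. Qed.

Lemma regp_C f : reg f -> regp (fun x => (f x)%:P).
Proof.
move=> hf; split; first by exists 1%N => x; exact: size_polyC_leq1.
move=> i; under eq_fun do rewrite coefC; case: eqP => // _; exact: reg_const.
Qed.

Lemma idealp_opp J P : ideal J -> idealp J P -> idealp J (fun x => - P x).
Proof.
move=> hJ hP; have := idealp_mul hJ (regp_const (-1)) hP.
by congr idealp; apply: funext => x; rewrite mulN1r.
Qed.

Lemma idealp_sub J P Q : ideal J -> idealp J P -> idealp J Q ->
  idealp J (fun x => P x - Q x).
Proof. by move=> hJ hP hQ; apply: idealp_add => //; exact: idealp_opp. Qed.

Lemma regp_deriv P : regp P -> regp (fun x => (P x)^`()).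
Proof.
move=> [[N hN] hP]; split.
  exists N => x; apply/leq_sizeP => j hj; rewrite coef_deriv nth_default ?mul0rn //.
  by rewrite (leq_trans (hN x)) // ltnW // ltnS.
move=> i; under eq_fun do rewrite coef_deriv -mulr_natl.
by apply: (reg_mul hA) => //; exact: reg_const.
Qed.

Lemma regp_add P Q : regp P -> regp Q -> regp (fun x => P x + Q x).
Proof. exact: idealp_add. Qed.

Lemma regp_sub P Q : regp P -> regp Q -> regp (fun x => P x - Q x).
Proof. exact: idealp_sub. Qed.

Lemma regp_mul P Q : regp P -> regp Q -> regp (fun x => P x * Q x).
Proof. exact: idealp_mul. Qed.

(* The solution of a linear system whose matrix is injective at x0 belongs to
   every ideal that contains the right-hand side. *)
Lemma solve_poly J (I O : finType) (w : T -> I -> F) (V : I -> O -> T -> {poly F})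
    (b : O -> T -> {poly F}) : ideal J -> (forall i o, regp (V i o)) ->
  (forall o, idealp J (b o)) ->
  (forall c : I -> F, (forall o, \sum_i c i *: V i o x0 = 0) -> forall i, c i = 0) ->
  (forall x o, \sum_i w x i *: V i o x = b o x) ->
  forall i, J (fun x => w x i).
Proof.
move=> hJ hV hb inj E i.
have [N [hN hNb]] : exists N, (forall i o x, (size (V i o x) <= N)%N) /\
    (forall o x, (size (b o x) <= N)%N).
  have [f hf] := choice (fun io : I * O => (hV io.1 io.2).1).
  have [f' hf'] := choice (fun o : O => (hb o).1).
  exists (\sum_io f io + \sum_o f' o)%N; split.
    move=> i' o x; rewrite (leq_trans (hf (i', o) x)) // (bigD1 (i', o)) //=.
    by rewrite -addnA leq_addr.
  move=> o x; rewrite (leq_trans (hf' o x)) // [X in (_ + X)%N](bigD1 o) //=.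
  by rewrite addnCA leq_addr.
pose O' := (O * 'I_N)%type.
pose M x := \matrix_(k < #|I|, l < #|{: O'}|)
  (V (enum_val k) (enum_val l).1 x)`_(enum_val l).2.
pose wv x : 'rV_#|I| := \row_k w x (enum_val k).
pose bv x : 'rV_#|{: O'}| := \row_(l < #|{: O'}|) (b (enum_val l).1 x)`_(enum_val l).2.
have vec (c : I -> F) x l : ((\row_k c (enum_val k)) *m M x) 0 l =
    (\sum_i c i *: V i (enum_val l).1 x)`_(enum_val l).2.
  rewrite mxE coef_sum (reindex (fun k : 'I_#|I| => enum_val k)) /=; last by apply: onW_bij; exact: enum_val_bij.
  by apply: eq_bigr => k _; rewrite !mxE coefZ.
have := @ideal_solve _ _ _ hA x0 J _ _ wv M bv hJ.
move=> /(_ _ _ _ _ (enum_rank i)).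
have -> : (fun x => wv x 0 (enum_rank i)) = (fun x => w x i).
  by apply: funext => x; rewrite mxE enum_rankK.
apply.
- by move=> k l; under eq_fun do rewrite mxE; have [_] := hV (enum_val k) (enum_val l).1.
- apply: inj_row_free => v hv.
  pose c k := v 0 (enum_rank k).
  have vE : v = \row_k c (enum_val k).
    by apply/rowP => k; rewrite mxE /c enum_valK.
  suff c0 : forall k, c k = 0 by rewrite vE; apply/rowP => k; rewrite !mxE c0.
  apply: inj => o; apply/polyP => j; rewrite coef0.
  have [jN|jN] := ltnP j N; last first.
    rewrite nth_default //; apply: leq_trans jN; apply: (leq_trans (size_sum _ _ _)).
    apply/bigmax_leqP => k _; exact: leq_trans (size_scale_leq _ _) (hN _ _ _).
  have := vec c x0 (enum_rank (o, Ordinal jN)).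
  by rewrite -vE hv mxE enum_rankK /= => <-.
- by move=> l; under eq_fun do rewrite mxE; have [_] := hb (enum_val l).1.
- move=> x; apply/rowP => l; rewrite (vec (w x)) E mxE //.
Qed.

Lemma poly_sumE N (p : {poly F}) : (size p <= N)%N -> p = \sum_(i < N) p`_i *: 'X^i.
Proof.
move=> hp; rewrite -{1}(coefK p) poly_def (big_ord_widen _ (fun i => p`_i *: 'X^i) hp).
rewrite big_mkcond /=; apply: eq_bigr => i _; case: ifP => // /negbT; rewrite -leqNgt => h.
by rewrite nth_default // scale0r.
Qed.

(** Multiplication by [P x0] is injective, so the coefficients of [Q] solve a linear system to which
    [solve_poly] applies. *)
Lemma idealp_div J P Q R : ideal J -> regp P -> P x0 != 0 -> bdd Q -> idealp J R ->
  (forall x, P x * Q x = R x) -> idealp J Q.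
Proof.
move=> hJ hP P0 [N hN] hR E; split; first by exists N.
move=> i; have [iN|iN] := ltnP i N; last first.
  apply: (ideal_lz hJ); exists (fun=> 1).
    by split; [exact: (fr_const hA)|exact: oner_neq0].
  by move=> x _; rewrite nth_default // (leq_trans (hN x)).
have := @solve_poly J 'I_N unit (fun x j => (Q x)`_j) (fun j _ x => P x * 'X^j) (fun _ => R) hJ.
move=> /(_ _ _ _ _ (Ordinal iN)); apply => //.
- by move=> j _; apply: regp_mul => //; exact: regp_const.
- move=> c /(_ tt) E0 j.
  have E1 : \poly_(i < N) (if insub i is Some k then c k else 0) = 0.
    apply: (mulfI P0); rewrite mulr0 -[RHS]E0 poly_def mulr_sumr; apply: eq_bigr => k _.
    by rewrite valK scalerAr.
  by have := congr1 (fun p : {poly F} => p`_j) E1; rewrite coef_poly ltn_ord valK coef0.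
- move=> x _; rewrite -E {2}(poly_sumE (hN x)) mulr_sumr; apply: eq_bigr => k _.
  by rewrite scalerAr.
Qed.

End PolynomialFamilies.

Section PellFamilies.
Variables (F : numClosedFieldType) (n k g : nat).
Hypotheses (kn : (k < n)%N) (gn : (g < n)%N).

Lemma coprimep_noroot (p q : {poly F}) : (forall r, root p r -> ~~ root q r) ->
  coprimep p q.
Proof.
move=> h; rewrite /coprimep; apply: contraT => /closed_rootP[r].
by rewrite root_gcd => /andP[/h/negPf->].
Qed.

Lemma pell_coprime (p : {poly F}) e sg h tau : pell n k g p e sg h tau ->
  coprimep (sg * h) (2%:R * sg^`() * h + sg * h^`()).
Proof.
move=> H; apply: coprimep_noroot => r hr.
have := pell_sep H hr; rewrite /root derivM !hornerE /= .
move: hr; rewrite rootM => /orP[] /eqP ->; rewrite ?(mul0r, mulr0, addr0, add0r) //.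
have -> : (1 + 1) * sg^`().[r] * h.[r] = (sg^`().[r] * h.[r]) *+ 2 by ring.
by rewrite mulrn_eq0.
Qed.

Lemma pell_disc_deriv (p : {poly F}) e sg h tau : pell n k g p e sg h tau ->
  (p ^+ 2 - (4%:R * e) *: 'X^(2 * k))^`() = sg * (2%:R * sg^`() * h + sg * h^`()).
Proof. by move=> H; rewrite (pell_eq H) expr2 !derivM; ring. Qed.

(** Replacing [c] by [- c] exchanges [u] and [v], so only the absolute value of the difference of
    degrees is meaningful. *)
Definition has_kappa (p : {poly F}) (e : F) (sg : {poly F}) (kappa : nat) :=
  exists c u v, [/\ c ^+ 2 = e, sg = u * v, u \is monic /\ v \is monic,
    u %| p - (2%:R * c) *: 'X^k /\ v %| p + (2%:R * c) *: 'X^k &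
    `|(size u)%:Z - (size v)%:Z|%N = kappa].

Lemma pell_sg_root0 (p : {poly F}) e sg h tau r : pell n k g p e sg h tau -> root sg r ->
  p.[r] ^+ 2 = 4%:R * e * r ^+ (2 * k) /\ (r ^+ k != 0).
Proof.
move=> H sr; have E := congr1 (fun q => q.[r]) (pell_eq H).
rewrite !hornerE /= (eqP sr) expr0n mul0r in E.
have {}E : p.[r] ^+ 2 = 4%:R * e * r ^+ (2 * k) by apply/eqP; rewrite -subr_eq0 -E; apply/eqP; ring.
split=> //; apply/eqP => rk; move/eqP: (rk); rewrite expf_eq0 => /andP[k0 /eqP r0].
have := pell_0 H k0; rewrite -[X in p.[X]]r0 -sqrf_eq0 E mulnC exprM rk expr0n mulr0 eqxx //.
Qed.

Lemma has_kappa_ex (p : {poly F}) e sg h tau : pell n k g p e sg h tau ->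
  exists kappa, has_kappa p e sg kappa.
Proof.
move=> H; have [rs Ers] := closed_field_poly_normal sg.
rewrite (monicP (pell_monic H)) scale1r in Ers.
have urs : uniq rs.
  rewrite -separable_prod_XsubC -Ers unlock; apply: coprimep_noroot => r sr.
  have := @pell_sep _ _ _ _ _ _ _ _ _ H r; rewrite rootM sr => /(_ isT).
  apply: contra => sr'; rewrite /root derivM !hornerE (eqP sr) (eqP sr') !mul0r addr0 //.
pose c := sqrtC e; pose good r := p.[r] == 2%:R * c * r ^+ k.
pose u : {poly F} := \prod_(r <- rs | good r) ('X - r%:P).
pose v : {poly F} := \prod_(r <- rs | ~~ good r) ('X - r%:P).
exists `|(size u)%:Z - (size v)%:Z|%N, c, u, v; split=> //.
- exact: sqrtCK.
- by rewrite Ers (bigID good).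
- by split; apply: monic_prod => r _; exact: monicXsubC.
split; rewrite /u /v -big_filter; apply: uniq_roots_dvdp; rewrite ?uniq_rootsE ?filter_uniq //.
- apply/allP => r; rewrite mem_filter => /andP[/eqP gr _].
  by rewrite /root !hornerE gr; apply/eqP; ring.
- apply/allP => r; rewrite mem_filter => /andP[gr rr].
  have sr : root sg r by rewrite Ers root_prod_XsubC.
  have [E _] := pell_sg_root0 H sr.
  have : (p.[r] == 2%:R * c * r ^+ k) || (p.[r] == - (2%:R * c * r ^+ k)).
    by rewrite -eqf_sqr E !exprMn sqrtCK -exprM mulnC; apply/eqP; ring.
  rewrite -/(good r) (negPf gr) /= => /eqP E2.
  by rewrite /root !hornerE E2; apply/eqP; ring.
Qed.

(* sum of the signs of the nodes, read off an interpolating polynomial *)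
Lemma has_kappa_theta (p : {poly F}) e sg h tau kappa : pell n k g p e sg h tau ->
  has_kappa p e sg kappa -> exists theta omega,
  [/\ 'X^k * theta - sg * omega = p * sg^`(), (size theta <= (n - g).-1)%N,
      (size omega <= n)%N & theta`_(n - g).-2 ^+ 2 = 4%:R * e * kappa%:R ^+ 2].
Proof.
move=> H [c [u [v [ce suv [mu mv] [/dvdpP[U EU] /dvdpP[V EV]] <-]]]].
have ssg := pell_size_sg H.
have su0 : (0 < size u)%N by rewrite size_poly_gt0 monic_neq0.
have sv0 : (0 < size v)%N by rewrite size_poly_gt0 monic_neq0.
have su : size sg = ((size u).-1 + (size v).-1).+1.
  by rewrite suv size_monicM ?monic_neq0 //; move: (size u) (size v) su0 sv0; lia.
have szd (q : {poly F}) : (size q^`() <= (size q).-1)%N.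
  apply/leq_sizeP => j hj; rewrite coef_deriv nth_default ?mul0rn //.
  by move: hj; move: (size q); lia.
have top (a b : {poly F}) : a \is monic -> b \is monic ->
    (a^`() * b)`_((size a).-1 + (size b).-1).-1 = (size a).-1%:R.
  move=> ma mb; have [a1|a1] := posnP (size a).-1.
    have sd := szd a; rewrite a1 leqn0 size_poly_eq0 in sd.
    by rewrite (eqP sd) mul0r coef0 a1.
  have -> : ((size a).-1 + (size b).-1).-1 = ((size a).-1.-1 + (size b).-1)%N.
    by move: (size a) (size b) a1; lia.
  rewrite coefM_top; last exact: leqSpred.
    rewrite -/(lead_coef b) (monicP mb) mulr1 coef_deriv prednK //.
    by rewrite -/(lead_coef a) (monicP ma).
  by apply: (leq_trans (szd a)); rewrite prednK.
(* At a root of [u] one has p = 2 c X^k and sg' = u' v; at a root of [v], p = - 2 c X^k and sg' = u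
   v'. So X^k [th] agrees with p sg' on all nodes, and its top coefficient is 2 c (deg u - deg
   v). *)
pose th := (2%:R * c) *: (u^`() * v - u * v^`()).
have Ep1 : p = U * u + (2%:R * c) *: 'X^k by rewrite -EU subrK.
have Ep2 : p = V * v - (2%:R * c) *: 'X^k by rewrite -EV addrK.
have E : 'X^k * th - sg * - (U * u^`() + V * v^`()) = p * sg^`().
  rewrite suv derivM mulrDr {1}Ep1 Ep2 /th -!mul_polyC; ring.
have sth : (size th <= (n - g).-1)%N.
  apply: (leq_trans (size_scale_leq _ _)); rewrite -ssg su /=.
  have h1 : (size (u^`() * v)%R <= (size u).-1 + (size v).-1)%N.
    apply: (leq_trans (size_polyMleq _ _)); have := szd u.
    by move: (size u) (size v) (size u^`()) su0 sv0; lia.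
  have h2 : (size (u * v^`())%R <= (size u).-1 + (size v).-1)%N.
    apply: (leq_trans (size_polyMleq _ _)); have := szd v.
    by move: (size u) (size v) (size v^`()) su0 sv0; lia.
  by apply: (leq_trans (size_polyD _ _)); rewrite size_polyN geq_max h1.
exists th, (- (U * u^`() + V * v^`())); split=> //.
  move: (- (U * _ + _)) E => om E; have [->|om0] := eqVneq om 0; first by rewrite size_poly0.
  have : (size (sg * om)%R <= 2 * n - g - 1)%N.
    have -> : sg * om = 'X^k * th - p * sg^`() by rewrite -E subKr.
    apply: (leq_trans (size_polyD _ _)); rewrite size_polyN geq_max; apply/andP; split.
      apply: (leq_trans (size_polyMleq _ _)); rewrite size_polyXn.
      by move: sth; move: (size th) => t; lia.
    apply: (leq_trans (size_polyMleq _ _)); rewrite (pell_size H).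
    by have := szd sg; rewrite ssg; move: (size sg^`()) => t; lia.
  rewrite size_monicM ?(pell_monic H) // ssg.
  by have := size_poly_gt0 om; rewrite om0; move: (size om) => t; lia.
have -> : (n - g).-2 = ((size u).-1 + (size v).-1).-1 by rewrite -ssg su.
rewrite coefZ coefB top // [u * _]mulrC [((size u).-1 + _)%N]addnC top // -ce.
suff -> : `|(size u)%:Z - (size v)%:Z|%N%:R ^+ 2 = ((size u).-1%:R - (size v).-1%:R) ^+ 2 :> F.
  by ring.
have [le|le] := leqP (size u) (size v).
  have -> : `|(size u)%:Z - (size v)%:Z|%N = ((size v).-1 - (size u).-1)%N.
    by move: (size u) (size v) su0 sv0 le; lia.
  by rewrite natrB; [rewrite -sqrrN opprB|move: (size u) (size v) su0 sv0 le; lia].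
have -> : `|(size u)%:Z - (size v)%:Z|%N = ((size u).-1 - (size v).-1)%N.
  by move: (size u) (size v) su0 sv0 le; lia.
by rewrite natrB //; move: (size u) (size v) su0 sv0 le; lia.
Qed.

Lemma has_kappa_le (p : {poly F}) (e : F) (sg : {poly F}) kappa : size sg = (n - g)%N ->
  has_kappa p e sg kappa -> (kappa < n - g)%N.
Proof.
move=> ssg [c [u [v [_ suv [mu mv] _ <-]]]].
have su0 : (0 < size u)%N by rewrite size_poly_gt0 monic_neq0.
have sv0 : (0 < size v)%N by rewrite size_poly_gt0 monic_neq0.
rewrite -ssg suv size_monicM ?monic_neq0 //.
by move: (size u) (size v) su0 sv0; lia.
Qed.

(** * Regularity of the Pell data and local constancy of kappa *)

Section Family.
Variables (T : Type) (A : (T -> F) -> Prop) (hA : fun_ring A) (x0 : T).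
Variables (p : T -> {poly F}) (e : T -> F) (sg h tau : T -> {poly F}).
Hypothesis H : forall x, pell n k g (p x) (e x) (sg x) (h x) (tau x).
Hypotheses (hp : regp A x0 (p : T -> {poly F})) (he : reg A x0 e).
Local Notation reg := (reg A x0).
Local Notation regp := (regp A x0).

Let hreg := reg_ideal hA x0.

Let disc x := p x ^+ 2 - (4%:R * e x) *: 'X^(2 * k).

Let regp_disc : regp disc.
Proof.
apply: regp_sub => //.
  by under eq_fun do rewrite expr2; exact: regp_mul.
under eq_fun do rewrite -mul_polyC; apply: regp_mul => //; last exact: regp_const.
by apply: regp_C => //; apply: reg_mul => //; exact: reg_const.
Qed.

Let bdd_size (P : T -> {poly F}) N : (forall x, size (P x) = N) -> bdd P.
Proof. by move=> hN; exists N => x; rewrite hN. Qed.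

Let size_sgh x : size (sg x * h x) = (n + g).+2.
Proof.
rewrite size_monicM ?(pell_monic (H x)) // ?(pell_size_sg (H x)) ?(pell_size_h (H x)).
  by lia.
exact: pell_h_neq0 (H x).
Qed.

(* sg h and its companion solve u P' = v P, uniquely once the leading
   coefficient of u is known *)
Let regp_sgh : regp (fun x => sg x * h x).
Proof.
pose w x (i : 'I_(n + g).+1 + 'I_(n + g).+1) : F := match i with
  | inl i => (sg x * h x)`_i
  | inr i => (2%:R * (sg x)^`() * h x + sg x * (h x)^`())`_i end.
pose V (i : 'I_(n + g).+1 + 'I_(n + g).+1) (o : unit) x : {poly F} := match i with
  | inl i => 'X^i * (disc x)^`() | inr i => - ('X^i * disc x) end.
pose b (o : unit) x : {poly F} := - ((p x)`_n ^+ 2 *: 'X^((n + g).+1) * (disc x)^`()).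
have hpn : reg (fun x => (p x)`_n ^+ 2).
  by under eq_fun do rewrite expr2; apply: reg_mul => //; case: hp.
have hd := regp_deriv hA regp_disc.
have lead x : (sg x * h x)`_(n + g).+1 = (p x)`_n ^+ 2.
  rewrite -(pell_lead (H x) kn gn) lead_coefE (pell_size_h (H x)).
  have -> : (n + g).+1 = ((n - g).-1 + (2 * g).+2)%N by lia.
  rewrite coefM_top ?(pell_size_h (H x)) // ?(pell_size_sg (H x)); last by lia.
  rewrite -(pell_size_sg (H x)) -/(lead_coef (sg x)) (monicP (pell_monic (H x))).
  by rewrite mul1r.
have usum x : sg x * h x = \sum_(i < (n + g).+1) (sg x * h x)`_i *: 'X^i +
    (p x)`_n ^+ 2 *: 'X^((n + g).+1).
  rewrite -lead -(big_ord_recr (n + g).+1 (fun i => (sg x * h x)`_i *: 'X^i)) /=.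
  by apply: poly_sumE; rewrite size_sgh.
have szd (q : {poly F}) : (size q^`() <= (size q).-1)%N.
  apply/leq_sizeP => j hj; rewrite coef_deriv nth_default ?mul0rn //.
  by move: hj; move: (size q); lia.
have svv x : (size (2%:R * (sg x)^`() * h x + sg x * (h x)^`())%R <= (n + g).+1)%N.
  apply: (leq_trans (size_polyD _ _)); rewrite geq_max -mulrA mulr_natl; apply/andP; split.
    rewrite mulr2n; apply: (leq_trans (size_polyD _ _)); rewrite maxnn; apply: (leq_trans (size_polyMleq _ _)).
    have := szd (sg x); rewrite (pell_size_sg (H x)) (pell_size_h (H x)).
    by move: (size (sg x)^`()) => t; lia.
  apply: (leq_trans (size_polyMleq _ _)).
  have := szd (h x); rewrite (pell_size_sg (H x)) (pell_size_h (H x)).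
  by move: (size (h x)^`()) => t; lia.
have rel x : sg x * h x * (disc x)^`() = (2%:R * (sg x)^`() * h x + sg x * (h x)^`()) * disc x.
  by rewrite /disc (pell_disc_deriv (H x)) (pell_eq (H x)); ring.
have hw i : reg (fun x => w x i).
  apply: (@solve_poly _ _ _ hA x0 reg _ _ w V b) => //.
  - case=> j o; last apply: (idealp_opp hA hreg); apply: regp_mul => //; exact: regp_const.
  - move=> o; apply: (idealp_opp hA hreg); apply: regp_mul => //.
    under eq_fun do rewrite -mul_polyC; apply: regp_mul => //; last exact: regp_const.
    exact: regp_C.
  - move=> c /(_ tt); rewrite big_sumType /=.
    pose uu := \sum_(j < (n + g).+1) c (inl j) *: 'X^j.
    pose vv := \sum_(j < (n + g).+1) c (inr j) *: 'X^j.
    have -> : \sum_i c (inl i) *: V (inl i) tt x0 = uu * (disc x0)^`().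
      by rewrite mulr_suml; apply: eq_bigr => j _; rewrite scalerAl.
    have -> : \sum_i c (inr i) *: V (inr i) tt x0 = - (vv * disc x0).
      by rewrite mulr_suml -sumrN; apply: eq_bigr => j _; rewrite scalerN scalerAl.
    move=> /eqP; rewrite subr_eq0 => /eqP E0.
    have sg0 : sg x0 != 0 by rewrite monic_neq0 ?(pell_monic (H x0)).
    have E1 : uu * (2%:R * (sg x0)^`() * h x0 + sg x0 * (h x0)^`()) = vv * (sg x0 * h x0).
      apply: (mulfI sg0); rewrite mulrCA.
      have := E0; rewrite {1}/disc (pell_disc_deriv (H x0)) => ->.
      by rewrite /disc (pell_eq (H x0)); ring.
    have ssum (f : 'I_(n + g).+1 -> F) : (size (\sum_j f j *: 'X^j)%R <= (n + g).+1)%N.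
      apply: (leq_trans (size_sum _ _ _)); apply/bigmax_leqP => j _.
      by apply: (leq_trans (size_scale_leq _ _)); rewrite size_polyXn ltn_ord.
    have uu0 : uu = 0.
      apply/eqP; apply: contraT => uu0.
      have dv : sg x0 * h x0 %| uu.
        rewrite -(Gauss_dvdpl _ (pell_coprime (H x0))) E1; exact: dvdp_mull.
      have := dvdp_leq uu0 dv; rewrite size_sgh => lt.
      by have := leq_trans lt (ssum _); rewrite ltnn.
    have vv0 : vv = 0.
      apply/eqP; have := E1; rewrite uu0 mul0r => /esym/eqP.
      by rewrite mulf_eq0 -(size_poly_eq0 (sg x0 * h x0)) size_sgh orbF.
    have cz (f : 'I_(n + g).+1 -> F) : \sum_j f j *: 'X^j = 0 -> forall j, f j = 0.
      move=> fz j; have := congr1 (fun q : {poly F} => q`_j) fz.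
      rewrite coef0 coef_sum (bigD1 j) //= coefZ coefXn eqxx mulr1 big1 ?addr0 //.
      move=> i' i'j; rewrite coefZ coefXn; case: eqP => [E2|_]; last by rewrite mulr0.
      by rewrite (val_inj E2) eqxx in i'j.
    by case=> j; [exact: (cz _ uu0 j)|exact: (cz _ vv0 j)].
  - move=> x o; rewrite big_sumType /=.
    have -> : \sum_i w x (inl i) *: V (inl i) tt x =
        (\sum_(i < (n + g).+1) (sg x * h x)`_i *: 'X^i) * (disc x)^`().
      by rewrite mulr_suml; apply: eq_bigr => j _; rewrite scalerAl.
    have -> : \sum_i w x (inr i) *: V (inr i) tt x =
        - ((2%:R * (sg x)^`() * h x + sg x * (h x)^`()) * disc x).
      rewrite {1}(poly_sumE (svv x)) mulr_suml -sumrN; apply: eq_bigr => j _.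
      by rewrite scalerN scalerAl.
    by rewrite /b -rel {2}usum mulrDl; ring.
split; first by apply: bdd_size => x; exact: size_sgh.
move=> i; have [iN|iN] := ltnP i (n + g).+1; first exact: (hw (inl (Ordinal iN))).
move: iN; rewrite leq_eqVlt => /orP[/eqP <-|iN].
  by under eq_fun do rewrite lead.
have -> : (fun x => (sg x * h x)`_i) = (fun=> 0); last exact: reg_const.
by apply: funext => x; rewrite nth_default ?size_sgh.
Qed.

Lemma regp_sg : regp sg.
Proof.
apply: (idealp_div hA hreg regp_sgh _ (bdd_size (fun x => pell_size_sg (H x))) regp_disc).
  by rewrite -size_poly_eq0 size_sgh.
by move=> x; rewrite /disc (pell_eq (H x)); ring.
Qed.

Lemma regp_h : regp h.
Proof.
apply: (idealp_div hA hreg regp_sg _ (bdd_size (fun x => pell_size_h (H x))) regp_sgh) => //.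
by rewrite monic_neq0 ?(pell_monic (H x0)).
Qed.

Lemma regp_tau : regp tau.
Proof.
apply: (idealp_div hA hreg regp_sg (R := fun x => 'X * (p x)^`() - k%:R * p x)).
- by rewrite monic_neq0 ?(pell_monic (H x0)).
- by exists g.+2 => x; exact: (pell_size_tau (H x) kn gn).
- apply: regp_sub => //; apply: regp_mul => //; try exact: regp_const.
  exact: regp_deriv.
- by move=> x; rewrite (pell_tau (H x)).
Qed.

Lemma kappa_near kappa0 : has_kappa (p x0) (e x0) (sg x0) kappa0 ->
  exists2 D, A D /\ D x0 != 0 & forall x, D x != 0 ->
    forall kappa, has_kappa (p x) (e x) (sg x) kappa -> kappa = kappa0.
Proof.
(* A constant [sg] only allows kappa = 0; it is treated apart because [(n - g).-2] is then not a top
   index. *)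
move=> hk0; have [n1|n1] := leqP (n - g) 1.
  exists (fun=> 1); first by split; [exact: (fr_const hA)|exact: oner_neq0].
  move=> x _ kappa hk.
  have := has_kappa_le (pell_size_sg (H x)) hk; have := has_kappa_le (pell_size_sg (H x0)) hk0.
  by lia.
have ex x : exists to : {poly F} * {poly F}, exists2 kappa, has_kappa (p x) (e x) (sg x) kappa &
    [/\ 'X^k * to.1 - sg x * to.2 = p x * (sg x)^`(), (size to.1 <= (n - g).-1)%N,
      (size to.2 <= n)%N & to.1`_(n - g).-2 ^+ 2 = 4%:R * e x * kappa%:R ^+ 2].
  have [kappa hk] := has_kappa_ex (H x).
  have [th [om hto]] := has_kappa_theta (H x) hk.
  by exists (th, om), kappa.
have [to hto] := choice ex.
have uniqx x (a b : {poly F}) : 'X^k * a = sg x * b -> (size a <= (n - g).-1)%N -> a = 0 /\ b = 0.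
  move=> E sa; have sgn0 : sg x != 0 by rewrite monic_neq0 ?(pell_monic (H x)).
  have cp : coprimep (sg x) 'X^k.
    apply: coprimep_noroot => r sr; have [_ rk] := pell_sg_root0 (H x) sr.
    by rewrite /root hornerXn.
  have a0 : a = 0.
    apply/eqP; apply: contraT => a0.
    have dv : sg x %| a by rewrite -(Gauss_dvdpr _ cp) E; exact: dvdp_mulr.
    have := dvdp_leq a0 dv; rewrite (pell_size_sg (H x)) => lt.
    by have := leq_trans lt sa; lia.
  split=> //; move/esym/eqP: E; rewrite a0 mulr0 mulf_eq0 (negPf sgn0) => /eqP //.
have sqk x kappa : has_kappa (p x) (e x) (sg x) kappa ->
    (to x).1`_(n - g).-2 ^+ 2 = 4%:R * e x * kappa%:R ^+ 2.
  move=> hk; have [th [om [E s1 s2 <-]]] := has_kappa_theta (H x) hk.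
  have [k2 _ [E' s1' s2' _]] := hto x.
  have [] := uniqx x (th - (to x).1) (om - (to x).2).
  - apply/eqP; rewrite -subr_eq0; apply/eqP; transitivity (('X^k * th - sg x * om) - ('X^k * (to x).1 - sg x * (to x).2)); first by ring.
    by rewrite E E' subrr.
  - by apply: (leq_trans (size_polyD _ _)); rewrite size_polyN geq_max s1.
  - by move=> /eqP; rewrite subr_eq0 => /eqP ->.
have hth : reg (fun x => (to x).1`_(n - g).-2).
  pose w x (i : 'I_(n - g).-1 + 'I_n) : F := match i with
    | inl i => (to x).1`_i | inr i => (to x).2`_i end.
  pose V (i : 'I_(n - g).-1 + 'I_n) (o : unit) x : {poly F} := match i with
    | inl i => 'X^k * 'X^i | inr i => - (sg x * 'X^i) end.
  have lt : ((n - g).-2 < (n - g).-1)%N by lia.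
  apply: (@solve_poly _ _ _ hA x0 reg _ _ w V (fun _ x => p x * (sg x)^`()) hreg _ _ _ _ (inl (Ordinal lt))).
  - case=> j o; last apply: (idealp_opp hA hreg); apply: regp_mul => //; try exact: regp_const.
    exact: regp_sg.
  - by move=> _; apply: regp_mul => //; apply: regp_deriv => //; exact: regp_sg.
  - move=> c /(_ tt); rewrite big_sumType /=.
    pose uu := \sum_(j < (n - g).-1) c (inl j) *: 'X^j.
    pose vv := \sum_(j < n) c (inr j) *: 'X^j.
    have -> : \sum_i c (inl i) *: V (inl i) tt x0 = 'X^k * uu.
      by rewrite mulr_sumr; apply: eq_bigr => j _; rewrite scalerAr.
    have -> : \sum_i c (inr i) *: V (inr i) tt x0 = - (sg x0 * vv).
      by rewrite mulr_sumr -sumrN; apply: eq_bigr => j _; rewrite scalerN scalerAr.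
    move=> /eqP; rewrite subr_eq0 => /eqP /uniqx[|uu0 vv0].
      apply: (leq_trans (size_sum _ _ _)); apply/bigmax_leqP => j _.
      by apply: (leq_trans (size_scale_leq _ _)); rewrite size_polyXn ltn_ord.
    have cz N (f : 'I_N -> F) : \sum_j f j *: 'X^j = 0 -> forall j, f j = 0.
      move=> fz j; have := congr1 (fun q : {poly F} => q`_j) fz.
      rewrite coef0 coef_sum (bigD1 j) //= coefZ coefXn eqxx mulr1 big1 ?addr0 //.
      move=> i' i'j; rewrite coefZ coefXn; case: eqP => [E2|_]; last by rewrite mulr0.
      by rewrite (val_inj E2) eqxx in i'j.
    by case=> j; [exact: (cz _ _ uu0 j)|exact: (cz _ _ vv0 j)].
  - move=> x o; rewrite big_sumType /=; have [k2 _ [<- s1 s2 _]] := hto x.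
    rewrite {2}(poly_sumE s1) {2}(poly_sumE s2) !mulr_sumr -sumrN; congr (_ + _).
      by apply: eq_bigr => j _; rewrite scalerAr.
    by apply: eq_bigr => j _; rewrite scalerN scalerAr.
(* The square of the top coefficient is 4 e kappa^2 with kappa < n - g: finitely many candidates.
   Where this product does not vanish, only [kappa0] remains. *)
pose f x := \prod_(j < n - g | val j != kappa0) ((to x).1`_(n - g).-2 ^+ 2 - 4%:R * e x * j%:R ^+ 2).
have hf : reg f.
  apply: (reg_prod hA) => j _; apply: (reg_add hA).
    by under eq_fun do rewrite expr2; exact: reg_mul.
  by apply: (reg_opp hA); apply: (reg_mul hA); [apply: (reg_mul hA) => //|]; exact: reg_const.
have f0 : f x0 != 0.
  apply/prodf_neq0 => j jk; rewrite (sqk x0 kappa0) // -mulrBr !mulf_neq0 ?(pell_e (H x0)) //.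
  rewrite subr_eq0 -!natrX eqr_nat eqn_sqr; apply: contra jk; by rewrite eq_sym.
have [D hD E] := reg_near hf f0; exists D; first exact: hD.
move=> x Dx kappa hk; have fx := E x Dx.
apply/eqP; apply: contraT => kk; move: fx.
have lt := has_kappa_le (pell_size_sg (H x)) hk.
by rewrite /f (bigD1 (Ordinal lt)) //= (sqk x kappa) // subrr mul0r eqxx.
Qed.

End Family.
End PellFamilies.

(** * The locus of d-th roots is open and closed *)

Section RootsOfPell.
Variables (F : numClosedFieldType) (n k g d m : nat).
Hypotheses (kn : (k < n)%N) (gn : (g < n)%N) (g0 : (0 < g)%N) (d0 : (0 < d)%N).
Hypotheses (dm : (d * m)%N = n) (gm : (g < m)%N).
Implicit Types (p sg h tau : {poly F}) (z w : {poly F} * {poly F}).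

Local Notation Lop h tau z := (Lam h tau d (2 * k)%:R z).

(* up to constants, z = q + b s is a d-th root of p + sg s *)
Definition has_root h tau := exists z,
  [/\ (z.1 != 0) || (z.2 != 0), (size z.1 <= m.+1)%N, (size z.2 <= m - g)%N &
      Lop h tau z = (0, 0)].

(** The roots of [h] are simple and at least two in number, so one of them is not 0. The nonzero
    root is what [odd_part_zero] asks for. *)
Lemma pell_simple_root p e sg h tau : pell n k g p e sg h tau ->
  exists r h1, [/\ r != 0, h = ('X - r%:P) * h1 & h1.[r] != 0].
Proof.
move=> H; have hsep r : root h r -> h^`().[r] != 0.
  move=> hr; have := @pell_sep _ _ _ _ _ _ _ _ _ H r; rewrite rootM hr orbT => /(_ isT).
  rewrite /root derivM !hornerE (eqP hr) mulr0 add0r mulf_eq0 negb_or => /andP[] //.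
have fac r : root h r -> exists2 h1, h = ('X - r%:P) * h1 & h1.[r] != 0.
  move=> hr; have /factor_theorem[h1 E] := hr; exists h1; first by rewrite mulrC.
  have := hsep r hr; rewrite E derivM derivXsubC !hornerE /=.
  by rewrite subrr mulr0 add0r.
have /closed_rootP[r hr] : size h != 1%N by rewrite (pell_size_h H).
have [h1 E h10] := fac r hr.
have [r0|r0] := eqVneq r 0; last by exists r, h1.
have h1n : h1 != 0 by apply: contraNneq h10 => ->; rewrite horner0.
have /closed_rootP[r' hr'] : size h1 != 1%N.
  have := pell_size_h H; rewrite E size_monicM ?monicXsubC // size_XsubC /=.
  by move=> s; apply/eqP => s1; move: s; rewrite s1; lia.
have hr2 : root h r' by rewrite E rootM hr' orbT.
have [h2 E2 h20] := fac r' hr2; exists r', h2; split=> //.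
by apply: contraNneq h10 => r'0; move: hr'; rewrite r0 r'0.
Qed.

(** At a simple root of [h] the multiplicities of z1^2 and z2^2 h have different parities. *)
Lemma pell_pnorm_neq0 p e sg h tau z : pell n k g p e sg h tau ->
  (z.1 != 0) || (z.2 != 0) -> pnorm h z != 0.
Proof.
move=> H nz; have [r [h1 [_ E h10]]] := pell_simple_root H.
have h1n : h1 != 0 by apply: contraNneq h10 => ->; rewrite horner0.
apply/eqP => /eqP; rewrite /pnorm subr_eq0 => /eqP E2.
have z2 : z.2 != 0.
  apply: contraL nz => /eqP z20; move/eqP: E2.
  by rewrite z20 expr0n mul0r sqrf_eq0 => /eqP ->; rewrite eqxx.
have z1 : z.1 != 0.
  by rewrite -sqrf_eq0 E2 E !mulf_neq0 ?expf_neq0 // polyXsubC_eq0.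
have := congr1 (mup r) E2; rewrite E expr2 expr2.
rewrite !mupM ?mulf_neq0 ?polyXsubC_eq0 //.
have -> : mup r ('X - r%:P) = 1%N by rewrite -['X - _]expr1 mup_XsubCX eqxx.
by rewrite (mupNroot h10); lia.
Qed.

Lemma LamD h tau c z w : Lam h tau d c (z.1 + w.1, z.2 + w.2) =
  ((Lam h tau d c z).1 + (Lam h tau d c w).1, (Lam h tau d c z).2 + (Lam h tau d c w).2).
Proof. by rewrite /Lam /= !derivD; congr pair; ring. Qed.

Lemma LamZ h tau c a z : Lam h tau d c (a *: z.1, a *: z.2) =
  (a *: (Lam h tau d c z).1, a *: (Lam h tau d c z).2).
Proof. by rewrite /Lam /= !derivZ -!mul_polyC; congr pair; ring. Qed.

(** Multiply 2 X Y' = 4 k Y + rho w by z, for which 2 d X z' = (2 k + 2 tau / s) z: the product Y z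
    solves the equation with a shifted constant and the source d rho (w z), where w z = L is a
    polynomial. This exhibits rho, up to a monomial factor, as a value of the operator. *)
Lemma Lam_residue h tau z w Y (L : {poly F}) (rho : {poly F} * {poly F}) :
  ddp h Y = ((4 * k)%:R * Y.1 + (pact h rho w).1, (4 * k)%:R * Y.2 * h + (pact h rho w).2) ->
  Lop h tau z = (0, 0) -> pmul h w z = (L, 0) ->
  Lam h tau d (4 * k * d + 2 * k)%:R (pmul h Y z) = (d%:R * L * rho.1, d%:R * L * rho.2).
Proof.
move=> Ey hz Ew; have w1 := congr1 fst Ew; have w2 := congr1 snd Ew.
have y1 := congr1 fst Ey; have y2 := congr1 snd Ey.
have [l1 l2] : d%:R * (ddp h z).1 = (pact h ((2 * k)%:R%:P, 2%:R * tau) z).1 /\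
    d%:R * (ddp h z).2 = (pact h ((2 * k)%:R%:P, 2%:R * tau) z).2.
  by have := LamE h tau d (2 * k)%:R z; rewrite hz /= !add0r => -[-> ->].
have := LamE h tau d (4 * k * d + 2 * k)%:R (pmul h Y z); rewrite ddpM.
move: l1 l2 y1 y2 w1 w2; case: (Lam _ _ _ _ _) => a b.
move: (ddp h Y) (ddp h z) => DY Dz; rewrite /pmul /pact /= => l1 l2 y1 y2 w1 w2 [e1 e2].
have -> : a = d%:R * ((DY.1 * z.1 + DY.2 * z.2)) + (d%:R * Dz.1) * Y.1 + (d%:R * Dz.2) * Y.2
    - ((4 * k * d + 2 * k)%:R%:P * (Y.1 * z.1 + Y.2 * z.2 * h) + 2%:R * tau * (Y.1 * z.2 + Y.2 * z.1)).
  by apply/eqP; rewrite eq_sym subr_eq -e1; apply/eqP; ring.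
have -> : b = d%:R * ((DY.1 * z.2 * h + DY.2 * z.1)) + (d%:R * Dz.1) * Y.2 * h + (d%:R * Dz.2) * Y.1
    - ((4 * k * d + 2 * k)%:R%:P * (Y.1 * z.2 + Y.2 * z.1) * h + 2%:R * tau * (Y.1 * z.1 + Y.2 * z.2 * h)).
  by apply/eqP; rewrite eq_sym subr_eq -e2; apply/eqP; ring.
rewrite l1 l2 y1 y2 !polyC_natr !natrD !natrM; congr pair.
  transitivity (d%:R * (rho.1 * (w.1 * z.1 + w.2 * z.2 * h) + rho.2 * (w.1 * z.2 + w.2 * z.1))).
    by ring.
  by rewrite w1 w2; ring.
transitivity (d%:R * (rho.2 * (w.1 * z.1 + w.2 * z.2 * h) + rho.1 * (w.1 * z.2 + w.2 * z.1) * h)).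
  by ring.
by rewrite w1 w2; ring.
Qed.

Lemma size_Lop p e sg h tau z : pell n k g p e sg h tau ->
  (size z.1 <= m.+1)%N -> (size z.2 <= m - g)%N ->
  (size (Lop h tau z).1 <= m.+1)%N /\ (size (Lop h tau z).2 <= m + g.+2)%N.
Proof.
move=> H s1 s2; have st := pell_size_tau H kn gn; have sh := pell_size_h H.
have szd (q : {poly F}) N : (size q <= N)%N -> (size q^`() <= N.-1)%N.
  by move=> sq; apply/leq_sizeP => j hj; rewrite coef_deriv nth_default ?mul0rn // (leq_trans sq) //; lia.
have sadd (a b : {poly F}) N : (size a <= N)%N -> (size b <= N)%N -> (size (a + b)%R <= N)%N.
  by move=> sa sb; apply: (leq_trans (size_polyD _ _)); rewrite geq_max sa.
have smul (a b : {poly F}) i j N : (size a <= i)%N -> (size b <= j)%N ->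
    ((i + j).-1 <= N)%N -> (size (a * b)%R <= N)%N.
  move=> sa sb; apply: leq_trans; apply: (leq_trans (size_polyMleq _ _)).
  by move: (size a) (size b) sa sb; lia.
have sC (a : F) (b : {poly F}) N : (size b <= N)%N -> (size (a%:P * b)%R <= N)%N.
  by move=> sb; rewrite mul_polyC; exact: leq_trans (size_scale_leq _ _) sb.
have sn (j : nat) (b : {poly F}) N : (size b <= N)%N -> (size (j%:R * b)%R <= N)%N.
  by rewrite -polyC_natr; exact: sC.
have sX (b : {poly F}) N : (size b <= N)%N -> (size ('X * b)%R <= N.+1)%N.
  by move=> sb; apply: (@smul _ _ 2%N N) => //; rewrite size_polyX.
have d1 := szd _ _ s1; have d2 := szd _ _ s2; have d3 := szd h _ (eq_leq sh).
rewrite /Lam /=; split; apply: (@sadd _ _ _); rewrite ?size_polyN.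
- apply: (@sadd _ _ _); rewrite ?size_polyN; [apply: (@sn _ _ _); exact: (sX _ m)|exact: sC].
- by rewrite -mulrA; apply: (@sn _ _ _); apply: smul st s2 _; lia.
- apply: (@sadd _ _ _); rewrite ?size_polyN.
    apply: (@sn _ _ _); apply: (@leq_trans (m + g.+1).+1); last by lia.
    apply: sX; apply: (@sadd _ _ _); last by apply: smul s2 d3 _; lia.
    by rewrite -mulrA; apply: (@sn _ _ _); apply: smul d2 (eq_leq sh) _; lia.
  by rewrite -mulrA; apply: sC; apply: smul s2 (eq_leq sh) _; lia.
- by rewrite -mulrA; apply: (@sn _ _ _); apply: smul st s1 _; lia.
Qed.

(** The exponents at 0 of the shifted operator are 2 k and 2 k + 2 k / d, none below 2 k; so Y z
    will be divisible by X^(2 k). *)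
Lemma low_ineq j (c : F) : (j < 2 * k)%N -> c != 0 ->
  ((4 * k * d + 2 * k)%:R - (2 * d * j)%:R) ^+ 2 * c != 4%:R * (k%:R ^+ 2 * c).
Proof.
move=> jk c0; have le : (2 * d * j + 2 * d <= 4 * k * d)%N by nia.
rewrite -natrB; last by lia.
have -> : 4%:R * (k%:R ^+ 2 * c) = (2 * k)%:R ^+ 2 * c by rewrite natrM; ring.
rewrite (inj_eq (mulIf c0)) -!natrX eqr_nat eqn_sqr; lia.
Qed.

(** No exponent at infinity exceeds m = n / d, so a value of the operator within the degree bounds
    has its preimage within them. *)
Lemma top_ineq j (c : F) : (m < j)%N -> c != 0 ->
  ((2 * d * j)%:R - (2 * k)%:R) ^+ 2 * c ^+ 2 != 4%:R * ((n - k)%:R * c) ^+ 2.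
Proof.
move=> mj c0; have le : (n < d * j)%N by rewrite -dm ltn_pmul2l.
rewrite -natrB; last by lia.
have -> : 4%:R * ((n - k)%:R * c) ^+ 2 = (2 * (n - k))%:R ^+ 2 * c ^+ 2 by rewrite natrM; ring.
rewrite (inj_eq (mulIf (expf_neq0 2 c0))) -!natrX eqr_nat eqn_sqr; lia.
Qed.

Lemma coef_first_order (a b : {poly F}) c j : 2%:R * ('X * a^`()) = c%:R * a + b ->
  ((2 * j)%:R - c%:R) * a`_j = b`_j.
Proof.
move=> /(congr1 (fun q : {poly F} => q`_j)); rewrite coefD !coef_natM coefXM.
case: j => [|j] /=.
  by rewrite muln0 mulr0 => /eqP; rewrite eq_sym addrC addr_eq0 => /eqP ->; ring.
rewrite coef_deriv -[_ *+ j.+1]mulr_natl => E; rewrite mulrBl natrM -mulrA E; ring.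
Qed.

(** * Openness of both solvability and unsolvability *)

Section Family.
Variables (T : Type) (A : (T -> F) -> Prop) (hA : fun_ring A) (x0 : T).
Variables (p : T -> {poly F}) (e : T -> F) (sg h tau : T -> {poly F}).
Hypothesis H : forall x, pell n k g (p x) (e x) (sg x) (h x) (tau x).
Hypotheses (hp : regp A x0 (p : T -> {poly F})) (he : reg A x0 e).
Local Notation reg := (reg A x0).
Local Notation regp := (regp A x0).

Let hreg := reg_ideal hA x0.
Let hsg : regp sg := regp_sg kn gn hA H hp he.
Let hh : regp h := regp_h kn gn hA H hp he.
Let htau : regp tau := regp_tau kn gn hA H hp he.

Let N := (m + g.+2)%N.
Let r := (m.+1 + (m - g))%N.

Let zof (v : 'rV[F]_r) : {poly F} * {poly F} := (rVpoly (lsubmx v), rVpoly (rsubmx v)).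
Let out x (v : 'rV[F]_r) : 'rV[F]_(N + N) :=
  row_mx (poly_rV (Lop (h x) (tau x) (zof v)).1) (poly_rV (Lop (h x) (tau x) (zof v)).2).
Let M x : 'M[F]_(r, N + N) := \matrix_i out x (delta_mx 0 i).

Let out_lin x a u v : out x (a *: u + v) = a *: out x u + out x v.
Proof.
rewrite /out; have -> : zof (a *: u + v) =
    ((a *: (zof u).1, a *: (zof u).2).1 + (zof v).1, (a *: (zof u).1, a *: (zof u).2).2 + (zof v).2).
  by rewrite /zof /= !linearP.
by rewrite LamD LamZ /= !linearP /= scale_row_mx add_row_mx.
Qed.

Let mulM x v : v *m M x = out x v.
Proof.
have out0 : out x 0 = 0.
  have := out_lin x 1 0 0; rewrite !scale1r addr0 => /eqP.
  by rewrite -{1}[out x 0]addr0 (inj_eq (addrI _)) eq_sym => /eqP.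
have outs (f : 'I_r -> 'rV[F]_r) (c : 'I_r -> F) : out x (\sum_i c i *: f i) = \sum_i c i *: out x (f i).
  by elim/big_rec2: _ => // i a b _ <-; rewrite out_lin.
rewrite mulmx_sum_row [in RHS](row_sum_delta v) outs; apply: eq_bigr => i _.
by rewrite rowK.
Qed.

Let szof v : (size (zof v).1 <= m.+1)%N /\ (size (zof v).2 <= m - g)%N.
Proof. by split; exact: size_poly. Qed.

Let out_eq0 x v : out x v = 0 -> Lop (h x) (tau x) (zof v) = (0, 0).
Proof.
move=> E; have [s1 s2] := szof v; have [t1 t2] := size_Lop (H x) s1 s2.
have t1' : (size (Lop (h x) (tau x) (zof v)).1 <= N)%N by apply: (leq_trans t1); rewrite /N; lia.
rewrite [LHS]surjective_pairing -(poly_rV_K t1') -(poly_rV_K t2).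
move: E; rewrite /out -row_mx0 => /eq_row_mx[-> ->].
by rewrite linear0.
Qed.

Let zof_neq0 v : v != 0 -> ((zof v).1 != 0) || ((zof v).2 != 0).
Proof.
move=> v0; rewrite -negb_and; apply: contra v0 => /andP[/eqP z1 /eqP z2].
rewrite -[v]hsubmxK -[lsubmx v]rVpolyK -[rsubmx v]rVpolyK.
by move: z1 z2; rewrite /zof /= => -> ->; rewrite !linear0 row_mx0.
Qed.

Let has_rootP x : has_root (h x) (tau x) <-> exists2 v : 'rV[F]_r, v != 0 & v *m M x = 0.
Proof.
split=> [[z [nz s1 s2 hz]]|[v v0]].
  exists (row_mx (poly_rV z.1) (poly_rV z.2)).
    apply: contraL nz => /eqP; rewrite -row_mx0 => /eq_row_mx[E1 E2].
    by rewrite -(poly_rV_K s1) -(poly_rV_K s2) E1 E2 !linear0 eqxx.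
  rewrite mulM /out; have -> : zof (row_mx (poly_rV z.1) (poly_rV z.2)) = z.
    by rewrite /zof row_mxKl row_mxKr !poly_rV_K // -surjective_pairing.
  by rewrite hz /= !linear0 row_mx0.
rewrite mulM => /out_eq0 E; exists (zof v); have [s1 s2] := szof v.
by split=> //; exact: zof_neq0.
Qed.

Let regp_Lop z : regp (fun x => (Lop (h x) (tau x) z).1) /\
  regp (fun x => (Lop (h x) (tau x) z).2).
Proof.
have rc q : regp (fun=> q) by exact: regp_const.
rewrite /Lam /=; split.
  by apply: regp_sub => //; apply: regp_mul => //; apply: regp_mul.
apply: regp_sub => //; last by apply: regp_mul => //; apply: regp_mul.
apply: regp_sub => //; last exact: regp_mul.
apply: regp_mul => //; apply: regp_mul => //; apply: regp_add => //; apply: regp_mul => //.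
exact: regp_deriv.
Qed.

Let regm_M : regm A x0 M.
Proof.
move=> i j; under eq_fun do rewrite mxE /out.
have [[_ h1] [_ h2]] := regp_Lop (zof (delta_mx 0 i)).
by case: (split_ordP j) => l ->; [under eq_fun do rewrite row_mxEl mxE|under eq_fun do rewrite row_mxEr mxE].
Qed.

Lemma no_root_near : ~ has_root (h x0) (tau x0) ->
  exists2 D, A D /\ D x0 != 0 & forall x, D x != 0 -> ~ has_root (h x) (tau x).
Proof.
move=> no; have rf : row_free (M x0).
  apply: inj_row_free => v hv; apply/eqP; apply: contraT => v0.
  by case: no; apply/has_rootP; exists v.
have /row_freeP[G MG] := rf.
have hN : regm A x0 (fun x => M x *m G) by apply: regm_mul => //; exact: regm_const.
have [|D hD E] := reg_near (regm_det hA hN); first by rewrite MG det1 oner_neq0.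
exists D => // x /E dx /has_rootP[v v0 vM]; case/eqP: v0.
have u : M x *m G \in unitmx by rewrite unitmxE unitfE.
by rewrite -[v]mulmx1 -(mulmxV u) !mulmxA vM !mul0mx.
Qed.

(** Extend the solution at [x0] to approximate solutions with residual [rho]. If [rho] does not
    vanish near [x0], Nakayama gives a functional [l], nonzero on some entry of [rho], that treats
    all regular factors as constants. Applied to the equation of the d-th power, [l] shows that
    l(rho) lies in the image of the operator at [x0]; by construction it lies in a complement of
    that image. *)
Lemma root_near : has_root (h x0) (tau x0) ->
  exists2 D, A D /\ D x0 != 0 & forall x, D x != 0 -> has_root (h x) (tau x).
Proof.
move=> /has_rootP[v0 v00 v0M]; pose G := pinvmx (M x0).
have MGM : M x0 *m G *m M x0 = M x0 by rewrite /G mulmxKpV.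
pose Nx x := 1%:M + (M x + - M x0) *m G.
have rN : regm A x0 Nx.
  apply: regm_add => //; first exact: regm_const.
  by apply: regm_mul => //; [apply: regm_add => //|]; exact: regm_const.
have N0 : Nx x0 = 1%:M by rewrite /Nx subrr mul0mx addr0.
(* A Lyapunov-Schmidt reduction: the correction keeps the residual in the kernel of [G *m M x0], a
   fixed complement of the image of [M x0]. The adjugate replaces the inverse so that no determinant
   is divided by. *)
pose v x := v0 *m \adj (Nx x); pose rho x := v x *m M x.
have vx0 : v x0 = v0 by rewrite /v N0 adj1 mulmx1.
have rv : regm A x0 v by apply: regm_mul => //; [exact: regm_const|exact: regm_adj].
have rrho : regm A x0 rho by exact: regm_mul.
have rho0 x : rho x *m (G *m M x0) = 0.
  have NM : Nx x *m M x0 = M x *m (G *m M x0).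
    by rewrite /Nx mulmxDl mul1mx mulmxDl mulmxDl mulNmx mulNmx MGM !mulmxA addrC subrK.
  by rewrite /rho -mulmxA -NM /v mulmxA -(mulmxA v0) mul_adj_mx mul_mx_scalar -scalemxAl v0M scaler0.
have [i vi] : exists i, v0 0 i != 0.
  apply: contrapT => no; case/eqP: v00; apply/rowP => i; rewrite mxE.
  by apply/eqP; apply: contraT => vi; case: no; exists i.
have [D1 hD1 E1] := reg_near (rv 0 i) (eq_ind_r (fun w : 'rV_r => w 0 i != 0) vi vx0).
have [lzr|[J [l [hJ hr [j0 lj0] ladd lmul]]]] := @ideal_functional _ _ _ hA x0 _ (fun j x => rho x 0 j).
  have [D hD] := choice (fun j => let: ex_intro2 D a b := lzr j in ex_intro (fun D => (A D /\ D x0 != 0) /\ forall x, D x != 0 -> rho x 0 j = 0) D (conj a b)).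
  have [AD D0] : A (fun x => \prod_j D j x) /\ \prod_j D j x0 != 0.
    split; last by apply/prodf_neq0 => j _; have [[]] := hD j.
    elim: (index_enum _) => [|j s IH].
      by under eq_fun do rewrite big_nil; exact: (fr_const hA).
    under eq_fun do rewrite big_cons; apply: (fr_mul hA) => //.
    by have [[]] := hD j.
  exists (fun x => D1 x * \prod_j D j x).
    by case: hD1 => aD1 D10; split; [exact: (fr_mul hA)|exact: mulf_neq0].
  move=> x; rewrite mulf_eq0 negb_or => /andP[/E1 vxi /prodf_neq0 Dx].
  apply/has_rootP; exists (v x).
    by apply: contraNneq vxi => ->; rewrite mxE.
  by apply/rowP => j; rewrite [RHS]mxE; have [_] := hD j; apply; exact: Dx.
exfalso.
have J0 := ideal0 hA hJ.
have l0 : l (fun=> 0) = 0.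
  have := ladd _ _ J0 J0; under [in LHS]eq_fun do rewrite addr0.
  by move=> /eqP; rewrite -{1}[l _]addr0 (inj_eq (addrI _)) eq_sym => /eqP.
have lconst c f : J f -> l (fun x => c * f x) = c * l f.
  by move=> hf; rewrite (lmul (fun=> c)) //; exact: reg_const.
have lsum (I : Type) (s : seq I) (f : I -> T -> F) : (forall i, J (f i)) ->
    l (fun x => \sum_(i <- s) f i x) = \sum_(i <- s) l (f i).
  move=> hf; elim: s => [|i0 s IH].
    by rewrite big_nil -[RHS]l0; congr l; apply: funext => x; rewrite big_nil.
  rewrite big_cons -IH -ladd //; last by apply: (ideal_sum hA hJ) => j _.
  by congr l; apply: funext => x; rewrite big_cons.
(* [Q] is the coefficientwise image of the family [P] under [l]. Since l (a f) = a(x0) l(f), every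
   other factor of a product is specialized at [x0]. *)
pose lp (P : T -> {poly F}) (Q : {poly F}) := forall i, Q`_i = l (fun x => (P x)`_i).
have lp_ex P : idealp J P -> exists2 Q, lp P Q &
    forall N', (forall x, size (P x) <= N')%N -> (size Q <= N')%N.
  move=> [[B hB] hP]; exists (\poly_(i < B) l (fun x => (P x)`_i)) => [i'|N' hN'].
    rewrite coef_poly; case: ltnP => // Bi; rewrite -l0; congr l; apply: funext => x.
    by rewrite nth_default // (leq_trans (hB x)).
  apply/leq_sizeP => j hj; rewrite coef_poly; case: ifP => // _; rewrite -[RHS]l0.
  by congr l; apply: funext => x; rewrite nth_default // (leq_trans (hN' x)).
have lp_uniq P Q Q' : lp P Q -> lp P Q' -> Q = Q'.
  by move=> h1 h2; apply/polyP => i'; rewrite h1 h2.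
have lp_add P P' Q Q' : idealp J P -> idealp J P' -> lp P Q -> lp P' Q' ->
    lp (fun x => P x + P' x) (Q + Q').
  move=> [_ hP] [_ hP'] h1 h2 i'; rewrite coefD h1 h2 -ladd //.
  by congr l; apply: funext => x; rewrite coefD.
have lp_mul a P Q : regp a -> idealp J P -> lp P Q -> lp (fun x => a x * P x) (a x0 * Q).
  move=> [_ ha] [_ hP] h1 i'; rewrite coefM.
  under eq_bigr => j _ do rewrite h1 -(lmul (fun x => (a x)`_j)) //.
  rewrite -(lsum _ _ (fun (j : 'I_i'.+1) x => (a x)`_j * (P x)`_(i' - j))); last first.
    by move=> j; apply: (ideal_mul hJ).
  by congr l; apply: funext => x; rewrite coefM.
have lp_deriv P Q : idealp J P -> lp P Q -> lp (fun x => (P x)^`()) (Q^`()).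
  move=> [_ hP] h1 i'; rewrite coef_deriv h1 -mulr_natl -lconst //.
  by congr l; apply: funext => x; rewrite coef_deriv mulr_natl.
have J_deriv P : idealp J P -> idealp J (fun x => (P x)^`()).
  move=> [[B hB] hP]; split.
    exists B => x; apply/leq_sizeP => j hj; rewrite coef_deriv nth_default ?mul0rn //.
    by rewrite (leq_trans (hB x)) // ltnW // ltnS.
  move=> i'; under eq_fun do rewrite coef_deriv -mulr_natl.
  by apply: (ideal_mul hJ) => //; exact: reg_const.
have J_rV J' n' (u : T -> 'rV[F]_n') : ideal A x0 J' -> (forall j, J' (fun x => u x 0 j)) ->
    idealp J' (fun x => rVpoly (u x)).
  move=> hJ' hu; split; first by exists n' => x; exact: size_poly.
  move=> i'; have [lt|ge] := ltnP i' n'.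
    have -> : (fun x => (rVpoly (u x))`_i') = (fun x => u x 0 (Ordinal lt)) => //.
    by apply: funext => x; rewrite -[i']/(val (Ordinal lt)) coef_rVpoly_ord.
  have -> : (fun x => (rVpoly (u x))`_i') = (fun=> 0); last exact: (ideal0 hA hJ').
  by apply: funext => x; rewrite nth_default // (leq_trans (size_poly _ _)).
have rc q : regp (fun=> q) by exact: regp_const.
pose z x := zof (v x).
have rz1 : regp (fun x => (z x).1).
  by apply: J_rV => // j; under eq_fun do rewrite mxE; exact: rv.
have rz2 : regp (fun x => (z x).2).
  by apply: J_rV => // j; under eq_fun do rewrite mxE; exact: rv.
pose rP x := Lop (h x) (tau x) (z x).
have rPE x : rP x = (rVpoly (lsubmx (rho x)), rVpoly (rsubmx (rho x))).
  have [s1 s2] := szof (v x); have [t1 t2] := size_Lop (H x) s1 s2.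
  have t1' : (size (Lop (h x) (tau x) (zof (v x))).1 <= N)%N by apply: (leq_trans t1); rewrite /N; lia.
  by rewrite /rho mulM /out row_mxKl row_mxKr !poly_rV_K // -surjective_pairing.
have JP1 : idealp J (fun x => (rP x).1).
  under eq_fun do rewrite rPE /=.
  by apply: J_rV => // j; under eq_fun do rewrite mxE; exact: hr.
have JP2 : idealp J (fun x => (rP x).2).
  under eq_fun do rewrite rPE /=.
  by apply: J_rV => // j; under eq_fun do rewrite mxE; exact: hr.
have rpmul (a b : T -> {poly F} * {poly F}) : regp (fun x => (a x).1) -> regp (fun x => (a x).2) ->
    regp (fun x => (b x).1) -> regp (fun x => (b x).2) ->
    regp (fun x => (pmul (h x) (a x) (b x)).1) /\ regp (fun x => (pmul (h x) (a x) (b x)).2).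
  move=> a1 a2 b1 b2; split; rewrite /pmul /=.
    by apply: regp_add => //; apply: regp_mul => //; apply: regp_mul.
  by apply: regp_add => //; apply: regp_mul.
have rpexp j : regp (fun x => (pexp (h x) (z x) j).1) /\ regp (fun x => (pexp (h x) (z x) j).2).
  elim: j => [|j [I1 I2]]; first by split; exact: rc.
  exact: (rpmul z (fun x => pexp (h x) (z x) j)).
have rsN : regp (fun x => - sg x) by apply: (idealp_opp hA hreg).
pose w x := pmul (h x) (pexp (h x) (z x) d.-1) (p x, - sg x).
pose E x := pmul (h x) (pexp (h x) (z x) d) (p x, - sg x).
have [rw1 rw2] : regp (fun x => (w x).1) /\ regp (fun x => (w x).2).
  by apply: (rpmul (fun x => pexp (h x) (z x) d.-1) (fun x => (p x, - sg x))) => //; case: (rpexp d.-1).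
have [rE1 rE2] : regp (fun x => (E x).1) /\ regp (fun x => (E x).2).
  by apply: (rpmul (fun x => pexp (h x) (z x) d) (fun x => (p x, - sg x))) => //; case: (rpexp d).
pose R x := pact (h x) (rP x) (w x).
have EqE x : 2%:R * ('X * (E x).1^`()) = (4 * k)%:R * (E x).1 + (R x).1 /\
    'X * (2%:R * (E x).2^`() * h x + (E x).2 * (h x)^`()) = (4 * k)%:R * (E x).2 * h x + (R x).2.
  by apply: (Lam_power (H x)); exact: d0.
have mulJ a b : idealp J a -> regp b -> idealp J (fun x => a x * b x).
  by move=> ha hb; under eq_fun do rewrite mulrC; exact: (idealp_mul hA hJ).
have addJ a b : idealp J a -> idealp J b -> idealp J (fun x => a x + b x).
  exact: (idealp_add hJ).
have JR1 : idealp J (fun x => (R x).1) by apply: (@addJ _ _); exact: mulJ.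
have JR2 : idealp J (fun x => (R x).2) by apply: (@addJ _ _); [apply: (@mulJ _ _) => //; exact: mulJ|exact: mulJ].
(* For an exact solution z, the product E = z^d (p - sg s) is the monomial lam X^(2 k). In general
   its deviations, [eps] and the odd part, lie in [J], so [l] applies to them although it does not
   apply to E. *)
pose lam x := (E x).1`_(2 * k).
pose eps x := (E x).1 - lam x *: 'X^(2 * k).
have Jeps : idealp J eps.
  have [[B hB] _] := rE1; split.
    exists (B + (2 * k).+1)%N => x; apply: (leq_trans (size_polyD _ _)).
    rewrite size_polyN geq_max (leq_trans (hB x)) ?leq_addr //.
    by apply: (leq_trans (size_scale_leq _ _)); rewrite size_polyXn leq_addl.
  move=> i'; have [->|ik] := eqVneq i' (2 * k)%N.
    by under eq_fun do rewrite coefB coefZ coefXn eqxx mulr1 subrr.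
  have c0 : (2 * i')%:R - (4 * k)%:R != 0 :> F by rewrite subr_eq0 eqr_nat; apply/eqP; move/eqP: ik; lia.
  have [_ /(_ i') hR] := JR1; apply: (ideal_cancel hA hJ (reg_const hA x0 ((2 * i')%:R - (4 * k)%:R))) => //.
  move: hR; congr J; apply: funext => x; rewrite coefB coefZ coefXn (negPf ik) mulr0 subr0.
  by rewrite (coef_first_order i' (EqE x).1).
have [r1 [h1 [r10 Eh1 _]]] := pell_simple_root (H x0).
have hr1 : root (h x0) r1 by rewrite Eh1 rootM root_XsubC eqxx.
have hx0n : h x0 != 0 := pell_h_neq0 (H x0).
pose Psi x (Y : {poly F}) := 'X * (2%:R * Y^`() * h x + Y * (h x)^`()) - (4 * k)%:R * Y * h x.
have Psi_sum x K (c : 'I_K -> F) (f : 'I_K -> {poly F}) :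
    Psi x (\sum_i c i *: f i) = \sum_i c i *: Psi x (f i).
  elim/big_rec2: _ => [|j a b _ <-]; first by rewrite /Psi deriv0; ring.
  by rewrite /Psi derivD derivZ -!mul_polyC; ring.
have Psi_inj Y : Psi x0 Y = 0 -> Y = 0.
  move=> /eqP; rewrite subr_eq0 => /eqP E2.
  by apply: (odd_part_zero (j := (2 * k)%N) r10 hr1 hx0n); rewrite E2 mulnA.
have JE2 : idealp J (fun x => (E x).2).
  have [[B hB] _] := rE2; split; first by exists B.
  move=> i'; have [iB|Bi] := ltnP i' B; last first.
    have -> : (fun x => (E x).2`_i') = (fun=> 0) => //.
    by apply: funext => x; rewrite nth_default // (leq_trans (hB x)).
  apply: (@solve_poly _ _ _ hA x0 J 'I_B unit (fun x j => (E x).2`_j)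
    (fun j _ x => Psi x 'X^j) (fun _ x => (R x).2) hJ _ _ _ _ (Ordinal iB)).
  - move=> j _; apply: regp_sub => //; last first.
      by apply: regp_mul => //; apply: regp_mul.
    apply: regp_mul => //; apply: regp_add => //; apply: regp_mul => //.
    exact: regp_deriv.
  - by [].
  - move=> c /(_ tt); rewrite -Psi_sum => /Psi_inj fz j.
    have := congr1 (fun q : {poly F} => q`_j) fz.
    rewrite coef0 coef_sum (bigD1 j) //= coefZ coefXn eqxx mulr1 big1 ?addr0 //.
    move=> i2 i2j; rewrite coefZ coefXn; case: eqP => [E2|_]; last by rewrite mulr0.
    by rewrite (val_inj E2) eqxx in i2j.
  - move=> x _; rewrite -Psi_sum -(poly_sumE (hB x)) /Psi (EqE x).2; ring.
have [Y1 lY1 _] := lp_ex _ Jeps; have [Y2 lY2 _] := lp_ex _ JE2.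
have [q1 lq1 sq1] := lp_ex _ JP1; have [q2 lq2 sq2] := lp_ex _ JP2.
have lp_mulr a P Q : regp a -> idealp J P -> lp P Q -> lp (fun x => P x * a x) (Q * a x0).
  by move=> ha hP h2; under eq_fun do rewrite mulrC; rewrite mulrC; exact: lp_mul.
(* The image under [l] of the equation of E: only the residual, with image (q1, q2), is transformed,
   and the cofactor [w] is frozen at [x0]. *)
have dY : ddp (h x0) (Y1, Y2) = ((4 * k)%:R * Y1 + (pact (h x0) (q1, q2) (w x0)).1,
    (4 * k)%:R * Y2 * h x0 + (pact (h x0) (q1, q2) (w x0)).2).
  congr pair.
    apply: (lp_uniq (fun x => 2%:R * ('X * (eps x)^`()))).
      apply: (lp_mul (fun=> 2%:R)) => //; first by apply: (idealp_mul hA hJ) => //; exact: J_deriv.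
      by apply: (lp_mul (fun=> 'X)) => //; [exact: J_deriv|exact: lp_deriv].
    have -> : (fun x => 2%:R * ('X * (eps x)^`())) = (fun x => (4 * k)%:R * eps x + (R x).1).
      apply: funext => x; have := (EqE x).1; rewrite /eps derivB derivZ derivXn.
      have -> : 2%:R * ('X * ((E x).1^`() - lam x *: ('X^((2 * k).-1) *+ (2 * k)))) =
         2%:R * ('X * (E x).1^`()) - (4 * k)%:R * (lam x *: 'X^(2 * k)).
        rewrite mulrBr mulrBr; congr (_ - _); rewrite -[_ *+ (2 * k)]mulr_natl -!mul_polyC.
        have EX : 'X * ((2 * k)%:R * 'X^((2 * k).-1)) = (2 * k)%:R * 'X^(2 * k) :> {poly F}.
          by case: (2 * k)%N => [|j]; rewrite ?mul0r ?mulr0 // mulrCA -exprS.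
        have -> : 2%:R * ('X * ((lam x)%:P * ((2 * k)%:R * 'X^((2 * k).-1)))) =
          2%:R * (lam x)%:P * ('X * ((2 * k)%:R * 'X^((2 * k).-1))) by ring.
        by rewrite EX !natrM; ring.
      by move=> ->; rewrite mulrBr; ring.
    apply: (@lp_add _ _ _ _) => //; first by apply: (idealp_mul hA hJ).
      exact: (lp_mul (fun=> (4 * k)%:R)).
    by apply: (@lp_add _ _ _ _); [exact: mulJ|exact: mulJ|exact: lp_mulr|exact: lp_mulr].
  apply: (lp_uniq (fun x => 'X * (2%:R * (E x).2^`() * h x + (E x).2 * (h x)^`()))).
    have rdh : regp (fun x => (h x)^`()) by exact: regp_deriv.
    have Jd := J_deriv _ JE2; have J2d : idealp J (fun x => 2%:R * (E x).2^`()).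
      exact: (idealp_mul hA hJ).
    apply: (lp_mul (fun=> 'X)) => //; first by apply: (@addJ _ _); exact: mulJ.
    apply: (@lp_add _ _ _ _); [exact: mulJ|exact: mulJ| |exact: lp_mulr].
    by apply: (@lp_mulr _ _ _) => //; apply: (lp_mul (fun=> 2%:R)) => //; exact: lp_deriv.
  have -> : (fun x => 'X * (2%:R * (E x).2^`() * h x + (E x).2 * (h x)^`())) =
      (fun x => (4 * k)%:R * (E x).2 * h x + (R x).2).
    by apply: funext => x; rewrite (EqE x).2.
  have J4 : idealp J (fun x => (4 * k)%:R * (E x).2) by exact: (idealp_mul hA hJ).
  apply: (@lp_add _ _ _ _) => //; first exact: mulJ.
    by apply: (@lp_mulr _ _ _) => //; exact: (lp_mul (fun=> (4 * k)%:R)).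
  apply: (@lp_add _ _ _ _); [by apply: (@mulJ _ _) => //; exact: mulJ|exact: mulJ| |exact: lp_mulr].
  by apply: (@lp_mulr _ _ _) => //; [exact: mulJ|exact: lp_mulr].
have hz0 : Lop (h x0) (tau x0) (z x0) = (0, 0).
  by apply: out_eq0; rewrite -mulM vx0.
have [E01 E02] : (E x0).1 = lam x0 *: 'X^(2 * k) /\ (E x0).2 = 0.
  have [e1 e2] := EqE x0; have R0 : R x0 = (0, 0).
    by rewrite /R /rP hz0 /pact /= !mul0r addr0.
  have e1' : 2%:R * ('X * (E x0).1^`()) = (4 * k)%:R * (E x0).1 by rewrite e1 R0 addr0.
  have e2' : 'X * (2%:R * (E x0).2^`() * h x0 + (E x0).2 * (h x0)^`()) =
    (4 * k)%:R * (E x0).2 * h x0 by rewrite e2 R0 addr0.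
  rewrite /lam; move: (E x0) e1' e2' => E0 e1' e2'; split.
    apply: deriv_monomial; apply: (@mulfI _ (2%:R)); first by rewrite -polyC_natr polyC_eq0 pnatr_eq0.
    by rewrite e1' !natrM; ring.
  by apply: Psi_inj; rewrite /Psi e2' subrr.
have lam0 : lam x0 != 0.
  apply/eqP => lam0; have nz := zof_neq0 v00; rewrite -vx0 in nz.
  have := pell_pnorm_neq0 (H x0) nz; apply/negP; rewrite negbK.
  have : pnorm (h x0) (E x0) = 0 by rewrite /pnorm E01 E02 lam0 scale0r expr0n mul0r subrr.
  rewrite /E pnormM pnormX (pell_norm (H x0)) => /eqP.
  rewrite mulf_eq0 scaler_eq0 mulf_eq0 (negPf (pell_e (H x0))) pnatr_eq0 /=.
  have X0 : 'X^(2 * k) != 0 :> {poly F} by rewrite monic_neq0 ?monicXn.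
  by rewrite (negPf X0) orbF expf_eq0 d0.
have wz : pmul (h x0) (w x0) (z x0) = (lam x0 *: 'X^(2 * k), 0).
  rewrite -E01 -E02 -surjective_pairing /w /E -[in RHS](prednK d0) pexpS.
  by rewrite pmulC pmulA.
have LR := Lam_residue dY hz0 wz.
have [u Zu] : exists u, pmul (h x0) (Y1, Y2) (z x0) = ('X^(2 * k) * u.1, 'X^(2 * k) * u.2).
  apply: (@Lam_low _ (h x0) (tau x0) d (4 * k * d + 2 * k)%:R).
  - move=> j jk; have k0 : (0 < k)%N by rewrite lt0n; apply: contraL jk => /eqP ->.
    have [hh0 ->] := pell_tau0 (H x0) k0.
    exact: low_ineq.
  - by rewrite LR /= -scalerAr -scalerAl dvdpZr // dvdp_mulr // dvdp_mull.
  - by rewrite LR /= -scalerAr -scalerAl dvdpZr // dvdp_mulr // dvdp_mull.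
(* After division by X^(2 k) the constant of the operator is 2 k again, and l(rho) is, up to the
   nonzero factor d lam, the value of the original operator at [u]. *)
have Lu : Lop (h x0) (tau x0) u = (d%:R * (lam x0)%:P * q1, d%:R * (lam x0)%:P * q2).
  have X0 : 'X^(2 * k) != 0 :> {poly F} by rewrite monic_neq0 ?monicXn.
  have := LR; rewrite Zu Lam_Xn.
  have -> : (4 * k * d + 2 * k)%:R - (2 * d * (2 * k))%:R = (2 * k)%:R :> F.
    by rewrite natrD !natrM; ring.
  case: (Lop _ _ _) => a b [] /= e1 e2; congr pair; apply: (mulfI X0).
    by rewrite e1 -mul_polyC; ring.
  by rewrite e2 -mul_polyC; ring.
have [su1 su2] : (size u.1 <= m.+1)%N /\ (size u.2 <= m - g)%N.
  have sz x := szof (v x).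
  apply: (@Lam_top _ (h x0) (tau x0) d (2 * k)%:R g m).
  - exact: pell_size_h (H x0).
  - exact: pell_size_tau (H x0) kn gn.
  - exact: ltnW.
  - move=> j jm; have -> : lead_coef (h x0) = _ := pell_lead (H x0) kn gn.
    rewrite (pell_tau_top (H x0) kn gn); apply: top_ineq => //.
    have sp := pell_size (H x0); have -> : n = (size (p x0)).-1 by rewrite sp.
    by rewrite -/(lead_coef _) lead_coef_eq0 -size_poly_eq0 sp.
  - rewrite Lu /= -mulrA mulr_natl mul_polyC.
    apply: (leq_trans (_ : _ <= size (lam x0 *: q1))%N); first by rewrite -scaler_nat size_scale_leq.
    apply: (leq_trans (size_scale_leq _ _)); apply: sq1 => x.
    by have [s1 s2] := szof (v x); have [] := size_Lop (H x) s1 s2.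
  - rewrite Lu /= -mulrA mulr_natl mul_polyC.
    apply: (leq_trans (_ : _ <= size (lam x0 *: q2))%N); first by rewrite -scaler_nat size_scale_leq.
    apply: (leq_trans (size_scale_leq _ _)); apply: sq2 => x.
    by have [s1 s2] := szof (v x); have [] := size_Lop (H x) s1 s2.
pose lrho : 'rV[F]_(N + N) := \row_j l (fun x => rho x 0 j).
have c0 : d%:R * lam x0 != 0 by rewrite mulf_neq0 // pnatr_eq0 -lt0n.
have lrhoE : lrho = ((d%:R * lam x0)^-1 *: row_mx (poly_rV u.1) (poly_rV u.2)) *m M x0.
  rewrite -scalemxAl mulM /out.
  have -> : zof (row_mx (poly_rV u.1) (poly_rV u.2)) = u.
    by rewrite /zof row_mxKl row_mxKr !poly_rV_K // -surjective_pairing.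
  rewrite Lu /= -!polyC_natr -!polyCM !mul_polyC !linearZ /= -scale_row_mx scalerA mulVf // scale1r.
  apply/rowP => j; rewrite mxE; case: (split_ordP j) => i' ->.
    rewrite row_mxEl mxE lq1; congr l; apply: funext => x.
    by rewrite rPE coef_rVpoly_ord [RHS]mxE.
  rewrite row_mxEr mxE lq2; congr l; apply: funext => x.
  by rewrite rPE coef_rVpoly_ord [RHS]mxE.
have lrho0 : lrho *m (G *m M x0) = 0.
  apply/rowP => j; rewrite !mxE -[RHS]l0.
  have -> : (fun=> 0) = (fun x => \sum_i' rho x 0 i' * (G *m M x0) i' j) :> (T -> F).
    by apply: funext => x; have := congr1 (fun B : 'rV_(N + N) => B 0 j) (rho0 x); rewrite !mxE.
  rewrite (lsum _ _ (fun i' x => rho x 0 i' * (G *m M x0) i' j)).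
    apply: eq_bigr => i' _; rewrite mxE mulrC -lconst //; congr l.
    by apply: funext => x; rewrite mulrC.
  by move=> i'; apply: (ideal_mulr hJ) => //; exact: reg_const.
(* The projection [G *m M x0] fixes the image of [M x0] and kills the complement, and l(rho) lies in
   both. *)
have lz : lrho = 0.
  by rewrite -[RHS]lrho0 [in RHS]lrhoE -[RHS]mulmxA (mulmxA (M x0)) MGM -lrhoE.
by case/eqP: lj0; have := congr1 (fun B : 'rV_(N + N) => B 0 j0) lz; rewrite !mxE.
Qed.

End Family.
End RootsOfPell.

(** * Chebyshev polynomials for the weight x^K *)

Section ChebyshevBase.
Variables (R : realType) (a : R).
Hypotheses (a0 : 0 < a) (a1 : a < 1).
Implicit Types (K j : nat) (th : R).

Let X0 : {poly R} := a^-1 *: ('X - (1 + a ^+ 2)%:P).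

(** At [yval th] the polynomial X0 is 2 cos th, so these are 2 cos (j th) as polynomials in y. *)
Fixpoint dickson j : {poly R} :=
  match j with
  | 0 => 2%:P
  | 1 => X0
  | (j'.+1 as j1).+1 => X0 * dickson j1 - dickson j'
  end.

(** At y = |a + e^(i th)|^2 this is twice the real part of e^(i j th) (a + e^(i th))^K, a number of
    modulus y^(K/2). So it oscillates between - 2 y^(K/2) and 2 y^(K/2), touching these curves
    whenever the argument is a multiple of pi; [trigp] gives the real and the imaginary part. *)
Fixpoint chebp K j : {poly R} :=
  if K is K'.+1 then a *: chebp K' j + chebp K' j.+1 else dickson j.

Fixpoint trigp (f : R -> R) K j th : R :=
  if K is K'.+1 then a * trigp f K' j th + trigp f K' j.+1 th else f (j%:R * th).

Definition yval th := 1 + a ^+ 2 + 2 * a * cos th.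

Let X0y th : X0.[yval th] = 2 * cos th.
Proof. by rewrite /X0 /yval !hornerE /=; field; rewrite gt_eqF. Qed.

Lemma dickson_cos j th : (dickson j).[yval th] = 2 * cos (j%:R * th).
Proof.
suff [] : (dickson j).[yval th] = 2 * cos (j%:R * th) /\
          (dickson j.+1).[yval th] = 2 * cos (j.+1%:R * th) by [].
elim: j => [|j [IH1 IH2]]; first by rewrite /= hornerC X0y mul0r cos0 mul1r mulr1.
split=> //; rewrite -[dickson j.+2]/(X0 * dickson j.+1 - dickson j).
rewrite hornerD hornerN hornerM X0y IH1 IH2.
have -> : j.+2%:R * th = j.+1%:R * th + th by ring.
have -> : j%:R * th = j.+1%:R * th - th by ring.
by rewrite cosB cosD; ring.
Qed.

Lemma chebp_trig K j th : (chebp K j).[yval th] = 2 * trigp cos K j th.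
Proof.
elim: K j => [|K IH] j; first exact: dickson_cos.
by rewrite /= hornerD hornerZ !IH; ring.
Qed.

Lemma trigp_rot K j th :
  trigp cos K j.+1 th = cos th * trigp cos K j th - sin th * trigp sin K j th /\
  trigp sin K j.+1 th = cos th * trigp sin K j th + sin th * trigp cos K j th.
Proof.
elim: K j => [|K IH] j.
  by rewrite /= mulrSr mulrDl mul1r cosD sinD; split; ring.
by rewrite /=; have [-> ->] := IH j.+1; have [-> ->] := IH j; split; ring.
Qed.

Lemma trigp_norm K j th : trigp cos K j th ^+ 2 + trigp sin K j th ^+ 2 = yval th ^+ K.
Proof.
elim: K j => [|K IH] j; first by rewrite /= cos2Dsin2.
rewrite -/(trigp cos K.+1 j th) -/(trigp sin K.+1 j th).
rewrite [trigp cos _ _ _]/= [trigp sin _ _ _]/=.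
have [-> ->] := trigp_rot K j th; rewrite [yval th ^+ _]exprS -(IH j).
have E := cos2Dsin2 th; rewrite /yval.
move: (trigp cos K j th) (trigp sin K j th) (cos th) (sin th) E => C S c s E.
transitivity ((c ^+ 2 + s ^+ 2 + a ^+ 2 + 2 * a * c) * (C ^+ 2 + S ^+ 2)); first by ring.
by rewrite E.
Qed.

Lemma trigp_bound f K j th : (forall x, `|f x| <= 1) -> `|trigp f K j th| <= (1 + a) ^+ K.
Proof.
move=> H; elim: K j => [|K IH] j; first by rewrite /= expr0 H.
apply: le_trans (ler_normD _ _) _; rewrite normrM gtr0_norm //.
have := IH j; have := IH j.+1; rewrite exprS.
move: (`|trigp f K j th|) (`|trigp f K j.+1 th|) (_ ^+ K) => x x' z h1 h2.
by have := ler_wpM2l (ltW a0) h2; lra.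
Qed.

Lemma trigp_approx f K j th : (forall x, `|f x| <= 1) ->
  `|trigp f K j th - f ((j + K)%:R * th)| <= (1 + a) ^+ K - 1.
Proof.
move=> H; elim: K j => [|K IH] j; first by rewrite /= addn0 !subrr normr0.
rewrite /= -addrA; apply: le_trans (ler_normD _ _) _; rewrite normrM gtr0_norm //.
have := trigp_bound K j th H; have := IH j.+1; rewrite exprS addSnnS.
move: (`|trigp f K j th|) (`|trigp f K j.+1 th - _|) (_ ^+ K) => x x' z h1 h2.
by have := ler_wpM2l (ltW a0) h2; lra.
Qed.

Lemma continuous_trigp (f : R -> R) K j : continuous f -> continuous (trigp f K j).
Proof.
move=> cf; elim: K j => [|K IH] j th /=.
  apply: continuous_comp; last exact: cf.
  by apply: cvgM; [exact: cvg_cst|exact: cvg_id].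
by apply: cvgD; [apply: cvgM; [exact: cvg_cst|exact: IH]|exact: IH].
Qed.

Lemma dickson_top j : (size (dickson j) <= j.+1)%N /\
  (dickson j)`_j = a^-1 ^+ j *+ (j == 0%N).+1.
Proof.
have s0 : (size X0 <= 2)%N by rewrite (leq_trans (size_scale_leq _ _)) // size_XsubC.
suff [] : ((size (dickson j) <= j.+1)%N /\ (dickson j)`_j = a^-1 ^+ j *+ (j == 0%N).+1) /\
  ((size (dickson j.+1) <= j.+2)%N /\ (dickson j.+1)`_j.+1 = a^-1 ^+ j.+1) by [].
elim: j => [|j [[IH1 IH2] [IH3 IH4]]].
  rewrite /= size_polyC pnatr_eq0 coefC /= expr0 expr1; split=> //; split=> //.
  by rewrite /X0 coefZ coefB coefX coefC /= subr0 mulr1.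
split=> //; rewrite -[dickson j.+2]/(X0 * dickson j.+1 - dickson j); split.
  rewrite (leq_trans (size_polyD _ _)) // size_polyN geq_max (leq_trans (size_polyMleq _ _)) /=.
    by rewrite (leq_trans IH1) // ltnS leqW.
  by move: s0 IH3; case: (size X0) => [|[|[|?]]] //=; lia.
rewrite coefB (@nth_default _ _ (dickson j)) ?subr0; last by apply: leq_trans IH1 _.
move: (dickson j.+1) IH3 IH4 => q IH3 IH4.
rewrite /X0 -scalerAl coefZ mulrBl coefB coefXM /= coefCM.
by rewrite (nth_default _ IH3) mulr0 subr0 IH4 [RHS]exprS.
Qed.

Lemma chebp_top K j : (size (chebp K j) <= (j + K).+1)%N /\
  ((0 < j + K)%N -> (chebp K j)`_(j + K) = a^-1 ^+ (j + K)).
Proof.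
elim: K j => [|K IH] j.
  rewrite addn0; have [h1 h2] := dickson_top j; split=> // j0.
  by rewrite /= h2; case: j j0 {h1 h2}.
have [h1 h2] := IH j; have [h3 h4] := IH j.+1; split.
  rewrite /= (leq_trans (size_polyD _ _)) // geq_max (leq_trans (size_scale_leq _ _)) /=.
    by rewrite -addSnnS.
  by rewrite (leq_trans h1) // addnS leqnSn.
move=> _; rewrite /= coefD coefZ nth_default; last by rewrite addnS.
by rewrite mulr0 add0r -addSnnS h4.
Qed.

(** At y = 0 the two values of e^(i th) become the numbers - a and - 1/a, mutually inverse; the
    formula is the sum of e^(i j th) (a + e^(i th))^K over both. *)
Lemma chebp_at0 K j : (chebp K j).[0] =
  (- a) ^+ j * 0 ^+ K + (- a^-1) ^+ j * (a - a^-1) ^+ K.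
Proof.
have X00 : X0.[0] = - a - a^-1 by rewrite /X0 !hornerE /=; field; rewrite gt_eqF.
elim: K j => [|K IH] j; last first.
  by rewrite /= hornerD hornerZ !IH !exprS; ring.
rewrite !expr0 !mulr1 /=.
suff [] : (dickson j).[0] = (- a) ^+ j + (- a^-1) ^+ j /\
   (dickson j.+1).[0] = (- a) ^+ j.+1 + (- a^-1) ^+ j.+1 by [].
elim: j => [|j [IH1 IH2]]; first by rewrite /= hornerC X00 !expr0 !expr1.
split=> //; rewrite -[dickson j.+2]/(X0 * dickson j.+1 - dickson j).
rewrite hornerD hornerN hornerM X00 IH1 IH2 !exprS.
by field; rewrite gt_eqF.
Qed.

Lemma chebp_le K j x : (1 - a) ^+ 2 <= x <= (1 + a) ^+ 2 ->
  (chebp K j).[x] ^+ 2 <= 4 * x ^+ K.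
Proof.
move=> /andP[h1 h2].
have c1 : -1 <= (x - (1 + a ^+ 2)) / (2 * a) <= 1.
  by rewrite ler_pdivlMr ?ler_pdivrMr ?mulr_gt0 //; apply/andP; split; lra.
have -> : x = yval (acos ((x - (1 + a ^+ 2)) / (2 * a))).
  by rewrite /yval acosK ?in_itv //; field; rewrite gt_eqF.
rewrite chebp_trig -(trigp_norm K j) exprMn.
have := sqr_ge0 (trigp sin K j (acos ((x - (1 + a ^+ 2)) / (2 * a)))).
by move: (_ ^+ 2) (trigp cos _ _ _ ^+ 2) => u v; lra.
Qed.

End ChebyshevBase.

Section Base.
Variables (R : realType) (M K : nat).
Hypothesis KM : (K <= M.+2)%N.

Lemma signr_sqr (n : nat) : (-1 : R) ^+ n * (-1) ^+ n = 1.
Proof. by rewrite -expr2 -exprM mulnC exprM sqrrN !expr1n. Qed.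

(** Small enough that (1 + a)^K - 1 is at most 1/4: then [C] and [S] stay within 1/4 of the cosine
    and the sine of m th. *)
Let a : R := (8 * K.+1%:R)^-1.
Let a0 : 0 < a. Proof. by rewrite invr_gt0 mulr_gt0. Qed.
Let aK : a * K.+1%:R = 8^-1.
Proof. by rewrite /a invfM -mulrA mulVf ?mulr1 // pnatr_eq0. Qed.
Let aK1 : a + a * K%:R = 8^-1.
Proof. by rewrite -aK mulrSr; ring. Qed.
Let a1 : a < 1.
Proof. by have := aK1; have : 0 <= a * K%:R; [by rewrite mulr_ge0 // ltW|lra]. Qed.

Let pow_a : (1 + a) ^+ K - 1 <= 4^-1.
Proof.
have H i : (i <= K)%N -> (1 + a) ^+ i <= 1 + 2 * (a * i%:R).
  elim: i => [|i IH] iK; first by rewrite expr0 mulr0; lra.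
  have iK' : a * i%:R <= a * K%:R by rewrite ler_wpM2l ?(ltW a0) // ler_nat ltnW.
  have ia : 0 <= a * i%:R by rewrite mulr_ge0 // ltW.
  have := IH (ltnW iK); rewrite exprS -(ler_pM2l (_ : 0 < 1 + a)); last by have := a0; lra.
  have h : a * (a * i%:R) <= a * 2^-1 by rewrite ler_wpM2l ?(ltW a0) //; have := aK1; have := a0; lra.
  rewrite [i.+1%:R]mulrSr [a * (_ + 1)]mulrDr mulr1 => /le_trans; apply; move: h; move: (a * i%:R) => x h.
  have -> : (1 + a) * (1 + 2 * x) = 1 + 2 * x + a + 2 * (a * x) by ring.
  by lra.
by have := H K (leqnn _); have := aK1; have := a0; lra.
Qed.

Local Notation m := M.+2.
Let C := trigp a cos K (m - K).
Let S := trigp a sin K (m - K).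

Let C_approx th : `|C th - cos (m%:R * th)| <= 4^-1.
Proof.
have := trigp_approx a0 K (m - K) th (@cos_max R).
by rewrite subnK // => /le_trans; apply; exact: pow_a.
Qed.

Let S_approx th : `|S th - sin (m%:R * th)| <= 4^-1.
Proof.
have := trigp_approx a0 K (m - K) th (@sin_max R).
by rewrite subnK // => /le_trans; apply; exact: pow_a.
Qed.

Let m0 : 0 < m%:R :> R. Proof. by rewrite ltr0n. Qed.
(** The sine of m th goes from one of 1 and -1 to the other on this window, so [S], within 1/4 of
    it, vanishes inside. There the modulus fixes |C|, and the sign is that of cos (m th), which
    exceeds 1/4 in absolute value. *)
Let node_ex j : exists th, [/\ (j%:R - 2^-1) * pi < m%:R * th < (j%:R + 2^-1) * pi,
  S th = 0 & C th = (-1) ^+ j * Num.sqrt (yval a th) ^+ K].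
Proof.
pose l : R := (j%:R - 2^-1) * pi / m%:R; pose u : R := (j%:R + 2^-1) * pi / m%:R.
have ml : m%:R * l = - (pi / 2) + pi *+ j.
  by rewrite /l mulrCA divff ?gt_eqF // mulr1 -[pi *+ j]mulr_natr; field.
have mu : m%:R * u = pi / 2 + pi *+ j.
  by rewrite /u mulrCA divff ?gt_eqF // mulr1 -[pi *+ j]mulr_natr; field.
have lu : l <= u.
  by rewrite -(ler_pM2l m0) ml mu lerD2r; have := @pi_gt0 R; lra.
have sl : `|S l + (-1) ^+ j| <= 4^-1.
  by have := S_approx l; rewrite ml (alternatingn (@sinDpi R)) sinN sin_pihalf mulrN1 opprK.
have su : `|S u - (-1) ^+ j| <= 4^-1.
  by have := S_approx u; rewrite mu (alternatingn (@sinDpi R)) sin_pihalf mulr1.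
have cS : {within `[l, u], continuous S}.
  by apply: continuous_subspaceT; apply: continuous_trigp; exact: continuous_sin.
have S0 : Num.min (S l) (S u) <= 0 <= Num.max (S l) (S u).
  rewrite ge_min le_max; move: sl su.
  rewrite !ler_norml -signr_odd; case: (odd j) => /=; rewrite ?expr0 ?expr1 => *;
    apply/andP; split; apply/orP; by [left; lra|right; lra].
have [th] := IVT lu cS S0; rewrite in_itv /= => /andP[h1 h2] S0th.
have ne1 : th != l.
  by apply/eqP => E; move: sl; rewrite -E S0th add0r normrX normrN1 expr1n; lra.
have ne2 : u != th.
  by apply/eqP => E; move: su; rewrite E S0th sub0r normrN normrX normrN1 expr1n; lra.
have hth : (j%:R - 2^-1) * pi < m%:R * th < (j%:R + 2^-1) * pi.
  rewrite -[ltLHS](divfK (lt0r_neq0 m0)) -[X in _ && (_ < X)](divfK (lt0r_neq0 m0)).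
  rewrite ![_ / _ * _]mulrC !ltr_pM2l // lt_neqAle eq_sym ne1 h1 lt_neqAle eq_sym ne2.
  by rewrite h2.
exists th; split=> //.
have y0 : 0 <= yval a th ^+ K by rewrite -(trigp_norm a K (m - K) th) addr_ge0 ?sqr_ge0.
have y0' : 0 <= yval a th.
  rewrite /yval; have := cos_geN1 th; have := a0; have := sqr_ge0 (1 - a) => h1' h2' h3'.
  have : 2 * a * -1 <= 2 * a * cos th by rewrite ler_wpM2l //; lra.
  by lra.
have C2 : C th ^+ 2 = (Num.sqrt (yval a th) ^+ K) ^+ 2.
  have := trigp_norm a K (m - K) th; rewrite -/(S th) -/(C th) S0th expr0n addr0 => ->.
  by rewrite -exprM mulnC exprM sqr_sqrtr.
have cpos : 0 <= (-1) ^+ j * cos (m%:R * th).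
  have -> : m%:R * th = (m%:R * th - j%:R * pi) + pi *+ j by rewrite -[pi *+ j]mulr_natl; ring.
  rewrite (alternatingn (@cosDpi R)) mulrA signr_sqr mul1r cos_ge0_pihalf //.
  by move: hth => /andP[]; move=> *; apply/andP; split; lra.
have cs := cos2Dsin2 (m%:R * th).
have Ss := S_approx th; rewrite S0th sub0r normrN in Ss.
have s2 : sin (m%:R * th) ^+ 2 <= 16^-1.
  rewrite -real_normK ?num_real //; have := ler_pM (normr_ge0 _) (normr_ge0 _) Ss Ss.
  by rewrite -expr2; lra.
have cge : 4^-1 < (-1) ^+ j * cos (m%:R * th).
  rewrite ltNge; apply/negP => h; have := ler_pM cpos cpos h h.
  by rewrite mulrACA signr_sqr mul1r -expr2; lra.
have Cs := C_approx th.
have Cpos : 0 <= (-1) ^+ j * C th.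
  have : `|(-1) ^+ j * C th - (-1) ^+ j * cos (m%:R * th)| <= 4^-1.
    by rewrite -mulrBr normrM normrX normrN1 expr1n mul1r.
  by rewrite ler_norml => /andP[]; lra.
have : (-1) ^+ j * C th = Num.sqrt (yval a th) ^+ K.
  apply/eqP; rewrite -(@eqrXn2 _ 2) // ?exprn_ge0 ?sqrtr_ge0 // -C2 exprMn.
  by rewrite expr2 signr_sqr mul1r.
by move=> <-; rewrite mulrA signr_sqr mul1r.
Qed.

Lemma base_ex : exists (p : {poly R}) (y : 'I_M.+1 -> R) (l u : R),
  [/\ size p = M.+3 /\ 0 < lead_coef p, {homo y : i j / (i < j)%N >-> i < j},
     0 < l /\ forall i, l < y i < u,
     forall i : 'I_M.+1, (-1) ^+ (M + i.+1) * p.[y i] = 2 * Num.sqrt (y i) ^+ K &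
     (forall x, l <= x <= u -> p.[x] ^+ 2 <= 4 * x ^+ K) /\ 2 * (0 : R) ^+ K < (-1) ^+ M * p.[0]].
Proof.
have [th Hth] := choice node_ex.
have thlt i j : (i < j)%N -> th i < th j.
  move=> ij; have [/andP[_ h1] _ _] := Hth i; have [/andP[h2 _] _ _] := Hth j.
  rewrite -(ltr_pM2l m0); apply: lt_trans h1 (le_lt_trans _ h2).
  rewrite ler_wpM2r ?pi_ge0 //; have : (i.+1%:R <= j%:R :> R) by rewrite ler_nat.
  by rewrite mulrSr; lra.
have thpi (i : 'I_M.+1) : 0 < th (M.+1 - i)%N < pi.
  have [/andP[h1 h2] _ _] := Hth (M.+1 - i)%N.
  have j1 : 1 <= (M.+1 - i)%:R :> R by rewrite ler1n; have := ltn_ord i; lia.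
  have j2 : (M.+1 - i)%:R + 1 <= m%:R :> R by rewrite -mulrSr ler_nat; lia.
  have p0 := @pi_gt0 R.
  rewrite -(pmulr_rgt0 _ m0) -(ltr_pM2l m0) (lt_trans _ h1) /=; last by rewrite mulr_gt0 //; lra.
  by apply: lt_trans h2 _; rewrite ltr_pM2r //; lra.
have inpi (i : 'I_M.+1) : th (M.+1 - i)%N \in `[0, pi].
  by have /andP[/ltW h1 /ltW h2] := thpi i; rewrite in_itv /= h1.
have coslt (i : 'I_M.+1) : -1 < cos (th (M.+1 - i)%N) < 1.
  have [h1 h2] := andP (thpi i); rewrite -[in -1 < _]cospi -[in _ < 1]cos0 !ltr_cos ?h1 ?h2 //.
    by rewrite in_itv /= lexx pi_ge0.
  by rewrite in_itv /= lexx pi_ge0.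
(* The order is reversed since the cosine decreases, and only the nodes 1 to M + 1 are taken: their
   windows lie inside the open interval from 0 to pi. *)
exists (chebp a K (m - K)), (fun i => yval a (th (M.+1 - i)%N)), ((1 - a) ^+ 2), ((1 + a) ^+ 2).
have [sp] := chebp_top a0 a1 K (m - K); rewrite subnK // => /(_ isT) top.
have topp : 0 < (chebp a K (m - K))`_m by rewrite top exprn_gt0 ?invr_gt0.
have sz : size (chebp a K (m - K)) = m.+1.
  apply/eqP; rewrite eqn_leq; move: (sp); rewrite subnK // => -> /=; rewrite ltnNge; apply/negP => h.
  by move: topp; rewrite nth_default // ltxx.
split.
- by split=> //; rewrite /lead_coef sz.
- move=> i j ij; rewrite /yval ltrD2l ltr_pM2l ?mulr_gt0 // ltr_cos //.
  by apply: thlt; have := ltn_ord j; lia.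
- split=> [|i]; first by rewrite exprn_gt0 // subr_gt0.
  have /andP[h1 h2] := coslt i; rewrite /yval.
  have : a * -1 < a * cos (th (M.+1 - i)%N) by rewrite ltr_pM2l.
  have : a * cos (th (M.+1 - i)%N) < a * 1 by rewrite ltr_pM2l.
  rewrite (_ : (1 - a) ^+ 2 = 1 + a ^+ 2 - 2 * a); last by ring.
  rewrite (_ : (1 + a) ^+ 2 = 1 + a ^+ 2 + 2 * a); last by ring.
  rewrite -mulrA; move: (a * cos _) (a ^+ 2) => u v ? ?.
  by apply/andP; split; lra.
- move=> i; rewrite chebp_trig // -/(C _); have [_ _ ->] := Hth (M.+1 - i)%N.
  rewrite mulrCA; congr (_ * _); rewrite mulrA -exprD -[RHS]mul1r; congr (_ * _).
  rewrite -signr_odd (_ : odd _ = false) //.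
  by have := ltn_ord i; move: (i : nat) => j; lia.
split=> [x|]; first exact: chebp_le.
rewrite chebp_at0 //.
have E : (-1) ^+ M = (-1) ^+ (m - K) * (-1) ^+ K :> R.
  by rewrite -exprD subnK // !exprS; ring.
have -> : (-1) ^+ M * ((- a) ^+ (m - K) * 0 ^+ K + (- a^-1) ^+ (m - K) * (a - a^-1) ^+ K) =
   a ^+ (m - K) * 0 ^+ K + a^-1 ^+ (m - K) * (a^-1 - a) ^+ K.
  have [aj av] : (- a) ^+ (m - K) = (-1) ^+ (m - K) * a ^+ (m - K) /\
    (- a^-1) ^+ (m - K) = (-1) ^+ (m - K) * a^-1 ^+ (m - K) by rewrite -!exprNn.
  have aw : (a - a^-1) ^+ K = (-1) ^+ K * (a^-1 - a) ^+ K by rewrite -exprNn opprB.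
  rewrite E aj av aw.
  case: (eqVneq K 0%N) => [->|K0]; last first.
    rewrite expr0n (negPf K0) !mulr0 !add0r.
    transitivity (((-1) ^+ (m - K) * (-1) ^+ (m - K)) * ((-1) ^+ K * (-1) ^+ K) *
      (a^-1 ^+ (m - K) * (a^-1 - a) ^+ K)); first by ring.
    by rewrite !signr_sqr !mul1r.
  transitivity (((-1) ^+ (m - 0) * (-1) ^+ (m - 0)) * (a ^+ (m - 0) + a^-1 ^+ (m - 0)));
    first by rewrite !expr0; ring.
  by rewrite signr_sqr mul1r !expr0 !mulr1.
have ai : a < a^-1 by rewrite (lt_trans a1) // invf_gt1.
case: (eqVneq K 0%N) => [K0|K0]; last first.
  rewrite expr0n (negPf K0) !mulr0 add0r mulr_gt0 // exprn_gt0 ?invr_gt0 //.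
  by rewrite subr_gt0.
rewrite K0 !expr0 !mulr1 exprVn.
have : 0 < a ^+ (m - 0) < 1 by rewrite exprn_gt0 // exprn_ilt1 // ltW.
move: (a ^+ _) => b /andP[b0 b1].
rewrite -subr_gt0 (_ : b + b^-1 - 2 = (1 - b) ^+ 2 / b); last by field; rewrite gt_eqF.
by rewrite divr_gt0 // exprn_gt0 // subr_gt0.
Qed.

End Base.

(** * A contraction principle *)

Section SupNorm.
Variable R : realType.

Lemma mx_norm_le n (v : 'rV[R]_n.+1) r : 0 <= r ->
  (forall i, `|v ord0 i| <= r) -> `|v| <= r.
Proof.
move=> r0 H; rewrite /Num.norm /= mx_normrE; apply: (big_ind (fun x => x <= r)) => //.
- by move=> x y hx hy; rewrite ge_max hx.
- by move=> [i j] _ /=; rewrite (ord1 i).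
Qed.

Lemma le_mx_norm n (v : 'rV[R]_n.+1) i : `|v ord0 i| <= `|v|.
Proof.
rewrite [leRHS]/Num.norm /= mx_normrE.
by rewrite (le_trans _ (le_bigmax _ _ (ord0, i))).
Qed.

Lemma sup_norm_fixpoint n (f : 'rV[R]_n.+1 -> 'rV[R]_n.+1) :
  (forall c c', `|f c - f c'| <= 2^-1 * `|c - c'|) -> exists c, c = f c.
Proof.
move=> H.
pose fT : {fun [set: 'rV[R]_n.+1] >-> [set: 'rV[R]_n.+1]} :=
  HB.pack f (isFun.Build _ _ setT setT f (fun x _ => I)).
pose X : completeNormedModType R := HB.pack 'rV[R]_n.+1.
have [] := @banach_fixed_point R X setT fT.
- exists (2^-1)%:nng; split => /=; first by rewrite invf_lt1 ?ltr1n.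
  by move=> [c c'] _; exact: H.
- exact: closedT.
- by exists 0.
- by move=> c _ E; exists c; rewrite {1}E.
Qed.

Lemma max_lipschitz (f f' : R -> R) (A : pred R) z z' e :
  A z -> A z' ->
  (forall y, A y -> f y <= f z) -> (forall y, A y -> f' y <= f' z') ->
  (forall y, A y -> `|f y - f' y| <= e) -> `|f z - f' z'| <= e.
Proof.
move=> hz hz' H H' E; have := E z hz; have := E z' hz'; have := H z' hz'; have := H' z hz.
by rewrite !ler_norml => ? ? /andP[? ?] /andP[? ?]; apply/andP; split; lra.
Qed.

(** * Prescribing local maxima by a contraction *)

Section Touch.
Variables (M : nat) (y : 'I_M.+1 -> R) (r : R) (G : 'I_M.+1 -> R -> R).
Variables (phi : 'I_M.+1 -> 'I_M.+1 -> R -> R) (S : pred 'I_M.+1).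
Hypotheses (r0 : 0 < r) (cG : forall i, continuous (G i)).
Hypothesis cphi : forall i j, continuous (phi i j).
Local Notation U i := (`[y i - r, y i + r]).
Hypothesis phi1 : forall i x, x \in U i -> \sum_j `|phi i j x - (i == j)%:R| <= 2^-1.
Hypothesis G0 : forall i x, x \in U i -> G i x <= 0.
Hypothesis Gy : forall i, G i (y i) = 0.

Let f i (c : 'rV[R]_M.+1) x := G i x + \sum_j c ord0 j * phi i j x.

Let yU i : y i \in U i.
Proof. by rewrite in_itv /=; apply/andP; split; have := r0; lra. Qed.

Let phi1' i (c : 'rV[R]_M.+1) x : x \in U i ->
  `|\sum_j c ord0 j * phi i j x - c ord0 i| <= 2^-1 * `|c|.
Proof.
move=> xU; have -> : c ord0 i = \sum_j c ord0 j * (i == j)%:R.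
  rewrite (bigD1 i) //= eqxx mulr1 big1 ?addr0 // => j /negPf.
  by rewrite eq_sym => ->; rewrite mulr0.
rewrite -sumrB; under eq_bigr do rewrite -mulrBr.
apply: le_trans (ler_norm_sum _ _ _) _; under eq_bigr do rewrite normrM.
have : `|c| * \sum_j `|phi i j x - (i == j)%:R| <= `|c| * 2^-1.
  by rewrite ler_wpM2l // phi1.
rewrite [_ * 2^-1]mulrC; apply: le_trans; rewrite mulr_sumr; apply: ler_sum => j _.
by rewrite ler_wpM2r // le_mx_norm.
Qed.

(** Because [phi] is close to the identity, the maximum over the i-th interval follows [c i] up to
    half the norm of [c]. Subtracting it from [c i] for i in [S], and setting c i = t elsewhere, is
    a contraction of ratio 1/2, and at its fixed point the maxima are 0. It maps 0 to a vector of
    norm at most t, hence the bound 2 t. *)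
Lemma touch_ex t : 0 <= t -> exists c : 'I_M.+1 -> R,
  [/\ forall i, `|c i| <= 2 * t, forall i, ~~ S i -> c i = t &
    forall i, S i -> (forall x, x \in U i -> G i x + \sum_j c j * phi i j x <= 0) /\
      exists2 z, z \in U i & G i z + \sum_j c j * phi i j z = 0].
Proof.
move=> t0.
have cf i c : continuous (f i c).
  move=> x; apply: cvgD; first exact: cG.
  apply: cvg_big; first exact: add_continuous.
  by move=> j _; apply: cvgM; [exact: cvg_cst|exact: cphi].
have ex (ic : 'I_M.+1 * 'rV[R]_M.+1) : exists z, z \in U ic.1 /\
    forall x, x \in U ic.1 -> f ic.1 ic.2 x <= f ic.1 ic.2 z.
  have [||z zU H] := @EVT_max R (f ic.1 ic.2) (y ic.1 - r) (y ic.1 + r).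
  - by have := r0; lra.
  - by apply: continuous_subspaceT; exact: cf.
  - by exists z.
have [z Hz] := choice ex.
pose F i c := f i c (z (i, c)).
pose Phi (c : 'rV[R]_M.+1) : 'rV[R]_M.+1 := \row_i (if S i then c ord0 i - F i c else t).
have lip c c' : `|Phi c - Phi c'| <= 2^-1 * `|c - c'|.
  apply: mx_norm_le; first by rewrite mulr_ge0 // invr_ge0.
  move=> i; rewrite !mxE; case: ifP => _; last by rewrite subrr normr0 mulr_ge0 // invr_ge0.
  have [zU mz] := Hz (i, c); have [zU' mz'] := Hz (i, c').
  have := @max_lipschitz (fun x => f i c x - c ord0 i) (fun x => f i c' x - c' ord0 i)
    (fun x => x \in U i) (z (i, c)) (z (i, c')) (2^-1 * `|c - c'|) zU zU'.
  rewrite /F => H; rewrite -[leLHS]normrN.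
  have -> : - (c ord0 i - f i c (z (i, c)) - (c' ord0 i - f i c' (z (i, c')))) =
    f i c (z (i, c)) - c ord0 i - (f i c' (z (i, c')) - c' ord0 i) by ring.
  apply: (@H _ _ _) => x xU; first by rewrite lerD2r mz.
    by rewrite lerD2r mz'.
  have := phi1' (c - c') xU; rewrite !mxE; congr (`|_| <= _).
  by under eq_bigr do rewrite !mxE mulrBl; rewrite sumrB /f; ring.
have [c Ec] := sup_norm_fixpoint lip.
have Phi0 : `|Phi 0| <= t.
  apply: mx_norm_le => // i; rewrite !mxE; case: ifP => _; last by rewrite ger0_norm.
  rewrite sub0r normrN /F; have [zU mz] := Hz (i, 0).
  have f0 x : f i 0 x = G i x.
    by rewrite /f big1 ?addr0 // => j _; rewrite mxE mul0r.
  have := mz _ (yU i); rewrite /= !f0 Gy => h.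
  by have -> : G i (z (i, 0)) = 0; [apply/eqP; rewrite eq_le h G0|rewrite normr0].
have nc : `|c| <= 2 * t.
  have := lip c 0; rewrite -Ec subr0 => h.
  have : `|c| <= `|c - Phi 0| + `|Phi 0| by rewrite -{1}[c](subrK (Phi 0)) ler_normD.
  by lra.
exists (fun i => c ord0 i); split=> [i|i Si|i Si].
- exact: le_trans (le_mx_norm _ _) nc.
- by rewrite Ec mxE (negPf Si).
have := congr1 (fun v : 'rV_M.+1 => v ord0 i) Ec; rewrite mxE Si => E.
have F0 : F i c = 0 by move: E; lra.
have [zU mz] := Hz (i, c); split=> [x xU|]; last by exists (z (i, c)).
by have := mz x xU; rewrite -/(F i c) F0.
Qed.

End Touch.
End SupNorm.


(** * Polynomials with prescribed alternation *)

Section Bands.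
Variable R : realType.
Implicit Types (f : R -> R) (p q P : {poly R}) (a b x z : R).

Lemma near_radius f a b : continuous f -> f a < b ->
  \forall r \near (0 : R)^'+, forall x, x \in `[a - r, a + r] -> f x < b.
Proof.
move=> cf fa; have /nbhs_ballP[e /= e0 H] : \forall x \near a, f x < b by exact: (cvgr_lt _ (cf a)).
near=> r => x; rewrite in_itv /= => /andP[h1 h2]; apply: H.
rewrite /ball /= ltr_norml; have : r < e by near: r; exact: nbhs_right_lt.
by move=> re; apply/andP; split; lra.
Unshelve. all: by end_near. Qed.

Lemma itv_ends y r x : 0 <= r -> x = y - r \/ x = y + r -> x \in `[y - r, y + r].
Proof. by move=> r0 hx; rewrite in_itv /=; apply/andP; case: hx => ->; split; lra. Qed.

Lemma near_forall n (P : 'I_n -> R -> Prop) :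
  (forall i, \forall r \near (0 : R)^'+, P i r) -> \forall r \near (0 : R)^'+, forall i, P i r.
Proof. by move=> H; apply: filter_forall. Qed.

Lemma near_lt_mul A b : 0 < b -> \forall t \near (0 : R)^'+, A * t < b.
Proof.
move=> b0; near=> t.
have t0 : 0 < t by near: t; exact: nbhs_right_gt.
have : t < b / (`|A| + 1) by near: t; apply: nbhs_right_lt; rewrite divr_gt0 // ltr_wpDl.
rewrite ltr_pdivlMr ?ltr_wpDl // => h; apply: le_lt_trans h.
by rewrite mulrC ler_wpM2l ?(ltW t0) // (le_trans (ler_norm A)) // lerDl.
Unshelve. all: by end_near. Qed.

Lemma near_horner_neq0 P a : P != 0 ->
  \forall r \near (0 : R)^'+, P.[a + r] != 0 /\ P.[a - r] != 0.
Proof.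
move=> P0; have [k [Q Qa E]] := multiplicity_XsubC P a.
have Qa0 : - `|Q.[a]| < 0 by rewrite oppr_lt0 normr_gt0; move: Qa; rewrite P0.
have cQ : continuous (fun x => - `|Q.[x]|).
  by move=> x; apply: cvgN; apply: cvg_norm; exact: continuous_horner.
near=> r; have r0 : 0 < r by near: r; exact: nbhs_right_gt.
have H : forall x, x \in `[a - r, a + r] -> Q.[x] != 0.
  move=> x hx; rewrite -normr_gt0 -oppr_lt0; move: x hx; near: r.
  exact: near_radius cQ Qa0.
rewrite E !hornerM !horner_exp !hornerXsubC !mulf_neq0 //.
- by apply: H; rewrite in_itv /=; apply/andP; split; lra.
- by rewrite expf_neq0 // addrAC subrr add0r oppr_eq0 gt_eqF.
- by apply: H; rewrite in_itv /=; apply/andP; split; lra.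
- by rewrite expf_neq0 // addrAC subrr add0r gt_eqF.
Unshelve. all: by end_near. Qed.

(** At a simple root [P] would change sign. *)
Lemma local_max_double P z : P.[z] = 0 ->
  (\forall r \near (0 : R)^'+, P.[z + r] <= 0 /\ P.[z - r] <= 0) ->
  ('X - z%:P) ^+ 2 %| P.
Proof.
move=> /eqP /factor_theorem[Q E] H.
suff /factor_theorem[Q' EQ] : root Q z by rewrite E EQ -mulrA -expr2 dvdp_mull.
apply/negPn/negP => Qz.
have cQ1 := @continuous_horner R Q.
have cQ2 : continuous (fun x => - Q.[x]) by move=> x; apply: cvgN; exact: cQ1.
have [r] : exists r, [/\ 0 < r, P.[z + r] <= 0 /\ P.[z - r] <= 0 &
    forall x, x \in `[z - r, z + r] -> (Q.[z] < 0 -> Q.[x] < 0) /\ (0 < Q.[z] -> 0 < Q.[x])].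
  have N1 : Q.[z] < 0 -> \forall r \near (0 : R)^'+, forall x, x \in `[z - r, z + r] -> Q.[x] < 0.
    by move=> h; exact: near_radius.
  have N2 : 0 < Q.[z] -> \forall r \near (0 : R)^'+, forall x, x \in `[z - r, z + r] -> - Q.[x] < 0.
    by move=> h; apply: (near_radius cQ2); rewrite oppr_lt0.
  have N0 := nbhs_right_gt (0 : R).
  have [Qz0|Qz0] := ltP Q.[z] 0.
    have [r [r0 [h h']]] := filter_ex (filterI N0 (filterI H (N1 Qz0))).
    exists r; split=> // x hx; split=> [_|]; first exact: h'.
    by move=> /(lt_trans Qz0); rewrite ltxx.
  have Qz1 : 0 < Q.[z] by rewrite lt_neqAle Qz0 eq_sym Qz.
  have [r [r0 [h h']]] := filter_ex (filterI N0 (filterI H (N2 Qz1))).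
  exists r; split=> // x hx; split=> [//|_].
  by rewrite -oppr_lt0; exact: h'.
rewrite E !hornerM !hornerXsubC.
have -> : z + r - z = r by ring.
have -> : z - r - z = - r by ring.
move=> -[r0 [h1 h2] h].
have [|a1 a2] := h (z + r); first by rewrite in_itv /=; apply/andP; split; lra.
have [|b1 b2] := h (z - r); first by rewrite in_itv /=; apply/andP; split; lra.
case: (ltgtP Q.[z] 0) => Qz0.
- by move: h2; rewrite mulrN -mulNr pmulr_lle0 // oppr_le0 leNgt b1.
- by move: h1; rewrite pmulr_lle0 // leNgt a2.
- by move: Qz; rewrite /root Qz0 eqxx.
Qed.

Definition lagrange_poly n (y : 'I_n -> R) (j : 'I_n) : {poly R} :=
  \prod_(i < n | i != j) ((y j - y i)^-1 *: ('X - (y i)%:P)).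

Lemma lagrange_polyE n (y : 'I_n -> R) i j : injective y ->
  (lagrange_poly y j).[y i] = (i == j)%:R.
Proof.
move=> yi; rewrite horner_prod; case: eqVneq => [->|ij]; last first.
  by rewrite (bigD1 i) //= hornerZ hornerXsubC subrr mulr0 mul0r.
rewrite big1 // => k kj; rewrite hornerZ hornerXsubC mulVf // subr_eq0.
by apply: contra kj => /eqP/yi ->.
Qed.

Lemma size_lagrange_poly n (y : 'I_n -> R) j : (size (lagrange_poly y j) <= n)%N.
Proof.
rewrite /lagrange_poly; apply: leq_trans (size_poly_prod_leq _ _) _.
have : (\sum_(i < n | i != j) size ((y j - y i)^-1 *: ('X - (y i)%:P)) <= n.-1 * 2)%N.
  have -> : (n.-1 * 2 = \sum_(i < n | i != j) 2)%N.
    by rewrite sum_nat_const (cardC1 j) card_ord.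
  apply: leq_sum => i _.
  by rewrite (leq_trans (size_scale_leq _ _)) // size_XsubC.
rewrite (cardC1 j) card_ord; have := ltn_ord j; move: (\sum_(i < n | _) _)%N => s; lia.
Qed.


(** * Keeping some contacts and opening the others *)

Section Perturbation.
Variables (M K : nat) (S : pred nat).
Hypothesis KM : (K <= M.+2)%N.
Local Notation rho x := (Num.sqrt x ^+ K).

Lemma rho_sqr x : 0 <= x -> rho x ^+ 2 = x ^+ K.
Proof. by move=> x0; rewrite -exprM mulnC exprM sqr_sqrtr. Qed.

Lemma rho_ge0 x : 0 <= rho x.
Proof. by rewrite exprn_ge0 ?sqrtr_ge0. Qed.

Lemma rho0 : rho (0 : R) = 0 ^+ K.
Proof. by rewrite sqrtr0. Qed.

Lemma continuous_rho : continuous (fun x : R => rho x).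
Proof.
move=> x; apply: (@continuous_comp _ _ _ (@Num.sqrt R) (fun y => y ^+ K)).
  exact: sqrt_continuous.
exact: exprn_continuous.
Qed.

Lemma sqr_le_rho x (s : R) : 0 <= x -> (s <= 2 * rho x) -> 0 <= s -> s ^+ 2 <= 4 * x ^+ K.
Proof.
move=> x0 h1 h2; rewrite -rho_sqr // (_ : 4 * _ = (2 * rho x) ^+ 2); last by ring.
by rewrite lerXn2r ?nnegrE // mulr_ge0 ?rho_ge0.
Qed.

Lemma le_rho x (s : R) : 0 <= x -> s ^+ 2 <= 4 * x ^+ K -> s <= 2 * rho x.
Proof.
move=> x0; rewrite -rho_sqr // (_ : 4 * _ = (2 * rho x) ^+ 2); last by ring.
move=> h; rewrite leNgt; apply/negP => h'.
have h0 : 0 <= 2 * rho x by rewrite mulr_ge0 ?rho_ge0.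
by move: h; rewrite leNgt ltrXn2r // nnegrE // (le_trans h0) // ltW.
Qed.

(** All inner extrema of the polynomial of [base_ex] touch the curves of height 2 x^(K/2). A small
    perturbation keeps the contacts with index in [S] and pushes the graph strictly past the curve
    at the others; [z 0 = 0] and the last point, far to the right, delimit the outer bands. *)
Lemma bands_ex : exists (q : {poly R}) (z : nat -> R),
  [/\ size q = M.+3 /\ 0 < lead_coef q, z 0%N = 0, forall i, (i < M.+2)%N -> z i < z i.+1,
   forall i, (i <= M)%N -> S i -> (-1) ^+ (M + i.+1) * q.[z i.+1] = 2 * rho (z i.+1) /\
     ('X - (z i.+1)%:P) ^+ 2 %| q ^+ 2 - 4%:R *: 'X^K &
   forall i, (i <= M.+2)%N -> ~~ [&& (0 < i)%N, (i <= M.+1)%N & S i.-1] ->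
     2 * rho (z i) < (-1) ^+ (M + i) * q.[z i]].
Proof.
have [p [y [l [u [[sp lp] ymono [l0 ylu] py [ple p0]]]]]] := base_ex R KM.
have yinj : injective y.
  move=> i j E; apply/val_inj; case: (ltngtP i j) => // /ymono; by rewrite E ltxx.
pose sg (i : nat) : R := (-1) ^+ (M + i.+1).
pose L := lagrange_poly y.
pose phi (i j : 'I_M.+1) x := sg i * sg j * (L j).[x].
pose G (i : 'I_M.+1) x := sg i * p.[x] - 2 * rho x.
pose P := p ^+ 2 - 4%:R *: 'X^K.
have PE x : P.[x] = p.[x] ^+ 2 - 4 * x ^+ K by rewrite /P !hornerE.
have sg2 i : sg i ^+ 2 = 1 by rewrite expr2 signr_sqr.
have cG i : continuous (G i).
  move=> x; apply: cvgB; (apply: cvgM; first exact: cvg_cst).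
    exact: continuous_horner.
  exact: continuous_rho.
have cphi i j : continuous (phi i j).
  by move=> x; apply: cvgM; [exact: cvg_cst|exact: continuous_horner].
have Pn0 : P != 0.
  apply/eqP => P0; have := PE 0; rewrite P0 horner0 => /esym/eqP; rewrite subr_eq0 => /eqP E.
  have : (2 * (0 : R) ^+ K) ^+ 2 < ((-1) ^+ M * p.[0]) ^+ 2.
    by rewrite ltrXn2r // nnegrE ?mulr_ge0 ?exprn_ge0 // (le_trans _ (ltW p0)) // mulr_ge0 ?exprn_ge0.
  rewrite !exprMn E [(_ ^+ M) ^+ 2]expr2 signr_sqr mul1r.
  by case: (K) => [|k]; rewrite ?expr0 ?expr0n /= ?expr0n /=; lra.
have phi1 (i : 'I_M.+1) : \forall r \near (0 : R)^'+, forall x, x \in `[y i - r, y i + r] ->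
    \sum_j `|phi i j x - (i == j)%:R| < 2^-1.
  apply: near_radius; last first.
    rewrite big1 ?invr_gt0 // => j _; rewrite /phi lagrange_polyE //.
    case: eqVneq => [->|ij]; last by rewrite mulr0 subrr normr0.
    by rewrite mulr1 -expr2 sg2 subrr normr0.
  move=> x; apply: cvg_big; first exact: add_continuous.
  by move=> j _; apply: cvg_norm; apply: cvgB; [exact: cphi|exact: cvg_cst].
have N3 (i : 'I_M.+1) : \forall r \near (0 : R)^'+, r < y i - l /\ r < u - y i.
  have /andP[h1 h2] := ylu i.
  by apply: filterI; apply: nbhs_right_lt; rewrite subr_gt0.
have N4 (i j : 'I_M.+1) : (i < j)%N -> \forall r \near (0 : R)^'+, r < (y j - y i) / 2.
  by move=> ij; apply: nbhs_right_lt; rewrite divr_gt0 // subr_gt0 ymono.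
have N4' (i j : 'I_M.+1) : \forall r \near (0 : R)^'+, (i < j)%N -> r < (y j - y i) / 2.
  by case: (ltnP i j) => ij; [apply: filterS (N4 _ _ ij)|apply: nearW].
have [r [r0 [Hr1 [Hr2 [Hr3 Hr4]]]]] := filter_ex (filterI (nbhs_right_gt (0 : R))
  (filterI (near_forall phi1) (filterI (near_forall (fun i => near_horner_neq0 (y i) Pn0))
  (filterI (near_forall N3) (near_forall (fun i => near_forall (N4' i))))))).
have yU (i : 'I_M.+1) x : x \in `[y i - r, y i + r] -> l < x < u.
  by rewrite in_itv /= => /andP[h1 h2]; have [h3 h4] := Hr3 i; apply/andP; split; lra.
have G0 (i : 'I_M.+1) x : x \in `[y i - r, y i + r] -> G i x <= 0.
  move=> /yU/andP[h1 h2]; rewrite /G subr_le0 le_rho ?(le_trans (ltW l0) (ltW h1)) //.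
  by rewrite exprMn sg2 mul1r ple // !ltW.
have Gb (i : 'I_M.+1) x : x = y i - r \/ x = y i + r -> G i x < 0.
  move=> hx; have xU : x \in `[y i - r, y i + r].
    exact: itv_ends (ltW r0) hx.
  have Px : P.[x] != 0 by have [h1 h2] := Hr2 i; case: hx => ->.
  rewrite lt_neqAle G0 // andbT; apply: contra Px => /eqP; rewrite /G => /eqP.
  have /andP[h1 _] := yU _ _ xU.
  rewrite subr_eq0 PE subr_eq0 => /eqP h; rewrite -rho_sqr ?(le_trans (ltW l0) (ltW h1)) //.
  apply/eqP; transitivity ((sg i * p.[x]) ^+ 2); first by rewrite exprMn sg2 mul1r.
  by rewrite h exprMn -natrX.
have [Rr [uR pR]] : exists Rr, u < Rr /\ 2 * rho Rr < p.[Rr].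
  have lcP : 0 < lead_coef P.
    rewrite /P lead_coefDl.
      by rewrite lead_coef_exp exprn_gt0.
    rewrite size_polyN size_scale ?pnatr_eq0 // size_polyXn.
    have := size_exp p 2; rewrite sp /=; move: (size (p ^+ 2)) => x; have := KM; lia.
  have [A HA] := poly_pinfty_gt_lc lcP.
  have [B HB] := poly_pinfty_gt_lc lp.
  pose Rr := Num.max A (Num.max B (u + 1)); exists Rr.
  have uR : u < Rr by rewrite !lt_max ltrDl ltr01 !orbT.
  have /HA h1 : A <= Rr by rewrite le_max lexx.
  have /HB h2 : B <= Rr by rewrite !le_max lexx orbT.
  have R0 : 0 <= Rr by apply: le_trans (ltW uR); rewrite (le_trans (ltW l0)) //;
     have /andP[h3 h4] := ylu ord0; exact: ltW (lt_trans h3 h4).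
  split=> //; rewrite ltNge; apply/negP => h.
  have := sqr_le_rho R0 h (le_trans (ltW lp) h2).
  rewrite -subr_le0 -PE leNgt => /negP; apply; exact: lt_le_trans h1.
pose A0 := \sum_(j < M.+1) `|(L j).[0]|; pose AR := \sum_(j < M.+1) `|(L j).[Rr]|.
have T1 : \forall t \near (0 : R)^'+, 2 * A0 * t < (-1) ^+ M * p.[0] - 2 * 0 ^+ K.
  by apply: near_lt_mul; rewrite subr_gt0.
have T2 : \forall t \near (0 : R)^'+, 2 * AR * t < p.[Rr] - 2 * rho Rr.
  by apply: near_lt_mul; rewrite subr_gt0.
have T3 (i : 'I_M.+1) : \forall t \near (0 : R)^'+, 3 * t < - G i (y i - r) /\ 3 * t < - G i (y i + r).
  by apply: filterI; apply: near_lt_mul; rewrite oppr_gt0; apply: Gb; [left|right].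
have [t [t0 [Ht1 [Ht2 Ht3]]]] := filter_ex (filterI (nbhs_right_gt (0 : R))
  (filterI T1 (filterI T2 (near_forall T3)))).
have [|||c [cb cS ct]] := @touch_ex R M y r G phi (fun i : 'I_M.+1 => S i) r0 cG cphi _ G0 _ t.
- by move=> i x hx; apply: ltW; apply: Hr1.
- by move=> i; rewrite /G py subrr.
- exact: ltW.
(* The Lagrange polynomials have lower degree than [p], so its leading term is unchanged. Outside
   [S] the coefficient is t > 0, and the graph overshoots at [y i] by exactly t. *)
pose q : {poly R} := p + \sum_(j < M.+1) (sg j * c j) *: L j.
have qE x : q.[x] = p.[x] + \sum_(j < M.+1) sg j * c j * (L j).[x].
  by rewrite /q hornerD horner_sum; congr (_ + _); apply: eq_bigr => j _; rewrite hornerZ.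
have qG (i : 'I_M.+1) x : sg i * q.[x] - 2 * rho x = G i x + \sum_j c j * phi i j x.
  rewrite qE mulrDr mulr_sumr /G addrAC; congr (_ + _); apply: eq_bigr => j _.
  by rewrite /phi; ring.
have qL x : `|q.[x] - p.[x]| <= 2 * (\sum_(j < M.+1) `|(L j).[x]|) * t.
  rewrite qE addrAC subrr add0r; apply: le_trans (ler_norm_sum _ _ _) _.
  rewrite mulrAC [2 * t * _]mulr_sumr; apply: ler_sum => j _.
  rewrite normrM ler_wpM2r // normrM; have -> : `|sg j| = 1 by rewrite normrX normrN1 expr1n.
  by rewrite mul1r cb.
have zex (i : 'I_M.+1) : exists x, [/\ y i - r < x < y i + r,
   S i -> sg i * q.[x] = 2 * rho x /\ ('X - x%:P) ^+ 2 %| q ^+ 2 - 4%:R *: 'X^K &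
   ~~ S i -> 2 * rho x < sg i * q.[x]].
  case Si : (S i); last first.
    exists (y i); split=> // [|_]; first by rewrite ltrDl ltrBlDr ltrDl r0.
    rewrite -subr_gt0 qG /G py subrr add0r (bigD1 i) //= big1 ?addr0 => [|j ji].
      by rewrite /phi lagrange_polyE // eqxx mulr1 -expr2 sg2 mulr1 cS ?Si.
    by rewrite /phi lagrange_polyE // eq_sym (negPf ji) !mulr0.
  have [Hle [x xU Hx]] := ct i Si.
  have ph x' : x' \in `[y i - r, y i + r] -> \sum_j `|phi i j x'| <= 3 / 2.
    move=> hx'; have h1 := Hr1 _ _ hx'.
    apply: (@le_trans _ _ (\sum_j (`|phi i j x' - (i == j)%:R| + (i == j)%:R))).
      apply: ler_sum => j _; rewrite -{1}(subrK (i == j)%:R (phi i j x')).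
      by apply: le_trans (ler_normD _ _) _; rewrite lerD2l normr_nat.
    rewrite big_split /= [X in _ + X](bigD1 i) //= eqxx [X in _ + (_ + X)]big1; last first.
      by move=> j /negPf; rewrite eq_sym => ->.
    by move: h1; rewrite addr0 (_ : true%:R = 1) //; lra.
  have bd x' : x' = y i - r \/ x' = y i + r -> G i x' + \sum_j c j * phi i j x' < 0.
    move=> hx'; have xU' : x' \in `[y i - r, y i + r].
      exact: itv_ends (ltW r0) hx'.
    have : \sum_j c j * phi i j x' <= 2 * t * (3 / 2).
      apply: le_trans (_ : 2 * t * \sum_j `|phi i j x'| <= _); last first.
        by rewrite ler_wpM2l ?ph // mulr_ge0 // ltW.
      rewrite mulr_sumr; apply: ler_sum => j _; apply: le_trans (ler_norm _) _.
      by rewrite normrM ler_wpM2r.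
    by have [h1 h2] := Ht3 i; case: hx' => ->; clear -h1 h2; lra.
  have xi : y i - r < x < y i + r.
    move: xU; rewrite in_itv /= => /andP[h1 h2]; rewrite !lt_neqAle h1 h2 !andbT.
    apply/andP; split; apply/eqP => E.
      by have := bd x (or_introl (esym E)); rewrite Hx ltxx.
    by have := bd x (or_intror E); rewrite Hx ltxx.
  have qx : sg i * q.[x] = 2 * rho x by apply/eqP; rewrite -subr_eq0 qG Hx.
  have x0 : 0 < x by have /andP[h1 _] := yU _ _ xU; exact: lt_trans h1.
  exists x; split=> // _; split=> //.
  have q2 : (sg i * q.[x]) ^+ 2 = q.[x] ^+ 2 by rewrite exprMn sg2 mul1r.
  apply: local_max_double.
    rewrite hornerD hornerN hornerZ horner_exp hornerXn -q2 qx exprMn rho_sqr ?(ltW x0) //.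
    by rewrite -natrX subrr.
  have csg : continuous (fun x => - (sg i * q.[x])).
    move=> w; apply: cvgN; apply: cvgM; [exact: cvg_cst|exact: continuous_horner].
  have csg0 : - (sg i * q.[x]) < 0 by rewrite oppr_lt0 qx mulr_gt0 // exprn_gt0 // sqrtr_gt0.
  have W0 : \forall e \near (0 : R)^'+, e < x - (y i - r) /\ e < y i + r - x.
    by have /andP[h1 h2] := xi; apply: filterI; apply: nbhs_right_lt; rewrite subr_gt0.
  apply: filterS (filterI (nbhs_right_gt (0 : R)) (filterI W0 (near_radius csg csg0))).
  move=> e [e0 [[w1 w2] w3]].
  suff H x' : x' \in `[x - e, x + e] -> (q ^+ 2 - 4%:R *: 'X^K).[x'] <= 0.
    by split; apply: H; apply: itv_ends (ltW e0) _; [right|left].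
  move=> hx'; have := w3 _ hx'; rewrite oppr_lt0 => pos.
  have xU' : x' \in `[y i - r, y i + r].
    move: hx' w1 w2; rewrite !in_itv /= => /andP[].
    by clear=> *; apply/andP; split; lra.
  have /andP[h1 _] := yU _ _ xU'; have h0 := ltW (lt_trans l0 h1).
  rewrite hornerD hornerN hornerZ horner_exp hornerXn subr_le0.
  have -> : q.[x'] ^+ 2 = (sg i * q.[x']) ^+ 2 by rewrite exprMn sg2 mul1r.
  by rewrite sqr_le_rho ?(ltW pos) // -subr_le0 qG Hle.
have [zz Hzz] := choice zex.
pose z i := if i is i'.+1 then (if (i' <= M)%N then zz (inord i') else Rr) else 0.
have zE (i : 'I_M.+1) : z i.+1 = zz i by rewrite /z -ltnS ltn_ord inord_val.
have zb (i : 'I_M.+1) : l < zz i < u.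
  have [/andP[h1 h2] _ _] := Hzz i; have [h3 h4] := Hr3 i.
  by clear -h1 h2 h3 h4; apply/andP; split; lra.
exists q, z; split=> //.
- have sq : (size (\sum_(j < M.+1) (sg j * c j) *: L j)%R < size p)%N.
    rewrite sp ltnS; apply: leq_trans (size_sum _ _ _) _.
    apply/bigmax_leqP => j _; rewrite (leq_trans (size_scale_leq _ _)) //.
    by rewrite (leq_trans (size_lagrange_poly _ _)).
  by rewrite /q size_polyDl // lead_coefDl.
- case=> [|i] iM.
    by have := zE ord0; rewrite /= => ->; have /andP[h _] := zb ord0; exact: lt_trans h.
  rewrite ltnS in iM; rewrite (zE (Ordinal iM)).
  case: (ltnP i M) => iM'; last first.
    have -> : z i.+2 = Rr by rewrite /z ltnNge iM'.
    by have /andP[_ h] := zb (Ordinal iM); exact: lt_trans uR.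
  have iM1 : (i.+1 < M.+1)%N by [].
  rewrite (zE (Ordinal iM1)).
  have [/andP[_ h1] _ _] := Hzz (Ordinal iM); have [/andP[h2 _] _ _] := Hzz (Ordinal iM1).
  apply: lt_trans h1 (lt_trans _ h2); have := Hr4 (Ordinal iM) (Ordinal iM1) (leqnn _).
  by lra.
- move=> i; rewrite -ltnS => iM Si; rewrite (zE (Ordinal iM)).
  by have [_ h _] := Hzz (Ordinal iM); exact: h.
case=> [|i] iM.
  move=> _; rewrite /= addn0 rho0; have := qL 0; rewrite -/A0 => h.
  have : `|(-1) ^+ M * (q.[0] - p.[0])| <= 2 * A0 * t.
    by rewrite normrM normrX normrN1 expr1n mul1r.
  by rewrite ler_norml mulrBr => /andP[? ?]; lra.
rewrite /= !ltnS; case: (ltnP i M.+1) => iM' /= Si.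
  have := zE (Ordinal iM'); rewrite /= => ->; have [_ _ h] := Hzz (Ordinal iM').
  by apply: h; move: Si; rewrite (_ : (i <= M)%N).
have iE : i = M.+1 by apply/eqP; rewrite eqn_leq iM' andbT -ltnS.
have -> : (if (i <= M)%N then zz (inord i) else Rr) = Rr by rewrite iE ltnn.
have -> : (-1) ^+ (M + i.+1) = 1 :> R by rewrite iE -signr_odd !addnS /= oddD addbb.
by have := qL Rr; rewrite -/AR mul1r ler_norml => /andP[? ?]; lra.
Qed.

End Perturbation.
End Bands.

(** * Powers of a solution of a Pell equation *)

Section Composition.
Variables (F : numFieldType) (q b h T : {poly F}) (m g K d k : nat) (c : F).
Hypotheses (c0 : c != 0) (sq : size q = m.+1) (lq : q`_m = c).
Hypotheses (gm : (g < m)%N) (d0 : (0 < d)%N) (dK : (d * K = 2 * k)%N).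
Hypotheses (sb : size b = (m - g)%N) (lb : b`_(m - g.+1) = c^-1 ^+ d.-1).
Hypotheses (sh : size h = (2 * g).+3) (Km : (K <= m)%N).
Hypothesis E : q ^+ 2 - 4%:R *: 'X^K = b ^+ 2 * h.
Hypothesis T1 : 2%:R * ('X * q^`()) - K%:R * q = b * T.
Hypothesis T2 : 'X * (2%:R * b^`() * h + b * h^`()) - K%:R * b * h = q * T.

Let lh : h`_(2 * g.+1) = c ^+ d ^+ 2.
Proof.
have := congr1 (fun p : {poly F} => p`_(m + m)) E.
rewrite coefB coefZ coefXn (_ : (m + m == K)%N = false) ?mulr0 ?subr0; last by apply/eqP; lia.
rewrite !expr2 (@coefM_top _ q q m m) ?sq // lq.
have -> : (m + m = (m - g.+1) + (m - g.+1) + 2 * g.+1)%N by lia.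
have sb' : (size b <= (m - g.+1).+1)%N by rewrite sb; lia.
have sbb : (size (b * b)%R <= ((m - g.+1) + (m - g.+1)).+1)%N.
  by rewrite (leq_trans (size_polyMleq _ _)) // sb; lia.
rewrite coefM_top ?sh //; last by lia.
rewrite coefM_top // lb; case: d d0 => // d' _ /= H.
have ci : c^-1 ^+ d' * c ^+ d' = 1 by rewrite -exprMn mulVf // expr1n.
have -> : c ^+ d'.+1 * c ^+ d'.+1 = c * c * (c ^+ d' * c ^+ d') by rewrite exprS; ring.
rewrite H -[LHS]mul1r -[1]mul1r -{1}ci -ci; ring.
Qed.

Let z := (q, b).

Let pexp_top j : let a := pexp h z j.+1 in
  [/\ (size a.1 <= (j.+1 * m).+1)%N, (size a.2 <= (j * m + (m - g.+1)).+1)%N,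
   a.1`_(j.+1 * m) = 2 ^+ j * c ^+ j.+1 &
   a.2`_(j * m + (m - g.+1)) = 2 ^+ j * c ^+ j * c^-1 ^+ d.-1].
Proof.
have sb' : (size b <= (m - g.+1).+1)%N by rewrite sb; lia.
elim: j => [|j [s1 s2 l1 l2]].
  rewrite /pexp /= /pmul /= !(mulr0, mulr1, mul0r, addr0, add0r) mul1n mul0n add0n sq.
  by rewrite lq lb !expr0 !expr1 !mul1r.
have sbh : (size (b * h)%R <= ((m - g.+1) + 2 * g.+1).+1)%N.
  by rewrite (leq_trans (size_polyMleq _ _)) // sb sh; lia.
move=> a; rewrite {}/a pexpS [pmul _ _ _]/pmul /=; set A := (pexp h z j.+1).1 in s1 l1 *; set B := (pexp h z j.+1).2 in s2 l2 *.
have e1 : (j.+2 * m = m + j.+1 * m)%N by rewrite mulSn.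
have e2 : (j.+2 * m = (m - g.+1) + (j * m + (m - g.+1)) + 2 * g.+1)%N by rewrite !mulSn; lia.
have e3 : (j.+1 * m + (m - g.+1) = m + (j * m + (m - g.+1)))%N by rewrite mulSn addnA.
have e4 : (j.+1 * m + (m - g.+1) = (m - g.+1) + j.+1 * m)%N by rewrite addnC.
have sbB : (size (b * B)%R <= ((m - g.+1) + (j * m + (m - g.+1))).+1)%N.
  by rewrite (leq_trans (size_polyMleq _ _)) //; move: sb' s2; move: (size b) (size B) => x y; lia.
have ci : c^-1 ^+ d.-1 * c^-1 ^+ d.-1 * c ^+ d ^+ 2 = c ^+ 2.
  case: d d0 => // d' _ /=; have ci : c^-1 ^+ d' * c ^+ d' = 1 by rewrite -exprMn mulVf // expr1n.
  transitivity (c ^+ 2 * (c^-1 ^+ d' * c ^+ d') ^+ 2); last by rewrite ci expr1n mulr1.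
  by rewrite (exprS c d'); ring.
have sz1 (u v : {poly F}) i i' : (size u <= i.+1)%N -> (size v <= i'.+1)%N -> (size (u * v)%R <= (i + i').+1)%N.
  by move=> h1 h2; rewrite (leq_trans (size_polyMleq _ _)) //; move: h1 h2; move: (size u) (size v) => x y; lia.
split.
- rewrite (leq_trans (size_polyD _ _)) // geq_max {1}e1 sz1 ?sq //= e2 sz1 // sh; lia.
- rewrite (leq_trans (size_polyD _ _)) // geq_max {1}e3 sz1 ?sq //= e4 sz1 //.
- rewrite coefD {1}e1 coefM_top ?sq // lq l1 e2 coefM_top ?sh //; last by lia.
  rewrite coefM_top // lb l2 lh !exprS.
  transitivity (2 ^+ j * c ^+ j * (c * c + (c^-1 ^+ d.-1 * c^-1 ^+ d.-1 * c ^+ d ^+ 2)));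
    first by ring.
  by rewrite ci; ring.
rewrite coefD {1}e3 coefM_top ?sq // lq l2 e4 coefM_top // lb l1 !exprS.
by ring.
Qed.

Let ptop : [/\ (size (pexp h z d).1 <= (d * m).+1)%N, (size (pexp h z d).2 <= (d.-1 * m + (m - g.+1)).+1)%N,
   (pexp h z d).1`_(d * m) = 2 ^+ d.-1 * c ^+ d &
   (pexp h z d).2`_(d.-1 * m + (m - g.+1)) = 2 ^+ d.-1 * c ^+ d.-1 * c^-1 ^+ d.-1].
Proof. by have := pexp_top d.-1; cbv zeta; rewrite (prednK d0). Qed.

(** The norm of q + b s is 4 X^K, so its d-th power has norm 4^d X^(2 k). Division by 2^(d-1) gives
    a Pell solution with e = 1, whose [p] is a Dickson polynomial in [q]; the leading coefficient
    c^(1-d) prescribed for [b] makes [sg] monic. *)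
Let r : F := (2 ^+ d.-1)^-1.
Let p := r *: (pexp h z d).1.
Let sg := r *: (pexp h z d).2.
Let tau := (d%:R / 2) *: T.

Let r0 : r != 0. Proof. by rewrite invr_eq0 expf_neq0 // pnatr_eq0. Qed.

Lemma comp_size : size p = (d * m).+1.
Proof.
have [s1 _ l1 _] := ptop; rewrite /p size_scale //.
apply/eqP; rewrite eqn_leq s1 ltnNge; apply/negP => hs; move: l1.
by rewrite nth_default // => /esym/eqP; rewrite mulf_eq0 !expf_eq0 (negPf c0) pnatr_eq0 /= !andbF.
Qed.

Lemma comp_sg : size sg = (d * m - g)%N /\ sg \is monic.
Proof.
have top : sg`_(d.-1 * m + (m - g.+1)) = 1.
  have [_ s2 _ l2] := ptop; rewrite /sg coefZ l2 /r -mulrA -exprMn divff //.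
  by rewrite expr1n mulr1 mulVf // expf_neq0 // pnatr_eq0.
have ss : size sg = (d.-1 * m + (m - g.+1)).+1.
  apply/eqP; rewrite eqn_leq; apply/andP; split.
    by have [_ s2 _ _] := ptop; rewrite /sg size_scale.
  by rewrite ltnNge; apply/negP => hs; move/eqP: top; rewrite nth_default // eq_sym oner_eq0.
split; last by rewrite monicE /lead_coef ss top.
rewrite ss; case: d d0 => // d' _; rewrite mulSn /=; lia.
Qed.

Lemma comp_eq : p ^+ 2 - (4%:R * 1) *: 'X^(2 * k) = sg ^+ 2 * h.
Proof.
have zn : pnorm h z = 4%:R *: 'X^K by rewrite /pnorm /= -E opprB addrC subrK.
have := pnormX h z d; rewrite zn exprZn -exprM mulnC dK /pnorm.
set A := (pexp h z d).1; set B := (pexp h z d).2 => EE.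
have -> : p ^+ 2 = (r ^+ 2) *: (A ^+ 2) by rewrite /p exprZn.
have -> : sg ^+ 2 * h = (r ^+ 2) *: (B ^+ 2 * h) by rewrite /sg exprZn -scalerAl.
have -> : A ^+ 2 = 4 ^+ d *: 'X^(2 * k) + B ^+ 2 * h by rewrite -EE subrK.
rewrite scalerDr scalerA addrAC -[RHS]add0r; congr (_ + _); apply/eqP.
rewrite subr_eq0; apply/eqP; congr (_ *: _).
have r2 : r ^+ 2 = (4 ^+ d.-1)^-1.
  by rewrite /r exprVn -exprM mulnC exprM (_ : 2 ^+ 2 = 4) // -natrX.
have -> : 4 ^+ d = 4 * 4 ^+ d.-1 :> F by rewrite -exprS prednK.
by rewrite r2 mulrCA mulVf // expf_neq0 // pnatr_eq0.
Qed.

Let ddpz : ddp h z = pact h (K%:R, T) z.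
Proof.
rewrite /ddp /pact /=; congr pair.
  by rewrite -[LHS](subrK (K%:R * q)) T1; ring.
by rewrite -[LHS](subrK (K%:R * b * h)) T2; ring.
Qed.

Let ddpw : ddp h (pexp h z d) = (d%:R * (pact h (K%:R, T) (pexp h z d)).1,
  d%:R * (pact h (K%:R, T) (pexp h z d)).2).
Proof. by case: d d0 => // d' _; rewrite ddp_exp ddpz pactA pexpS. Qed.

Lemma comp_tau : 'X * p^`() - k%:R * p = sg * tau.
Proof.
have := congr1 fst ddpw; rewrite /ddp /pact /=.
set A := (pexp h z d).1; set B := (pexp h z d).2 => EE.
have E2 : 2%:R * ('X * A^`() - k%:R * A) = d%:R * (B * T).
  rewrite mulrBr EE mulrDr; have : d%:R * (K%:R * A) = 2%:R * (k%:R * A).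
    by rewrite !mulrA -!natrM dK.
  by move=> ->; rewrite addrAC subrr add0r [T * B]mulrC.
have E3 : 'X * A^`() - k%:R * A = (d%:R / 2) *: (B * T).
  have u2 : (2 : F) != 0 by rewrite pnatr_eq0.
  apply: (scalerI u2); rewrite scalerA mulrCA divff // mulr1.
  by rewrite scaler_nat scaler_nat -[LHS]mulr_natl -[RHS]mulr_natl.
rewrite /p /sg /tau derivZ -!scalerAr -scalerAl -scalerBr E3.
by rewrite !scalerA mulrC.
Qed.

Lemma comp_Lam : Lam h tau d (2 * k)%:R z = (0, 0).
Proof.
have h1 : 2%:R * ('X * q^`()) = K%:R * q + b * T by rewrite -T1; ring.
have h2 : 'X * (2%:R * b^`() * h + b * h^`()) = K%:R * b * h + q * T by rewrite -T2; ring.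
have tE : 2%:R * tau = d%:R * T.
  rewrite /tau mulr_natl -scaler_nat scalerA mulrCA divff ?pnatr_eq0 // mulr1.
  by rewrite scaler_nat mulr_natl.
rewrite /Lam h2 tE -dK [(d * K)%:R]natrM [_.1]/= [_.2]/=.
have h3 : (2 * d)%:R * ('X * q^`()) = d%:R * (K%:R * q + b * T) by rewrite -h1 natrM; ring.
by rewrite h3 polyCM !polyC_natr; congr pair; ring.
Qed.

End Composition.

Section Polar.
Variables (R : realType) (h : {poly R}) (z : {poly R} * {poly R}) (x t r phi : R).
Hypotheses (t2 : t ^+ 2 = - h.[x]) (z1 : z.1.[x] = r * cos phi).
Hypothesis z2 : z.2.[x] * t = r * sin phi.

(** De Moivre's formula: since s^2 = h and t^2 = - h(x), the value of s at x is i t, and z takes the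
    value r e^(i phi). *)
Lemma pexp_polar j : (pexp h z j).1.[x] = r ^+ j * cos (j%:R * phi) /\
  (pexp h z j).2.[x] * t = r ^+ j * sin (j%:R * phi).
Proof.
elim: j => [|j [IH1 IH2]].
  by rewrite /pexp /= hornerC horner0 !mul0r expr0 cos0 sin0 mulr1 mulr0.
have hx : h.[x] = - t ^+ 2 by rewrite t2 opprK.
have a1 : j.+1%:R * phi = phi + j%:R * phi by rewrite -natr1; ring.
rewrite pexpS /pmul /= !hornerE /= hx a1 cosD sinD !exprS z1 IH1; split.
  transitivity (r * cos phi * (r ^+ j * cos (j%:R * phi)) -
    (z.2.[x] * t) * ((pexp h z j).2.[x] * t)); first by ring.
  by rewrite z2 IH2; ring.
transitivity (r * cos phi * ((pexp h z j).2.[x] * t) +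
  (z.2.[x] * t) * (r ^+ j * cos (j%:R * phi))); first by ring.
by rewrite z2 IH2; ring.
Qed.

End Polar.

Lemma pexp_node (F : numFieldType) (h : {poly F}) z x j : z.2.[x] = 0 ->
  (pexp h z j).1.[x] = z.1.[x] ^+ j /\ (pexp h z j).2.[x] = 0.
Proof.
move=> z2; elim: j => [|j [IH1 IH2]]; first by rewrite /pexp /= hornerC horner0 expr0.
by rewrite pexpS /pmul /= !hornerE /= z2 IH1 IH2 !mul0r !mulr0 !addr0 exprS.
Qed.

(** * Elementary real analysis *)

Section RealLemmas.
Variable R : realType.
Implicit Types (f : R -> R) (a b x y : R).

Lemma first_zero f l u : continuous f -> l <= u -> f l < 0 -> 0 <= f u ->
  exists b, [/\ l < b <= u, f b = 0 & forall x, l <= x < b -> f x < 0].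
Proof.
move=> cf lu fl fu; pose E := [set x | l <= x <= u /\ 0 <= f x].
have Eu : E u by split=> //; rewrite lu lexx.
have lbE : lbound E l by move=> x [/andP[]].
have hl : has_lbound E by exists l.
have hi : has_inf E by split; [exists u|].
have inf_le x : E x -> inf E <= x by move=> Ex; exact: ge_inf.
have lb : l <= inf E by apply: lb_le_inf => //; exists u.
have neg x : l <= x < inf E -> f x < 0.
  move=> /andP[h1 h2]; rewrite ltNge; apply/negP => fx.
  have := inf_le x; rewrite leNgt h2 => H; have : false; last by [].
  by apply: H; split=> //; rewrite h1 (le_trans (ltW h2)) // inf_le.
have cN : continuous (fun x => - f x) by move=> x; apply: cvgN; exact: cf.
have f_ge : 0 <= f (inf E).
  rewrite leNgt; apply/negP => fb.
  have [r [r0 Hr]] := filter_ex (filterI (nbhs_right_gt (0 : R)) (near_radius cf fb)).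
  have [e [h1 h2] h3] := inf_adherent r0 hi.
  have := Hr e; rewrite in_itv /= (ltW h3) (le_trans _ (inf_le e _)) ?lerBlDr ?lerDl ?ltW // => /(_ isT).
  by rewrite ltNge h2.
have lb' : l < inf E by rewrite lt_neqAle lb andbT; apply: contraTneq fl => ->; rewrite -leNgt.
exists (inf E); split=> //; first by rewrite lb' inf_le.
apply/eqP; rewrite eq_le f_ge andbT leNgt; apply/negP => fb.
have fb' : - f (inf E) < 0 by rewrite oppr_lt0.
have lE : 0 < inf E - l by rewrite subr_gt0.
have [r [r0 [Hr r1]]] := filter_ex (filterI (nbhs_right_gt (0 : R))
  (filterI (near_radius cN fb') (nbhs_right_lt lE))).
have := Hr (inf E - r); rewrite itv_ends ?ltW //; last by left.
move=> /(_ isT); rewrite oppr_lt0 ltNge => /negP; apply; apply/ltW/neg.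
by rewrite gtrBl r0 andbT lerBrDl addrC -lerBrDl ltW.
Qed.

(** Here b is the first zero of [g], and a the last zero of [f] before b, found by running
    [first_zero] backwards. *)
Lemma crossing (f g : R -> R) l u : continuous f -> continuous g -> l <= u ->
  (forall x, l <= x -> g x < f x) -> f l < 0 -> 0 <= g u ->
  exists a b, [/\ l <= a, a < b <= u, f a = 0, g b = 0 &
    forall x, a < x < b -> 0 < f x /\ g x < 0].
Proof.
move=> cf cg lu gf fl gu; have gl : g l < 0 by exact: lt_trans (gf l (lexx l)) fl.
have [b [/andP[lb bu] gb Hb]] := first_zero cg lu gl gu.
have cf' : continuous (fun x => - f (- x)).
  move=> x; apply: cvgN; apply: continuous_comp; [exact: opp_continuous|exact: cf].
have [|||a [/andP[a1 a2] fa Ha]] := @first_zero (fun x => - f (- x)) (- b) (- l) cf'.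
- by rewrite lerN2 ltW.
- by rewrite opprK oppr_lt0 -gb gf // ltW.
- by rewrite opprK oppr_ge0 ltW.
have al : l <= - a by rewrite lerNr.
have ab : - a < b by rewrite ltrNl.
exists (- a), b; split=> //.
- by rewrite ab.
- by apply/eqP; rewrite -oppr_eq0 fa.
move=> x /andP[ax xb]; split; last by apply: Hb; rewrite xb andbT (le_trans al) // ltW.
by have := Ha (- x); rewrite opprK oppr_lt0; apply; rewrite lerN2 ltrNl ax ltW.
Qed.

(* unlike acos, continuous on the whole line *)
Definition acos_clamp y : R := acos (Num.max (-1) (Num.min 1 y)).

Lemma clampP y : Num.max (-1) (Num.min 1 y) \in `[-1, 1].
Proof.
rewrite in_itv /= le_max lexx /= ge_max ge_min lexx /= andbT.
by rewrite -subr_ge0 opprK addr_ge0.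
Qed.

Lemma acos_clamp_pi y : acos_clamp y \in `[0, pi].
Proof.
have := clampP y; rewrite !in_itv /= => h.
by rewrite acos_ge0 // acos_lepi.
Qed.

Lemma cos_acos_clamp y : -1 <= y <= 1 -> cos (acos_clamp y) = y.
Proof.
move=> /andP[h1 h2]; rewrite /acos_clamp acosK ?clampP //.
by rewrite (min_idPr h2) (max_idPr h1).
Qed.

Lemma acos_clamp_lt y al : 0 < al <= pi -> cos al < y -> acos_clamp y < al.
Proof.
move=> /andP[a0 ap] h; have ai : al \in `[0, pi] by rewrite in_itv /= ap ltW.
rewrite -(ltr_cos (acos_clamp_pi y) ai) acosK ?clampP // lt_max lt_min h andbT.
by rewrite -cos0 ltr_cos ?a0 ?orbT // in_itv /= lexx pi_ge0.
Qed.

Lemma acos_clamp_gt y al : 0 <= al < pi -> y < cos al -> al < acos_clamp y.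
Proof.
move=> /andP[a0 ap] h; have ai : al \in `[0, pi] by rewrite in_itv /= a0 ltW.
rewrite -(ltr_cos ai (acos_clamp_pi y)) acosK ?clampP // gt_max gt_min h orbT andbT.
by rewrite -cospi ltr_cos // in_itv /= lexx pi_ge0.
Qed.

Lemma continuous_acos_clamp : continuous acos_clamp.
Proof.
move=> y; have := acos_clamp_pi y; rewrite in_itv /= => /andP[t0 tp].
have yi := acos_clamp_pi y; have cE : cos (acos_clamp y) = Num.max (-1) (Num.min 1 y).
  by rewrite /acos_clamp acosK ?clampP.
apply/cvgrPdist_lt => e e0.
have N1 : \forall y' \near y, (0 <= acos_clamp y - e -> y' < cos (acos_clamp y - e)).
  have [h|h] := boolP (0 <= acos_clamp y - e); last by near=> y'.
  have hi : acos_clamp y - e \in `[0, pi] by rewrite in_itv /= h lerBlDr (le_trans tp) // lerDl ltW.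
  have : cos (acos_clamp y) < cos (acos_clamp y - e) by rewrite ltr_cos // gtrBl.
  rewrite cE gt_max gt_min => /andP[_ /orP[|yc]]; first by rewrite ltNge cos_le1.
  by near=> y' => _; near: y'; exact: lt_nbhsl.
have N2 : \forall y' \near y, (acos_clamp y + e <= pi -> cos (acos_clamp y + e) < y').
  have [h|h] := boolP (acos_clamp y + e <= pi); last by near=> y'.
  have hi : acos_clamp y + e \in `[0, pi] by rewrite in_itv /= h andbT addr_ge0 // ltW.
  have : cos (acos_clamp y + e) < cos (acos_clamp y) by rewrite ltr_cos // ltrDl.
  rewrite cE lt_max lt_min => /orP[|/andP[_ yc]]; first by rewrite ltNge cos_geN1.
  by near=> y' => _; near: y'; exact: lt_nbhsr.
near=> y'; have := acos_clamp_pi y'; rewrite in_itv /= => /andP[h1 h2].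
rewrite distrC ltr_norml; apply/andP; split.
  rewrite ltrBrDl; have [h|h] := ltP (acos_clamp y - e) 0; first exact: lt_le_trans h1.
  have hp : acos_clamp y - e < pi by rewrite (lt_le_trans _ tp) // gtrBl.
  apply: acos_clamp_gt; first by rewrite h.
  by move: h; near: y'.
rewrite ltrBlDl; have [h|h] := ltP pi (acos_clamp y + e); first exact: le_lt_trans h.
apply: acos_clamp_lt; first by rewrite h andbT ltr_wpDl.
by move: h; near: y'.
Unshelve. all: by end_near. Qed.

(* f takes its values in a finite set *)
Lemma const_of_roots f (P : {poly R}) a b : a <= b -> {within `[a, b], continuous f} ->
  P != 0 -> (forall x, a <= x <= b -> P.[f x] = 0) -> f a = f b.
Proof.
move=> ab cf P0 H.
have gap v w : v < w -> exists c, v < c < w /\ P.[c] != 0.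
  move=> vw; have vw' : 0 < w - v by rewrite subr_gt0.
  have [r [r0 [[r1 _] r2]]] := filter_ex (filterI (nbhs_right_gt (0 : R))
    (filterI (near_horner_neq0 v P0) (nbhs_right_lt vw'))).
  by exists (v + r); rewrite ltrDl r0 -ltrBrDl.
have fin c : Num.min (f a) (f b) <= c <= Num.max (f a) (f b) -> P.[c] = 0.
  by move=> /(IVT ab cf)[x]; rewrite in_itv /= => /H Px <-.
case: (ltgtP (f a) (f b)) => // /gap[c [/andP[h1 h2]]]; rewrite fin ?eqxx // ge_min le_max.
  by rewrite (ltW h1) (ltW h2) orbT.
by rewrite (ltW h1) (ltW h2) orbT.
Qed.

Lemma sin_pi_div (d e : nat) : (0 < e)%N -> sin (d%:R * (pi / e%:R) : R) = 0 -> (e %| d)%N.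
Proof.
move=> e0; rewrite {1}(divn_eq d e) natrD natrM.
have en : e%:R != 0 :> R by rewrite pnatr_eq0 -lt0n.
have -> : ((d %/ e)%:R * e%:R + (d %% e)%:R) * (pi / e%:R) = (d %% e)%:R * (pi / e%:R) + pi *+ (d %/ e) :> R.
  by rewrite -[pi *+ _]mulr_natl; field.
rewrite (alternatingn (@sinDpi R)) => /eqP; rewrite mulf_eq0 signr_eq0 /= => /eqP s0.
rewrite /dvdn; apply: contraT; rewrite -lt0n => r0.
have : 0 < sin ((d %% e)%:R * (pi / e%:R) : R).
  apply: sin_gt0_pi; rewrite mulr_gt0 ?ltr0n ?divr_gt0 ?pi_gt0 ?ltr0n //=.
  by rewrite mulrCA gtr_pMr ?pi_gt0 // ltr_pdivrMr ?ltr0n // mul1r ltr_nat ltn_mod.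
by rewrite s0 ltxx.
Qed.

Lemma polar_ex (c s r : R) : 0 < r -> c ^+ 2 + s ^+ 2 = r ^+ 2 ->
  exists phi, c = r * cos phi /\ s = r * sin phi.
Proof.
move=> r0 E; have rn : r != 0 by rewrite gt_eqF.
have cb : -1 <= c / r <= 1.
  rewrite -ler_norml -(ler_sqr (normr_ge0 _)) ?nnegrE // expr1n real_normK ?num_real //.
  by rewrite expr_div_n ler_pdivrMr ?exprn_gt0 // mul1r -E lerDl sqr_ge0.
have sE : r * sin (acos (c / r)) = `|s|.
  rewrite sin_acos // -{1}(gtr0_norm r0) -sqrtr_sqr -sqrtrM ?sqr_ge0 // -[RHS]sqrtr_sqr.
  congr Num.sqrt; have -> : s ^+ 2 = r ^+ 2 - c ^+ 2 by rewrite -E addrAC subrr add0r.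
  by field.
have cE : r * cos (acos (c / r)) = c by rewrite acosK // mulrC divfK.
have [s0|s0] := leP 0 s; first by exists (acos (c / r)); rewrite cE sE ger0_norm.
by exists (- acos (c / r)); rewrite cosN sinN mulrN cE sE ltr0_norm ?opprK.
Qed.

End RealLemmas.

(** * Real examples *)

Lemma sqr_prod_dvdp (F : fieldType) (s : seq F) (D : {poly F}) : uniq s ->
  (forall x, x \in s -> ('X - x%:P) ^+ 2 %| D) -> (\prod_(x <- s) ('X - x%:P)) ^+ 2 %| D.
Proof.
elim: s => [|x s IH] /=; first by rewrite big_nil expr1n dvd1p.
move=> /andP[xs us] H; rewrite big_cons exprMn Gauss_dvdp; last first.
  by rewrite coprimep_pexpl // coprimep_sym coprimep_pexpl // coprimep_XsubC root_prod_XsubC.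
rewrite H ?mem_head // IH // => y ys; apply: H.
by rewrite in_cons ys orbT.
Qed.

Fact card_good_arith M g n X : (g <= M.+1)%N -> (M.+1 - g + X = M.+2 + n)%N -> X = (n + g.+1)%N.
Proof. lia. Qed.

Fact size_split_arith M g n : (g <= M.+1)%N -> (M.+2 <= n)%N ->
  (n - g + (2 * g).+3).-1 = (n + g.+1).+1.
Proof. lia. Qed.

Lemma count_parity d (par : bool) : odd d ->
  (\sum_(0 <= j < d.+1 | (0 < j < d) && (odd j == par)) 1 = d./2)%N.
Proof.
move=> od; rewrite -[in LHS](odd_double_half d) od add1n; move: (d./2) => e {od}.
rewrite big_mkcond big_nat_recl //= big_nat_recr //= ltnn add0n addn0.
rewrite big_nat (eq_bigr (fun j => (odd j != par) : nat)) -?big_nat; last first.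
  by move=> j /andP[_ je]; rewrite ltnS je; case: (odd j); case: par.
elim: e => [|e IH]; first by rewrite big_geq.
rewrite doubleS !big_nat_recr //= IH odd_double; case: (par) => //=; lia.
Qed.

Fact size_rs_arith M g n X : (g <= M.+1)%N -> (X + M.+2 = n)%N ->
  (X + (M.+1 - g) = (n - g).-1)%N.
Proof. lia. Qed.

Lemma count_enum (T : finType) (A P Q : pred T) : (forall x, A x -> Q x = P x) ->
  count Q (enum A) = #|[pred x | A x & P x]|.
Proof.
move=> H; rewrite -sum1_count big_enum_cond /= -sum1_card; apply: eq_bigl => x.
rewrite !inE; case Ax : (x \in A); move: (Ax); rewrite unfold_in => -> //=.
by rewrite H.
Qed.

Lemma pnorm_horner (F : numFieldType) (h : {poly F}) z x :
  (pnorm h z).[x] = z.1.[x] ^+ 2 - z.2.[x] ^+ 2 * h.[x].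
Proof. by rewrite /pnorm !hornerE. Qed.

Lemma pell_eq_at (F : numFieldType) n k g (p : {poly F}) e sg h tau x :
  pell n k g p e sg h tau ->
  p.[x] ^+ 2 - 4%:R * e * x ^+ (2 * k) = sg.[x] ^+ 2 * h.[x].
Proof. by move=> H; have := congr1 (fun P => P.[x]) (pell_eq H); rewrite !hornerE. Qed.

(** With zero residual, [Lam_power] makes z^d (p - sg s) a multiple of X^(2 k); multiply by p + sg s
    and cancel X^(2 k). *)
Lemma Lam_root_power (F : numFieldType) n k g (p : {poly F}) e sg h tau a d z :
  pell n k g p e sg h tau -> a != 0 -> root h a -> (0 < d)%N ->
  Lam h tau d (2 * k)%:R z = (0, 0) -> exists mu, pexp h z d = (mu *: p, mu *: sg).
Proof.
move=> H a0 ha d0 LZ; set W := pexp h z d.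
have pz w : pact h (0, 0) w = (0, 0) by rewrite /pact /= !mul0r !addr0.
have := Lam_power H z d0; cbv zeta; rewrite LZ pz [(0, 0).1]/= [(0, 0).2]/= !addr0 -/W.
case EE : (pmul h W (p, - sg)) => [E1 E2] [e1 e2]; rewrite [_.1]/= in e1; rewrite [_.2]/= in e2.
have E20 : E2 = 0.
  by apply: (@odd_part_zero _ h E2 (2 * k) a) => //; [exact: pell_h_neq0 H|rewrite e2 mulnA].
have /deriv_monomial E1' : 'X * E1^`() = (2 * k)%:R * E1.
  have u2 : (2 : {poly F}) != 0 by rewrite -polyC_natr polyC_eq0 pnatr_eq0.
  by apply: (mulfI u2); rewrite e1 mulrA -natrM mulnA.
have wn : pmul h (p, - sg) (p, sg) = ((4%:R * e) *: 'X^(2 * k), 0).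
  rewrite /pmul /=; congr pair; last by ring.
  have -> : p * p + - sg * sg * h = p ^+ 2 - sg ^+ 2 * h by ring.
  by rewrite -(pell_eq H) opprB addrC subrK.
have := pmulA h W (p, - sg) (p, sg); rewrite wn EE E20 /pmul /= !(mul0r, mulr0, addr0, add0r) => -[f1 f2].
have e40 : 4%:R * e != 0 by rewrite mulf_neq0 ?pnatr_eq0 // (pell_e H).
have X0 : (4%:R * e) *: 'X^(2 * k) != 0 :> {poly F}.
  by rewrite scaler_eq0 negb_or e40 -size_poly_eq0 size_polyXn.
exists (E1`_(2 * k) / (4%:R * e)); rewrite [LHS]surjective_pairing; congr pair; apply: (mulIf X0);
  [rewrite f1|rewrite f2]; by rewrite E1' coefZ coefXn eqxx mulr1 -!scalerAl -!scalerAr scalerA divfK // mulrC.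
Qed.

Section RealExample.
Variables (R : realType) (M K d k g : nat) (S : pred nat).
Hypotheses (KM : (K <= M.+2)%N) (d0 : (0 < d)%N) (dK : (d * K = 2 * k)%N).
Hypotheses (g0 : (0 < g)%N) (gM : (g <= M.+1)%N).
Hypothesis cS : #|[pred i : 'I_M.+1 | S i]| = (M.+1 - g)%N.
Local Notation rho x := (Num.sqrt x ^+ K).
Local Notation n := (d * M.+2)%N.
Variables (q : {poly R}) (z : nat -> R).
Hypotheses (sq : size q = M.+3) (lq : 0 < lead_coef q) (z0 : z 0%N = 0).
Hypothesis zlt : forall i, (i < M.+2)%N -> z i < z i.+1.
Hypothesis zS : forall i, (i <= M)%N -> S i ->
  (-1) ^+ (M + i.+1) * q.[z i.+1] = 2 * rho (z i.+1) /\
  ('X - (z i.+1)%:P) ^+ 2 %| q ^+ 2 - 4%:R *: 'X^K.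
Hypothesis zN : forall i, (i <= M.+2)%N -> ~~ [&& (0 < i)%N, (i <= M.+1)%N & S i.-1] ->
  2 * rho (z i) < (-1) ^+ (M + i) * q.[z i].

Let c := lead_coef q.
Let c0 : c != 0. Proof. by rewrite gt_eqF. Qed.

Let zlt2 i j : (i < j)%N -> (j <= M.+2)%N -> z i < z j.
Proof.
elim: j => // j IH; rewrite ltnS leq_eqVlt => /orP[/eqP ->|ij] jM; first exact: zlt.
by apply: lt_trans (IH ij (ltnW jM)) _; exact: zlt.
Qed.

Let zpos i : (i < M.+2)%N -> 0 < z i.+1.
Proof. by move=> iM; rewrite -z0; apply: zlt2. Qed.

Let zinj i j : (i <= M.+2)%N -> (j <= M.+2)%N -> z i = z j -> i = j.
Proof.
move=> iM jM E; case: (ltngtP i j) => // h; first by have := zlt2 h jM; rewrite E ltxx.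
by have := zlt2 h iM; rewrite E ltxx.
Qed.

Let rho_gt0 (x : R) : 0 < x -> 0 < rho x.
Proof. by move=> x0; rewrite exprn_gt0 ?sqrtr_gt0. Qed.

Let Dl := q ^+ 2 - 4%:R *: 'X^K.
Let DlE x : Dl.[x] = q.[x] ^+ 2 - 4 * x ^+ K.
Proof. by rewrite /Dl !hornerE. Qed.

Let zs : seq R := [seq z (i : 'I_M.+1).+1 | i <- enum [pred i : 'I_M.+1 | S i]].

Let zsP x : reflect (exists i : 'I_M.+1, S i /\ x = z i.+1) (x \in zs).
Proof.
apply: (iffP mapP); first by case=> i; rewrite mem_enum => Si ->; exists i.
by case=> i [Si ->]; exists i; rewrite ?mem_enum.
Qed.

Let size_zs : size zs = (M.+1 - g)%N.
Proof. by rewrite size_map -cardE cS. Qed.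

Let zs_uniq : uniq zs.
Proof.
rewrite map_inj_in_uniq ?enum_uniq // => i j _ _ /zinj E; apply/val_inj.
by apply: succn_inj; apply: E; rewrite ltnW // ltnS ltn_ord.
Qed.

Let zs_touch x : x \in zs -> [/\ 0 < x, q.[x] ^+ 2 = 4 * x ^+ K & ('X - x%:P) ^+ 2 %| Dl].
Proof.
move=> /zsP[i [Si ->]]; have iM : (i <= M)%N by rewrite -ltnS.
have [h1 h2] := zS iM Si; have x0 : 0 < z i.+1 by apply: zpos; rewrite ltnS ltnW.
split=> //; have : ((-1) ^+ (M + i.+1) * q.[z i.+1]) ^+ 2 = q.[z i.+1] ^+ 2.
  by rewrite exprMn [(_ ^+ _) ^+ 2]expr2 signr_sqr mul1r.
by move=> <-; rewrite h1 exprMn rho_sqr ?(ltW x0) // -natrX.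
Qed.

Let sg0 := \prod_(x <- zs) ('X - x%:P).

Let size_sg0 : size sg0 = (M.+2 - g)%N.
Proof. by rewrite size_prod_XsubC size_zs [RHS]subSn. Qed.

Let sg0_monic : sg0 \is monic. Proof. exact: monic_prod_XsubC. Qed.

Let beta := c^-1 ^+ d.-1.
Let beta0 : 0 < beta. Proof. by rewrite exprn_gt0 // invr_gt0. Qed.
Let b := beta *: sg0.
Let h := (beta ^- 2) *: (Dl %/ sg0 ^+ 2).

Let bh : Dl = b ^+ 2 * h.
Proof.
have /divpK E : sg0 ^+ 2 %| Dl by apply: sqr_prod_dvdp zs_uniq _ => x /zs_touch[].
rewrite /b /h exprZn -scalerAl -scalerAr scalerA divff ?scale1r; last first.
  by rewrite expf_neq0 // gt_eqF.
by rewrite mulrC E.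
Qed.

Let size_Dl : size Dl = (2 * M.+2).+1.
Proof.
have sq2 : size (q ^+ 2) = (2 * M.+2).+1.
  by have := size_exp q 2; rewrite sq /=; case: (size (q ^+ 2)) (size_poly_gt0 (q ^+ 2)) => [|x];
    [rewrite ltnn expf_neq0 // -size_poly_gt0 sq|move=> _ /= ->; rewrite mulnC].
rewrite /Dl size_polyDl sq2 // size_polyN size_scale ?pnatr_eq0 // size_polyXn.
by have := KM; lia.
Qed.

Let b0 : b != 0.
Proof. by rewrite scaler_eq0 negb_or gt_eqF //= monic_neq0. Qed.

Let size_b : size b = (M.+2 - g)%N.
Proof. by rewrite size_scale ?size_sg0 // gt_eqF. Qed.

Let lead_b : b`_(M.+2 - g.+1) = c^-1 ^+ d.-1.
Proof.
rewrite coefZ -/beta; move: sg0_monic; rewrite monicE /lead_coef size_sg0.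
by rewrite subnS => /eqP ->; rewrite mulr1.
Qed.

Let Dl0 : Dl != 0. Proof. by rewrite -size_poly_gt0 size_Dl. Qed.

Let size_h : size h = (2 * g).+3.
Proof.
have h0 : h != 0 by apply: contraNneq Dl0; rewrite bh => ->; rewrite mulr0.
have := size_Dl; rewrite bh expr2 !size_mul ?mulf_neq0 // size_b.
by have := gM; move: (size h) => x; lia.
Qed.

Let bq : coprimep b q.
Proof.
rewrite coprimepZl ?gt_eqF // coprimep_sym /sg0 big_seq.
apply: (big_ind (fun x => coprimep q x)) => [|x y hx hy|x /zs_touch[x0 qx _]].
- exact: coprimep1.
- by rewrite coprimepMr hx.
rewrite coprimep_XsubC; apply/negP => /eqP q0.
by move/eqP: qx; rewrite q0 expr0n /= eq_sym mulf_eq0 pnatr_eq0 /= expf_eq0 gt_eqF ?andbF.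
Qed.

Let T_ex : exists T, 2%:R * ('X * q^`()) - K%:R * q = b * T /\
  'X * (2%:R * b^`() * h + b * h^`()) - K%:R * b * h = q * T.
Proof.
have E : b * ('X * (2%:R * b^`() * h + b * h^`()) - K%:R * b * h) =
    q * (2%:R * ('X * q^`()) - K%:R * q).
  have -> : b * ('X * (2%:R * b^`() * h + b * h^`()) - K%:R * b * h) =
      'X * (b ^+ 2 * h)^`() - K%:R * (b ^+ 2 * h) by rewrite !expr2 !derivM; ring.
  rewrite -bh /Dl derivB derivZ derivXn expr2 derivM.
  have XK : 'X * ('X^(K.-1) *+ K) = K%:R * 'X^K :> {poly R}.
    by case: (K) => [|K']; rewrite ?mulr0n ?mulr0 ?mul0r // mulr_natl mulrnAr -exprS.
  transitivity ('X * (q^`() * q + q * q^`()) - K%:R * (q * q) -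
    4 *: ('X * ('X^(K.-1) *+ K) - K%:R * 'X^K)); last by rewrite XK subrr scaler0 subr0; ring.
  by rewrite -!mul_polyC; ring.
have /dvdpP[T ET] : b %| 2%:R * ('X * q^`()) - K%:R * q.
  by rewrite -(Gauss_dvdpr _ bq) -E dvdp_mulr.
exists T; rewrite [b * T]mulrC; split=> //.
by apply: (mulfI b0); rewrite E ET; ring.
Qed.

Let th (j : nat) : R := j%:R * (pi / d%:R).
Let d0R : 0 < d%:R :> R. Proof. by rewrite ltr0n. Qed.
Let dth j : d%:R * th j = pi *+ j.
Proof. by rewrite /th mulrCA [d%:R * _]mulrC divfK ?gt_eqF // mulr_natl. Qed.
Let th_pi j : (j <= d)%N -> th j \in `[0, pi].
Proof.
move=> jd; rewrite in_itv /= mulr_ge0 ?divr_ge0 ?pi_ge0 //= /th.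
by rewrite mulrCA ler_piMr ?pi_ge0 // ler_pdivrMr // mul1r ler_nat.
Qed.
Let thd : th d = pi. Proof. by rewrite /th mulrC divfK // gt_eqF. Qed.

Let cth_inj i j : (i <= d)%N -> (j <= d)%N -> cos (th i) = cos (th j) -> i = j.
Proof.
move=> id jd /(cos_inj (th_pi id) (th_pi jd)) /eqP; rewrite /th.
rewrite (inj_eq (mulIf _)); last by rewrite mulf_neq0 ?invr_eq0 ?gt_eqF ?pi_gt0.
by rewrite eqr_nat => /eqP.
Qed.

(** The index of the angle, 0 or pi, whose cosine is the sign of [q] at [z i]. *)
Let lidx i := if odd (M + i) then d else 0%N.
Let lidxE i : cos (th (lidx i)) = (-1) ^+ (M + i).
Proof.
rewrite /lidx -signr_odd; case: ifP => _; first by rewrite thd cospi expr1.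
by rewrite /th mul0r cos0 expr0.
Qed.

(** A contact point [z i] is the right end of one interval and the left end of the next one; this
    excludes its second occurrence. *)
Let bad i j := [&& (0 < i)%N, S i.-1 & j == lidx i].

(** Between consecutive points [z i] the graph of [q] crosses from one of the curves of height 2 rho
    and - 2 rho to the other, so every intermediate height 2 rho cos (th j) is attained. A solution
    at the left end would make the pair bad. *)
Let xi_ex i j : (i < M.+2)%N -> (j <= d)%N -> ~~ bad i j ->
  exists x, z i < x <= z i.+1 /\ q.[x] = 2 * rho x * cos (th j).
Proof.
move=> iM jd nb; pose f x := q.[x] - 2 * rho x * cos (th j).
have cf : continuous f.
  move=> x; apply: cvgB; first exact: continuous_horner.
  by do 2?(apply: cvgM; last exact: cvg_cst) => //; apply: cvgM; [exact: cvg_cst|exact: continuous_rho].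
have ge i' : (i' <= M.+2)%N -> 2 * rho (z i') <= (-1) ^+ (M + i') * q.[z i'].
  move=> hi; case: (boolP [&& (0 < i')%N, (i' <= M.+1)%N & S i'.-1]); last first.
    by move=> /(zN hi)/ltW.
  case: i' hi => // i' hi /= /andP[i'M Si].
  by have [-> _] := zS (i'M : (i' <= M)%N) Si.
have g1 := ge i (ltnW iM); have g2 := ge i.+1 iM.
have r1 := rho_ge0 K (z i); have r2 := rho_ge0 K (z i.+1).
have c1 := cos_geN1 (th j); have c2 := cos_le1 (th j).
have b1 y : 0 <= rho y -> - (2 * rho y) <= 2 * rho y * cos (th j) <= 2 * rho y.
  move=> y0; rewrite -[X in X <= _]mulr1 -[X in _ && (_ <= X)]mulr1 mulNr -mulrN.
  by rewrite !ler_wpM2l // mulr_ge0.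
have /andP[b2 b3] := b1 _ r1; have /andP[b4 b5] := b1 _ r2.
have := IVT (ltW (zlt iM)) (continuous_subspaceT cf) (_ : Num.min (f (z i)) (f (z i.+1)) <= 0 <= Num.max (f (z i)) (f (z i.+1))).
case.
  rewrite ge_min le_max; move: g1 g2; rewrite addnS exprS mulN1r mulNr /f.
  move: b2 b3 b4 b5; rewrite -signr_odd.
  case: (odd (M + i)); rewrite /= ?expr0 ?expr1 ?mulN1r ?mul1r => ? ? ? ? ? ?;
    by apply/andP; split; apply/orP; by [left; lra|right; lra].
move=> x; rewrite in_itv /= => /andP[x1 x2] /eqP; rewrite subr_eq0 => /eqP fx.
exists x; split=> //; rewrite x2 andbT lt_neqAle x1 andbT; apply/eqP => xz.
rewrite -xz in fx; case: (boolP [&& (0 < i)%N, (i <= M.+1)%N & S i.-1]); last first.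
  move=> /(zN (ltnW iM)); rewrite fx; move: b2 b3; rewrite -signr_odd.
  by case: (odd _); rewrite /= ?expr0 ?expr1 ?mulN1r ?mul1r => *; lra.
case: i iM nb x1 x2 fx {g1 g2 r1 r2 b2 b3 b4 b5} xz => // i iM nb x1 x2 fx xz /= /andP[iM' Si].
have [h1 _] := zS (iM' : (i <= M)%N) Si.
have rz := rho_gt0 (zpos (ltnW iM)); move: h1; rewrite fx mulrCA -{2}[2 * _]mulr1.
have nz : 2 * rho (z i.+1) != 0 by rewrite gt_eqF // mulr_gt0.
move=> /(mulfI nz) E; move: nb; rewrite /bad /= Si /=; case/eqP; apply: cth_inj => //.
  by rewrite /lidx; case: ifP.
by rewrite lidxE -[LHS]mul1r -[in LHS](signr_sqr R (M + i.+1)) -mulrA E mulr1.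
Qed.

Let bad' (ij : 'I_M.+2 * 'I_d.+1) := bad ij.1 ij.2.

Let xi_sig : exists xi : 'I_M.+2 * 'I_d.+1 -> R, forall ij, ~~ bad' ij ->
  z ij.1 < xi ij <= z ij.1.+1 /\ q.[xi ij] = 2 * rho (xi ij) * cos (th ij.2).
Proof.
suff /choice[xi H] : forall ij : 'I_M.+2 * 'I_d.+1, exists x, ~~ bad' ij ->
    z ij.1 < x <= z ij.1.+1 /\ q.[x] = 2 * rho x * cos (th ij.2) by exists xi.
move=> [i j].
case: (boolP (bad' (i, j))) => [_|nb]; first by exists 0.
by have [x Hx] := xi_ex (ltn_ord i) (ltn_ord j : (j <= d)%N) nb; exists x.
Qed.

Hypothesis lastS : ~~ S M.

Let example := exists (p sg h tau : {poly R}) (zz : {poly R} * {poly R}), [/\ pell n k g p 1 sg h tau,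
    separable_poly (sg * h) /\ p.[0] ^+ 2 - 4 * 0 ^+ (2 * k) != 0,
    [/\ size zz.1 = M.+3, (size zz.2 <= M.+2 - g)%N & Lam h tau d (2 * k)%:R zz = (0, 0)],
    (forall d' z', (0 < d')%N -> (z'.1 != 0) || (z'.2 != 0) ->
      Lam h tau d' (2 * k)%:R z' = (0, 0) -> (d' %| d)%N) &
    odd d -> exists u v : {poly R}, [/\ sg = u * v, u \is monic /\ v \is monic,
      u %| p - 2%:R *: 'X^k /\ v %| p + 2%:R *: 'X^k,
      size u = (M.+2 * d./2 + #|[pred i : 'I_M.+1 | S i & ~~ odd (M + i.+1)]|).+1 &
      size v = (M.+2 * d./2 + #|[pred i : 'I_M.+1 | S i & odd (M + i.+1)]|).+1]].

(** * The Pell solution obtained from [q] by a Dickson polynomial *)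

Section Composite.
Variables (T : {poly R}) (xi : 'I_M.+2 * 'I_d.+1 -> R).
Hypothesis T1 : 2%:R * ('X * q^`()) - K%:R * q = b * T.
Hypothesis T2 : 'X * (2%:R * b^`() * h + b * h^`()) - K%:R * b * h = q * T.
Hypothesis Hxi : forall ij, ~~ bad' ij ->
  z ij.1 < xi ij <= z ij.1.+1 /\ q.[xi ij] = 2 * rho (xi ij) * cos (th ij.2).

Let r : R := (2 ^+ d.-1)^-1.
Let p := r *: (pexp h (q, b) d).1.
Let sg := r *: (pexp h (q, b) d).2.
Let tau := (d%:R / 2) *: T.

Let lq' : q`_M.+2 = c. Proof. by rewrite /c /lead_coef sq. Qed.
Let gm : (g < M.+2)%N. Proof. by rewrite ltnS. Qed.

Let size_p : size p = n.+1.
Proof. exact: (comp_size c0 sq lq' gm d0 dK size_b lead_b size_h KM bh). Qed.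

Let sgP : size sg = (n - g)%N /\ sg \is monic.
Proof. exact: (comp_sg c0 sq lq' gm d0 dK size_b lead_b size_h KM bh). Qed.

Let pE : p ^+ 2 - (4%:R * 1) *: 'X^(2 * k) = sg ^+ 2 * h.
Proof. exact: (comp_eq d0 dK bh). Qed.

Let tauE : 'X * p^`() - k%:R * p = sg * tau.
Proof. exact: (comp_tau d0 dK T1 T2). Qed.

Let LamE0 : Lam h tau d (2 * k)%:R (q, b) = (0, 0).
Proof. exact: (comp_Lam dK T1 T2). Qed.

Let rho_d (x : R) : 0 < x -> rho x ^+ d = x ^+ k.
Proof.
by move=> x0; rewrite -exprM mulnC dK exprM sqr_sqrtr // ltW.
Qed.

Let r2 (x : R) : r * (2 * x) ^+ d = 2 * x ^+ d.
Proof.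
rewrite exprMn mulrA; congr (_ * _); rewrite /r -[in LHS](prednK d0) exprS /= mulrCA mulVf ?mulr1 //.
Qed.

Let p_at x phi t : 0 < x -> q.[x] = 2 * rho x * cos phi -> t ^+ 2 = - h.[x] ->
  b.[x] * t = 2 * rho x * sin phi ->
  p.[x] = 2 * x ^+ k * cos (d%:R * phi) /\ sg.[x] * t = 2 * x ^+ k * sin (d%:R * phi).
Proof.
move=> x0 qx t2 bt; have [h1 h2] := pexp_polar t2 (z := (q, b)) qx bt d.
rewrite /p /sg !hornerZ h1 -[_ * _ * t]mulrA h2 !mulrA r2 rho_d //.
Qed.

Let bh_at x phi : 0 < x -> q.[x] = 2 * rho x * cos phi ->
  b.[x] ^+ 2 * h.[x] = - (2 * rho x * sin phi) ^+ 2.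
Proof.
move=> x0 qx; rewrite -horner_exp -hornerM -bh DlE qx -[x ^+ K](rho_sqr K (ltW x0)).
by rewrite ![(_ * _) ^+ 2]exprMn sin2cos2; ring.
Qed.

Let t_ex x phi : 0 < x -> q.[x] = 2 * rho x * cos phi -> b.[x] != 0 ->
  exists t, t ^+ 2 = - h.[x] /\ b.[x] * t = 2 * rho x * sin phi.
Proof.
move=> x0 qx bx; exists (2 * rho x * sin phi / b.[x]); split; last by rewrite mulrC divfK.
by rewrite expr_div_n -[_ ^+ 2 in LHS]opprK -(bh_at x0 qx); field.
Qed.

Let xi_gt0 ij : ~~ bad' ij -> 0 < xi ij.
Proof.
move=> /Hxi[/andP[h1 _] _]; apply: le_lt_trans h1.
by case: (ij.1 : nat) (ltn_ord ij.1) => [|i] iM; [rewrite z0|apply: ltW; apply: zpos; exact: ltnW].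
Qed.

Let interior (ij : 'I_M.+2 * 'I_d.+1) := (0 < ij.2 < d)%N.

Let interior_bad ij : interior ij -> ~~ bad' ij.
Proof.
move=> /andP[j0 jd]; apply/negP => /and3P[_ _ /eqP]; rewrite /lidx.
by case: ifP => _ E; move: j0 jd; rewrite E ?ltnn.
Qed.

Let sin_th j : (0 < j < d)%N -> 0 < sin (th j).
Proof.
move=> /andP[j0 jd]; apply: sin_gt0_pi; rewrite /th mulr_gt0 ?ltr0n ?divr_gt0 ?pi_gt0 //=.
by rewrite mulrCA gtr_pMr ?pi_gt0 // ltr_pdivrMr // mul1r ltr_nat.
Qed.

Let xi_interior ij : interior ij -> sg.[xi ij] = 0 /\ p.[xi ij] = 2 * (-1) ^+ ij.2 * xi ij ^+ k.
Proof.
move=> hij; have nb := interior_bad hij; have [_ qx] := Hxi nb.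
have x0 := xi_gt0 nb; have bx := bh_at x0 qx.
have s0 : 2 * rho (xi ij) * sin (th ij.2) != 0.
  by rewrite gt_eqF // !mulr_gt0 // ?rho_gt0 ?sin_th.
have bn : b.[xi ij] != 0.
  by apply: contraNneq s0 => b00; move/eqP: bx; rewrite b00 expr0n mul0r eq_sym oppr_eq0 sqrf_eq0.
have [t [t2 bt]] := t_ex x0 qx bn; have [-> st] := p_at x0 qx t2 bt.
have t0 : t != 0 by apply: contraNneq s0; rewrite -bt => ->; rewrite mulr0.
rewrite dth in st *; have := alternatingn (@cosDpi R) ij.2 0; rewrite add0r cos0 mulr1 => ->.
have := alternatingn (@sinDpi R) ij.2 0; rewrite add0r sin0 mulr0 => E; rewrite E mulr0 in st.
split; last by ring.
by apply/eqP; move/eqP: st; rewrite mulf_eq0 (negPf t0) orbF.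
Qed.

Let sg_node x : b.[x] = 0 -> sg.[x] = 0 /\ p.[x] = r * q.[x] ^+ d.
Proof.
move=> bx; have [h1 h2] := pexp_node h (z := (q, b)) d bx.
by rewrite /sg /p !hornerZ h1 h2 mulr0.
Qed.

Let xi_root ij : ~~ bad' ij -> root (sg * h) (xi ij).
Proof.
move=> nb; rewrite rootM; case: (boolP (interior ij)) => [/xi_interior[h1 _]|hij].
  by rewrite /root h1 eqxx.
have [_ qx] := Hxi nb; have x0 := xi_gt0 nb; have := bh_at x0 qx.
have -> : sin (th ij.2) = 0.
  move: hij; rewrite /interior negb_and -leqNgt leqn0 -leqNgt => /orP[/eqP ->|dj].
    by rewrite /th mul0r sin0.
  have -> : (ij.2 : nat) = d by apply/eqP; rewrite eqn_leq dj -ltnS ltn_ord.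
  by rewrite thd sinpi.
rewrite mulr0 expr0n oppr0 => /eqP; rewrite mulf_eq0 sqrf_eq0 => /orP[/eqP|hx].
  by move=> /sg_node[h1 _]; rewrite /root h1 eqxx.
by rewrite /root hx orbT.
Qed.

Let xi_inj : {in [pred ij | ~~ bad' ij] &, injective xi}.
Proof.
move=> [i j] [i' j'] /= nb nb' E; have [/andP[h1 h2] h3] := Hxi nb; have [/andP[h1' h2'] h3'] := Hxi nb'.
rewrite -E /= in h1 h2 h3 h1' h2' h3'.
have ii : i = i'.
  apply/val_inj => /=; case: (ltngtP i i') => // hi.
    have : z i.+1 <= z i' by move: hi; rewrite leq_eqVlt => /orP[/eqP ->//|hi]; rewrite ltW // zlt2 // ltnW.
    by move=> zh; have := lt_le_trans h1' (le_trans h2 zh); rewrite ltxx.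
  have : z i'.+1 <= z i by move: hi; rewrite leq_eqVlt => /orP[/eqP ->//|hi]; rewrite ltW // zlt2 // ltnW.
  by move=> zh; have := lt_le_trans h1 (le_trans h2' zh); rewrite ltxx.
subst i'; congr pair; apply/val_inj; apply: cth_inj; rewrite -1?ltnS ?ltn_ord //.
move: h3; rewrite h3' => /mulfI -> //; rewrite gt_eqF // mulr_gt0 // rho_gt0 //.
exact: (xi_gt0 nb).
Qed.

Let card_bad : #|[pred ij | bad' ij]| = (M.+1 - g)%N.
Proof.
rewrite -cS; pose f (i : 'I_M.+1) : 'I_M.+2 * 'I_d.+1 := (lift ord0 i, inord (lidx i.+1)).
have fi : injective f by move=> i i' /(congr1 fst)/lift_inj.
rewrite -(card_imset _ fi); apply: eq_card => -[i j]; rewrite inE /bad' /bad /=.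
apply/and3P/imsetP => [[i0 Si /eqP jl]|[i' Si' [-> ->]]].
  have i1 : (i.-1 < M.+1)%N by case: (i : nat) i0 (ltn_ord i).
  exists (Ordinal i1) => //; rewrite /f; congr pair; apply/val_inj => /=.
    by rewrite /bump /= add1n prednK.
  rewrite inordK ?prednK // /lidx; by case: ifP.
rewrite /= /bump /= add1n inordK; last by rewrite /lidx; case: ifP.
by split.
Qed.

(** The points [xi] are distinct roots of [sg * h]. Of the (M + 2)(d + 1) pairs, M + 1 - g are bad,
    which leaves n + g + 1, the degree of [sg * h]: all roots are found, and all are simple and
    positive. *)
Let sep : separable_poly (sg * h) /\ (forall x, root (sg * h) x -> 0 < x).
Proof.
pose rs := [seq xi ij | ij <- enum [pred ij | ~~ bad' ij]].
have ur : uniq rs.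
  rewrite map_inj_in_uniq ?enum_uniq // => x y; rewrite !mem_enum; exact: xi_inj.
have sr : size rs = (n + g.+1)%N.
  rewrite size_map -cardE; have := cardC [pred ij | bad' ij].
  rewrite card_bad card_prod !card_ord mulnC mulSn => E.
  exact: card_good_arith gM E.
have [s1 s2] := sgP.
have sW : size (sg * h) = (size rs).+1.
  rewrite size_monicM // ?size_h ?s1 ?sr; last by rewrite -size_poly_gt0 size_h.
  by apply: size_split_arith gM _; rewrite leq_pmull.
have ar : all (root (sg * h)) rs.
  by apply/allP => x /mapP[ij]; rewrite mem_enum => nb ->; exact: xi_root.
have E := all_roots_prod_XsubC sW ar; rewrite uniq_rootsE in E.
have W0 : lead_coef (sg * h) != 0 by rewrite lead_coef_eq0 -size_poly_gt0 sW.
split; first by rewrite (E ur) (eqp_separable (eqp_scale _ W0)) separable_prod_XsubC.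
move=> x; rewrite (E ur) rootZ // root_prod_XsubC => /mapP[ij].
by rewrite mem_enum => nb ->; exact: xi_gt0.
Qed.

Let P0 : p.[0] ^+ 2 - 4 * 0 ^+ (2 * k) != 0.
Proof.
have E : (p ^+ 2 - (4%:R * 1) *: 'X^(2 * k)).[0] = p.[0] ^+ 2 - 4 * 0 ^+ (2 * k).
  by rewrite hornerD hornerN hornerZ horner_exp hornerXn mulr1.
rewrite -E pE; apply/negP => /eqP W; have : root (sg * h) 0.
  by move/eqP: W; rewrite rootE !hornerM !mulf_eq0 orbb.
by move=> /sep.2; rewrite ltxx.
Qed.

Let pellR : pell n k g p 1 sg h tau.
Proof.
split.
- exact: size_p.
- exact: oner_neq0.
- by case: sgP.
- by case: sgP.
- exact: size_h.
- exact: pE.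
- move=> x rx; have := sep.1; rewrite separable_poly.unlock => /coprimep_root/(_ rx).
  by [].
- exact: tauE.
move=> k0; apply: contraNneq P0 => ->.
by rewrite !expr0n muln_eq0 (gtn_eqF k0) /= mulr0 subrr.
Qed.

(** At a contact q + b s reduces to q, and the d-th power keeps the sign of q because d is odd. For
    even d all these nodes would fall on the same side, which is why only odd indices carry a
    kappa. *)
Let touch_p (i : 'I_M.+1) : odd d -> S i ->
  sg.[z i.+1] = 0 /\ p.[z i.+1] = 2 * (-1) ^+ (M + i.+1) * z i.+1 ^+ k.
Proof.
move=> od Si; have iM : (i <= M)%N by rewrite -ltnS.
have [h1 h2] := zS iM Si; have x0 : 0 < z i.+1 by apply: zpos; rewrite ltnS ltnW.
have [|-> ->] := @sg_node (z i.+1).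
  rewrite /b hornerZ; apply/eqP; rewrite mulf_eq0; apply/orP; right.
  by rewrite -[_ == 0]/(root sg0 _) root_prod_XsubC; apply/zsP; exists i.
split=> //; have -> : q.[z i.+1] = (-1) ^+ (M + i.+1) * (2 * rho (z i.+1)).
  by rewrite -h1 mulrA signr_sqr mul1r.
rewrite exprMn mulrCA r2 rho_d // -exprM -[_ ^+ (_ * d)]signr_odd oddM od andbT signr_odd.
by rewrite mulrCA mulrA.
Qed.

Let interior_card (par : bool) : odd d ->
  #|[pred ij | interior ij & odd ij.2 == par]| = (M.+2 * d./2)%N.
Proof.
move=> od; have H : #|[pred j : 'I_d.+1 | (0 < j < d)%N & odd j == par]| = d./2.
  by rewrite -sum1_card -(count_parity par od) (@big_mkord _ _ _ d.+1 (fun j => (0 < j < d)%N && (odd j == par))).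
have -> : #|[pred ij | interior ij & odd ij.2 == par]| =
   #|[predX 'I_M.+2 & [pred j : 'I_d.+1 | (0 < j < d)%N & odd j == par]]|.
  by apply: eq_card => -[i j].
by rewrite cardX H card_ord.
Qed.

Let kappaR : odd d -> exists u v : {poly R}, [/\ sg = u * v, u \is monic /\ v \is monic,
  u %| p - 2%:R *: 'X^k /\ v %| p + 2%:R *: 'X^k,
  size u = (M.+2 * d./2 + #|[pred i : 'I_M.+1 | S i & ~~ odd (M + i.+1)]|).+1 &
  size v = (M.+2 * d./2 + #|[pred i : 'I_M.+1 | S i & odd (M + i.+1)]|).+1].
Proof.
move=> od.
pose rs := [seq xi ij | ij <- enum interior] ++ zs.
have rsP x : x \in rs -> [/\ 0 < x, root sg x & p.[x] = 2 * x ^+ k \/ p.[x] = - (2 * x ^+ k)].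
  rewrite mem_cat => /orP[/mapP[ij]|/zsP[i [Si ->]]].
    rewrite mem_enum => hij ->; have [h1 h2] := xi_interior hij; split.
    - exact/xi_gt0/interior_bad.
    - by rewrite /root h1.
    rewrite h2 -signr_odd; case: (odd _); rewrite ?expr0 ?expr1 ?mulr1; [right|by left].
    by rewrite mulrN1 mulNr.
  have [h1 h2] := touch_p od Si; split.
  - by apply: zpos; rewrite ltnS ltnW.
  - by rewrite /root h1.
  rewrite h2 -signr_odd; case: (odd _); rewrite ?expr0 ?expr1 ?mulr1; [right|by left].
  by rewrite mulrN1 mulNr.
have ur : uniq rs.
  rewrite cat_uniq zs_uniq andbT map_inj_in_uniq ?enum_uniq; last first.
    by move=> x y; rewrite !mem_enum => hx hy; apply: xi_inj; exact: interior_bad.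
  apply/hasPn => x xz; apply/mapP => -[ij]; rewrite mem_enum => hij E.
  have nb := interior_bad hij; have [_ qx] := Hxi nb; have x0 := xi_gt0 nb.
  have [_ q2 _] := zs_touch xz; move: q2; rewrite E qx exprMn [(2 * _) ^+ 2]exprMn rho_sqr ?ltW //.
  rewrite -natrX cos2sin2 mulrBr mulr1 -[RHS]subr0 => /addrI /eqP.
  rewrite eqr_opp !mulf_eq0 pnatr_eq0 /= !expf_eq0 gt_eqF // andbF /=.
  by rewrite gt_eqF // sin_th.
have c1 : #|interior| = (M.+2 * d.-1)%N.
  rewrite -(cardID [pred ij : 'I_M.+2 * 'I_d.+1 | odd ij.2] interior).
  rewrite (eq_card (B := [pred ij | interior ij & odd ij.2 == true])); last first.
    by move=> ij; rewrite !inE eqb_id andbC.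
  rewrite interior_card // (eq_card (B := [pred ij | interior ij & odd ij.2 == false])); last first.
    by move=> ij; rewrite !inE eqbF_neg andbC.
  rewrite interior_card // -mulnDr addnn; congr (_ * _)%N.
  by rewrite -[in RHS](odd_double_half d) od.
have srs : size rs = (n - g).-1.
  rewrite size_cat size_map -cardE c1 size_zs; apply: size_rs_arith gM _.
  by rewrite addnC -mulnS prednK // mulnC.
have [s1 s2] := sgP.
have ng : (0 < n - g)%N by rewrite subn_gt0 (leq_trans gm) // leq_pmull.
have sgE : sg = \prod_(x <- rs) ('X - x%:P).
  rewrite [LHS](@all_roots_prod_XsubC _ sg rs) ?uniq_rootsE //.
  - by rewrite (monicP s2) scale1r.
  - by rewrite s1 srs prednK.
  - by apply/allP => x /rsP[].
pose Q x := p.[x] == 2 * x ^+ k.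
pose ru := [seq x <- rs | Q x]; pose rv := [seq x <- rs | ~~ Q x].
have QN x : x \in rs -> p.[x] = - (2 * x ^+ k) -> ~~ Q x.
  move=> /rsP[x0 _ _] E; rewrite /Q E -subr_eq0 -opprD oppr_eq0 gt_eqF //.
  by rewrite addr_gt0 // mulr_gt0 // exprn_gt0.
have Qxi ij : interior ij -> Q (xi ij) = ~~ odd ij.2.
  move=> hij; have [_ h2] := xi_interior hij; have xr : xi ij \in rs.
    by rewrite mem_cat map_f // mem_enum.
  move: h2; rewrite -signr_odd; case: (odd _); rewrite ?expr0 ?expr1 ?mulr1 => h2; last exact/eqP.
  by apply/negbTE/QN; rewrite // h2 mulrN1 mulNr.
have Qz (i : 'I_M.+1) : S i -> Q (z i.+1) = ~~ odd (M + i.+1).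
  move=> Si; have [_ h2] := touch_p od Si; have xr : z i.+1 \in rs.
    by rewrite mem_cat; apply/orP; right; apply/zsP; exists i.
  move: h2; rewrite -signr_odd; case: (odd _); rewrite ?expr0 ?expr1 ?mulr1 => h2; last exact/eqP.
  by apply/negbTE/QN; rewrite // h2 mulrN1 mulNr.
have cnt (Q' : pred R) (f : pred nat) : (forall ij, interior ij -> Q' (xi ij) = f ij.2) ->
    (forall i : 'I_M.+1, S i -> Q' (z i.+1) = f (M + i.+1)%N) ->
    count Q' rs = (#|[pred ij | interior ij & f ij.2]| + #|[pred i : 'I_M.+1 | S i & f (M + i.+1)%N]|)%N.
  move=> h1 h2; rewrite count_cat !count_map; congr (_ + _)%N.
    exact: count_enum.
  exact: count_enum.
exists (\prod_(x <- ru) ('X - x%:P)), (\prod_(x <- rv) ('X - x%:P)); split.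
- by rewrite sgE (bigID Q) /= !big_filter.
- by split; exact: monic_prod_XsubC.
- have XE x : (2%:R *: 'X^k : {poly R}).[x] = 2 * x ^+ k by rewrite hornerZ hornerXn.
  split; apply: uniq_roots_dvdp; rewrite ?uniq_rootsE ?filter_uniq //; apply/allP => x;
    rewrite mem_filter => /andP[Qx xr]; rewrite /root hornerD ?hornerN XE.
    by rewrite subr_eq0.
  have [_ _ []] := rsP x xr; last by move=> ->; rewrite addNr.
  by move=> E; move: Qx; rewrite /Q E eqxx.
- rewrite size_prod_XsubC size_filter (cnt Q (fun j => ~~ odd j) Qxi Qz); congr (_ + _).+1.
  rewrite -(interior_card false od); apply: eq_card => ij; rewrite !inE.
  by rewrite eqbF_neg.
rewrite size_prod_XsubC size_filter (cnt (fun x => ~~ Q x) odd).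
- congr (_ + _).+1; rewrite -(interior_card true od); apply: eq_card => ij; rewrite !inE.
  by rewrite eqb_id.
- by move=> ij /Qxi ->; rewrite negbK.
by move=> i /Qz ->; rewrite negbK.
Qed.


(** As [S M] fails, the graph starts strictly below - 2 rho at [z M.+1] and ends strictly above 2
    rho at [z M.+2]. *)
Let band_ex : exists a b', [/\ z M.+1 <= a, a < b', q.[a] = - (2 * rho a),
  q.[b'] = 2 * rho b' & forall x, a < x < b' -> - (2 * rho x) < q.[x] < 2 * rho x].
Proof.
have cq := @continuous_horner R q; have cr := @continuous_rho R K.
have cr2 : continuous (fun x : R => 2 * rho x) by move=> x; apply: cvgM; [exact: cvg_cst|exact: cr].
have cf : continuous (fun x => q.[x] + 2 * rho x) by move=> x; apply: cvgD; [exact: cq|exact: cr2].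
have cg : continuous (fun x => q.[x] - 2 * rho x) by move=> x; apply: cvgB; [exact: cq|exact: cr2].
have z1 := zpos (ltnW (ltnSn M.+1)).
have [||||a [b' [h1 /andP[h2 _] h3 h4 H]]] := @crossing R _ _ (z M.+1) (z M.+2) cf cg.
- by apply/ltW/zlt.
- move=> x zx; rewrite ltrD2l; have := rho_gt0 (lt_le_trans z1 zx); lra.
- have := @zN M.+1 (leqnSn _); rewrite /= leqnn (negPf lastS) => /(_ isT).
  rewrite addnS -signr_odd /= oddD addbb expr1 mulN1r; lra.
- have := @zN M.+2 (leqnn _); rewrite /= ltnn => /(_ isT).
  rewrite !addnS -signr_odd /= oddD addbb expr0 mul1r; lra.
exists a, b'; split=> //; [lra|lra|].
by move=> x /H[? ?]; apply/andP; split; lra.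
Qed.

Let b_gt0 x : z M.+1 <= x -> 0 < b.[x].
Proof.
move=> zx; rewrite hornerZ mulr_gt0 // /sg0 horner_prod big_seq.
apply: prodr_gt0 => y /zsP[i [Si ->]]; rewrite hornerXsubC subr_gt0.
apply: lt_le_trans zx; apply: zlt2 => //; rewrite ltnS ltn_neqAle -ltnS ltn_ord andbT.
by apply: contraNneq lastS => <-.
Qed.

(** On this band p + sg s is 2 x^k e^(i d theta) with theta going from pi to 0. By continuity the
    argument of a d'-th root differs from d theta / d' by a constant modulo multiples of pi, up to
    sign. The root is real at both ends, where [h] vanishes, so d pi / d' is a multiple of pi. *)
Let exact_root d' z' : (0 < d')%N -> (z'.1 != 0) || (z'.2 != 0) ->
  Lam h tau d' (2 * k)%:R z' = (0, 0) -> (d' %| d)%N.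
Proof.
move=> d'0 z'n LZ; have [a [b' [za ab qa qb Hab]]] := band_ex.
have z1 := zpos (ltnW (ltnSn M.+1)).
have xpos x : a <= x -> 0 < x by move=> ax; exact: lt_le_trans z1 (le_trans za ax).
have a0 := xpos a (lexx a).
have bpos x : a <= x -> 0 < b.[x] by move=> ax; apply: b_gt0; exact: le_trans za ax.
have qle x : a <= x <= b' -> -1 <= q.[x] / (2 * rho x) <= 1.
  move=> /andP[ax xb]; have r0 := rho_gt0 (xpos x ax).
  rewrite ler_pdivlMr ?ler_pdivrMr ?mulr_gt0 // mulN1r mul1r.
  case: (eqVneq x a) => [->|xa]; first by rewrite qa lexx /=; have := rho_gt0 a0; lra.
  case: (eqVneq x b') => [->|xb']; first by rewrite qb lexx andbT; have := rho_ge0 K b'; lra.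
  have hx : a < x < b' by rewrite !lt_neqAle eq_sym xa ax xb' xb.
  by have /andP[/ltW -> /ltW ->] := Hab x hx.
pose theta x := acos_clamp (q.[x] / (2 * rho x)).
pose t x := Num.sqrt (- h.[x]).
have qth x : a <= x <= b' -> q.[x] = 2 * rho x * cos (theta x).
  move=> hx; rewrite /theta cos_acos_clamp ?qle // mulrC divfK // gt_eqF // mulr_gt0 // rho_gt0 //.
  by apply: xpos; case/andP: hx.
have sth x : 0 <= sin (theta x) by apply: sin_ge0_pi; have := acos_clamp_pi (q.[x] / (2 * rho x)); rewrite in_itv.
have tP x : a <= x <= b' -> t x ^+ 2 = - h.[x] /\ b.[x] * t x = 2 * rho x * sin (theta x).
  move=> hx; have /andP[ax _] := hx; have E := bh_at (xpos x ax) (qth x hx).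
  have b0' := bpos x ax; have hle : 0 <= - h.[x].
    have -> : - h.[x] = (2 * rho x * sin (theta x)) ^+ 2 / b.[x] ^+ 2.
      by rewrite -[X in X / _]opprK -E; field; rewrite gt_eqF.
    by rewrite divr_ge0 // sqr_ge0.
  have t2 : t x ^+ 2 = - h.[x] by rewrite sqr_sqrtr.
  split=> //; apply/eqP; rewrite -(@eqrXn2 _ 2) // ?mulr_ge0 ?sqrtr_ge0 ?rho_ge0 ?(ltW b0') //.
  by rewrite exprMn t2 mulrN E opprK.
have ha : h.[a] = 0.
  have /eqP : b.[a] ^+ 2 * h.[a] = 0.
    rewrite -horner_exp -hornerM -bh DlE qa sqrrN exprMn rho_sqr ?ltW // -natrX.
    by rewrite subrr.
  by rewrite mulf_eq0 sqrf_eq0 gt_eqF ?bpos //= => /eqP.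
have hb : h.[b'] = 0.
  have b'0 := xpos _ (ltW ab); have /eqP : b.[b'] ^+ 2 * h.[b'] = 0.
    rewrite -horner_exp -hornerM -bh DlE qb exprMn rho_sqr ?ltW // -natrX.
    by rewrite subrr.
  by rewrite mulf_eq0 sqrf_eq0 gt_eqF ?bpos ?(ltW ab) //= => /eqP.
have [mu [mu0 Emu1 Emu2]] : exists mu, [/\ mu != 0, (pexp h z' d').1 = mu *: p & (pexp h z' d').2 = mu *: sg].
  have [mu Emu] : exists mu, pexp h z' d' = (mu *: p, mu *: sg).
    by apply: (Lam_root_power pellR (a := a)) => //; rewrite ?gt_eqF // /root ha.
  exists mu; rewrite Emu; split=> //; apply/eqP => mu0.
  have N0 : pnorm h z' = 0.
    apply/eqP; have /eqP := pnormX h z' d'; rewrite Emu mu0 !scale0r /pnorm /= expr0n mul0r subr0.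
    by rewrite eq_sym expf_eq0 d'0.
  (* Inside the band [h] is negative, so the norm of z' is a sum of two squares; if it is 0, both
     components vanish on an interval. *)
  have zero x : a < x < b' -> z'.1.[x] = 0 /\ z'.2.[x] = 0.
    move=> hx; have /andP[ax xb] := hx; have /andP[q1 q2] := Hab x hx.
    have x0 := xpos x (ltW ax); have b0' := bpos x (ltW ax).
    have hneg : h.[x] < 0.
      rewrite -(pmulr_rlt0 _ (_ : 0 < b.[x] ^+ 2)) ?exprn_gt0 //.
      rewrite -horner_exp -hornerM -bh DlE -[x ^+ K](rho_sqr K (ltW x0)).
      rewrite (_ : _ - _ = (q.[x] - 2 * rho x) * (q.[x] + 2 * rho x)); last by ring.
      by rewrite nmulr_rlt0 ?subr_lt0 // -ltrBlDr sub0r.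
    have E : z'.1.[x] ^+ 2 = z'.2.[x] ^+ 2 * h.[x].
      have := congr1 (fun P => P.[x]) N0; rewrite pnorm_horner horner0 => /eqP.
      by rewrite subr_eq0 => /eqP.
    have z20 : z'.2.[x] = 0.
      apply/eqP; rewrite -sqrf_eq0; apply: contraT => z2n.
      have : z'.2.[x] ^+ 2 * h.[x] < 0 by rewrite nmulr_llt0 // lt0r z2n sqr_ge0.
      by rewrite -E ltNge sqr_ge0.
    by split=> //; apply/eqP; rewrite -sqrf_eq0 E z20 expr0n mul0r.
  have ba : 0 < b' - a by rewrite subr_gt0.
  have nz P : P != 0 -> exists2 x, a < x < b' & P.[x] != 0.
    move=> Pn; have [r' [r'0 [[h1 _] h2]]] := filter_ex (filterI (nbhs_right_gt (0 : R))
      (filterI (near_horner_neq0 a Pn) (nbhs_right_lt ba))).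
    by exists (a + r') => //; rewrite ltrDl r'0 -ltrBrDl.
  by case/orP: z'n => /nz[x /zero[h1 h2]]; rewrite ?h1 ?h2 eqxx.
pose N := pnorm h z'.
have NE x : N.[x] ^+ d' = mu ^+ 2 * (4 * x ^+ (2 * k)).
  have := pell_eq_at x pellR; rewrite mulr1 => pEx.
  rewrite -horner_exp /N -pnormX pnorm_horner Emu1 Emu2 (hornerZ mu p) (hornerZ mu sg).
  by rewrite !exprMn -[_ * _ * h.[x]]mulrA -pEx; ring.
have Nt x : a <= x <= b' -> z'.1.[x] ^+ 2 + (z'.2.[x] * t x) ^+ 2 = N.[x].
  move=> hx; have [t2 _] := tP x hx; rewrite /N pnorm_horner.
  by rewrite exprMn t2; ring.
have Npos x : a <= x <= b' -> 0 < N.[x].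
  move=> hx; have /andP[ax _] := hx; rewrite lt_neqAle -{2}(Nt x hx) addr_ge0 ?sqr_ge0 // andbT.
  apply/eqP => N00; have := NE x; rewrite -N00 expr0n gtn_eqF //= => /esym/eqP.
  by rewrite !mulf_eq0 (negPf mu0) pnatr_eq0 /= expf_eq0 gt_eqF ?andbF // xpos.
(* [G] is the cosine of the difference between the argument of z' and psi; written in this way, its
   continuity needs no continuous choice of the argument. *)
pose psi x := d%:R * theta x / d'%:R.
pose G x := (z'.1.[x] * cos (psi x) + z'.2.[x] * t x * sin (psi x)) / Num.sqrt N.[x].
have [d'R d'R0] : (d'%:R != 0 :> R) /\ 0 < d'%:R :> R by rewrite pnatr_eq0 ltr0n -lt0n.
(* [B] is the Chebyshev polynomial of the second kind, with sin (d' x) = sin x B(cos x). So the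
   polynomial [Xh * B ^+ 2] vanishes at the cosines of angles x with sin (d' x) = 0, and [G] has
   finitely many possible values. *)
pose Xh : {poly R} := 'X^2 - 1; pose B : {poly R} := (pexp Xh ('X, 1) d').2.
have B1 : B.[1] = d'%:R.
  suff [] : (pexp Xh ('X, 1) d').1.[1] = 1 /\ B.[1] = d'%:R by [].
  rewrite /B; elim: (d') => [|j [IH1 IH2]]; first by rewrite /pexp /= hornerC horner0.
  rewrite pexpS /pmul /= !hornerE /= IH1 IH2 /Xh ?hornerE /=; split; first by ring.
  by rewrite -natr1.
have B0 : Xh * B ^+ 2 != 0.
  rewrite mulf_neq0 ?expf_neq0 //.
    by rewrite -size_poly_gt0 -[Xh]/('X^2 - 1%:P) size_XnsubC.
  by apply: contraNneq d'R => B0; rewrite -B1 B0 horner0.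
have GP x : a <= x <= b' -> (Xh * B ^+ 2).[G x] = 0.
  move=> hx; have rN : 0 < Num.sqrt N.[x] by rewrite sqrtr_gt0 Npos.
  have [|phi [c1 s1]] := @polar_ex R z'.1.[x] (z'.2.[x] * t x) _ rN.
    by rewrite Nt // sqr_sqrtr // ltW // Npos.
  have Gc : G x = cos (phi - psi x).
    by rewrite /G c1 s1 cosB; field; rewrite gt_eqF.
  have [t2 bt] := tP x hx; have x0 : 0 < x by apply: xpos; case/andP: hx.
  have [p1 s2] := p_at x0 (qth x hx) t2 bt.
  have [p3 s3] := pexp_polar t2 c1 s1 d'; rewrite Emu1 hornerZ p1 in p3; rewrite Emu2 hornerZ -mulrA s2 in s3.
  set r' := Num.sqrt N.[x] ^+ d' in p3 s3; have r'0 : r' != 0 by rewrite expf_neq0 // gt_eqF.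
  have sin0 : sin (d'%:R * (phi - psi x)) = 0.
    have -> : d'%:R * (phi - psi x) = d'%:R * phi - d%:R * theta x by rewrite /psi; field.
    apply: (mulfI r'0); rewrite sinB mulr0 mulrBr !mulrA -p3 -s3; ring.
  have hs : sin (phi - psi x) ^+ 2 = - Xh.[cos (phi - psi x)].
    by rewrite /Xh !hornerE /= sin2cos2; ring.
  have [_ Bs] := @pexp_polar R Xh ('X, 1) (cos (phi - psi x)) (sin (phi - psi x)) 1 (phi - psi x) hs
    (etrans (hornerX _) (esym (mul1r _))) (congr1 (fun y => y * _) (hornerC _ _)) d'.
  rewrite -/B sin0 mulr0 in Bs.
  rewrite Gc hornerM horner_exp -[Xh.[_]]opprK -hs mulNr -exprMn [sin _ * _]mulrC Bs.
  by rewrite expr0n oppr0.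
have cG : {within `[a, b'], continuous G}.
  apply: continuous_in_subspaceT => x; rewrite inE /= in_itv /= => hx.
  have x0 : 0 < x by apply: xpos; case/andP: hx.
  have ct : {for x, continuous t}.
    apply: (@continuous_comp _ _ _ (fun x => - h.[x]) Num.sqrt); last exact: sqrt_continuous.
    by apply: cvgN; exact: continuous_horner.
  have cth : {for x, continuous theta}.
    apply: (@continuous_comp _ _ _ (fun x => q.[x] / (2 * rho x)) (@acos_clamp R)); last exact: continuous_acos_clamp.
    apply: cvgM; first exact: continuous_horner.
    apply: cvgV; first by rewrite gt_eqF // mulr_gt0 // rho_gt0.
    by apply: cvgM; [exact: cvg_cst|exact: continuous_rho].
  have cpsi : {for x, continuous psi}.
    by apply: cvgM; [apply: cvgM; [exact: cvg_cst|exact: cth]|exact: cvg_cst].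
  apply: cvgM; last first.
    apply: cvgV; first by rewrite gt_eqF // sqrtr_gt0 Npos.
    apply: (@continuous_comp _ _ _ (fun x => N.[x]) Num.sqrt); last exact: sqrt_continuous.
    exact: continuous_horner.
  apply: cvgD; apply: cvgM.
  - exact: continuous_horner.
  - by apply: (@continuous_comp _ _ _ psi cos) => //; exact: continuous_cos.
  - by apply: cvgM; [exact: continuous_horner|exact: ct].
  - by apply: (@continuous_comp _ _ _ psi sin) => //; exact: continuous_sin.
have Gab := const_of_roots (ltW ab) cG B0 GP.
have ia : a <= a <= b' by rewrite lexx ltW.
have ib : a <= b' <= b' by rewrite lexx ltW.
have ta : t a = 0 by rewrite /t ha oppr0 sqrtr0.
have tb : t b' = 0 by rewrite /t hb oppr0 sqrtr0.
have ra := rho_gt0 a0; have rb := rho_gt0 (xpos b' (ltW ab)).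
have tha : psi a = d%:R * (pi / d'%:R).
  rewrite /psi /theta qa (_ : - (2 * rho a) / (2 * rho a) = -1); last by field; rewrite gt_eqF.
  rewrite /acos_clamp min_r ?lerN10 // ?max_l // ?acosN1 ?mulrA //.
have thb : psi b' = 0.
  rewrite /psi /theta qb divff; last by rewrite gt_eqF // mulr_gt0.
  by rewrite /acos_clamp minxx max_r ?acos1 ?mulr0 ?mul0r // lerNl opprK lerDl.
(* Where t = 0 the number z' is real, so its argument drops out of the square of [G]. *)
have sq1 x : a <= x <= b' -> t x = 0 -> G x ^+ 2 = cos (psi x) ^+ 2.
  move=> hx tx; have := Nt x hx; rewrite tx mulr0 expr0n addr0 => Nx.
  have Nx0 := Npos x hx; have z10 : z'.1.[x] != 0 by rewrite -sqrf_eq0 Nx gt_eqF.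
  rewrite /G tx mulr0 mul0r addr0 -Nx sqrtr_sqr expr_div_n real_normK ?num_real // exprMn.
  by field.
have := sq1 a ia ta; rewrite Gab (sq1 b' ib tb) thb cos0 expr1n tha => /esym E.
apply: (@sin_pi_div R d d' d'0); apply/eqP; rewrite -sqrf_eq0 sin2cos2 E subrr //.
Qed.

Lemma example_composite : example.
Proof.
exists p, sg, h, tau, (q, b); split=> //.
- by split; [case: sep|exact: P0].
- by rewrite /= size_b; split.
Qed.

End Composite.

Lemma real_example_of_bands : exists (p sg h tau : {poly R}) (zz : {poly R} * {poly R}), [/\ pell n k g p 1 sg h tau,
    separable_poly (sg * h) /\ p.[0] ^+ 2 - 4 * 0 ^+ (2 * k) != 0,
    [/\ size zz.1 = M.+3, (size zz.2 <= M.+2 - g)%N & Lam h tau d (2 * k)%:R zz = (0, 0)],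
    (forall d' z', (0 < d')%N -> (z'.1 != 0) || (z'.2 != 0) ->
      Lam h tau d' (2 * k)%:R z' = (0, 0) -> (d' %| d)%N) &
    odd d -> exists u v : {poly R}, [/\ sg = u * v, u \is monic /\ v \is monic,
      u %| p - 2%:R *: 'X^k /\ v %| p + 2%:R *: 'X^k,
      size u = (M.+2 * d./2 + #|[pred i : 'I_M.+1 | S i & ~~ odd (M + i.+1)]|).+1 &
      size v = (M.+2 * d./2 + #|[pred i : 'I_M.+1 | S i & odd (M + i.+1)]|).+1]].
Proof.
have [T [T1 T2]] := T_ex; have [xi Hxi] := xi_sig.
exact: (example_composite T1 T2 Hxi).
Qed.

End RealExample.

Lemma real_example (R : realType) M K d k g (S : pred nat) :
  (K <= M.+2)%N -> (0 < d)%N -> (d * K = 2 * k)%N -> (0 < g)%N -> (g <= M.+1)%N ->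
  #|[pred i : 'I_M.+1 | S i]| = (M.+1 - g)%N -> ~~ S M ->
  exists (p sg h tau : {poly R}) (zz : {poly R} * {poly R}), [/\ pell (d * M.+2) k g p 1 sg h tau,
    separable_poly (sg * h) /\ p.[0] ^+ 2 - 4 * 0 ^+ (2 * k) != 0,
    [/\ size zz.1 = M.+3, (size zz.2 <= M.+2 - g)%N & Lam h tau d (2 * k)%:R zz = (0, 0)],
    (forall d' z', (0 < d')%N -> (z'.1 != 0) || (z'.2 != 0) ->
      Lam h tau d' (2 * k)%:R z' = (0, 0) -> (d' %| d)%N) &
    odd d -> exists u v : {poly R}, [/\ sg = u * v, u \is monic /\ v \is monic,
      u %| p - 2%:R *: 'X^k /\ v %| p + 2%:R *: 'X^k,
      size u = (M.+2 * d./2 + #|[pred i : 'I_M.+1 | S i & ~~ odd (M + i.+1)]|).+1 &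
      size v = (M.+2 * d./2 + #|[pred i : 'I_M.+1 | S i & odd (M + i.+1)]|).+1]].
Proof.
move=> KM d0 dK g0 gM cS lastS.
have [q [z [[sq lq] z0 zlt zS zN]]] := @bands_ex R M K S KM.
exact: (real_example_of_bands KM d0 dK g0 gM cS sq lq z0 zlt zS zN lastS).
Qed.

(** * Complex examples *)

Section AdditiveMap.
Variables (F1 F2 : numFieldType) (f : {rmorphism F1 -> F2}) (g : F2 -> F1).
Hypotheses (g0 : g 0 = 0) (gD : forall x y, g (x + y) = g x + g y).
Hypothesis gf : forall a x, g (f a * x) = a * g x.
Implicit Types (p q : {poly F2}) (a : {poly F1}).

Let coef_g p i : (map_poly g p)`_i = g p`_i.
Proof. by rewrite coef_map_id0. Qed.

Let gN x : g (- x) = - g x.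
Proof. by have := gf (-1) x; rewrite rmorphN1 !mulN1r. Qed.

Let gsum (I : Type) (s : seq I) (F : I -> F2) : g (\sum_(i <- s) F i) = \sum_(i <- s) g (F i).
Proof. by elim/big_rec2: _ => // i y1 y2 _ <-. Qed.

Let gZ n x : g (x *+ n) = g x *+ n.
Proof. by elim: n => [|n IH]; rewrite ?mulr0n ?g0 // !mulrS gD IH. Qed.

Lemma map_polyB p q : map_poly g (p - q) = map_poly g p - map_poly g q.
Proof. by apply/polyP => i; rewrite coefB !coef_g coefB gD gN. Qed.

Lemma map_polyD p q : map_poly g (p + q) = map_poly g p + map_poly g q.
Proof. by apply/polyP => i; rewrite coefD !coef_g coefD gD. Qed.

Lemma map_poly_mulr a p : map_poly g (map_poly f a * p) = a * map_poly g p.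
Proof.
apply/polyP => i; rewrite coef_g !coefM gsum; apply: eq_bigr => j _.
by rewrite coef_map coef_g gf.
Qed.

Lemma map_poly_deriv p : map_poly g p^`() = (map_poly g p)^`().
Proof. by apply/polyP => i; rewrite coef_g !coef_deriv coef_g gZ. Qed.

(** The operator has real coefficients, so the real and the imaginary part of a complex solution are
    real solutions; one of them is nonzero. This transfers the exclusion of d'-th roots from the
    reals to the complex numbers. *)
Lemma map_poly_Lam (h tau : {poly F1}) d (c : nat) (z : {poly F2} * {poly F2}) :
  let L := Lam (map_poly f h) (map_poly f tau) d c%:R z in
  (map_poly g L.1, map_poly g L.2) = Lam h tau d c%:R (map_poly g z.1, map_poly g z.2).
Proof.
have E1 : (Lam (map_poly f h) (map_poly f tau) d c%:R z).1 =
    map_poly f ((2 * d)%:R * 'X) * z.1^`() - map_poly f c%:R * z.1 - map_poly f (2%:R * tau) * z.2.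
  by rewrite !rmorphM !rmorph_nat /= map_polyX /Lam /= polyC_natr; ring.
have E2 : (Lam (map_poly f h) (map_poly f tau) d c%:R z).2 =
    map_poly f (d%:R * 'X * (2%:R * h)) * z.2^`() + map_poly f (d%:R * 'X * h^`()) * z.2
    - map_poly f (c%:R * h) * z.2 - map_poly f (2%:R * tau) * z.1.
  by rewrite !rmorphM !rmorph_nat /= map_polyX /Lam /= polyC_natr deriv_map; ring.
cbv zeta; rewrite E1 E2 !(map_polyB, map_polyD, map_poly_mulr, map_poly_deriv) /Lam /= polyC_natr.
by congr pair; ring.
Qed.

End AdditiveMap.

Lemma separable_simple_root (F : fieldType) (p : {poly F}) r : separable_poly p -> root p r -> ~~ root p^`() r.
Proof. by rewrite separable_poly.unlock => /coprimep_root H /H. Qed.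

Lemma pell_map (F1 F2 : numFieldType) (f : {rmorphism F1 -> F2}) n k g (p sg h tau : {poly F1}) :
  pell n k g p 1 sg h tau -> separable_poly (sg * h) ->
  pell n k g (map_poly f p) 1 (map_poly f sg) (map_poly f h) (map_poly f tau).
Proof.
move=> H sep; split; rewrite ?size_map_poly.
- exact: pell_size H.
- exact: oner_neq0.
- by rewrite map_monic (pell_monic H).
- exact: pell_size_sg H.
- exact: pell_size_h H.
- have := congr1 (map_poly f) (pell_eq H); rewrite rmorphB [_ (sg ^+ 2 * h)]rmorphM !rmorphXn /= map_polyZ /= => <-.
  by rewrite map_polyXn rmorphM rmorph1 rmorph_nat.
- by move=> r; apply: separable_simple_root; rewrite -rmorphM separable_map.
- rewrite deriv_map -rmorphM -(pell_tau H) rmorphB !rmorphM /= map_polyX rmorph_nat.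
  by [].
by move=> k0; have := pell_0 H k0; rewrite -(fmorph_eq0 f) -horner_map rmorph0.
Qed.

Lemma has_root_map (F1 : numFieldType) (F2 : numClosedFieldType) (f : {rmorphism F1 -> F2})
    k g d m (h tau : {poly F1}) (z : {poly F1} * {poly F1}) :
  (z.1 != 0) || (z.2 != 0) -> (size z.1 <= m.+1)%N -> (size z.2 <= m - g)%N ->
  Lam h tau d (2 * k)%:R z = (0, 0) -> has_root k g d m (map_poly f h) (map_poly f tau).
Proof.
move=> zn s1 s2 L; exists (map_poly f z.1, map_poly f z.2).
rewrite /= !map_poly_eq0 !size_map_poly; split=> //.
have [L1 L2] : (Lam h tau d (2 * k)%:R z).1 = 0 /\ (Lam h tau d (2 * k)%:R z).2 = 0 by rewrite L.
have := congr1 (map_poly f) L1; have := congr1 (map_poly f) L2.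
rewrite /Lam [_.1]/= [_.2]/= !polyC_natr !rmorph0 => e2 e1; congr pair.
  by rewrite -[RHS]e1 !rmorphB !rmorphM !rmorph_nat /= map_polyX deriv_map.
rewrite -[RHS]e2 !rmorphB !rmorphM (rmorphD _ (2%:R * z.2^`() * h)) !rmorphM !rmorph_nat /=.
by rewrite map_polyX !deriv_map.
Qed.

Lemma count_lt_parity (par : bool) N u : (2 * u <= N)%N ->
  #|[pred i : 'I_N | (odd i == par) && (i < 2 * u)%N]| = u.
Proof.
move=> uN; rewrite -sum1_card.
transitivity (\sum_(0 <= i < N | (odd i == par) && (i < 2 * u)) 1)%N; first by rewrite big_mkord.
rewrite (big_cat_nat _ uN) //= [X in (_ + X)%N]big_nat_cond [X in (_ + X)%N]big1 ?addn0; last first.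
  by move=> i /andP[/andP[h _] /andP[_]]; rewrite ltnNge h.
rewrite big_nat_cond (eq_bigl (fun i => (0 <= i < 2 * u)%N && (odd i == par))); last first.
  by move=> i /=; case: (i < 2 * u)%N; rewrite ?andbT ?andbF.
rewrite -big_nat_cond; elim: u {uN} => [|u IH]; first by rewrite big_geq.
rewrite mulnS !add2n mul2n; rewrite mul2n in IH.
rewrite big_mkcond !big_nat_recr //= -big_mkcond IH odd_double.
by case: (par) => /=; lia.
Qed.

Fact kappa_arith X u v de ka (b : bool) : (2 * u = de + ka)%N -> (2 * v = de - ka)%N ->
  (ka <= de)%N -> `|((X + (if b then u else v)).+1%:Z - (X + (if b then v else u)).+1%:Z)%R|%N = ka.
Proof. by case: b; lia. Qed.

Lemma example_ex (R : realType) n m K d k g kappa : (d * m = n)%N -> (d * K = 2 * k)%N ->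
  (0 < d)%N -> (K <= m)%N -> (0 < g)%N -> (g < m)%N ->
  (odd d -> [/\ kappa <= m.-1 - g, kappa <= g & odd kappa = odd (m.-1 - g)]%N) ->
  exists p sg h tau : {poly R[i]}, [/\ pell n k g p 1 sg h tau,
    has_root k g d m h tau,
    forall d' m', (0 < d')%N -> ~~ (d' %| d)%N -> ~ has_root k g d' m' h tau,
    odd d -> has_kappa k p 1 sg kappa &
    p.[0] ^+ 2 - 4 * 0 ^+ (2 * k) != 0].
Proof.
case: m => [|[|M]]; rewrite ?ltn0 //; first by move=> _ _ _ _; rewrite ltnS lt0n => /negPf; lia.
move=> dm dK d0 KM g0 gM Hk /=.
set de := (M.+1 - g)%N.
(* For even d no kappa is prescribed, and 0 or 1, according to the parity of [de], serves. *)
have [ka [ka1 ka2 ka3 kaE]] : exists ka, [/\ (ka <= de)%N, (ka <= g)%N, odd ka = odd de & odd d -> ka = kappa].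
  case od : (odd d); first by have [h1 h2 h3] := Hk od; exists kappa.
  exists (odd de); split=> //; [|by apply: leq_trans (leq_b1 _) _|by rewrite oddb].
  by case: (de) => //= x; case: (odd x).
pose u := (de + ka)./2; pose v := (de - ka)./2.
have hu : (2 * u = de + ka)%N by rewrite mul2n halfK oddD ka3 addbb subn0.
have hv : (2 * v = de - ka)%N by rewrite mul2n halfK oddB // ka3 addbb subn0.
(* The first [u] even and the first [v] odd indices: u + v = M + 1 - g contacts, with u - v = ka as
   the difference of signs. *)
pose S i := if odd i then (i < 2 * v)%N else (i < 2 * u)%N.
have uN : (2 * u <= M.+1)%N by rewrite hu /de; lia.
have vN : (2 * v <= M.+1)%N by rewrite hv /de; lia.
have S0 : #|[pred i : 'I_M.+1 | S i & odd i == false]| = u.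
  rewrite -(@count_lt_parity false _ _ uN); apply: eq_card => i; rewrite !inE /S.
  by case: (odd i); rewrite /= ?andbF ?andbT.
have S1 : #|[pred i : 'I_M.+1 | S i & odd i == true]| = v.
  rewrite -(@count_lt_parity true _ _ vN); apply: eq_card => i; rewrite !inE /S.
  by case: (odd i); rewrite /= ?andbF ?andbT.
have cS : #|[pred i : 'I_M.+1 | S i]| = (M.+1 - g)%N.
  rewrite -(cardID [pred i : 'I_M.+1 | odd i]) addnC.
  rewrite (eq_card (B := [pred i : 'I_M.+1 | S i & odd i == false])); last first.
    by move=> i; rewrite !inE eqbF_neg andbC.
  rewrite S0 (eq_card (B := [pred i : 'I_M.+1 | S i & odd i == true])); last first.
    by move=> i; rewrite !inE eqb_id andbC.
  by rewrite S1 -/de; lia.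
have lastS : ~~ S M.
  rewrite /S; case oM : (odd M); rewrite -leqNgt; first by rewrite hv /de; lia.
  have : odd (2 * u) = false by rewrite mul2n odd_double.
  by move: uN; rewrite leq_eqVlt => /orP[/eqP -> /=|//]; rewrite oM.
have [p [sg [h [tau [zz [HP [sep P0] [z1 z2 LZ] ex kap]]]]]] :=
  @real_example R M K d k g S KM d0 dK g0 gM cS lastS.
pose f : {rmorphism R -> R[i]} := real_complex R.
exists (map_poly f p), (map_poly f sg), (map_poly f h), (map_poly f tau); split.
- by rewrite -dm; exact: pell_map.
- apply: (@has_root_map _ _ f _ _ _ _ _ _ zz) => //; last by rewrite z1.
  by rewrite -size_poly_eq0 z1.
- move=> d' m' d'0 nd [z [zn _ _ L]]; move/negP: nd; apply.
  have [L1 L2] : (Lam (map_poly f h) (map_poly f tau) d' (2 * k)%:R z).1 = 0 /\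
     (Lam (map_poly f h) (map_poly f tau) d' (2 * k)%:R z).2 = 0 by rewrite L.
  have key (ga : R[i] -> R) : ga 0 = 0 -> (forall x y, ga (x + y) = ga x + ga y) ->
      (forall a x, ga (f a * x) = a * ga x) ->
      (map_poly ga z.1 != 0) || (map_poly ga z.2 != 0) -> (d' %| d)%N.
    move=> ga0 gaD gaf gn; apply: (@ex _ (map_poly ga z.1, map_poly ga z.2)) => //.
    by rewrite -(map_poly_Lam ga0 gaD gaf) L1 L2 map_poly0.
  have kR := key (@complex.Re R) (erefl _); have kI := key (@complex.Im R) (erefl _).
  have [zR|zR] := boolP ((map_poly (@complex.Re R) z.1 != 0) || (map_poly (@complex.Re R) z.2 != 0)).
    apply: kR zR => [[x1 x2] [y1 y2] //|a [x1 x2] /=]; by rewrite mul0r subr0.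
  have [zI|zI] := boolP ((map_poly (@complex.Im R) z.1 != 0) || (map_poly (@complex.Im R) z.2 != 0)).
    apply: kI zI => [[x1 x2] [y1 y2] //|a [x1 x2] /=]; by rewrite mul0r addr0.
  have zero (P : {poly R[i]}) : map_poly (@complex.Re R) P = 0 -> map_poly (@complex.Im R) P = 0 -> P = 0.
    move=> h1 h2; apply/polyP => i; rewrite coef0.
    have := congr1 (fun Q : {poly R} => Q`_i) h1; have := congr1 (fun Q : {poly R} => Q`_i) h2.
    by rewrite !coef_map_id0 // !coef0; case: (P`_i) => x y /= -> ->.
  move: zR zI zn; rewrite !negb_or !negbK => /andP[/eqP a1 /eqP a2] /andP[/eqP b1 /eqP b2].
  by rewrite (zero _ a1 b1) (zero _ a2 b2) eqxx.
- move=> od; have [u' [v' [E [mu mv] [du dv] su sv]]] := kap od.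
  exists 1, (map_poly f u'), (map_poly f v').
  rewrite expr1n mulr1 E rmorphM !map_monic mu mv; split=> //.
    have c2 : (2%:R : R[i]) *: 'X^k = map_poly f (2%:R *: 'X^k).
      by rewrite map_polyZ /= map_polyXn rmorph_nat.
    by rewrite c2 -rmorphB -rmorphD !dvdp_map.
  rewrite !size_map_poly su sv -(kaE od).
  have c0 : #|[pred i : 'I_M.+1 | S i & ~~ odd (M + i.+1)]| = if odd M then u else v.
    case oM : (odd M); [rewrite -S0|rewrite -S1]; apply: eq_card => i; rewrite !inE oddD oM /=;
    by case: (odd i); rewrite /= ?andbT ?andbF.
  have c1 : #|[pred i : 'I_M.+1 | S i & odd (M + i.+1)]| = if odd M then v else u.
    case oM : (odd M); [rewrite -S1|rewrite -S0]; apply: eq_card => i; rewrite !inE oddD oM /=;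
    by case: (odd i); rewrite /= ?andbT ?andbF.
  by rewrite c0 c1; exact: kappa_arith hu hv ka1.
have := P0; rewrite -(fmorph_eq0 f) rmorphB (rmorphM f 4) !rmorphXn /= -horner_map rmorph_nat.
by rewrite rmorph0.
Qed.

(** * Lattice points and sublattices of the kite *)

Section Kite.
Variables (R : realType) (k k' : nat).
Hypothesis k'0 : (0 < k')%N.
Local Notation n := (k + k')%N.
Local Notation D := (kite R k k').
Implicit Types (m : Z2) (M : set Z2).

Definition kite_ineq (p : R * R) : Prop :=
  [/\ k%:R * p.1 <= p.2, - (k%:R * p.1) <= p.2,
      p.2 + k'%:R * p.1 <= n%:R & p.2 - k'%:R * p.1 <= n%:R].

Let n0 : 0 < n%:R :> R. Proof. by rewrite ltr0n addn_gt0 k'0 orbT. Qed.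

Lemma kiteP p : D p <-> kite_ineq p.
Proof.
have k0 : 0 <= k%:R :> R by []; have k'R : 0 <= k'%:R :> R by [].
have nE : n%:R = k%:R + k'%:R :> R by rewrite natrD.
split.
  move=> [w [w0 w1] ->]; move: w1 (w0 ord0) (w0 (lift ord0 ord0)) (w0 (lift ord0 (lift ord0 ord0)))
    (w0 (lift ord0 (lift ord0 (lift ord0 ord0)))).
  rewrite !big_ord_recl !big_ord0 /= /kite_ineq /= !mulr0 !mulr1 !add0r !addr0.
  rewrite rmorphN1 mulrN1 -!pmulrn nE.
  set x0 := w ord0; set x1 := w _; set x2 := w _; set x3 := w _ => e h0 h1 h2 h3.
  have hk1 := mulr_ge0 h1 k0; have hk2 := mulr_ge0 h2 k0; have hk3 := mulr_ge0 h3 k0.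
  have gk1 := mulr_ge0 h1 k'R; have gk2 := mulr_ge0 h2 k'R; have gk3 := mulr_ge0 h3 k'R.
  have gk0 := mulr_ge0 h0 k'R; have hk0 := mulr_ge0 h0 k0.
  have ek := congr1 (fun y => y * k%:R) e; have ek' := congr1 (fun y => y * k'%:R) e.
  rewrite /= !mulrDl !mul1r in ek ek'.
  by split; rewrite ?mulrDr ?mulrBr ?mulrDl; lra.
move=> [h1 h2 h3 h4].
case: p h1 h2 h3 h4 => x y /= h1 h2 h3 h4.
have [ax [axE axx axN]] : exists ax, [/\ ax = x \/ ax = - x, x <= ax & - x <= ax].
  exists `|x|; split; [|exact: ler_norm|by rewrite -normrN ler_norm].
  by have [h|h] := lerP 0 x; [left; rewrite ger0_norm|right; rewrite ltr0_norm].
(* Barycentric weights: with ax = |x|, the side vertices get the positive and the negative part of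
   x, and the top vertex the rest of the second coordinate. *)
pose a1 := (ax + x) / 2; pose a2 := (ax - x) / 2.
have hy : k%:R * ax <= y by case: axE => ->; rewrite ?mulrN.
have hy' : y + k'%:R * ax <= n%:R by case: axE => ->; rewrite ?mulrN.
have ax1 : ax <= 1.
  by rewrite -(ler_pM2l n0) mulr1; move: hy hy'; rewrite nE mulrDl; lra.
pose a3 := (y - k%:R * ax) / n%:R.
have a30 : 0 <= a3 by rewrite divr_ge0 ?(ltW n0) // subr_ge0.
have a3n : a3 * n%:R = y - k%:R * ax by rewrite divfK // gt_eqF.
have a31 : a3 <= 1 - ax.
  rewrite -(ler_pM2r n0) a3n; move: hy'; rewrite nE mulrBl mul1r mulrDr; lra.
have a10 : 0 <= a1 by rewrite /a1; lra.
have a20 : 0 <= a2 by rewrite /a2; lra.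
exists (fun i : 'I_4 => nth 0 [:: 1 - ax - a3; a1; a2; a3] i); first split.
- by case; case=> [|[|[|[|//]]]] hi //=; lra.
- by rewrite !big_ord_recl !big_ord0 /= /a1 /a2; lra.
rewrite !big_ord_recl !big_ord0 /= !mulr0 !addr0 !add0r rmorphN1 -!pmulrn a3n.
congr pair; rewrite /a1 /a2; last by lra.
by rewrite mulr1 mulrN1; lra.
Qed.

Lemma kite_lattice m : lattice_points D m <->
  (m.1 = 0 /\ 0 <= m.2 <= n%:Z) \/ m = (1, k%:Z) \/ m = (-1, k%:Z).
Proof.
rewrite /lattice_points /preimage /= kiteP /kite_ineq /real_point /=.
have e (a b : int) : (a%:~R <= b%:~R :> R) = (a <= b) by rewrite ler_int.
rewrite (_ : [/\ _, _, _ & _] <-> [/\ k%:Z * m.1 <= m.2, - (k%:Z * m.1) <= m.2,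
   m.2 + k'%:Z * m.1 <= n%:Z & m.2 - k'%:Z * m.1 <= n%:Z]); last first.
  by rewrite -!e !(rmorphD, rmorphN, rmorphM) /= -!pmulrn.
case: m => x y /=; split.
  move=> [h1 h2 h3 h4].
  have hx : -1 <= x <= 1 by nia.
  have : x = 0 \/ x = 1 \/ x = -1 by lia.
  case=> [->|[] xE]; first by left; lia.
    by right; left; rewrite xE; congr pair; lia.
  by right; right; rewrite xE; congr pair; lia.
by move=> [[-> h]|[|] [-> ->]]; split; lia.
Qed.

Lemma kite_finite : finite_set (lattice_points D).
Proof.
apply: (@sub_finite_set _ _ ([set (0, j%:Z) | j in `I_n.+1] `|` [set (1, k%:Z)] `|` [set (-1, k%:Z)])).
  move=> m /kite_lattice; case: m => x y /= [[-> h]|[|] ->]; [left; left|left; right|right] => //.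
  by exists `|y|%N; [rewrite /=; lia|congr pair; lia].
by rewrite !finite_setU; split; [split|]; [exact: finite_image|exact: finite_set1|exact: finite_set1].
Qed.

Lemma mono_kite m : m \in monomials D <->
  (m.1 = 0 /\ 0 <= m.2 <= n%:Z) \/ m = (1, k%:Z) \/ m = (-1, k%:Z).
Proof.
rewrite -kite_lattice /monomials in_fset_set; last exact: kite_finite.
by split=> [/set_mem|/mem_set].
Qed.

Let lin (a b : R) (p : R * R) := a * p.1 + b * p.2.

Let lin_cont a b (p : R * R) : lin a b x @[x --> p] --> lin a b p.
Proof.
rewrite /lin; apply: cvgD; apply: cvgM; try exact: cvg_cst; [exact: cvg_fst|exact: cvg_snd].
Qed.

Lemma kite_closure : closure D = D.
Proof.
apply/esym/closure_id.
rewrite (_ : D = [set p | lin k%:R (-1) p <= 0] `&` [set p | lin (- k%:R) (-1) p <= 0] `&`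
   [set p | lin k'%:R 1 p <= n%:R] `&` [set p | lin (- k'%:R) 1 p <= n%:R]); last first.
  apply/seteqP; rewrite /lin; split=> p /=; rewrite kiteP /kite_ineq => H.
    by case: H => h1 h2 h3 h4; split; [split; [split|]|]; lra.
  by case: H => [[[h1 h2] h3] h4]; split; lra.
have cl a b c : closed [set p : R * R | lin a b p <= c].
  rewrite (_ : [set _ | _] = lin a b @^-1` [set x | x <= c]) //.
  by apply: closed_comp; [move=> p _; exact: lin_cont|exact: closed_le].
by do 3 apply: closedI => //.
Qed.

Lemma kite_interior m : lattice_points (interior D) m <-> m.1 = 0 /\ 0 < m.2 < n%:Z.
Proof.
split=> [h|].
  have hD : lattice_points D m by exact: interior_subset h.
  have dir (u v : R) : \forall e \near (0 : R)^'+, D (m.1%:~R + e * u, m.2%:~R + e * v).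
    have : (m.1%:~R + e * u, m.2%:~R + e * v) @[e --> (0 : R)^'+] --> (real_point R m : R * R).
      rewrite /real_point -[X in _ --> (X, _)]addr0 -[X in _ --> (_, X)]addr0.
      rewrite -[X in _ --> (_ + X, _)](mul0r u) -[X in _ --> (_, _ + X)](mul0r v).
      apply: (@cvg_pair _ _ _ _ _ _ _ (nbhs_filter _) (nbhs_filter _)) => /=; apply: cvgD; try exact: cvg_cst; apply: cvgM; try exact: cvg_cst;
        exact: cvg_within.
    by move/(_ _ h).
  have get (u v : R) : exists2 e : R, 0 < e & kite_ineq (m.1%:~R + e * u, m.2%:~R + e * v).
    have : \forall e \near (0 : R)^'+, 0 < e by exact: nbhs_right_gt.
    move=> /(filterI (dir u v)) /filter_ex [e [he e0]]; exists e => //.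
    exact/kiteP.
  have k'R : 0 < k'%:R :> R by rewrite ltr0n.
  have nE : n%:R = k%:R + k'%:R :> R by rewrite natrD.
  move/kite_lattice: hD => [[m1 hm]|[|] mE]; [split=> // | exfalso | exfalso].
  - have [e e0 [+ _ _ _]] := get 0 (-1); have [e' e'0 [_ _ + _]] := get 0 1.
    rewrite /= m1 /= !mulr0 !addr0 mulr1 mulrN1 !mulr0 => a b.
    have : 0 < m.2%:~R :> R by lra.
    have : m.2%:~R < n%:~R :> R by rewrite -pmulrn; lra.
    by rewrite ltr0z ltr_int => -> ->.
  - have [e e0 [_ _ + _]] := get 1 0; rewrite mE /= -!pmulrn nE; nra.
  - have [e e0 [_ _ _ +]] := get (-1) 0; rewrite mE /= -!pmulrn nE rmorphN1; nra.
move=> [m1 /andP[m0 mn]]; rewrite /lattice_points /preimage /=.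
have op (q : R * R) a b c : lin a b q < c -> \forall p \near q, lin a b p <= c.
  move=> h; have : \forall y \near lin a b q, y < c by exact: lt_nbhsl.
  by move/(@lin_cont a b q) => h'; apply: (@filterS _ _ (nbhs_filter q) _ _ _ h') => p /= /ltW.
have opD (q : R * R) : lin k%:R (-1) q < 0 -> lin (- k%:R) (-1) q < 0 ->
    lin k'%:R 1 q < n%:R -> lin (- k'%:R) 1 q < n%:R -> \forall p \near q, D p.
  move=> o1 o2 o3 o4.
  have I := @filterI _ _ (nbhs_filter q).
  have H := I _ _ (I _ _ (op _ _ _ _ o1) (op _ _ _ _ o2)) (I _ _ (op _ _ _ _ o3) (op _ _ _ _ o4)).
  apply: (@filterS _ _ (nbhs_filter q) _ _ _ H) => p [[h1 h2] [h3 h4]]; apply/kiteP.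
  by move: h1 h2 h3 h4; rewrite /lin /kite_ineq => *; split; lra.
have m0R : 0 < m.2%:~R :> R by rewrite ltr0z.
have mnR : m.2%:~R < n%:R :> R by rewrite pmulrn ltr_int.
by apply: opD; rewrite /lin /= m1; lra.
Qed.

Lemma kite_boundary m : lattice_points (boundary D) m <->
  m = (0, 0) \/ m = (0, n%:Z) \/ m = (1, k%:Z) \/ m = (-1, k%:Z).
Proof.
have -> : lattice_points (boundary D) m <-> lattice_points D m /\ ~ lattice_points (interior D) m.
  by rewrite /lattice_points /preimage /= /boundary kite_closure.
rewrite kite_interior kite_lattice; have nZ : 0 < n%:Z by lia.
case: m => x y /=; split.
  move=> [[[-> h]|[|] [-> ->]] ni]; [|by right; right; left|by right; right; right].
  have [->|y0] := eqVneq y 0; first by left.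
  have [->|yn] := eqVneq y n%:Z; first by right; left.
  by case: ni; split=> //; lia.
move=> [|[|[|]]] [-> ->]; split; try (by right; left); try (by right; right);
  try (by left; split=> //; lia); by move=> [] /=; lia.
Qed.

Definition slope (d : nat) : set Z2 := [set m | (d %| m.2 - k%:Z * m.1)%Z].

Lemma slope_index d : (0 < d)%N -> lattice_index (slope d) = d.
Proof.
move=> d0; rewrite /lattice_index.
have coset a : [set b | slope d (b - a)] = [set b | (b.2 - k%:Z * b.1 = a.2 - k%:Z * a.1 %[mod d])%Z].
  apply/seteqP; split=> b /=; rewrite /slope /= => h.
    by apply/eqP; rewrite eqz_mod_dvd; move: h; congr (_ %| _)%Z; ring.
  by move/eqP: h; rewrite eqz_mod_dvd; congr (_ %| _)%Z; ring.
pose f (i : nat) := [set b : Z2 | (b.2 - k%:Z * b.1 = i%:Z %[mod d])%Z].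
have -> : range (fun a : Z2 => [set b | slope d (b - a)]) = f @` `I_d.
  apply/seteqP; split=> X /=.
    move=> [a _ <-]; rewrite coset; exists `|(a.2 - k%:Z * a.1)%R %% d|%Z%N.
      by have := ltz_pmod (a.2 - k%:Z * a.1) (d := d); have := modz_ge0 (a.2 - k%:Z * a.1) (d := d); lia.
    rewrite /f gez0_abs ?modz_ge0 //; last by lia.
    by rewrite modz_mod.
  by move=> [i _ <-]; exists (0, i%:Z) => //; rewrite coset /= mulr0 subr0.
have fin : finite_set `I_d by exact: finite_II.
have inj : {in `I_d &, injective f}.
  move=> i j /set_mem /= hi /set_mem /= hj ff.
  have : f i (0, i%:Z) by rewrite /f /= mulr0 subr0.
  by rewrite ff /f /= mulr0 subr0 !modz_small; [case|lia|lia].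
by apply: card_fset_set; exact: inj_card_eq.
Qed.

Lemma slope_count d : (0 < d)%N -> (d %| n)%N -> interior_count D (slope d) = (n %/ d).-1.
Proof.
move=> d0 /dvdnP[m nE]; rewrite nE mulnK // /interior_count.
have -> : lattice_points (interior D) `&` slope d = (fun i : nat => (0, (i.+1 * d)%N%:Z) : Z2) @` `I_m.-1.
  apply/seteqP; split=> -[x y] /=.
    rewrite kite_interior nE /slope /= => -[[-> /andP[y0 yn]]]; rewrite mulr0 subr0 => /dvdzP[q qE].
    have q0 : 0 < q by nia.
    have qm : q < m%:Z by nia.
    exists `|q|.-1%N; first by lia.
    by congr pair; rewrite qE prednK ?absz_gt0 ?gt_eqF // PoszM gez0_abs // ltW.
  move=> [i im [<- <-]]; rewrite kite_interior nE /slope /= mulr0 subr0; split; last by rewrite PoszM dvdz_mull.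
  by split=> //; nia.
apply: card_fset_set; apply: inj_card_eq => i j _ _ [] /eqP.
by rewrite eqn_pmul2r // eqSS => /eqP.
Qed.

(** As (1, k) belongs to [M], the sublattice is determined by its points on the vertical axis, which
    form a subgroup generated by some d. The points (0, k + k') and (1, k) + (-1, k) give the two
    divisibilities. *)
Lemma admissible_slope g M : (0 < g)%N -> admissible_sublattice D g M ->
  exists d, [/\ M = slope d, (0 < d)%N, (d %| n)%N, (d %| 2 * k)%N & (g < n %/ d)%N].
Proof.
move=> g0 [[M0 MB] bd cnt].
have BE (x y x' y' : int) : ((x, y) : Z2) - (x', y') = (x - x', y - y') by [].
have DE (x y x' y' : int) : ((x, y) : Z2) + (x', y') = (x + x', y + y') by [].
have MN a : M a -> M (- a) by rewrite -sub0r; exact: MB.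
have MD a b : M a -> M b -> M (a + b) by move=> ha hb; rewrite -[b]opprK; apply: MB => //; exact: MN.
have vert m : m = (0, 0) \/ m = (0, n%:Z) \/ m = (1, k%:Z) \/ m = (-1, k%:Z) -> M m.
  by move/kite_boundary; rewrite -bd => -[].
have M1 : M (1, k%:Z) by apply: vert; right; right; left.
have M2 : M (-1, k%:Z) by apply: vert; right; right; right.
have Mn : M (0, n%:Z) by apply: vert; right; left.
have Mz x y (z : int) : M (x, y) -> M (x * z, y * z).
  move=> ha; have hn (i : nat) : M (x * i%:Z, y * i%:Z).
    elim: i => [|i ih]; first by rewrite !mulr0.
    by rewrite intS !mulrDr !mulr1; exact: MD ha ih.
  by case: (intP z) => [|i|i]; rewrite ?mulrN; [exact: (hn 0%N)|exact: hn|exact: MN (hn _)].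
have Ms m : M m <-> M (0, m.2 - k%:Z * m.1).
  have h : M (m.1, k%:Z * m.1) by have := @Mz _ _ m.1 M1; rewrite mul1r.
  case: m h => x y /= h; split=> h'; first by have := MB _ _ h' h; rewrite BE subrr.
  by have := MD _ _ h' h; rewrite DE add0r subrK.
have ex : exists i, (0 < i)%N && `[< M (0, i%:Z) >] by exists n; rewrite addn_gt0 k'0 orbT; apply/asboolP.
case: (ex_minnP ex) => d /andP[d0 /asboolP Md] dmin.
have dP (y : int) : M (0, y) <-> (d %| y)%Z.
  split=> [My|/dvdzP[q ->]]; last by have := @Mz _ _ q Md; rewrite mul0r mulrC.
  have Mr : M (0, (y %% d)%Z).
    have := MB _ _ My (@Mz _ _ (y %/ d)%Z Md); rewrite BE mul0r subrr.
    by rewrite {1}(divz_eq y d) mulrC addrAC subrr add0r.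
  have r0 : 0 <= (y %% d)%Z by apply: modz_ge0; lia.
  have rd : (y %% d)%Z < d%:Z by apply: ltz_pmod; lia.
  apply/dvdz_mod0P; apply/eqP; rewrite eq_le r0 andbT leNgt; apply/negP => rp.
  have := dmin `|(y %% d)%Z|%N; rewrite gez0_abs // absz_gt0 gt_eqF //= => /(_ (asboolT Mr)).
  lia.
have dn : (d %| n)%N by have /dP := Mn.
have ME : M = slope d by apply/seteqP; split=> m; rewrite Ms dP.
exists d; split=> //.
  have := MD _ _ M1 M2; rewrite DE subrr => /dP.
  by rewrite -PoszD addnn -mul2n.
by move: cnt; rewrite ME slope_count //; lia.
Qed.

Lemma sharp_labels g : (0 < g)%N -> exists L : seq (nat * nat),
  [/\ size L = sharp R k k' g, uniq L & forall d kappa, (d, kappa) \in L ->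
     [/\ (0 < d)%N, (d %| n)%N, (d %| 2 * k)%N, (g < n %/ d)%N &
         if odd d then [/\ kappa <= (n %/ d).-1 - g, kappa <= g & odd kappa = odd ((n %/ d).-1 - g)]%N
         else kappa = 0%N]].
Proof.
move=> g0; rewrite /sharp.
pose kap (M : set Z2) : seq nat := if odd (lattice_index M) then
  [seq i <- iota 0 (minn (delta_ D g M) g).+1 | i == delta_ D g M %[mod 2]] else [:: 0%N].
have kapE M : size (kap M) = multiplicity D g M.
  rewrite /kap /multiplicity; case: ifP => // _.
  by rewrite -(big_mkord (fun i => i == delta_ D g M %[mod 2]) (fun=> 1%N)) sum1_count /index_iota subn0 size_filter.
(* For an infinite support this list is empty by default; then the sum is 0 and the list of labels
   is empty as well. *)
set s := finite_support _ _ _.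
have su : uniq s by exact: finite_support_uniq.
have sP M : M \in s -> admissible_sublattice D g M.
  have [fin|inf] := pselect (finite_set (admissible_sublattice D g `&`
      (fun M => multiplicity D g M) @^-1` [set~ 0%N])).
    by rewrite /s in_finite_support // => /set_mem [].
  by rewrite /s no_finite_support.
have idxP M : M \in s -> exists d, [/\ M = slope d, (0 < d)%N, (d %| n)%N, (d %| 2 * k)%N & (g < n %/ d)%N].
  by move=> /sP /(admissible_slope g0).
exists (flatten [seq [seq (lattice_index M, i) | i <- kap M] | M <- s]); split.
- rewrite size_flatten /shape -map_comp sumnE big_map; apply: eq_bigr => M _.
  by rewrite /= size_map kapE.
- apply: (allpairs_uniq_dep su).
    move=> M _; rewrite /kap; case: ifP => // _; exact/filter_uniq/iota_uniq.
  move=> _ _ /allpairsPdep[M1 [i1 [M1s _ ->]]] /allpairsPdep[M2 [i2 [M2s _ ->]]] /= [].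
  have [d1 [E1 d10 _ _ _]] := idxP _ M1s; have [d2 [E2 d20 _ _ _]] := idxP _ M2s.
  by rewrite E1 E2 !slope_index // => -> ->.
move=> d kappa /allpairsPdep[M [i [Ms ik [-> ->]]]].
have [e [E e0 en ek ge]] := idxP _ Ms.
move: ik; rewrite /kap /delta_ E !slope_index // slope_count //; split=> //.
case: ifP ik => [_|_]; last by rewrite inE => /eqP.
rewrite mem_filter mem_iota add0n ltnS leq_min => /andP[/eqP par /andP[_ /andP[i1 i2]]]; split=> //.
by move: par; rewrite !modn2; case: (odd i); case: (odd _).
Qed.

End Kite.

(** * Laurent polynomials *)

Section LaurentPolynomials.
Variable F : fieldType.
Implicit Types (P Q S : {poly {poly F}}) (g h : laurent F) (m : Z2) (c : F).

Definition cz Q (i j : int) : F :=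
  if (0 <= i) && (0 <= j) then Q`_`|i|%N`_`|j|%N else 0.

Lemma cz_nat Q (i j : nat) : cz Q i j = Q`_i`_j. Proof. by []. Qed.

Lemma cz_inj P Q : (forall i j, cz P i j = cz Q i j) -> P = Q.
Proof. by move=> h; apply/polyP => i; apply/polyP => j; rewrite -!cz_nat. Qed.

Lemma cz_sum (I : Type) (r : seq I) (G : I -> {poly {poly F}}) i j :
  cz (\sum_(a <- r) G a) i j = \sum_(a <- r) cz (G a) i j.
Proof.
rewrite /cz; case: ifP => _; last by rewrite big1.
by rewrite coef_sum coef_sum.
Qed.

Definition monom c (a b : nat) : {poly {poly F}} := (c%:P * 'X^b)%:P * 'X^a.

Lemma cz_monomM c a b Q i j : cz (monom c a b * Q) i j = c * cz Q (i - a%:Z) (j - b%:Z).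
Proof.
rewrite /cz; case: i => i; last by rewrite /= ifF ?mulr0 //; lia.
case: j => j; last by rewrite andbF ifF ?mulr0 //; lia.
rewrite /= /monom -mulrA coefCM coefXnM.
case: ltnP => ia; first by rewrite mulr0 coef0 ifF ?mulr0 //; lia.
rewrite -mulrA coefCM coefXnM; case: ltnP => jb; first by rewrite mulr0 ifF ?mulr0 //; lia.
rewrite ifT; last by lia.
by rewrite !(distnEl,subzn) //.
Qed.

Lemma cz1 i j : cz 1 i j = ((i == 0) && (j == 0))%:R.
Proof.
rewrite /cz; case: i => i; last by [].
case: j => j; last by rewrite andbF; case: (Posz i == 0).
by rewrite /= !coefC; case: i => [|i] /=; rewrite ?coef0 ?coefC //; case: j.
Qed.

Lemma cz_monom c a b i j : cz (monom c a b) i j = c * ((i == a) && (j == b))%:R.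
Proof. by rewrite -[monom _ _ _]mulr1 cz_monomM cz1 !subr_eq0. Qed.

(** This says f = x^(-a) y^(-b) Q, with x the outer and y the inner variable of [Q]. *)
Definition lrepr (f : Z2 -> F) Q (a b : nat) : Prop :=
  forall m, f m = cz Q (m.1 + a%:Z) (m.2 + b%:Z).

Lemma repr_inj (f : Z2 -> F) P Q a b : lrepr f P a b -> lrepr f Q a b -> P = Q.
Proof.
move=> hP hQ; apply: cz_inj => i j.
by have := hP (i - a%:Z, j - b%:Z); rewrite hQ /= !subrK.
Qed.

Lemma repr_sum g a b :
    (forall m, m \in finsupp g -> 0 <= m.1 + a%:Z /\ 0 <= m.2 + b%:Z) ->
  lrepr g (\sum_(m <- finsupp g) monom (g m) (absz (m.1 + a%:Z)) (absz (m.2 + b%:Z))) a b.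
Proof.
move=> pos m; rewrite cz_sum.
have E m' : m' \in finsupp g -> cz (monom (g m') (absz (m'.1 + a%:Z)) (absz (m'.2 + b%:Z))) (m.1 + a%:Z) (m.2 + b%:Z) =
    if m' == m then g m else 0.
  move=> /pos [h1 h2]; rewrite cz_monom !gez0_abs //.
  have -> : (m.1 + a%:Z == m'.1 + a%:Z) && (m.2 + b%:Z == m'.2 + b%:Z) = (m' == m).
    by rewrite !(inj_eq (addIr _)) -pair_eqE /= eq_sym [m.2 == _]eq_sym.
  by case: eqP => [->|_]; rewrite ?mulr1 ?mulr0.
rewrite big_seq (eq_bigr _ E) -big_seq.
have [mi|mi] := boolP (m \in finsupp g).
  rewrite (bigD1_seq m) ?fset_uniq //= eqxx big1 ?addr0 // => m' /negPf -> //.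
rewrite -big_mkcond big1_seq => [|m' /andP[/eqP ->]]; last by rewrite (negPf mi).
by move: mi; rewrite mem_finsupp negbK => /eqP.
Qed.

Lemma repr_ex g : exists Q N, lrepr g Q N N.
Proof.
pose N := (\sum_(m <- finsupp g) (`|m.1|%N + `|m.2|%N))%N.
eexists; exists N; apply: repr_sum => m mi.
have : (`|m.1|%N + `|m.2|%N <= N)%N by rewrite /N (big_rem m) //= leq_addr.
by lia.
Qed.

Lemma repr_pos g Q a b m : lrepr g Q a b -> m \in finsupp g -> 0 <= m.1 + a%:Z /\ 0 <= m.2 + b%:Z.
Proof.
move=> h; rewrite mem_finsupp h /cz; case: ifP => [/andP[]|] //.
by rewrite eqxx.
Qed.

Lemma repr_expand g Q a b : lrepr g Q a b ->
  Q = \sum_(m <- finsupp g) monom (g m) (absz (m.1 + a%:Z)) (absz (m.2 + b%:Z)).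
Proof. by move=> h; apply: (repr_inj h); apply: repr_sum => m /(repr_pos h). Qed.

Lemma repr_laurent Q a b : exists g : laurent F, lrepr g Q a b.
Proof.
pose s := [seq (i%:Z - a%:Z, j%:Z - b%:Z) | i <- iota 0 (size Q), j <- iota 0 (\max_(i < size Q) size (Q`_i)%R)].
exists [fsfun m in [fset m | m in s]%fset => cz Q (m.1 + a%:Z) (m.2 + b%:Z) | 0] => m.
rewrite fsfunE; case: ifP => // /negbT; apply: contraNeq => h.
rewrite inE /=; move: h; rewrite /cz; case: ifP => [/andP[h1 h2] q0|]; last by rewrite eqxx.
apply/allpairsP; exists ((absz (m.1 + a%:Z)), (absz (m.2 + b%:Z))); split=> /=.
- rewrite mem_iota add0n leq0n /= ltnNge; apply: contraNN q0 => h.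
  by rewrite [Q`__]nth_default // coef0.
- rewrite mem_iota add0n leq0n /= ltnNge; apply: contraNN q0 => h.
  case: (ltnP (absz (m.1 + a%:Z)) (size Q)) => h'; last by rewrite [Q`__]nth_default // coef0.
  by rewrite nth_default //; apply: leq_trans h; exact: (leq_bigmax (Ordinal h')).
by rewrite !gez0_abs // !addrK; case: m {h1 h2 q0}.
Qed.

Lemma repr_mul g h Q S a b a' b' : lrepr g Q a b -> lrepr h S a' b' ->
  lrepr (lmul g h) (Q * S) (a + a') (b + b').
Proof.
move=> hg hh m; rewrite (repr_expand hg) mulr_suml cz_sum /lmul.
rewrite big_seq [RHS]big_seq; apply: eq_bigr => m' /(repr_pos hg) [h1 h2].
rewrite cz_monomM hh !gez0_abs //; congr (_ * cz _ _ _); rewrite PoszD /=; ring.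
Qed.

Section Evaluation.
Variables (K : fieldType) (iota : {rmorphism F -> K}) (x y : K).

Definition ev2 : {rmorphism {poly {poly F}} -> K} :=
  (horner_eval x \o map_poly (horner_eval y \o map_poly iota)).

Lemma ev2C A : ev2 A%:P = ev iota y A.
Proof. by rewrite /= map_polyC /= /horner_eval hornerC. Qed.

Lemma ev2X : ev2 'X = x.
Proof. by rewrite /= map_polyX /horner_eval hornerX. Qed.

Lemma ev2_monom c a b : ev2 (monom c a b) = iota c * x ^+ a * y ^+ b.
Proof.
rewrite rmorphM rmorphXn ev2X ev2C /ev rmorphM /= map_polyXn map_polyC /=.
by rewrite hornerM hornerC hornerXn mulrAC.
Qed.

Lemma repr_leval g Q a b : x != 0 -> y != 0 -> lrepr g Q a b ->
  leval iota x y g * x ^+ a * y ^+ b = ev2 Q.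
Proof.
move=> x0 y0 h; rewrite (repr_expand h) rmorph_sum /leval !mulr_suml.
rewrite big_seq [RHS]big_seq; apply: eq_bigr => m /(repr_pos h) [h1 h2].
rewrite ev2_monom !exprnP !gez0_abs // !expfzDr //.
by ring.
Qed.

End Evaluation.
End LaurentPolynomials.

(** * Laurent polynomials supported on a kite *)

Section KitePolynomial.
Variables (F : fieldType) (n k : nat) (a b : F) (p : {poly F}).

Definition kite_coef (m : Z2) : F :=
  if m == (1, k%:Z) then a else if m == (-1, k%:Z) then b
  else if (m.1 == 0) && (0 <= m.2) then p`_(absz m.2) else 0.

Lemma kite_coef0 j : kite_coef (0, j%:Z) = p`_j.
Proof. by rewrite /kite_coef !xpair_eqE. Qed.

Lemma kite_coef1 : kite_coef (1, k%:Z) = a.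
Proof. by rewrite /kite_coef eqxx. Qed.

Lemma kite_coefN1 : kite_coef (-1, k%:Z) = b.
Proof. by rewrite /kite_coef eqxx xpair_eqE. Qed.

Variable f : laurent F.
Hypothesis fE : forall m, f m = kite_coef m.

Lemma kite_sum (V : nmodType) (G : Z2 -> V) : (size p <= n.+1)%N ->
    (forall m, f m = 0 -> G m = 0) ->
  \sum_(m <- finsupp f) G m =
    G (1, k%:Z) + G (-1, k%:Z) + \sum_(j < n.+1) G (0, j%:Z).
Proof.
move=> sp G0; have [T TE] : exists T : seq Z2, T = [seq (0, j%:Z) | j <- iota 0 n.+1] by eexists.
pose L : seq Z2 := (1, k%:Z) :: (-1, k%:Z) :: T.
have uL : uniq L.
  rewrite /L /= inE xpair_eqE /= TE map_inj_uniq ?iota_uniq ?andbT; last by move=> i j [].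
  by apply/andP; split; apply/negP => /seq.mapP[j _ /eqP]; rewrite xpair_eqE.
have LE : \sum_(m <- L) G m = G (1, k%:Z) + G (-1, k%:Z) + \sum_(j < n.+1) G (0, j%:Z).
  by rewrite /L !big_cons TE big_map addrA -(big_mkord xpredT (fun j => G (0, j%:Z))) /index_iota subn0.
rewrite -LE [RHS](bigID (fun m => m \in finsupp f)) /= [X in _ = _ + X]big1 ?addr0; last first.
  by move=> m; rewrite mem_finsupp negbK => /eqP; exact: G0.
rewrite -[RHS]big_filter; apply: perm_big; apply: uniq_perm; rewrite ?filter_uniq ?fset_uniq // => m.
rewrite mem_filter mem_finsupp; apply/esym/andb_idr; rewrite fE /kite_coef /L !inE.
case: (m == (1, _)) => //=; case: (m == (-1, _)) => //=.
case: ifP => [/andP[/eqP m1 m2] pj|_]; last by rewrite eqxx.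
rewrite TE; apply/seq.mapP; exists (absz m.2); last by case: m m1 m2 {pj} => x y /= -> h; rewrite gez0_abs.
by rewrite mem_iota /= add0n; apply: leq_trans sp; rewrite ltnNge; apply: contraNN pj => /(nth_default _) ->.
Qed.

(** The polynomial x f, of degree 2 in x: the shift by 1 clears the denominator x. *)
Definition kite_poly : {poly {poly F}} := monom a 2 k + monom b 0 k + p%:P * 'X.

Lemma kite_repr : lrepr f kite_poly 1 0.
Proof.
move=> m; rewrite fE /kite_poly /kite_coef.
have D P Q i j : cz (P + Q) i j = cz P i j + cz Q i j :> F.
  by rewrite /cz; case: ifP => _; rewrite ?addr0 // !coefD.
have CX i j : cz (p%:P * 'X) i j = if (i == 1) && (0 <= j) then p`_(absz j) else 0.
  rewrite /cz; case: i => i; last by [].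
  case: j => j; last by rewrite /= !andbF.
  by rewrite /= andbT coefCM coefX eqz_nat; case: eqP; rewrite ?mulr1 ?mulr0 ?coef0.
rewrite !D !cz_monom CX addr0; case: m => x y; rewrite !xpair_eqE /=.
have [->|y0] := eqVneq y k%:Z; rewrite ?andbT ?andbF ?mulr0 ?add0r.
  have [->|x1] := eqVneq x 1; first by rewrite /= mulr1 mulr0 !addr0.
  have [->|x2] := eqVneq x (-1); first by rewrite /= mulr1 mulr0 add0r addr0.
  have -> : (x + 1 == 2) = false by lia.
  have -> : (x + 1 == 0) = false by lia.
  have -> : (x + 1 == 1) = (x == 0) by lia.
  by rewrite !mulr0 !add0r.
by have -> : (x + 1 == 1) = (x == 0) by lia.
Qed.

Hypotheses (a0 : a != 0) (b0 : b != 0).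

Lemma monom_neq0 (c : F) i j : c != 0 -> monom c i j != 0.
Proof. by move=> c0; rewrite mulf_neq0 ?polyC_eq0 ?mulf_neq0 ?polyC_eq0 // -size_poly_eq0 size_polyXn. Qed.

Let low_ex (A : idomainType) (P : {poly A}) : P != 0 -> exists e P1, P = 'X^e * P1 /\ P1`_0 != 0.
Proof.
elim: (size P).+1 {-2}P (ltnSn (size P)) => // N IH Q sQ Q0.
have [q0|q0] := eqVneq Q`_0 0; last by exists 0%N, Q; rewrite mul1r.
have QE : Q = 'X * \poly_(i < (size Q).-1) Q`_i.+1.
  apply/polyP => -[|i]; rewrite coefXM //= coef_poly.
  by case: ltnP => // h; rewrite nth_default // -ltnS; case: (size Q) h => // m; rewrite ltnS.
have Q1 : \poly_(i < (size Q).-1) Q`_i.+1 != 0 by apply: contraNneq Q0 => E; rewrite QE E mulr0.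
have [|e [P1 [E h]]] := IH _ _ Q1.
  apply: leq_ltn_trans (size_poly _ _) _; move: sQ Q0; rewrite -size_poly_eq0.
  by move: (size Q) => u; lia.
by exists e.+1, P1; rewrite QE E mulrA -exprS.
Qed.

Let low_uniq (A : idomainType) (P Q : {poly A}) i j :
  P`_0 != 0 -> Q`_0 != 0 -> 'X^i * P = 'X^j * Q -> P = Q.
Proof.
have X0 e : 'X^e != 0 :> {poly A} by rewrite -size_poly_eq0 size_polyXn.
have hlp (P' Q' : {poly A}) i' j' : (i' <= j')%N -> P'`_0 != 0 -> 'X^i' * P' = 'X^j' * Q' -> P' = Q'.
  move=> ij P0; rewrite -(subnKC ij) exprD -mulrA => /(mulfI (X0 _)) E; move: P0; rewrite E.
  by case: (j' - i')%N => [|e]; [rewrite expr0 mul1r|rewrite exprS -mulrA coefXM /= eqxx].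
move=> P0 Q0 E; case/orP: (leq_total i j) => h; first exact: hlp h P0 E.
by apply/esym; exact: hlp h Q0 (esym E).
Qed.

Lemma kite_poly_size : size kite_poly = 3%N.
Proof.
have H : kite_poly`_2 != 0.
  rewrite /kite_poly /monom !coefD !coefCM coefX !coefXn /= mulr1 !mulr0 !addr0.
  by rewrite mulf_neq0 ?polyC_eq0 // -size_poly_eq0 size_polyXn.
apply/eqP; rewrite eqn_leq; apply/andP; split; last first.
  by rewrite ltnNge; apply: contraNN H => /(nth_default _) ->.
rewrite /kite_poly /monom; apply: leq_trans (size_polyD _ _) _; rewrite geq_max; apply/andP; split.
  apply: leq_trans (size_polyD _ _) _; rewrite geq_max; apply/andP; split.
    by rewrite mul_polyC; apply: leq_trans (size_scale_leq _ _) _; rewrite size_polyXn.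
  by rewrite mul_polyC; apply: leq_trans (size_scale_leq _ _) _; rewrite size_polyXn.
by rewrite mul_polyC; apply: leq_trans (size_scale_leq _ _) _; rewrite size_polyX.
Qed.

Let kp_0 : kite_poly`_0 != 0.
Proof.
rewrite /kite_poly /monom !coefD !coefCM coefX !coefXn /= mulr1 !mulr0 add0r addr0.
by rewrite mulf_neq0 ?polyC_eq0 // -size_poly_eq0 size_polyXn.
Qed.

Lemma repr_shift (g : Z2 -> F) Q i j c d : lrepr g Q i j -> lrepr g (monom 1 c d * Q) (i + c) (j + d).
Proof.
move=> h m; rewrite cz_monomM mul1r h; congr cz; rewrite PoszD; ring.
Qed.

(* A multiple of [f] has width at least 2 in the direction of x. *)
Lemma ldvd_width (g : laurent F) Q i j : ldvd f g -> lrepr g Q i j -> (size Q <= 2)%N -> Q = 0.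
Proof.
move=> [q qE] gQ sQ; have [S [N qS]] := repr_ex q.
have gS : lrepr g (S * kite_poly) (N + 1) N.
  by move=> m; rewrite qE (repr_mul qS kite_repr) addn0.
have E : monom 1 (N + 1) N * Q = monom 1 i j * (S * kite_poly).
  apply: (@repr_inj _ g); first exact: repr_shift gQ.
  by rewrite addnC [(j + N)%N]addnC; exact: repr_shift gS.
apply/eqP; case: eqVneq => // Q0.
have S0 : S != 0.
  by apply: contraNneq Q0 => S0; move/eqP: E; rewrite S0 mul0r mulr0 mulf_eq0 (negPf (monom_neq0 _ _ (oner_neq0 _))).
have [e [Q1 [QE Q10]]] := low_ex Q0; have [d [S1 [SE S10]]] := low_ex S0.
have Y0 e' : ('X^e' : {poly F})%:P != 0 :> {poly {poly F}} by rewrite polyC_eq0 -size_poly_eq0 size_polyXn.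
have E' : 'X^(N + 1 + e) * (('X^N)%:P * Q1) = 'X^(i + d) * (('X^j)%:P * (S1 * kite_poly)).
  transitivity (monom 1 (N + 1) N * Q); first by rewrite QE /monom mul1r exprD; ring.
  by rewrite E SE /monom mul1r exprD; ring.
have {E'} := low_uniq _ _ E'.
have Y1 e' : ('X^e' : {poly F}) != 0 by rewrite -size_poly_eq0 size_polyXn.
rewrite !coefCM coef0M !mulf_neq0 // => /(_ isT isT) /(congr1 (size \o val)) /=.
have sz e' (P : {poly {poly F}}) : size (('X^e')%:P * P) = size P.
  by rewrite mul_polyC size_scale.
have S10' : S1 != 0 by apply: contraNneq S10 => ->; rewrite coef0.
have sQ1 : (size Q1 <= 2)%N.
  apply: leq_trans sQ; rewrite QE; have [->|q1] := eqVneq Q1 0; first by rewrite size_poly0.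
  by rewrite mulrC size_mulXn // leq_addl.
change (size (('X^N)%:P * Q1) = size (('X^j)%:P * (S1 * kite_poly)) -> false = true).
rewrite !sz size_mul //; last by rewrite -size_poly_eq0 kite_poly_size.
rewrite kite_poly_size; move: S10'; rewrite -size_poly_gt0; move: sQ1.
by move: (size Q1) (size S1) => u v; lia.
Qed.

Section FunctionField.
Variables (K : fieldType) (iota : {rmorphism F -> K}) (x y : K).
Hypothesis FF : (forall g, leval iota x y g = 0 <-> ldvd f g).
Hypotheses (x0 : x != 0) (y0 : y != 0).
Local Notation ev := (ev iota y).

Lemma ff_free A B : ev A + ev B * x = 0 -> A = 0 /\ B = 0.
Proof.
move=> E; have [g gQ] := repr_laurent (A%:P + B%:P * 'X) 0 0.
have g0 : leval iota x y g = 0.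
  by have := repr_leval iota x0 y0 gQ; rewrite !expr0 !mulr1 => ->; rewrite rmorphD rmorphM ev2C ev2X ev2C.
have s2 : (size (A%:P + B%:P * 'X : {poly {poly F}})%R <= 2)%N.
  apply: leq_trans (size_polyD _ _) _; rewrite geq_max; apply/andP; split.
    by apply: leq_trans (size_polyC_leq1 _) _.
  by rewrite mul_polyC; apply: leq_trans (size_scale_leq _ _) _; rewrite size_polyX.
have := ldvd_width ((FF g).1 g0) gQ s2.
move=> E0; split.
  by have := congr1 (fun P : {poly {poly F}} => P`_0) E0; rewrite coefD coefC coefCM coefX mulr0 addr0 coef0.
by have := congr1 (fun P : {poly {poly F}} => P`_1) E0; rewrite coefD coefC coefCM coefX mulr1 add0r coef0.
Qed.

Lemma ev2_kite : ev2 iota x y kite_poly =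
  iota a * x ^+ 2 * y ^+ k + iota b * y ^+ k + ev p * x.
Proof. by rewrite !rmorphD !ev2_monom rmorphM ev2C ev2X mulr1. Qed.

Lemma ff_root : iota a * x ^+ 2 * y ^+ k + iota b * y ^+ k + ev p * x = 0.
Proof.
have f0 : leval iota x y f = 0.
  apply: (FF f).2; have [q q1] := @repr_laurent F 1 0 0; exists q => m.
  by rewrite (repr_mul q1 kite_repr) mul1r kite_repr.
by rewrite -ev2_kite -(repr_leval iota x0 y0 kite_repr) f0 !mul0r.
Qed.

End FunctionField.
End KitePolynomial.

(** * The hyperelliptic model of a kite curve *)

Section QuadraticExtension.
Variables (F K : fieldType) (iota : {rmorphism F -> K}) (y s : K) (h : {poly F}).
Local Notation ev := (ev iota y).
Hypothesis sq : s ^+ 2 = ev h.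
Hypothesis free : forall A B, ev A + ev B * s = 0 -> A = 0 /\ B = 0.

Definition in_quad (z : K) : Prop :=
  exists A B D, D != 0 /\ z * ev D = ev A + ev B * s.

Let ev_neq0 D : D != 0 -> ev D != 0.
Proof.
by move=> D0; apply: contraNneq D0 => E; apply/eqP; apply: (@free D 0 _).1; rewrite E ev0 mul0r addr0.
Qed.

Lemma quad_e A B : in_quad (ev A + ev B * s).
Proof. by exists A, B, 1; rewrite oner_neq0 ev1 mulr1. Qed.

Lemma quad_ev A : in_quad (ev A).
Proof. by have := quad_e A 0; rewrite ev0 mul0r addr0. Qed.

Lemma quad_s : in_quad s.
Proof. by have := quad_e 0 1; rewrite ev0 ev1 mul1r add0r. Qed.

Lemma quadD z z' : in_quad z -> in_quad z' -> in_quad (z + z').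
Proof.
move=> [A [B [D [D0 E]]]] [A' [B' [D' [D0' E']]]].
exists (A * D' + A' * D), (B * D' + B' * D), (D * D'); rewrite mulf_neq0 //; split=> //.
rewrite !evD !evM mulrDl mulrA E [z' * _]mulrCA E'; ring.
Qed.

Lemma quadM z z' : in_quad z -> in_quad z' -> in_quad (z * z').
Proof.
move=> [A [B [D [D0 E]]]] [A' [B' [D' [D0' E']]]].
exists (A * A' + B * B' * h), (A * B' + B * A'), (D * D'); rewrite mulf_neq0 //; split=> //.
rewrite !evD !evM -sq mulrACA E E'; ring.
Qed.

Lemma quadV z : in_quad z -> in_quad z^-1.
Proof.
have [->|z0] := eqVneq z 0; first by rewrite invr0.
move=> [A [B [D [D0 E]]]]; exists (D * A), (- (D * B)), (A ^+ 2 - h * B ^+ 2).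
have nE : ev (A ^+ 2 - h * B ^+ 2) = (ev A + ev B * s) * (ev A - ev B * s).
  by rewrite evD evN evM !evX_n -sq; ring.
have w0 : ev A + ev B * s != 0 by rewrite -E mulf_neq0 // ev_neq0.
split; last by rewrite nE mulrA -E mulKf // evN !evM; ring.
apply: contraNneq w0 => N0; move/eqP: nE; rewrite N0 ev0 eq_sym mulf_eq0 => /orP[//|/eqP].
rewrite -mulNr -evN => /free [-> /eqP]; rewrite oppr_eq0 => /eqP ->.
by rewrite !ev0 mul0r addr0.
Qed.

Lemma quad_pow z (i : int) : in_quad z -> in_quad (z ^ i).
Proof.
move=> hz; have H (j : nat) : in_quad (z ^+ j).
  elim: j => [|j ih]; first by rewrite expr0 -(ev1 iota y); exact: quad_ev.
  by rewrite exprS; exact: quadM.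
by case: i => j; [exact: H|rewrite NegzE -exprnN; exact/quadV/H].
Qed.

Lemma quad_leval x g : in_quad x -> in_quad (leval iota x y g).
Proof.
move=> hx; rewrite /leval; elim/big_ind: _; [by rewrite -(ev0 iota y); exact: quad_ev|exact: quadD|].
move=> m _; apply: quadM; last by apply: quad_pow; rewrite -(evX iota y); exact: quad_ev.
by apply: quadM; [rewrite -(evC iota y); exact: quad_ev|exact: quad_pow].
Qed.

End QuadraticExtension.

(** All multiplicities are at most 2, and [sg] collects the double roots. The last clause records
    that [sg] has simple roots, in the form that yields divisibility. *)
Lemma cube_free_decomposition (F : closedFieldType) (P : {poly F}) : P != 0 ->
    (forall r, root P r -> root P^`() r -> ~~ root P^`(2) r) ->
  exists sg h, [/\ P = sg ^+ 2 * h, sg \is monic,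
    forall r, root (sg * h) r -> ~~ root (sg * h)^`() r &
    forall w, (forall r, root sg r -> root w r) -> sg %| w].
Proof.
move=> P0 tri; have [rs PE] := closed_field_poly_normal P.
have l0 : lead_coef P != 0 by rewrite lead_coef_eq0.
have rem_prod z (r : seq F) : z \in r ->
    \prod_(u <- r) ('X - u%:P) = ('X - z%:P) * \prod_(u <- rem z r) ('X - u%:P).
  by move=> zr; rewrite (big_rem z).
have cnt z : (count_mem z rs <= 2)%N.
  rewrite leqNgt; apply/negP => c3.
  have m1 : z \in rs by rewrite -has_pred1 has_count; lia.
  have m2 : z \in rem z rs by rewrite -has_pred1 has_count count_mem_rem eqxx; lia.
  have m3 : z \in rem z (rem z rs) by rewrite -has_pred1 has_count !count_mem_rem eqxx; lia.
  move: PE; rewrite (rem_prod _ _ m1) (rem_prod _ _ m2) (rem_prod _ _ m3).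
  set Q := \prod_(_ <- _) _ => PE.
  have E : P = ('X - z%:P) ^+ 3 * (lead_coef P *: Q) by rewrite {1}PE -!mul_polyC; ring.
  have r0 : root P z by rewrite E rootM root_exp_XsubC eqxx.
  have r1 : root P^`() z.
    by rewrite E derivM deriv_exp /root !hornerE /= subrr !(expr0n, mul0r, mulr0, mul0rn, addr0).
  have := tri _ r0 r1; rewrite E !derivnS derivn0 !(derivM, derivD, deriv_exp, derivMn, derivXsubC) /root.
  by rewrite !hornerE /= subrr !(expr0n, mul0r, mulr0, mul0rn, addr0) eqxx.
pose d z := count_mem z rs == 2; pose us := undup rs.
pose sg := \prod_(z <- [seq z <- us | d z]) ('X - z%:P).
pose h := lead_coef P *: \prod_(z <- [seq z <- us | ~~ d z]) ('X - z%:P).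
have sghE : sg * h = lead_coef P *: \prod_(z <- us) ('X - z%:P).
  by rewrite /h -scalerAr /sg !big_filter [in RHS](bigID d).
have uus : uniq us by exact: undup_uniq.
exists sg, h; split.
- rewrite expr2 -mulrA sghE PE -scalerAr lead_coefZ lead_coef_prod_XsubC mulr1; congr (_ *: _).
  rewrite -prodr_undup_exp_count -/us /sg big_filter [X in X * _]big_mkcond -big_split /=.
  rewrite big_seq [RHS]big_seq; apply: eq_bigr => z; rewrite mem_undup => zr.
  have : (0 < count_mem z rs)%N by rewrite -has_count has_pred1.
  have := cnt z; rewrite /d; case: eqP => [-> _ _|]; first by rewrite expr2.
  by case: (count_mem z rs) => [|[|[|]]] //; rewrite mul1r.
- exact: monic_prod_XsubC.
- move=> r; rewrite sghE derivZ !rootZ // root_prod_XsubC => ru.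
  rewrite (rem_prod _ _ ru) derivM derivXsubC mul1r /root hornerD hornerM !hornerXsubC subrr mul0r addr0.
  by rewrite -/(root _ _) root_prod_XsubC mem_rem_uniq // inE eqxx.
- move=> w H; apply: uniq_roots_dvdp; last by rewrite uniq_rootsE filter_uniq.
  apply/allP => z zs; apply: H; by rewrite root_prod_XsubC.
Qed.

Section KiteModel.
Variables (F : numClosedFieldType) (n k : nat) (a b : F) (p : {poly F}).
Hypotheses (a0 : a != 0) (b0 : b != 0).

(** At a common root of the discriminant and its derivative, p (X p' - k p) vanishes. This produces
    [tau], and it relates triple roots of the discriminant to degenerate singular points. *)
Lemma kite_deriv :
  'X * (p ^+ 2 - (4%:R * (a * b)) *: 'X^(2 * k))^`() -
    (2 * k)%:R * (p ^+ 2 - (4%:R * (a * b)) *: 'X^(2 * k)) =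
  2%:R * p * ('X * p^`() - k%:R * p).
Proof.
rewrite derivB derivZ expr2 derivM derivXn -[_ *+ (2 * k)]scaler_nat.
have E : 'X * ((2 * k)%:R *: 'X^((2 * k).-1)) = (2 * k)%:R * 'X^(2 * k) :> {poly F}.
  case: k => [|k']; first by rewrite muln0 scale0r mulr0 mul0r.
  by rewrite -scalerAr -exprS prednK // ?mulnS // scaler_nat mulr_natl.
rewrite mulrBr -['X * (_ *: (_ *: _))]scalerAr E -!mul_polyC natrM; ring.
Qed.

Section Hyper.
Variables (K : fieldType) (iota : {rmorphism F -> K}) (x y : K) (sg h : {poly F}).
Local Notation ev := (ev iota y).
Hypotheses (x0 : x != 0) (y0 : y != 0).
Hypothesis free : forall A B, ev A + ev B * x = 0 -> A = 0 /\ B = 0.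
Hypothesis root : iota a * x ^+ 2 * y ^+ k + iota b * y ^+ k + ev p * x = 0.
Hypothesis frac : forall z, exists g h : laurent F,
  leval iota x y h != 0 /\ z = leval iota x y g / leval iota x y h.
Hypotheses (sg0 : sg != 0)
  (PE : p ^+ 2 - (4%:R * (a * b)) *: 'X^(2 * k) = sg ^+ 2 * h).

(** Completing the square in the quadratic equation of x: the numerator is a square root of the
    discriminant sg^2 h. *)
Let s := (2%:R * iota a * x * y ^+ k + ev p) / ev sg.

Let ev_neq0 D : D != 0 -> ev D != 0.
Proof.
by move=> D0; apply: contraNneq D0 => E; apply/eqP; apply: (@free D 0 _).1; rewrite E ev0 mul0r addr0.
Qed.

Lemma kite_hyper : hyper iota y s h.
Proof.
have sg0' := ev_neq0 sg0.
have ssg : s * ev sg = 2%:R * iota a * x * y ^+ k + ev p by rewrite divfK.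
have sq : s ^+ 2 = ev h.
  apply: (mulfI (expf_neq0 2 sg0')); rewrite -{2}evX_n -evM -PE -exprMn mulrC ssg.
  rewrite evD evN evZ !evX_n evX rmorphM rmorph_nat rmorphM [(2 * k)%N]mulnC exprM.
  have := congr1 (fun z => 4%:R * iota a * y ^+ k * z) root; rewrite mulr0 => E.
  by apply/eqP; rewrite -subr_eq0 -[X in _ == X]E; apply/eqP; ring.
have fr A B : ev A + ev B * s = 0 -> A = 0 /\ B = 0.
  move=> E; have : ev (A * sg + B * p) + ev ((2%:R * a) *: (B * 'X^k)) * x = 0.
    rewrite evD evZ !evM evX_n evX rmorphM rmorph_nat.
    have E' : ev A * ev sg + ev B * (s * ev sg) = 0 by rewrite mulrA -mulrDl E mul0r.
    by rewrite -[RHS]E' ssg; ring.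
  move=> /free [E1 /eqP]; have X0 : 'X^k != 0 :> {poly F} by rewrite -size_poly_eq0 size_polyXn.
  rewrite scaler_eq0 !mulf_eq0 (negPf a0) pnatr_eq0 (negPf X0) /= orbF => /eqP B0.
  by move/eqP: E1; rewrite B0 mul0r addr0 mulf_eq0 (negPf sg0) orbF => /eqP.
have c0 : ev ((2%:R * a) *: 'X^k) != 0.
  by apply: ev_neq0; rewrite -size_poly_eq0 size_scale ?size_polyXn // mulf_neq0 ?pnatr_eq0.
have hx : in_quad iota y s x.
  have -> : x = (s * ev sg + ev (- p)) * (ev ((2%:R * a) *: 'X^k))^-1.
    apply: (mulIf c0); rewrite divfK // ssg evN addrK evZ evX_n evX rmorphM rmorph_nat; ring.
  apply: (quadM sq); last by apply: (quadV sq fr); exact: quad_ev.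
  by apply: quadD; [apply: (quadM sq); [exact: quad_s|exact: quad_ev]|exact: quad_ev].
split=> // z; have [u [v [v0 ->]]] := frac z.
by apply: (quadM sq); [|apply: (quadV sq fr)]; exact: (quad_leval sq fr).
Qed.

End Hyper.

Section Genus.
Variables (K : fieldType) (iota : {rmorphism F -> K}) (x y : K) (f : laurent F).
Hypotheses (fE : forall m, f m = kite_coef k a b p m) (FF : [/\ x != 0, y != 0,
  forall g, leval iota x y g = 0 <-> ldvd f g & forall z, exists g h : laurent F,
    leval iota x y h != 0 /\ z = leval iota x y g / leval iota x y h]).
Variable g : nat.

Let hyp sg h : sg != 0 -> p ^+ 2 - (4%:R * (a * b)) *: 'X^(2 * k) = sg ^+ 2 * h ->
  exists s, hyper iota y s h.
Proof.
case: FF => x0 y0 ker frac sg0 E; eexists; apply: (@kite_hyper _ _ x y sg h) => //.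
  exact: (ff_free fE a0 b0 ker).
exact: (ff_root fE ker).
Qed.

Lemma kite_genus sg h tau : pell n k g p (a * b) sg h tau -> has_genus iota g.
Proof.
move=> H; have [s hs] := hyp (monic_neq0 (pell_monic H)) (pell_eq H).
apply: (hyperelliptic_genus hs (pell_size_h H)) => c hc.
have := pell_sep H (r := c); rewrite /root hornerM hc mulr0 eqxx => /(_ isT).
by rewrite derivM hornerD !hornerM hc mulr0 add0r; apply: contraNneq => ->; rewrite mulr0.
Qed.

(** The discriminant has degree 2 n, so [h] has even degree 2 j + 2, and the genus of the function
    field identifies j with g. *)
Lemma kite_pell : (k < n)%N -> size p = n.+1 -> ((0 < k)%N -> p.[0] != 0) ->
    let P := p ^+ 2 - (4%:R * (a * b)) *: 'X^(2 * k) in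
    (forall r, root P r -> root P^`() r -> ~~ root P^`(2) r) -> has_genus iota g ->
  (g < n)%N /\ exists sg h tau, pell n k g p (a * b) sg h tau.
Proof.
move=> kn sp p0 P tri gen.
have pn0 : p != 0 by rewrite -size_poly_eq0 sp.
have sP : size P = (2 * n).+1.
  have s2 : size (p ^+ 2) = (2 * n).+1 by rewrite expr2 size_mul // sp; lia.
  rewrite /P size_polyDl s2 // size_polyN; apply: leq_ltn_trans (size_scale_leq _ _) _.
  by rewrite size_polyXn; lia.
have P0 : P != 0 by rewrite -size_poly_eq0 sP.
have [sg [h [PE msg sep dv]]] := cube_free_decomposition P0 tri.
have sg0 := monic_neq0 msg.
have h0 : h != 0 by apply: contraNneq P0 => h0; rewrite PE h0 mulr0.
have [s hs] := hyp sg0 PE.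
have szs : (2 * (size sg).-1 + size h = (2 * n).+1)%N.
  move: sP; rewrite PE expr2 !size_mul ?mulf_neq0 //; move: sg0 h0; rewrite -!size_poly_gt0.
  by move: (size sg) (size h) => u v; lia.
(* A constant [h] would make [s] a constant, [F] being algebraically closed, against the
   independence of 1 and s. *)
have h1 : size h != 1%N.
  apply/negP => /size_poly1P [c c0 hc]; have := hyper_sq hs; rewrite hc evC => sc.
  have [mu muE] : exists mu, c = mu ^+ 2 by exists (sqrtC c); rewrite sqrtCK.
  move: sc; rewrite muE rmorphXn => /eqP; rewrite eqf_sqr => /orP[]/eqP sE.
    have /(hyper_free hs)[_] : ev iota y (- mu%:P) + ev iota y 1 * s = 0.
      by rewrite evN evC ev1 sE mul1r addNr.
    by move/eqP; rewrite oner_eq0.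
  have /(hyper_free hs)[_] : ev iota y (mu%:P) + ev iota y 1 * s = 0.
    by rewrite evC ev1 sE mul1r subrr.
  by move/eqP; rewrite oner_eq0.
have [j hj] : exists j, size h = (2 * j).+3.
  move: szs h1; move: (size sg) (size h) => u v szs v1.
  by exists (n - u.-1 - 1)%N; lia.
have jg : j = g.
  apply: (has_genus_unique _ gen); apply: (hyperelliptic_genus hs hj) => c hc.
  have := sep c; rewrite /root hornerM hc mulr0 eqxx => /(_ isT).
  by rewrite derivM hornerD !hornerM hc mulr0 add0r; apply: contraNneq => ->; rewrite mulr0.
have sg1 : (0 < size sg)%N by rewrite size_poly_gt0.
split; first by move: szs sg1; rewrite hj jg; move: (size sg) => u; lia.
have root_p r : root sg r -> p.[r] != 0.
  move=> sr; have Pr : P.[r] = 0 by rewrite PE hornerM horner_exp (rootP sr) expr0n mul0r.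
  apply/eqP => pr; move/eqP: Pr; rewrite /P hornerD hornerN hornerZ horner_exp hornerXn pr expr0n sub0r oppr_eq0.
  rewrite !mulf_eq0 (negPf a0) (negPf b0) pnatr_eq0 /= expf_eq0 => /andP[k0 /eqP r0].
  have k1 : (0 < k)%N by lia.
  by move: pr (p0 k1); rewrite r0 => ->; rewrite eqxx.
(* At a root of [sg] both the discriminant and its derivative vanish, and p does not; apply
   [kite_deriv]. *)
have /dvdpP [tau tauE] : sg %| 'X * p^`() - k%:R * p.
  apply: dv => r sr; have pr := root_p r sr.
  have Pr : P.[r] = 0 by rewrite PE hornerM horner_exp (rootP sr) expr0n mul0r.
  have Pr' : P^`().[r] = 0.
    by rewrite PE derivM expr2 derivM hornerD !hornerM !hornerD !hornerM (rootP sr) !(mul0r, mulr0, addr0).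
  have : (2%:R * p * ('X * p^`() - k%:R * p)).[r] = 0.
    by rewrite -kite_deriv -/P hornerD hornerN (hornerM 'X) (hornerM (2 * k)%:R) Pr Pr' !mulr0 subr0.
  rewrite (hornerM (2%:R * p)) (hornerM 2%:R) -[2%:R]polyC_natr hornerC => /eqP.
  by rewrite !mulf_eq0 (negPf pr) pnatr_eq0.
exists sg, h, tau; split=> //; first by rewrite mulf_neq0.
- by move: szs; rewrite hj jg; move: sg1; move: (size sg) => u; lia.
- by rewrite hj jg.
- by rewrite tauE mulrC.
Qed.

End Genus.
End KiteModel.

(** * Function fields of kite curves *)

Lemma fractionP (A : idomainType) (x : {fraction A}) :
  exists u v : A, v != 0 /\ x * FracField.tofrac v = FracField.tofrac u.
Proof.
elim/generic_quotient.quotW: x => f; exists (val f).1, (val f).2; split; first exact: denom_ratioP.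
rewrite -[_ * _]/(FracField.mul _ _) !generic_quotient.piE; apply/generic_quotient.eqmodP => /=.
by rewrite FracField.equivfE /FracField.mulf !numden_Ratio ?mulr1 ?oner_neq0 ?denom_ratioP // mulrC.
Qed.

(** Descent: both [u] and [v] vanish at r, and a factor can be cancelled from each. *)
Lemma not_square (F : fieldType) (h u v : {poly F}) r :
  h.[r] = 0 -> h^`().[r] != 0 -> v != 0 -> u ^+ 2 <> h * v ^+ 2.
Proof.
move=> hr hr'; elim: (size v).+1 {-2}v (ltnSn (size v)) u => // N IH {}v sv u v0 E.
have /factor_theorem [h1 h1E] : root h r by apply/rootP.
have Xr0 : 'X - r%:P != 0 by rewrite polyXsubC_eq0.
have h1r : h1.[r] != 0.
  by move: hr'; rewrite h1E derivM derivXsubC hornerD !hornerM hornerXsubC subrr mulr0 add0r hornerC mulr1.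
have : root u r.
  by have := congr1 (fun q : {poly F} => q.[r]) E; rewrite !hornerM hr mul0r => /eqP; rewrite mulf_eq0 orbb.
move/factor_theorem => [u1 u1E].
have E1 : u1 ^+ 2 * ('X - r%:P) = h1 * v ^+ 2.
  apply: (mulIf Xr0); move: E; rewrite u1E h1E => E.
  by transitivity ((u1 * ('X - r%:P)) ^+ 2); [ring|rewrite E; ring].
have : root v r.
  have := congr1 (fun q : {poly F} => q.[r]) E1; rewrite hornerM hornerXsubC subrr mulr0 hornerM horner_exp => /esym/eqP.
  by rewrite mulf_eq0 (negPf h1r) /= expf_eq0.
move/factor_theorem => [v1 v1E].
have v10 : v1 != 0 by apply: contraNneq v0 => z; rewrite v1E z mul0r.
apply: (IH v1 _ u1) => //; first by move: sv; rewrite v1E size_mul // size_XsubC addn2 ltnS.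
apply: (mulIf Xr0); rewrite E1 v1E h1E; ring.
Qed.

(** Adjoin a square root of [h] to the field of rational functions; the simple root prevents [h]
    from being a square there. *)
Lemma quadratic_field (F : numClosedFieldType) (h : {poly F}) r : h.[r] = 0 -> h^`().[r] != 0 ->
  exists (K : fieldType) (iota : {rmorphism F -> K}) (y s : K), hyper iota y s h.
Proof.
move=> hr hr'; pose FF := {fraction {poly F}}.
pose tf : {rmorphism {poly F} -> FF} := @FracField.tofrac {poly F}.
pose q : {poly FF} := 'X^2 - (tf h)%:P.
have sq : size q = 3%N by rewrite /q size_polyDl size_polyXn // size_polyN; apply: leq_ltn_trans (size_polyC_leq1 _) _.
have tf_eq0 A : (tf A == 0) = (A == 0) by exact: tofrac_eq0.
have noroot (x : FF) : x ^+ 2 <> tf h.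
  move=> x2; have [u [v [v0 xE]]] := fractionP x.
  have xE' : x * tf v = tf u by [].
  have : tf (u ^+ 2) = tf (h * v ^+ 2) by rewrite rmorphXn rmorphM rmorphXn -xE' exprMn x2.
  move/eqP; rewrite -subr_eq0 -rmorphB tf_eq0 subr_eq0 => /eqP.
  exact: (@not_square _ h u v r hr hr' v0).
have irr : irreducible_poly q.
  apply: cubic_irreducible => [|x]; first by rewrite sq.
  by apply/negP; rewrite /root /q hornerD hornerN hornerXn hornerC subr_eq0 => /eqP /noroot.
have [L _ [s sr gen]] := irredp_FAdjoin irr.
pose phi : {rmorphism {poly F} -> L} := in_alg L \o tf.
pose iota : {rmorphism F -> L} := phi \o polyC.
have evE A : ev iota (phi 'X) A = phi A.
  rewrite /ev (_ : map_poly iota A = map_poly phi (map_poly polyC A)); last by rewrite -map_poly_comp.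
  by rewrite horner_map -[(map_poly polyC A).['X]]/(A \Po 'X) comp_polyXr.
have phi0 A : phi A = 0 -> A = 0.
  by move/eqP; rewrite fmorph_eq0 tf_eq0 => /eqP.
have s2 : s ^+ 2 = ev iota (phi 'X) h.
  move: sr; rewrite /root /q rmorphB /= map_polyXn map_polyC hornerD hornerN hornerXn hornerC subr_eq0 => /eqP ->.
  by rewrite evE.
have fr A B : ev iota (phi 'X) A + ev iota (phi 'X) B * s = 0 -> A = 0 /\ B = 0.
  rewrite !evE => E; have [B0|B0] := eqVneq B 0.
    by move: E; rewrite B0 rmorph0 mul0r addr0 => /phi0.
  have pB : tf B != 0 by rewrite tf_eq0.
  case: (noroot (- tf A / tf B)); apply: (fmorph_inj (in_alg L)).
  have pB' : phi B != 0 by rewrite fmorph_eq0.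
  have E1 : in_alg L ((- tf A / tf B) ^+ 2) = s ^+ 2.
    rewrite rmorphXn; congr (_ ^+ 2); apply: (mulfI pB').
    have e : tf B * (- tf A / tf B) = - tf A by rewrite mulrC divfK.
    transitivity (in_alg L (- tf A)); first by rewrite -[in RHS]e [RHS]rmorphM.
    by rewrite rmorphN; apply/eqP; rewrite eq_sym -addr_eq0 addrC E.
  exact: (etrans E1 (etrans s2 (evE h))).
exists L, iota, (phi 'X), s; split=> // z.
rewrite -(@Fadjoin_poly_eq _ L (falgebra.aspace1 L) s z); last by have := memvf z; rewrite -gen.
set Q := Fadjoin_poly _ _ _.
have Q1 : Q \is a polyOver (falgebra.asval (falgebra.aspace1 L)) by exact: Fadjoin_polyOver.
rewrite horner_coef; elim/big_ind: _.
- by rewrite -(ev0 iota (phi 'X)); exact: quad_ev.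
- by move=> ? ?; exact: (quadD).
move=> i _; apply: (quadM s2); last first.
  by rewrite exprnP; apply: (quad_pow s2 fr); exact: quad_s.
have /vlineP[c ->] := polyOverP Q1 i.
have [u [v [v0 cE]]] := fractionP c.
exists u, 0, v; rewrite v0 !evE rmorph0 mul0r addr0; split=> //.
by rewrite -[phi u]/(in_alg L (tf u)) -[tf u]cE rmorphM.
Qed.

Section Integrality.
Variables (F : fieldType) (f : laurent F).
Variables (K : fieldType) (iota : {rmorphism F -> K}) (x y : K).
Hypotheses (x0 : x != 0) (y0 : y != 0).
Hypothesis ker : forall g, leval iota x y g = 0 <-> ldvd f g.

Let xy_neq0 i j : x ^+ i * y ^+ j != 0. Proof. by rewrite mulf_neq0 // expf_neq0. Qed.

Lemma ff_lone : ~ ldvd f (@lone F).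
Proof.
move=> [q qE]; have [g g1] := @repr_laurent F 1 0 0.
have gE : g =1 @lone F by move=> [i j]; rewrite g1 cz1 !addr0 /lone -pair_eqE.
have /ker g0 : ldvd f g by exists q => m; rewrite gE qE.
have := repr_leval iota x0 y0 g1; rewrite g0 !mul0r rmorph1 => /eqP.
by rewrite eq_sym oner_eq0.
Qed.

Lemma ff_prime (g h : laurent F) : ldvd f (lmul g h) -> ldvd f g \/ ldvd f h.
Proof.
have [Q [i gQ]] := repr_ex g; have [S [j hS]] := repr_ex h.
have [gh ghE] := repr_laurent (Q * S) (i + j) (i + j).
move=> [q qE]; have /ker gh0 : ldvd f gh by exists q => m; rewrite ghE -(repr_mul gQ hS) qE.
have /esym/eqP := repr_leval iota x0 y0 ghE; rewrite gh0 !mul0r rmorphM mulf_eq0.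
have zero (u : laurent F) U l : lrepr u U l l -> ev2 iota x y U = 0 -> ldvd f u.
  move=> uU U0; apply/ker; have /eqP := repr_leval iota x0 y0 uU.
  by rewrite U0 -mulrA mulf_eq0 (negPf (xy_neq0 _ _)) orbF => /eqP.
by case/orP => /eqP E; [left; apply: zero gQ E|right; apply: zero hS E].
Qed.

End Integrality.

Section KiteFunctionField.
Variables (F : numClosedFieldType) (k : nat) (a b : F) (p : {poly F}) (f : laurent F).
Hypothesis a0 : a != 0.
Hypothesis fE : forall m, f m = kite_coef k a b p m.
Variables (sg h : {poly F}) (r : F).
Hypotheses (sg0 : sg != 0) (hr : h.[r] = 0) (hr' : h^`().[r] != 0).
Hypothesis PE : p ^+ 2 - (4%:R * (a * b)) *: 'X^(2 * k) = sg ^+ 2 * h.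

Lemma kite_function_field : exists (K : fieldType) (iota : {rmorphism F -> K}) (x y : K),
  [/\ x != 0, y != 0, forall g, leval iota x y g = 0 <-> ldvd f g &
   forall z, exists g h : laurent F,
     leval iota x y h != 0 /\ z = leval iota x y g / leval iota x y h].
Proof.
have [K [iota [y [s [s2 fr gen]]]]] := quadratic_field hr hr'.
pose ev := ev iota y.
have ev_neq0 D : D != 0 -> ev D != 0.
  by move=> D0; apply: contraNneq D0 => E; apply/eqP; apply: (@fr D 0 _).1; rewrite -/ev E /ev ev0 mul0r addr0.
have X0 j : 'X^j != 0 :> {poly F} by rewrite -size_poly_eq0 size_polyXn.
have y0 : y != 0 by have := ev_neq0 _ (X0 1%N); rewrite expr1 /ev evX.
pose c := ev ((2%:R * a) *: 'X^k).
have cE : c = 2%:R * iota a * y ^+ k by rewrite /c /ev evZ evX_n evX rmorphM rmorph_nat.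
have c0 : c != 0.
  by apply: ev_neq0; rewrite -size_poly_eq0 size_scale ?size_polyXn // mulf_neq0 ?pnatr_eq0.
pose x := (s * ev sg - ev p) / c.
have xc : x * c = s * ev sg - ev p by rewrite divfK.
have x0 : x != 0.
  apply/eqP => xz; move/eqP: xc; rewrite xz mul0r eq_sym => /eqP E.
  have /fr[_ s0] : ev (- p) + ev sg * s = 0 by move: E; rewrite /ev evN => E; rewrite -[RHS]E; ring.
  by move: sg0; rewrite s0 eqxx.
have root : iota a * x ^+ 2 * y ^+ k + iota b * y ^+ k + ev p * x = 0.
  have c4 : 4%:R * iota a * y ^+ k != 0.
    have -> : 4%:R * iota a * y ^+ k = 2%:R * c by rewrite cE; ring.
    by rewrite mulf_neq0 // -(rmorph_nat iota) fmorph_eq0 pnatr_eq0.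
  apply: (mulfI c4); rewrite mulr0.
  transitivity ((x * c) ^+ 2 + 2%:R * ev p * (x * c) + 4%:R * (iota a * iota b) * y ^+ (2 * k)).
    by rewrite cE mulnC exprM; ring.
  have := congr1 ev PE; rewrite /ev evD evN evZ !evM !evX_n evX -s2 rmorphM rmorph_nat rmorphM => E.
  by rewrite xc /ev; apply/eqP; rewrite -subr_eq0; move/eqP: E; rewrite -subr_eq0 => /eqP E;
    apply/eqP; rewrite -[RHS]oppr0 -[in RHS]E; ring.
have fr' A B : ev A + ev B * x = 0 -> A = 0 /\ B = 0.
  move=> E; have : ev ((2%:R * a) *: (A * 'X^k) - B * p) + ev (B * sg) * s = 0.
    rewrite -[RHS](mul0r c) -E; have -> : (ev A + ev B * x) * c = ev A * c + ev B * (x * c) by ring.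
    by rewrite xc cE /ev evD evN evZ !evM evX_n evX rmorphM rmorph_nat; ring.
  move=> /fr[+ /eqP]; rewrite mulf_eq0 (negPf sg0) orbF => + /eqP B0; rewrite B0 mul0r subr0 => /eqP.
  by rewrite scaler_eq0 !mulf_eq0 (negPf a0) pnatr_eq0 (negPf (X0 k)) /= orbF => /eqP.
pose KF := kite_poly k a b p.
have KF0 : ev2 iota x y KF = 0 by rewrite ev2_kite -[RHS]root.
have rf := kite_repr fE.
have xy_neq0 i j : x ^+ i * y ^+ j != 0 by rewrite mulf_neq0 // expf_neq0.
exists K, iota, x, y; split=> //.
  move=> g; have [Q [N gQ]] := repr_ex g; have gE := repr_leval iota x0 y0 gQ; split; last first.
    move=> [q qE]; have [S [M qS]] := repr_ex q.
    have gS : lrepr g (S * KF) (M + 1) (M + 0) by move=> m; rewrite qE (repr_mul qS rf).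
    have /eqP := repr_leval iota x0 y0 gS; rewrite rmorphM KF0 mulr0 -mulrA mulf_eq0.
    by rewrite (negPf (xy_neq0 _ _)) orbF => /eqP.
  move=> g0; move: gE; rewrite g0 !mul0r => /esym Q0.
  have KF_neq0 : KF != 0 by rewrite -size_poly_eq0 kite_poly_size.
  (* Pseudo-division in x. The leading coefficient a y^k is invertible among Laurent polynomials,
     and the remainder A + B x vanishes by the independence of 1 and x. *)
  have E := Pdiv.WeakIdomain.divp_eq Q KF.
  have sR : (size (Q %% KF)%R <= 2)%N.
    by have := Pdiv.CommonIdomain.ltn_modp Q KF; rewrite kite_poly_size // KF_neq0.
  have R0 : Q %% KF = 0.
    have [A [B RE]] : exists A B, Q %% KF = A%:P + B%:P * 'X.
      exists (Q %% KF)`_0, (Q %% KF)`_1.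
      apply/polyP => -[|[|i]]; rewrite coefD coefC coefCM coefX /= ?mulr0 ?addr0 ?mulr1 ?add0r //.
      by rewrite nth_default // (leq_trans sR).
    have := congr1 (ev2 iota x y) E; rewrite -mul_polyC rmorphM Q0 mulr0 rmorphD rmorphM KF0 mulr0 add0r.
    by rewrite RE rmorphD rmorphM !ev2C ev2X => /esym /fr' [-> ->]; rewrite mul0r addr0.
  move: E; rewrite R0 addr0; set M := scalp Q KF; set S := Q %/ KF => E.
  have lE : lead_coef KF = a%:P * 'X^k.
    rewrite /lead_coef kite_poly_size // /KF /kite_poly /monom !coefD !coefCM coefX !coefXn /=.
    by rewrite mulr1 !mulr0 !addr0.
  have [q qS] := repr_laurent (monom (a^-1 ^+ M) 1 0 * S) N (N + k * M).
  exists q => m; have := repr_mul qS rf; rewrite addn0 => ->.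
  rewrite (repr_shift 1 (k * M) gQ); congr cz.
  rewrite -/KF -[RHS]mulrA -E lE exprMn -mul_polyC /monom !rmorphM /= -!rmorphXn /= -exprM !mul1r.
  have e : (a^-1 ^+ M)%:P * (a ^+ M)%:P = 1 :> {poly F}.
    by rewrite -polyCM -exprMn mulVf // expr1n.
  have e2 : ((a^-1 ^+ M)%:P)%:P * ((a ^+ M)%:P)%:P = 1 :> {poly {poly F}} by rewrite -polyCM e.
  have cancel (A : comRingType) (u v w X P : A) : u * v = 1 -> w * X * P = u * 1 * X * (v * w * P).
    by move=> uv; rewrite mulr1 -[LHS]mul1r -uv; ring.
  by rewrite (expr0 'X) polyC1; exact: cancel e2.
move=> z; have [A [B [D [D0 E]]]] := gen z.
have [u uQ] := repr_laurent ((A * sg)%:P + B%:P * (((2%:R * a) *: 'X^k)%:P * 'X + p%:P)) 0 0.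
have [v vQ] := repr_laurent ((D * sg)%:P) 0 0.
have := repr_leval iota x0 y0 uQ; have := repr_leval iota x0 y0 vQ; rewrite !expr0 !mulr1.
rewrite ev2C => vE; rewrite !rmorphD !rmorphM rmorphD rmorphM !ev2C ev2X => uE.
exists u, v; rewrite vE uE -!/(ev _) -/c.
have Dsg : ev (D * sg) != 0 by apply: ev_neq0; rewrite mulf_neq0.
split=> //; apply: (mulIf Dsg); rewrite divfK // [ev (D * sg)]evM mulrA [z * _]E mulrDl.
by rewrite [c * x]mulrC xc /ev; ring.
Qed.

End KiteFunctionField.

(** * Nodal kite curves *)

Lemma ffactzE (l i : nat) : ffactz l%:Z i = (l ^_ i)%N%:Z.
Proof.
elim: i => [|i IH]; first by rewrite /ffactz big_ord0.
rewrite /ffactz big_ord_recr /= -/(ffactz _ _) IH ffactnSr.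
have [il|li] := leqP i l; first by rewrite subzn // PoszM.
by rewrite ffact_small // mul0r mul0n.
Qed.

Lemma ffactz_pow (F : fieldType) (s : F) (l i : nat) :
  (ffactz l%:Z i)%:~R * s ^ (l%:Z - i%:Z) = ('X^l)^`(i).[s].
Proof.
rewrite ffactzE derivnXn hornerMn hornerXn -pmulrn mulr_natl.
have [il|li] := leqP i l; first by rewrite subzn.
by rewrite ffact_small // !mulr0n.
Qed.

Lemma horner_derivn_sum (F : fieldType) (p : {poly F}) N i s : (size p <= N)%N ->
  \sum_(l < N) p`_l * ('X^l)^`(i).[s] = p^`(i).[s].
Proof.
move=> sp; rewrite [in RHS](_ : p = \sum_(l < N) p`_l *: 'X^l).
  by rewrite linear_sum horner_sum; apply: eq_bigr => l _; rewrite linearZ hornerZ.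
apply/polyP => j; rewrite coef_sum; case: (ltnP j N) => jN.
  rewrite (bigD1 (Ordinal jN)) //= coefZ coefXn eqxx mulr1 big1 ?addr0 // => l lj.
  rewrite coefZ coefXn; case: eqP => [e|_]; last by rewrite mulr0.
  by case/negP: lj; apply/eqP/val_inj.
rewrite nth_default ?(leq_trans sp) // big1 // => l _; rewrite coefZ coefXn.
by rewrite gtn_eqF ?mulr0 // (leq_trans (ltn_ord l)).
Qed.

Fact hessian_at_triple_root (F : fieldType) (a b q0 q1 q2 e0 e1 e2 t : F) :
    2%:R != 0 :> F -> a != 0 -> b != 0 -> q0 != 0 -> t = - (2%:R * a) / q0 ->
    q0 ^+ 2 - 4%:R * (a * b) * e0 = 0 -> q1 * q0 + q0 * q1 - 4%:R * (a * b) * e1 = 0 ->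
    q2 * q0 + q1 * q1 + (q1 * q1 + q0 * q2) - 4%:R * (a * b) * e2 = 0 ->
  [/\ a * 1 / t + b * e0 * t + q0 * 1 = 0, a * 0 / t + b * e1 * t + q1 * 1 = 0,
      a * 1 * - t^-1 ^+ 2 + b * e0 * 1 + q0 * 0 = 0 &
      (a * 0 * - t^-1 ^+ 2 + b * e1 * 1 + q1 * 0) ^+ 2 -
      (a * 0 / t + b * e2 * t + q2 * 1) *
      (a * 1 * (2%:R * t^-1 ^+ 3) + b * e0 * 0 + q0 * 0) = 0].
Proof.
move=> n2 a0 b0 q00 tE r0 r1 r2.
have n4 : 4%:R != 0 :> F by rewrite (natrM _ 2 2) mulf_neq0.
have ab0 : 4%:R * (a * b) != 0 by rewrite !mulf_neq0.
have tV : t^-1 = - q0 / (2%:R * a) by rewrite tE invf_div invrN mulrN mulNr.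
have solve e x : x - 4%:R * (a * b) * e = 0 -> e = x / (4%:R * (a * b)).
  by move/eqP; rewrite subr_eq0 => /eqP ->; rewrite mulrC mulKf.
by rewrite tV tE (solve _ _ r0) (solve _ _ r1) (solve _ _ r2); split; field; rewrite ?q00 ?a0 ?b0 ?n2 ?n4.
Qed.

Section Nodes.
Variables (R : realType) (k k' : nat).
Hypothesis k'0 : (0 < k')%N.
Local Notation n := (k + k')%N.
Local Notation C := (R[i]).
Variables (a b : C) (p : {poly C}) (f : laurent C).
Hypotheses (fE : forall m, f m = kite_coef k a b p m) (sp : (size p <= n.+1)%N).
Hypotheses (a0 : a != 0) (b0 : b != 0).
Local Notation P := (p ^+ 2 - (4%:R * (a * b)) *: 'X^(2 * k)).
Local Notation D := (kite R k k').

(** In this chart y = s and x = s^(-k) / t, and the curve becomes a / t + b s^(2 k) t + p(s) = 0,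
    which is quadratic in t. *)
Lemma edge_chart_x : edge_chart D (- k%:Z, 1) (-1, 0) 0.
Proof.
split; first by rewrite /= mulr0 mul1r sub0r opprK.
  by move=> m /(@mono_kite R k k' k'0 m); rewrite /pairing; case: m => x y /= [[-> h]|[|] [-> ->]]; nia.
exists (0, 0), (1, k%:Z); split=> //; rewrite ?(@mono_kite R k k' k'0) // /pairing /=.
- by left; split=> //; lia.
- by right; left.
- by rewrite !mulr0.
- by rewrite mulr1 mul1r addNr.
Qed.

Lemma local_eq_x (i j : nat) s t : local_eq f (- k%:Z, 1) (-1, 0) 0 i j s t =
  a * ('X^0)^`(i).[s] * ((ffactz (-1) j)%:~R * t ^ (-1 - j%:Z)) +
  b * ('X^(2 * k))^`(i).[s] * ((ffactz 1 j)%:~R * t ^ (1 - j%:Z)) +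
  p^`(i).[s] * ((ffactz 0 j)%:~R * t ^ (0 - j%:Z)).
Proof.
rewrite /local_eq (kite_sum (k := k) (n := n) fE sp); last by move=> m ->; rewrite !mul0r.
rewrite !fE kite_coef1 kite_coefN1 /pairing /=.
have e1 : - k%:Z * 1 + 1 * k%:Z - 0 = 0%:Z by lia.
have e2 : - k%:Z * -1 + 1 * k%:Z - 0 = (2 * k)%N%:Z by lia.
have e3 : -1 * 1 + 0 * k%:Z = -1 :> int by lia.
have e4 : -1 * -1 + 0 * k%:Z = 1 :> int by lia.
have shuffle (u v w z z' : C) : u * (v * w) * z * z' = u * (v * z) * (w * z') by ring.
rewrite e1 e2 e3 e4 !rmorphM /= -!ffactz_pow; congr (_ + _ + _).
- exact: shuffle.
- exact: shuffle.
rewrite -(horner_derivn_sum i s sp) mulr_suml; apply: eq_bigr => l _.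
rewrite fE kite_coef0 -ffactz_pow.
have -> : - k%:Z * 0 + 1 * l%:Z - 0 = l%:Z by lia.
have -> : -1 * 0 + 0 * l%:Z = 0 :> int by lia.
by rewrite rmorphM; exact: shuffle.
Qed.

Let ff1 (t : C) : t != 0 -> [/\ (ffactz (-1) 0)%:~R * t ^ (-1 - 0%N%:Z) = t^-1,
  (ffactz (-1) 1)%:~R * t ^ (-1 - 1%N%:Z) = - t^-1 ^+ 2 &
  (ffactz (-1) 2)%:~R * t ^ (-1 - 2%N%:Z) = 2%:R * t^-1 ^+ 3].
Proof.
move=> t0; rewrite /ffactz !big_ord_recr !big_ord0 /=; split.
- by rewrite mul1r.
- by rewrite mul1r subr0 mulN1r exprVn.
- by rewrite mul1r exprVn.
Qed.

Let ff2 (t : C) : [/\ (ffactz 1 0)%:~R * t ^ (1 - 0%N%:Z) = t,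
  (ffactz 1 1)%:~R * t ^ (1 - 1%N%:Z) = 1 & (ffactz 1 2)%:~R * t ^ (1 - 2%N%:Z) = 0].
Proof.
rewrite /ffactz !big_ord_recr !big_ord0 /=; split.
- by rewrite mul1r.
- by rewrite !mul1r.
- by rewrite subrr mulr0 mul0r.
Qed.

Let ff0 (t : C) : [/\ (ffactz 0 0)%:~R * t ^ (0 - 0%N%:Z) = 1,
  (ffactz 0 1)%:~R * t ^ (0 - 1%N%:Z) = 0 & (ffactz 0 2)%:~R * t ^ (0 - 2%N%:Z) = 0].
Proof.
rewrite /ffactz !big_ord_recr !big_ord0 /=; split.
- by rewrite mul1r.
- by rewrite subrr mulr0 mul0r.
- by rewrite subrr mulr0 !mul0r.
Qed.

(** A double root of the discriminant gives a singular point, whose Hessian vanishes when the root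
    is triple. *)
Lemma nodal_no_triple : nodal D f -> ((0 < k)%N -> p.[0] != 0) ->
  forall r, root P r -> root P^`() r -> ~~ root P^`(2) r.
Proof.
move=> nd p0 r /rootP; rewrite hornerD hornerN hornerZ horner_exp => r0 /rootP r1.
apply/negP => /rootP r2.
have ab0 : 4%:R * (a * b) != 0 :> C by rewrite !mulf_neq0 ?pnatr_eq0.
have pr : p.[r] != 0.
  apply/eqP => pr; move/eqP: r0; rewrite pr expr0n sub0r oppr_eq0 mulf_eq0 (negPf ab0) /= hornerXn expf_eq0.
  move=> /andP[k0 /eqP rz]; have k1 : (0 < k)%N by lia.
  by move: pr (p0 k1); rewrite rz => ->; rewrite eqxx.
move: r1; rewrite derivB derivZ expr2 derivM hornerD hornerN hornerZ hornerD !hornerM => r1.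
move: r2; rewrite !derivnS derivn0 derivB derivZ expr2 derivM derivB derivZ derivD !derivM.
rewrite hornerD hornerN hornerZ !hornerD !hornerM => r2.
(* The double root in t of the quadratic equation at s = r. *)
pose t : C := - (2%:R * a) / p.[r].
have t0 : t != 0 by rewrite mulf_neq0 ?invr_eq0 // oppr_eq0 mulf_neq0 ?pnatr_eq0.
have := nd _ _ _ edge_chart_x r t t0; rewrite /= !local_eq_x.
rewrite !derivnS !derivn0 expr0 derivC deriv0 !hornerC.
have [-> -> ->] := ff1 t0; have [-> -> ->] := ff2 t; have [-> -> ->] := ff0 t.
set e0 := ('X^(2 * k)).[r] in r0 *; set e1 := ('X^(2 * k))^`().[r] in r1 *.
set e2 := ('X^(2 * k))^`()^`().[r] in r2 *.
set q0 := p.[r] in r0 r1 r2 pr t t0 *; set q1 := p^`().[r] in r1 r2 *; set q2 := p^`()^`().[r] in r2 *.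
clearbody e0 e1 e2 q0 q1 q2 => Hn.
have n2 : 2%:R != 0 :> C by rewrite pnatr_eq0.
have [E1 E2 E3 E4] := hessian_at_triple_root n2 a0 b0 pr (erefl t) r0 r1 r2.
by have := Hn E1 E2 E3; rewrite E4 eqxx.
Qed.

(** * A discriminant without triple roots gives a nodal curve *)

Section Converse.
Hypothesis no_triple : forall r, root P r -> root P^`() r -> ~~ root P^`(2) r.
Hypothesis P0 : P.[0] != 0.

Section TorusPoint.
Variables (u w : Z2) (h : int) (s t : C).
Hypotheses (det : u.1 * w.2 - u.2 * w.1 = 1) (s0 : s != 0) (t0 : t != 0).
Local Notation U m := (pairing u m - h).
Local Notation W m := (pairing w m).

Let M (phi : Z2 -> int) : C := \sum_(m <- finsupp f) f m * (phi m)%:~R * s ^ U m * t ^ W m.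

Let local_M (i j : nat) :
  local_eq f u w h i j s t * s ^+ i * t ^+ j = M (fun m => ffactz (U m) i * ffactz (W m) j).
Proof.
rewrite /local_eq /M !mulr_suml; apply: eq_bigr => m _.
have cancel (z : C) (e l : int) : z != 0 -> z ^ (e - l) * z ^ l = z ^ e.
  by move=> z0; rewrite -expfzDr // subrK.
by rewrite -[in RHS](cancel s _ i%:Z s0) -[in RHS](cancel t _ j%:Z t0) -!exprnP; ring.
Qed.

Let c := s ^ (- h).
Let X := s ^ u.1 * t ^ w.1.
Let Y := s ^ u.2 * t ^ w.2.

Let c0 : c != 0. Proof. by rewrite expfz_neq0. Qed.
Let X0 : X != 0. Proof. by rewrite mulf_neq0 ?expfz_neq0. Qed.
Let Y0 : Y != 0. Proof. by rewrite mulf_neq0 ?expfz_neq0. Qed.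

Let monoE m : s ^ U m * t ^ W m = c * X ^ m.1 * Y ^ m.2.
Proof.
rewrite /c /X /Y /pairing !expfzDr // !expfzMl !exprz_exp; ring.
Qed.

Let Ep := a * (c * X * Y ^+ k).
Let Em := b * (c * X^-1 * Y ^+ k).

Let M_sum phi : M phi = (phi (1, k%:Z))%:~R * Ep + (phi (-1, k%:Z))%:~R * Em +
  c * \sum_(l < n.+1) (phi (0, l%:Z))%:~R * p`_l * Y ^+ l.
Proof.
rewrite /M (kite_sum (k := k) (n := n) fE sp); last by move=> m ->; rewrite !mul0r.
rewrite !fE kite_coef1 kite_coefN1 -!mulrA !monoE /= expr1z -exprnP; congr (_ + _ + _).
- by rewrite /Ep; ring.
- by rewrite /Em exprN1; ring.
rewrite mulr_sumr; apply: eq_bigr => l _.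
by rewrite fE kite_coef0 -!mulrA !monoE /= expr0z -exprnP; ring.
Qed.

Let theta_sum (q : {poly C}) : (size q <= n.+1)%N ->
  ('X * q^`()).[Y] = \sum_(l < n.+1) l%:~R * q`_l * Y ^+ l /\ (size ('X * q^`())%R <= n.+1)%N.
Proof.
move=> sq; have cE l : ('X * q^`())`_l = l%:~R * q`_l.
  by rewrite coefXM coef_deriv -pmulrn mulr_natl; case: l => [|l]; rewrite ?mulr0n.
have sX : (size ('X * q^`())%R <= n.+1)%N.
  by apply/leq_sizeP => j hj; rewrite cE [q`_j]nth_default ?mulr0 // (leq_trans sq).
by split=> //; rewrite (horner_coef_wide _ sX); apply: eq_bigr => l _; rewrite cE.
Qed.

(** Through s d/ds and t d/dt, the derivatives in the chart become combinations of the moments sum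
    f_m m1^i m2^j x^m, which do not depend on the chart. At a degenerate singular point the moments
    force the two side monomials to take equal values and the discriminant to have a triple root at
    Y. *)
Lemma nodal_torus : local_eq f u w h 0 0 s t = 0 -> local_eq f u w h 1 0 s t = 0 ->
  local_eq f u w h 0 1 s t = 0 ->
  local_eq f u w h 1 1 s t ^+ 2 - local_eq f u w h 2 0 s t * local_eq f u w h 0 2 s t != 0.
Proof.
have ff_0 z : ffactz z 0 = 1 by rewrite /ffactz big_ord0.
have ff_1 z : ffactz z 1 = z by rewrite /ffactz big_ord_recr big_ord0 /= mul1r subr0.
have ff_2 z : ffactz z 2 = z * (z - 1) by rewrite /ffactz !big_ord_recr big_ord0 /= mul1r subr0.
have d00 := local_M 0 0; have d10 := local_M 1 0; have d01 := local_M 0 1.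
have d11 := local_M 1 1; have d20 := local_M 2 0; have d02 := local_M 0 2.
rewrite !expr0 !mulr1 in d00 d10 d20; rewrite expr0 mulr1 expr1 in d01; rewrite expr0 mulr1 in d02.
move=> h00 h10 h01; rewrite h00 in d00; rewrite h10 mul0r in d10; rewrite h01 mul0r in d01.
pose mu i j := M (fun m => m.1 ^+ i * m.2 ^+ j).
have m00 : mu 0%N 0%N = 0.
  by rewrite [RHS]d00; apply: eq_bigr => m _; rewrite !ff_0.
pose u1 : C := u.1%:~R; pose u2 : C := u.2%:~R; pose w1 : C := w.1%:~R; pose w2 : C := w.2%:~R.
pose hh : C := h%:~R.
have detC : u1 * w2 - u2 * w1 = 1 by rewrite /u1 /u2 /w1 /w2 -!rmorphM -rmorphB det.
have e10 : u1 * mu 1%N 0%N + u2 * mu 0%N 1%N - hh * mu 0%N 0%N = 0.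
  rewrite d10 /mu /M !mulr_sumr -big_split -sumrB /=; apply: eq_bigr => m _.
  by rewrite ff_0 ff_1 /pairing !(rmorphM, rmorphD, rmorphB) /= -/u1 -/u2 -/hh; ring.
have e01 : w1 * mu 1%N 0%N + w2 * mu 0%N 1%N = 0.
  rewrite d01 /mu /M !mulr_sumr -big_split /=; apply: eq_bigr => m _.
  by rewrite ff_0 ff_1 /pairing !(rmorphM, rmorphD, rmorphB) /= -/w1 -/w2; ring.
rewrite m00 mulr0 subr0 in e10.
have m10 : mu 1%N 0%N = 0.
  have -> : mu 1%N 0%N = w2 * (u1 * mu 1%N 0%N + u2 * mu 0%N 1%N) - u2 * (w1 * mu 1%N 0%N + w2 * mu 0%N 1%N).
    by rewrite -[LHS]mul1r -detC; ring.
  by rewrite e10 e01 !mulr0 subr0.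
have m01 : mu 0%N 1%N = 0.
  have -> : mu 0%N 1%N = u1 * (w1 * mu 1%N 0%N + w2 * mu 0%N 1%N) - w1 * (u1 * mu 1%N 0%N + u2 * mu 0%N 1%N).
    by rewrite -[LHS]mul1r -detC; ring.
  by rewrite e10 e01 !mulr0 subr0.
have e11 : local_eq f u w h 1 1 s t * s ^+ 1 * t ^+ 1 =
    u1 * w1 * mu 2%N 0%N + (u1 * w2 + u2 * w1) * mu 1%N 1%N + u2 * w2 * mu 0%N 2%N
    - hh * (w1 * mu 1%N 0%N + w2 * mu 0%N 1%N).
  rewrite d11 /mu /M mulrDr !mulr_sumr -!big_split -sumrB /=; apply: eq_bigr => m _.
  by rewrite !ff_1 /pairing !(rmorphM, rmorphD, rmorphB, rmorphXn) /= -/u1 -/u2 -/hh -/w1 -/w2; ring.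
have e20 : local_eq f u w h 2 0 s t * s ^+ 2 =
    u1 ^+ 2 * mu 2%N 0%N + 2%:R * u1 * u2 * mu 1%N 1%N + u2 ^+ 2 * mu 0%N 2%N
    - (2%:R * hh + 1) * (u1 * mu 1%N 0%N) - (2%:R * hh + 1) * (u2 * mu 0%N 1%N) + hh * (hh + 1) * mu 0%N 0%N.
  rewrite d20 /mu /M !mulr_sumr -!big_split -!sumrB -!big_split /=; apply: eq_bigr => m _.
  by rewrite ff_0 ff_2 /pairing !(rmorphM, rmorphD, rmorphB, rmorphXn) /= -/u1 -/u2 -/hh; ring.
have e02 : local_eq f u w h 0 2 s t * t ^+ 2 =
    w1 ^+ 2 * mu 2%N 0%N + 2%:R * w1 * w2 * mu 1%N 1%N + w2 ^+ 2 * mu 0%N 2%N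
    - w1 * mu 1%N 0%N - w2 * mu 0%N 1%N.
  rewrite d02 /mu /M !mulr_sumr -!big_split -!sumrB /=; apply: eq_bigr => m _.
  by rewrite ff_0 ff_2 /pairing !(rmorphM, rmorphD, rmorphB, rmorphXn) /= -/w1 -/w2; ring.
apply/negP => /eqP hess.
(* As the moments of order 0 and 1 vanish, the Hessian of the chart is that of the moments times the
   square of the determinant, which is 1. *)
have hess' : mu 1%N 1%N ^+ 2 - mu 2%N 0%N * mu 0%N 2%N = 0.
  have : (local_eq f u w h 1 1 s t * s ^+ 1 * t ^+ 1) ^+ 2 -
    (local_eq f u w h 2 0 s t * s ^+ 2) * (local_eq f u w h 0 2 s t * t ^+ 2) = 0.
    by rewrite -[RHS](mulr0 (s ^+ 2 * t ^+ 2)) -hess; ring.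
  rewrite e11 e20 e02 m00 m10 m01 => E.
  have : (u1 * w2 - u2 * w1) ^+ 2 * (mu 1%N 1%N ^+ 2 - mu 2%N 0%N * mu 0%N 2%N) = 0.
    by rewrite -[RHS]E; ring.
  by rewrite detC expr1n mul1r.
have [q1E sq1] := theta_sum sp; have [q2E sq2] := theta_sum sq1.
set q1 := 'X * p^`() in q1E q2E sq1 sq2; set q2 := 'X * q1^`() in q2E sq2.
have q1c l : q1`_l = l%:~R * p`_l.
  by rewrite coefXM coef_deriv -pmulrn mulr_natl; case: l => [|l]; rewrite ?mulr0n.
have m00E : mu 0%N 0%N = Ep + Em + c * p.[Y].
  rewrite /mu M_sum !mul1r (horner_coef_wide _ sp); congr (_ + _ * _).
  by apply: eq_bigr => l _; rewrite !mul1r.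
have m10E : mu 1%N 0%N = Ep - Em.
  rewrite /mu M_sum !mulr1 !expr1 mul1r mulN1r big1 ?mulr0 ?addr0 // => l _.
  by rewrite expr1 !mul0r.
have m01E : mu 0%N 1%N = k%:R * (Ep + Em) + c * q1.[Y].
  rewrite /mu M_sum q1E !mul1r !expr1 -pmulrn mulrDr; congr (_ + _ * _).
  by apply: eq_bigr => l _; rewrite !mul1r expr1.
have m20E : mu 2%N 0%N = Ep + Em.
  rewrite /mu M_sum big1 => [|l _]; last by rewrite /= expr0n !mul0r.
  by rewrite mulr0 addr0 /= !mulr1 expr1n -[in RHS](mul1r Ep) -[in RHS](mul1r Em).
have m11E : mu 1%N 1%N = k%:R * (Ep - Em).
  rewrite /mu M_sum !expr1 mul1r mulN1r rmorphN /= -pmulrn mulNr mulrBr big1 ?mulr0 ?addr0 // => l _.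
  by rewrite expr1 !mul0r.
have m02E : mu 0%N 2%N = k%:R ^+ 2 * (Ep + Em) + c * q2.[Y].
  rewrite /mu M_sum q2E !mul1r rmorphXn /= -pmulrn mulrDr; congr (_ + _ * _).
  by apply: eq_bigr => l _; rewrite mul1r q1c rmorphXn /=; ring.
rewrite m00E in m00; rewrite m10E in m10; rewrite m01E in m01.
move: hess'; rewrite m11E m10 mulr0 expr0n sub0r => /eqP; rewrite oppr_eq0 m20E m02E.
have EE : Em = Ep by apply/eqP; rewrite eq_sym -subr_eq0 m10.
have Ep0 : Ep != 0.
  by apply: mulf_neq0 => //; apply: mulf_neq0; [exact: mulf_neq0|exact: expf_neq0].
have EE2 : Ep + Ep = 2%:R * Ep by ring.
rewrite EE EE2 in m00 m01 *.
rewrite mulf_eq0 mulf_eq0 (negPf Ep0) pnatr_eq0 /= => /eqP m02.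
have hp : c * p.[Y] = - (2%:R * Ep) by apply/eqP; rewrite -addr_eq0 addrC m00.
have hq1 : q1.[Y] = k%:R * p.[Y].
  by apply: (mulfI c0); rewrite mulrCA hp mulrN; apply/eqP; rewrite -addr_eq0 addrC m01.
have hq2 : q2.[Y] = k%:R ^+ 2 * p.[Y].
  by apply: (mulfI c0); rewrite mulrCA hp mulrN; apply/eqP; rewrite -addr_eq0 addrC m02.
(* Up to c^2 this is (c p)^2 - 4 Ep Em, where c p = - 2 Ep and Em = Ep. The vanishing of P' and P''
   at Y then follows from [kite_deriv] and its derivative. *)
have PY : P.[Y] = 0.
  rewrite hornerD hornerN hornerZ horner_exp hornerXn; apply: (mulfI (expf_neq0 2 c0)).
  rewrite mulr0 mulrBr -exprMn hp sqrrN exprMn.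
  have -> : c ^+ 2 * (4%:R * (a * b) * Y ^+ (2 * k)) = 4%:R * (Ep * Em).
    by rewrite /Ep /Em mulnC exprM; field.
  by rewrite EE; ring.
have KD := kite_deriv k a b p; rewrite -/q1 -!polyC_natr in KD.
move: no_triple PY KD; move: P => PP tri PY KD.
have PY1 : PP^`().[Y] = 0.
  apply: (mulfI Y0); have := congr1 (fun q : {poly C} => q.[Y]) KD.
  rewrite hornerD hornerN (hornerM 'X) hornerX (hornerM _ PP) PY mulr0 subr0 mulr0 => ->.
  by rewrite (hornerM (2%:R%:P * p)) hornerD hornerN (hornerM k%:R%:P) hq1 hornerC subrr mulr0.
have PY2 : PP^`(2).[Y] = 0.
  rewrite !derivnS derivn0; apply: (mulfI (mulf_neq0 Y0 Y0)); rewrite mulr0.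
  have := congr1 (fun q : {poly C} => Y * (q^`()).[Y]) KD.
  rewrite derivB (derivM 'X) derivX mul1r (derivM (2 * k)%:R%:P) derivC mul0r add0r.
  rewrite hornerD hornerN hornerD (hornerM 'X) hornerX (hornerM (2 * k)%:R%:P) PY1 mulr0 subr0 add0r mulrA => ->.
  rewrite (derivM (2%:R%:P * p)) derivB (derivM k%:R%:P) derivC mul0r add0r hornerD.
  rewrite (hornerM _ (q1 - _)) (hornerM (2%:R%:P * p)) !hornerD !hornerN !(hornerM k%:R%:P) hornerC hq1 subrr mulr0 add0r.
  have hq2' : Y * q1^`().[Y] = k%:R ^+ 2 * p.[Y] by rewrite -hq2 /q2 hornerM hornerX.
  have hq1' : Y * p^`().[Y] = k%:R * p.[Y] by rewrite -hq1 /q1 hornerM hornerX.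
  transitivity ((2%:R%:P * p).[Y] * (Y * q1^`().[Y] - k%:R * (Y * p^`().[Y]))); first by ring.
  by rewrite hq2' hq1'; ring.
by have := tri Y (introT rootP PY) (introT rootP PY1); rewrite /root PY2 eqxx.
Qed.

End TorusPoint.

(** Only monomials on the edge survive at s = 0. With two of them, a singular point would force
    equal exponents of t, against the determinant 1. Three occur only on the horizontal edge for k =
    0, and there a singular point means p(0)^2 = 4 a b, excluded by [P0]. *)
Lemma nodal_boundary (u w : Z2) (h : int) t : edge_chart D u w h -> t != 0 ->
  local_eq f u w h 0 0 0 t = 0 -> local_eq f u w h 0 1 0 t <> 0.
Proof.
move=> [det hmin [m1 [m2 [m1D m2D m12 m1h m2h]]]] t0.
have ff_0 z : ffactz z 0 = 1 by rewrite /ffactz big_ord0.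
have ff_1 z : ffactz z 1 = z by rewrite /ffactz big_ord_recr big_ord0 /= mul1r subr0.
have mD (x y : int) : (x = 0 /\ 0 <= y <= n%:Z) \/ ((x, y) = (1, k%:Z) \/ (x, y) = (-1, k%:Z)) ->
    h <= u.1 * x + u.2 * y.
  by move=> H; apply: (hmin (x, y)); apply/(@mono_kite R k k' k'0).
have hp : h <= u.1 + u.2 * k%:Z by have := mD 1 k%:Z; rewrite mulr1; apply; right; left.
have hm : h <= - u.1 + u.2 * k%:Z by have := mD (-1) k%:Z; rewrite mulrN1; apply; right; right.
have h0 : h <= 0 by have := mD 0 0; rewrite !mulr0 addr0; apply; left; split=> //; lia.
have hn : h <= u.2 * n%:Z by have := mD 0 n%:Z; rewrite mulr0 add0r; apply; left; split=> //; lia.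
pose on (m : Z2) := pairing u m == h.
have onP (x y : int) : on (x, y) = (u.1 * x + u.2 * y == h) by [].
have u20 : u.2 != 0.
  apply/eqP => u2; move: hp hm; rewrite u2 !mul0r !addr0 => hp hm.
  have u1n : u.1 != 0 by apply/eqP => u1; move: det; rewrite u1 u2 !mul0r.
  have shape m : m \in monomials D -> pairing u m = h -> m = (1, k%:Z) /\ u.1 = h \/ m = (-1, k%:Z) /\ - u.1 = h.
    move/(@mono_kite R k k' k'0); case: m => x y /= [[-> _]|[|] [-> ->]]; rewrite /pairing /= u2.
    - by rewrite mulr0 mul0r; lia.
    - by rewrite mul0r addr0 mulr1; left.
    - by rewrite mul0r addr0 mulrN1; right.
  have := shape _ m1D m1h; have := shape _ m2D m2h.
  by move=> [[e2 h2]|[e2 h2]] [[e1 h1]|[e1 h1]]; [move: m12; rewrite e1 e2 eqxx| | |move: m12; rewrite e1 e2 eqxx]; lia.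
(* The lowest or the highest lattice point of the axis, according to the sign of [u.2]: the only one
   the edge can contain. *)
pose l0 : nat := if 0 < u.2 then 0%N else n.
have onl (l : nat) : (l <= n)%N -> on (0, l%:Z) -> l = l0.
  rewrite onP mulr0 add0r /l0 => ln /eqP e; case: ifP => u2; nia.
have shape m : m \in monomials D -> pairing u m = h -> [\/ m = (1, k%:Z) /\ on (1, k%:Z),
    m = (-1, k%:Z) /\ on (-1, k%:Z) | m = (0, l0%:Z) /\ on (0, l0%:Z)].
  move=> mi mh; have om : on m by rewrite /on mh.
  move: mi om {mh}; move/(@mono_kite R k k' k'0); case: m => x y /= [[-> hy]|[|] [-> ->]] om.
  - have yE : y = (absz y)%:Z by lia.
    constructor 3; rewrite yE in om *; have yn : (absz y <= n)%N by lia.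
    by rewrite -(onl _ yn om).
  - by constructor 1.
  - by constructor 2.
have zpow (z : int) : (0 : C) ^ z = (z == 0)%:R by exact: exp0rz.
have expand j : local_eq f u w h 0 j 0 t =
    a * (ffactz (pairing w (1, k%:Z)) j)%:~R * (on (1, k%:Z))%:R * t ^ (pairing w (1, k%:Z) - j%:Z) +
    b * (ffactz (pairing w (-1, k%:Z)) j)%:~R * (on (-1, k%:Z))%:R * t ^ (pairing w (-1, k%:Z) - j%:Z) +
    p`_l0 * (ffactz (pairing w (0, l0%:Z)) j)%:~R * (on (0, l0%:Z))%:R * t ^ (pairing w (0, l0%:Z) - j%:Z).
  rewrite /local_eq (kite_sum (k := k) (n := n) fE sp); last by move=> m ->; rewrite !mul0r.
  rewrite !fE kite_coef1 kite_coefN1 !ff_0 !mul1r !subr0 !zpow !subr_eq0; congr (_ + _).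
  have l0n : (l0 < n.+1)%N by rewrite /l0; case: ifP.
  rewrite (bigD1 (Ordinal l0n)) //= big1 => [|l ll0].
    by rewrite addr0 fE kite_coef0 ff_0 mul1r subr0 zpow subr_eq0.
  rewrite subr0 zpow subr_eq0 -/(on _) [on _](_ : _ = false) ?mulr0 ?mul0r //.
  apply: contraNF ll0 => ol; apply/eqP/val_inj/onl => //; by rewrite -ltnS ltn_ord.
rewrite !expand {expand} !ff_0 !ff_1 !mulr1 !subr0.
set W1 := pairing w (1, k%:Z); set W2 := pairing w (-1, k%:Z); set W0 := pairing w (0, l0%:Z).
have tz (z : int) : t ^ z != 0 by rewrite expfz_neq0.
have two (x y : C) (d e : int) : x != 0 -> x * t ^ d + y * t ^ e = 0 ->
    x * d%:~R * t ^ (d - 1%N%:Z) + y * e%:~R * t ^ (e - 1%N%:Z) = 0 -> d = e.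
  move=> x0 e1 e2; have T z : t ^ (z - 1%N%:Z) = t ^ z / t by rewrite expfzDr.
  have e3 : x * t ^ d * d%:~R + y * t ^ e * e%:~R = 0.
    by rewrite -[RHS](mul0r t) -e2 !T mulrDl !mulrA !divfK //; ring.
  have : x * t ^ d * (d%:~R - e%:~R) = 0.
    have -> : x * t ^ d * (d%:~R - e%:~R) =
      (x * t ^ d * d%:~R + y * t ^ e * e%:~R) - (x * t ^ d + y * t ^ e) * e%:~R by ring.
    by rewrite e3 e1 mul0r subr0.
  move/eqP; rewrite !mulf_eq0 (negPf x0) (negPf (tz _)) /= -rmorphB intr_eq0 subr_eq0.
  by move/eqP.
have pairs : [|| on (1, k%:Z) && on (-1, k%:Z), on (1, k%:Z) && on (0, l0%:Z) | on (-1, k%:Z) && on (0, l0%:Z)].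
  have [[E1 p1]|[E1 p1]|[E1 p1]] := shape _ m1D m1h; have [[E2 p2]|[E2 p2]|[E2 p2]] := shape _ m2D m2h;
  by [move: m12; rewrite E1 E2 eqxx|rewrite p1 p2 ?orbT].
move=> z0 z1; case o1 : (on (1, k%:Z)) pairs z0 z1; case o2 : (on (-1, k%:Z)) => /=.
(* Both side vertices lie on the edge: it is horizontal, k = 0, and the determinant leaves u = (0,
   1) and w.1 = -1. *)
- move=> _; move: o1 o2; rewrite !onP mulr1 mulrN1 => /eqP o1 /eqP o2.
  have u1 : u.1 = 0 by lia.
  rewrite u1 mul0r sub0r in det; rewrite u1 add0r in o1.
  have u2p : 0 < u.2.
    rewrite lt_neqAle eq_sym u20 /= leNgt; apply/negP => u2n.
    have : u.2 * n%:Z - u.2 * k%:Z = u.2 * k'%:Z by rewrite PoszD; ring.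
    have : u.2 * k'%:Z < 0 by rewrite pmulr_llt0 // ltz_nat.
    by rewrite -o1 in hn; lia.
  have kz : k = 0%N.
    move: h0; rewrite -o1 pmulr_rle0 //; lia.
  have [u2E w1E] : u.2 = 1 /\ w.1 = -1.
    have w1n : w.1 < 0 by rewrite -(pmulr_rlt0 _ u2p); lia.
    have : u.2 <= u.2 * - w.1 by rewrite ler_peMr ?(ltW u2p) //; lia.
    have : - w.1 <= u.2 * - w.1 by rewrite ler_peMl //; lia.
    by rewrite mulrN; lia.
  have l00 : l0 = 0%N by rewrite /l0 u2p.
  have -> : W1 = -1 by rewrite /W1 /pairing /= w1E kz; lia.
  have -> : W2 = 1 by rewrite /W2 /pairing /= w1E kz; lia.
  have -> : W0 = 0 by rewrite /W0 /pairing /= l00; lia.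
  have -> : (u.1 * 0 + u.2 * l0%:Z == h) = true by rewrite l00 -o1 kz !mulr0.
  move=> z0 z1; have {}z0 : a * t^-1 + b * t + p`_0 = 0 by move: z0; rewrite l00 !mulr1.
  have {}z1 : - a * (t ^+ 2)^-1 + b = 0.
    by rewrite -[RHS]z1 !mulr1 mulr0 !mul0r addr0 rmorphN1 mulrN1.
  have aE : a = b * t ^+ 2.
    have : (- a * (t ^+ 2)^-1 + b) * t ^+ 2 = 0 by rewrite z1 mul0r.
    by rewrite mulrDl divfK ?expf_neq0 // addrC => /eqP; rewrite subr_eq0 => /eqP.
  move/negP: P0; apply; rewrite hornerD hornerN hornerZ horner_exp hornerXn kz expr0 mulr1.
  have -> : p.[0] = - (2%:R * b * t).
    rewrite horner_coef0; apply/eqP; rewrite -addr_eq0 -[X in _ == X]z0 aE; apply/eqP; field; exact: t0.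
  by rewrite aE; apply/eqP; ring.
- rewrite orbF => o0; rewrite o0 !mulr1 !mulr0 !mul0r !addr0 => z0 z1.
  have W10 := two _ _ _ _ a0 z0 z1; move: o1 o0 W10; rewrite !onP /W1 /W0 /pairing /= mulr1 mulr0 add0r mulr1 mulr0 add0r.
  move=> /eqP o1 /eqP o0 W10; have U10 : u.1 = u.2 * (l0%:Z - k%:Z) by rewrite mulrBr o0 -o1 addrK.
  have W10' : w.1 = w.2 * (l0%:Z - k%:Z) by rewrite mulrBr -W10 addrK.
  by move: det; rewrite U10 W10' => /eqP; rewrite [_ - _](_ : _ = 0) //; ring.
- move=> o0; rewrite o0 !mulr1 !mulr0 !mul0r !add0r => z0 z1.
  have W20 := two _ _ _ _ b0 z0 z1; move: o2 o0 W20; rewrite !onP /W2 /W0 /pairing /= mulrN1 mulr0 add0r mulrN1 mulr0 add0r.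
  move=> /eqP o2 /eqP o0 W20; have U20 : u.1 = u.2 * (k%:Z - l0%:Z) by rewrite mulrBr o0 -o2; ring.
  have W20' : w.1 = w.2 * (k%:Z - l0%:Z) by rewrite mulrBr -W20; ring.
  by move: det; rewrite U20 W20' => /eqP; rewrite [_ - _](_ : _ = 0) //; ring.
- by [].
Qed.

Lemma nodal_kite : nodal D f.
Proof.
move=> u w h ch s t t0 /= d00 d10 d01; have [s0|s0] := eqVneq s 0.
  by rewrite s0 in d00 d01; case: (nodal_boundary ch t0 d00).
by case: ch => det _ _; exact: nodal_torus.
Qed.

End Converse.
End Nodes.

(** * The Severi variety of a kite *)

Section SeveriPell.
Variables (R : realType) (k k' : nat).
Hypothesis k'0 : (0 < k')%N.
Local Notation n := (k + k')%N.
Local Notation C := (R[i]).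
Local Notation D := (kite R k k').
Implicit Types c : {ffun monomials D -> C^o}.

Definition right_coef c : C := section_poly c (1, k%:Z).
Definition left_coef c : C := section_poly c (-1, k%:Z).
Definition mid_poly c : {poly C} := \poly_(j < n.+1) section_poly c (0, j%:Z).

Definition severi_curve g c : Prop :=
  let f := section_poly c in
  [/\ avoids_fixed_points D f, integral_curve f, nodal D f & geometric_genus f g].

Let mono m : m \in monomials D <->
  (m.1 = 0 /\ 0 <= m.2 <= n%:Z) \/ m = (1, k%:Z) \/ m = (-1, k%:Z).
Proof. exact: mono_kite. Qed.

Lemma section_polyE c m : section_poly c m = if insub m is Some m' then c m' else 0.
Proof. by rewrite /section_poly fsfun_ffun; case: insubP. Qed.

Lemma section_kite c m :
  section_poly c m = kite_coef k (right_coef c) (left_coef c) (mid_poly c) m.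
Proof.
rewrite /kite_coef; case: eqP => [->//|m1]; case: eqP => [->//|m2].
have out : m \notin monomials D -> section_poly c m = 0.
  by move=> mD; rewrite section_polyE insubN.
case: ifP => [/andP[/eqP m10 m20]|H]; last first.
  apply: out; apply/negP => /mono [[e1 e2]|[|] //]; move/negP: H; apply; rewrite e1 eqxx /=.
  by case/andP: e2.
have mE : m = (0, (absz m.2)%:Z) by case: m m10 m20 {m1 m2 out} => x y /= -> ?; rewrite gez0_abs.
rewrite coef_poly; case: ltnP => h; first by rewrite -mE.
apply: out; apply/negP => /mono [[_ /andP[_ e2]]|[/m1|/m2] //].
by move: h; rewrite ltnNge => /negP; apply; rewrite -lez_nat gez0_abs.
Qed.

Lemma size_mid_poly c : (size (mid_poly c) <= n.+1)%N.
Proof. exact: size_poly. Qed.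

Lemma kite_section (a b : C) (p : {poly C}) : (size p <= n.+1)%N ->
  exists c, [/\ right_coef c = a, left_coef c = b & mid_poly c = p].
Proof.
move=> sp; pose c : {ffun monomials D -> C^o} := [ffun m => kite_coef k a b p (val m)]; exists c.
have E m : m \in monomials D -> section_poly c m = kite_coef k a b p m.
  by move=> mD; rewrite section_polyE insubT ffunE.
split.
- by rewrite /right_coef E ?kite_coef1 //; apply/mono; right; left.
- by rewrite /left_coef E ?kite_coefN1 //; apply/mono; right; right.
apply/polyP => j; rewrite coef_poly; case: ltnP => h; last by rewrite nth_default // (leq_trans sp).
by rewrite E ?kite_coef0 //; apply/mono; left; split=> //=; lia.
Qed.

Lemma contains_orbitE (f : laurent C) v : contains_orbit_of f v <-> f v = 0.
Proof.
rewrite /contains_orbit_of; have -> : \sum_(m <- finsupp f) f m * fixed_point R (m - v) = f v; last by [].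
have [vf|vf] := boolP (v \in finsupp f).
  rewrite (bigD1_seq v) ?fset_uniq //= /fixed_point subrr eqxx mulr1 big1 ?addr0 // => m /negPf mv.
  by rewrite subr_eq0 mv mulr0.
rewrite big1_seq => [|m /andP[_ mf]]; first by move: vf; rewrite mem_finsupp negbK => /eqP.
by rewrite /fixed_point subr_eq0; case: eqP => [e|_]; [move: vf; rewrite -e mf|rewrite mulr0].
Qed.

Lemma severi_curve_pell g c : severi_curve g c ->
  [/\ right_coef c != 0, left_coef c != 0, (g < n)%N & exists sg h tau,
    pell n k g (mid_poly c) (right_coef c * left_coef c) sg h tau].
Proof.
move=> [av int nd [K [iota [x [y [FF gen]]]]]]; have fE := section_kite c.
have nz v : vertex D v -> section_poly c v != 0.
  by move=> vv; apply/eqP => e; apply: (av _ vv); apply/contains_orbitE.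
have a0 : right_coef c != 0.
  apply: nz; split; first by apply/mono; right; left.
  exists (-1, 0) => -[i j] /mono /= [[-> h]|[|] [-> ->]]; rewrite /pairing /= ?eqxx //; lia.
have b0 : left_coef c != 0.
  apply: nz; split; first by apply/mono; right; right.
  exists (1, 0) => -[i j] /mono /= [[-> h]|[|] [-> ->]]; rewrite /pairing /= ?eqxx //; lia.
have pn : (mid_poly c)`_n != 0.
  rewrite coef_poly ltnSn; apply: nz; split; first by apply/mono; left; split=> //=; lia.
  exists (0, -1) => -[i j] /mono /= [[-> h]|[|] [-> ->]]; rewrite /pairing /= ?xpair_eqE /=; lia.
have p0 : (0 < k)%N -> (mid_poly c).[0] != 0.
  move=> k0; rewrite horner_coef0 coef_poly /=; apply: nz; split; first by apply/mono; left; split=> //=; lia.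
  exists (0, 1) => -[i j] /mono /= [[-> h]|[|] [-> ->]]; rewrite /pairing /= ?xpair_eqE /=; lia.
have sp : size (mid_poly c) = n.+1.
  apply/eqP; rewrite eqn_leq size_mid_poly /= ltnNge; apply: contraNN pn => /(nth_default _) ->.
  exact: eqxx.
have kn : (k < n)%N by lia.
have tri := nodal_no_triple k'0 fE (size_mid_poly c) a0 b0 nd p0.
by have [gn H] := kite_pell a0 b0 fE FF kn sp p0 tri gen.
Qed.

Lemma pell_no_triple (F : numFieldType) m g (p sg h tau : {poly F}) e : pell m k g p e sg h tau ->
  let P := p ^+ 2 - (4%:R * e) *: 'X^(2 * k) in
  forall r, root P r -> root P^`() r -> ~~ root P^`(2) r.
Proof.
move=> H /= r; rewrite (pell_eq H); have sep := pell_sep H (r := r).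
rewrite expr2 !(derivM, derivD) /root !(hornerM, hornerD) mulf_eq0 mulf_eq0 orbb.
move: sep; rewrite derivM /root hornerD !hornerM mulf_eq0.
set s0 := sg.[r]; set s1 := sg^`().[r]; set s2 := _.[r]; set h0 := h.[r]; set h1 := h^`().[r]; set h2 := _.[r].
case: (eqVneq s0 0) => [-> /= /(_ isT)|s00 /=].
  rewrite mul0r addr0 => sh _ _; rewrite !(mul0r, mulr0, addr0, add0r).
  have -> : (s1 * s1 + s1 * s1) * h0 = 2%:R * (s1 * (s1 * h0)) by ring.
  by move: sh; rewrite !mulf_eq0 pnatr_eq0 !negb_or => /andP[-> ->].
move=> sep h00; move: (sep h00); move/eqP: h00 => ->.
by rewrite !(mulr0, add0r) !mulf_eq0 (negPf s00) /= => /negPf ->.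
Qed.

(** For k = 0 the kite has a horizontal edge, and the condition at 0 keeps the curve free of
    singular points on its divisor. *)
Lemma pell_severi_curve g c sg h tau : right_coef c = 1 -> left_coef c = 1 ->
  pell n k g (mid_poly c) 1 sg h tau -> (mid_poly c).[0] ^+ 2 - 4%:R * 0 ^+ (2 * k) != 0 ->
  severi_curve g c.
Proof.
move=> aE bE H P0; have fE := section_kite c; rewrite aE bE in fE.
have one : (1 : C) * 1 = 1 by rewrite mulr1.
have PE := pell_eq H; have sg0 := monic_neq0 (pell_monic H).
have [r hr] : exists r, root h r.
  by apply/closed_rootP; rewrite (pell_size_h H).
have hr' : h^`().[r] != 0.
  have := pell_sep H (r := r); rewrite /root derivM hornerM hornerD !hornerM (rootP hr) !mulr0 add0r eqxx => /(_ isT).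
  by rewrite mulf_eq0 negb_or => /andP[].
have PE' : mid_poly c ^+ 2 - (4%:R * (1 * 1)) *: 'X^(2 * k) = sg ^+ 2 * h by rewrite one.
have [K [iota [x [y FF]]]] := @kite_function_field C k 1 1 (mid_poly c) _ (oner_neq0 _) fE sg h r sg0 (rootP hr) hr' PE'.
have [x0 y0 ker frac] := FF.
split.
- move=> v [vD [u uP]] /contains_orbitE; rewrite fE.
  have /mono vm := vD; case: vm => [[v1 v2]|[|] ->]; rewrite ?kite_coef1 ?kite_coefN1; try by apply/eqP/oner_neq0.
  have vE : v = (0, (absz v.2)%:Z) by case: v v1 v2 {vD uP} => i j /= -> /andP[? _]; rewrite gez0_abs.
  rewrite vE kite_coef0; have u0 : (0, 0) != v -> pairing u v < 0.
    move=> nv; have := uP (0, 0); rewrite /pairing /= !mulr0 addr0; apply=> //.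
    by apply/mono; left; split=> //; lia.
  have un : (0, n%:Z) != v -> pairing u v < u.2 * n%:Z.
    move=> nv; have := uP (0, n%:Z); rewrite [pairing u (0, _)]/pairing /= mulr0 add0r; apply=> //.
    by apply/mono; left; split=> //=; lia.
  have [vz|vz] := eqVneq (absz v.2) 0%N.
    rewrite vz -horner_coef0; have [k0|k0] := posnP k; last exact/eqP/(pell_0 H).
    have up : v != (1, k%:Z) -> pairing u v < u.1 * 1 + u.2 * k%:Z.
      by move=> _; apply: (uP (1, k%:Z)); [apply/mono; right; left|rewrite vE].
    have um : v != (-1, k%:Z) -> pairing u v < u.1 * -1 + u.2 * k%:Z.
      by move=> _; apply: (uP (-1, k%:Z)); [apply/mono; right; right|rewrite vE].
    by move: up um; rewrite vE vz k0 /pairing /= !mulr0 => /(_ isT) + /(_ isT); lia.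
  have [vn|vn] := eqVneq (absz v.2) n.
    have := pell_size H; rewrite vn => sp; apply/eqP.
    by rewrite -[n]/(n.+1.-1) -sp -/(lead_coef _) lead_coef_eq0 -size_poly_eq0 sp.
  have hu0 : pairing u v < 0 by apply: u0; rewrite vE xpair_eqE /= eq_sym.
  have hun : pairing u v < u.2 * n%:Z by apply: un; rewrite vE xpair_eqE /= eq_sym.
  exfalso; move: hu0 hun; rewrite vE /pairing /= mulr0 add0r => hu0 hun.
  have u2 : u.2 < 0 by move: hu0; rewrite pmulr_llt0 //; lia.
  case/andP: v2 => v20 v2n; move: hun; rewrite ltr_nM2l // ltz_nat ltnNge => /negP; apply.
  by rewrite -lez_nat gez0_abs.
- split; [exists (1, k%:Z)|exact: (ff_lone x0 y0 ker)|exact: (ff_prime x0 y0 ker)].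
  by rewrite fE kite_coef1 oner_neq0.
- apply: (nodal_kite k'0 fE (size_mid_poly c)); rewrite ?oner_neq0 //.
    by rewrite one; exact: (pell_no_triple H).
  by rewrite hornerD hornerN hornerZ horner_exp hornerXn one mulr1.
exists K, iota, x, y; split=> //; apply: (kite_genus (oner_neq0 _) (oner_neq0 _) fE FF).
by rewrite one; exact: H.
Qed.

End SeveriPell.

(** * Irreducible sets of lines *)

Section Cones.
Variables (F : numFieldType) (I : finType).
Local Notation V := {ffun I -> F^o}.
Implicit Types (v : V) (P : mpoly.mpoly #|I| F) (L : proj F I).

Definition eval_at v P : F := mpoly.meval (fun i => v (enum_val i)) P.

Lemma eval_at_homog v P d (la : F) : P \is mpoly.ishomog1 d mpoly.mdeg ->
  eval_at (la *: v) P = la ^+ d * eval_at v P.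
Proof.
move=> /mpoly.dhomogP hP; rewrite /eval_at !mpoly.mevalE mulr_sumr.
rewrite big_seq [RHS]big_seq; apply: eq_bigr => m /hP <-.
rewrite mulrCA; congr (_ * _).
under eq_bigr do rewrite ffunE exprMn.
by rewrite big_split /= mpoly.mdegE prodrXr.
Qed.

Lemma nonroot_ex (q : {poly F}) : q != 0 -> exists2 la, la != 0 & q.[la] != 0.
Proof.
move=> q0; pose rs : seq F := [seq i.+1%:R | i <- iota 0 (size q)].
have urs : uniq rs by rewrite map_inj_uniq ?iota_uniq // => i j /eqP; rewrite eqr_nat => /eqP[].
have [/hasP[la]|/hasPn ar] := boolP (has (fun x => ~~ root q x) rs).
  by move=> /seq.mapP[i _ ->] h; exists i.+1%:R; rewrite ?pnatr_eq0.
have all_rs : all (root q) rs by apply/allP => x /ar; rewrite negbK.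
by have := max_poly_roots q0 all_rs urs; rewrite size_map size_iota ltnn.
Qed.

Let partition P : exists N,
  (forall v, eval_at v P = \sum_(d < N) eval_at v (mpoly.pihomog mpoly.mdeg d P)) /\
  forall d v, (N <= d)%N -> eval_at v (mpoly.pihomog mpoly.mdeg d P) = 0.
Proof.
pose N := mpoly.mmeasure mpoly.mdeg P.
have E := @mpoly.pihomog_partitionE _ _ mpoly.mdeg N P (leqnn _).
exists N; split=> [v|d v Nd]; first by rewrite {1}E /eval_at raddf_sum.
rewrite E raddf_sum /eval_at raddf_sum big1 // => j _.
have jd : (nat_of_ord j != d) by rewrite neq_ltn (leq_trans (ltn_ord j) Nd).
have Z := mpoly.pihomog_ne0 jd (mpoly.pihomogP mpoly.mdeg j P).
by apply: etrans (congr1 _ Z) _; exact: mpoly.meval0.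
Qed.

Lemma homog_component v P : eval_at v P != 0 ->
  exists d, eval_at v (mpoly.pihomog mpoly.mdeg d P) != 0.
Proof.
move=> h; apply/not_existsP => no; move/negP: h; apply; apply/eqP.
have [N [-> _]] := partition P; rewrite big1 // => i _.
by apply/eqP; apply: contraT => /no.
Qed.

Lemma eval_at_scaled_ex v P d : eval_at v (mpoly.pihomog mpoly.mdeg d P) != 0 ->
  exists2 la, la != 0 & eval_at (la *: v) P != 0.
Proof.
move=> h; have [N [E Nbig]] := partition P.
pose q : {poly F} := \poly_(j < N) eval_at v (mpoly.pihomog mpoly.mdeg j P).
have qE la : q.[la] = eval_at (la *: v) P.
  rewrite horner_poly E; apply: eq_bigr => j _.
  by rewrite (eval_at_homog _ _ (mpoly.pihomogP _ _ _)) mulrC.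
have q0 : q != 0.
  have [dN|Nd] := ltnP d N; last by rewrite Nbig ?eqxx in h.
  by apply: contraNneq h => q0; have := congr1 (fun r : {poly F} => r`_d) q0; rewrite coef_poly dN coef0 => ->.
by have [la la0 hl] := nonroot_ex q0; exists la; rewrite -?qE.
Qed.

(** The polynomials are not homogeneous. A homogeneous component of each that does not vanish at the
    given vector defines a closed set of lines; off it, the polynomial is nonzero at some multiple
    of any vector of the line, since a nonzero polynomial in the scaling factor has a nonroot. *)
Lemma irreducible_meet (A : set (proj F I)) P1 P2 L1 L2 v1 v2 :
    irreducible_subset (@zariski_closed F I) A -> A L1 -> A L2 ->
    v1 \in val L1 -> v2 \in val L2 -> eval_at v1 P1 != 0 -> eval_at v2 P2 != 0 ->
  exists L, A L /\ forall v, v \in val L -> v != 0 ->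
    (exists2 la, la != 0 & eval_at (la *: v) P1 != 0) /\
    (exists2 la, la != 0 & eval_at (la *: v) P2 != 0).
Proof.
move=> [_ irr] A1 A2 v1L v2L /homog_component[d1 n1] /homog_component[d2 n2].
pose Z P : set (proj F I) := [set L : proj F I | forall p v, [set P] p -> v \in val L -> eval_at v p = 0].
have cl P d : zariski_closed (Z (mpoly.pihomog mpoly.mdeg d P)).
  by exists [set mpoly.pihomog mpoly.mdeg d P]; split=> // p ->; exists d; exact: mpoly.pihomogP.
apply: contrapT => no; case: (irr _ _ (cl P1 d1) (cl P2 d2)).
- move=> L AL; apply: contrapT => /not_orP[nZ1 nZ2]; apply: no; exists L; split=> // v vL v0.
  have span w : w \in val L -> exists mu, w = mu *: v.
    move=> wL; apply/vlineP; have := wL; apply: (subvP _ w).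
    suff /eqP -> : <[v]>%VS == val L by exact: subvv.
    by rewrite eqEdim dim_vline v0 (eqP (valP L)) leqnn andbT; exact: vL.
  have nz P d : ~ Z (mpoly.pihomog mpoly.mdeg d P) L -> eval_at v (mpoly.pihomog mpoly.mdeg d P) != 0.
    move=> nZ; apply/negP => /eqP z; apply: nZ => p w -> /span[mu ->].
    by rewrite (eval_at_homog _ _ (mpoly.pihomogP _ _ _)) z mulr0.
  by split; [exact: eval_at_scaled_ex (nz _ _ nZ1)|exact: eval_at_scaled_ex (nz _ _ nZ2)].
- by move=> /(_ _ A1) /(_ _ v1 erefl v1L) /eqP; apply/negP.
- by move=> /(_ _ A2) /(_ _ v2 erefl v2L) /eqP; apply/negP.
Qed.

End Cones.

Lemma component_through (T : Type) (closed : set (set T)) (V : set T) x : V x ->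
  exists2 A, irreducible_components closed V A & A x.
Proof.
(* The point is adjoined to every member of the family so that the empty chain has an upper bound
   too. *)
move=> Vx; pose P B := B `|` [set x] `<=` V /\ irreducible_subset closed (B `|` [set x]).
have [|A [[AV irr] maxA]] := @Zorn_bigcup T P.
  move=> G GP tot; split=> [y [[B GB By]|->] //|]; first by have [+ _] := GP _ GB; apply; left.
  split; first by exists x; right.
  move=> Z1 Z2 c1 c2 cov; apply: contrapT => /not_orP[/existsNP[y /not_implyP[yU y1]] /existsNP[z /not_implyP[zU z2]]].
  have [B [By Bz BP]] : exists B, [/\ (B `|` [set x]) y, (B `|` [set x]) z & B = set0 \/ G B].
    case: yU => [[B GB By]|yx]; case: zU => [[B' GB' Bz]|zx].
    - have [s|s] := tot _ _ GB GB'; [exists B'|exists B]; split; try (by right); left => //; exact: s.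
    - by exists B; split; [left|right|right].
    - by exists B'; split; [right|left|right].
    - by exists set0; split; [right|right|left].
  have irB : irreducible_subset closed (B `|` [set x]).
    case: BP => [->|/GP[] //]; rewrite set0U; split; first by exists x.
    by move=> W1 W2 _ _ /(_ x erefl) [h|h]; [left|right] => ? ->.
  have sub : B `|` [set x] `<=` Z1 `|` Z2.
    move=> w Bw; apply: cov; case: Bw => [Bw|->]; last by right.
    by case: BP Bw => [->//|GB] Bw; left; exists B.
  by case: (irB.2 _ _ c1 c2 sub) => h; [apply: y1|apply: z2]; exact: h.
exists (A `|` [set x]); last by right.
split=> // B BV irB AB; apply: contrapT => neq; apply: (maxA B); last first.
  by split; rewrite (_ : B `|` [set x] = B) //; apply/setUidPl => y ->; apply: AB; right.
split=> [|BA]; first by apply: subset_trans AB; left.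
by apply: neq; apply/seteqP; split=> // y /BA; left.
Qed.

(** * Invariants of families of kite curves *)

Section Families.
Variables (R : realType) (k k' : nat).
Hypothesis k'0 : (0 < k')%N.
Local Notation n := (k + k')%N.
Local Notation C := (R[i]).
Local Notation D := (kite R k k').
Local Notation V := {ffun monomials D -> C^o}.
Implicit Types c : V.

Let section_polyZ (la : C) c m : section_poly (la *: c) m = la * section_poly c m.
Proof. by rewrite !section_polyE; case: insubP => [m' _ _|_]; rewrite ?ffunE ?mulr0. Qed.

Lemma right_coefZ (la : C) c : right_coef (la *: c) = la * right_coef c.
Proof. exact: section_polyZ. Qed.

Lemma left_coefZ (la : C) c : left_coef (la *: c) = la * left_coef c.
Proof. exact: section_polyZ. Qed.

Lemma mid_polyZ (la : C) c : mid_poly (la *: c) = la *: mid_poly c.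
Proof.
apply/polyP => j; rewrite coefZ !coef_poly; case: ifP => _; last by rewrite mulr0.
exact: section_polyZ.
Qed.

(** [sg] stays monic, so [h] absorbs la^2; thus s, and with it tau, is multiplied by la. *)
Lemma pell_scale (F : numFieldType) m g (p : {poly F}) e sg h tau la : la != 0 ->
  pell m k g p e sg h tau ->
  pell m k g (la *: p) (la ^+ 2 * e) sg (la ^+ 2 *: h) (la *: tau).
Proof.
move=> la0 [sp e0 msg ssg sh E sep tauE p0]; have la2 : la ^+ 2 != 0 by rewrite expf_neq0.
split=> //.
- by rewrite size_scale.
- by rewrite mulf_neq0.
- by rewrite size_scale.
- by rewrite exprZn -[RHS]scalerAr -E scalerBr scalerA mulrCA.
- by move=> r; rewrite -scalerAr derivZ !rootZ //; exact: sep.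
- by rewrite derivZ -!scalerAr -scalerBr tauE.
by move=> k0; rewrite hornerZ mulf_neq0 // p0.
Qed.

Lemma has_root_scale (F : numClosedFieldType) g d m (h tau : {poly F}) la : la != 0 ->
  has_root k g d m h tau -> has_root k g d m (la ^+ 2 *: h) (la *: tau).
Proof.
move=> la0 [z [z0 s1 s2 L]]; exists (z.1, la^-1 *: z.2); split=> /=.
- by move: z0; rewrite scaler_eq0 invr_eq0 (negPf la0).
- exact: s1.
- exact: leq_trans (size_scale_leq _ _) s2.
have u : la^-1%:P * la%:P = 1 by rewrite -polyCM mulVf.
move: L; rewrite /Lam /= => -[L1 L2]; congr pair.
  rewrite -!mul_polyC -[RHS]L1.
  transitivity ((2 * d)%:R * ('X * z.1^`()) - (2 * k)%:R%:P * z.1 - (la^-1%:P * la%:P) * (2%:R * tau * z.2)).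
    by ring.
  by rewrite u mul1r.
rewrite !derivZ -!mul_polyC polyC_exp.
transitivity (d%:R * ('X * ((la^-1%:P * la%:P) * (la%:P * (2%:R * z.2^`() * h + z.2 * h^`())))) -
  (2 * k)%:R%:P * ((la^-1%:P * la%:P) * (la%:P * (z.2 * h))) - la%:P * (2%:R * tau * z.1)); first by ring.
rewrite u !mul1r -[RHS](mulr0 la%:P) -L2; ring.
Qed.

Lemma has_kappa_scale (F : numClosedFieldType) (p : {poly F}) e sg kappa la :
  has_kappa k p e sg kappa -> has_kappa k (la *: p) (la ^+ 2 * e) sg kappa.
Proof.
move=> [c [u [v [ce suv muv [du dv] sz]]]]; exists (la * c), u, v; split=> //; first by rewrite exprMn ce.
have E : (2%:R * (la * c)) *: 'X^k = la *: ((2%:R * c) *: 'X^k) :> {poly F} by rewrite scalerA mulrCA.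
by rewrite E -scalerBr -scalerDr; split; rewrite -mul_polyC dvdp_mull.
Qed.

Variable g : nat.

(** Points are vectors rather than lines, so that coefficients are functions; the Pell data are part
    of a point, which spares a choice. *)
Definition pell_family : Type :=
  {t : V * ({poly C} * {poly C} * {poly C}) |
    pell n k g (mid_poly t.1) (right_coef t.1 * left_coef t.1) t.2.1.1 t.2.1.2 t.2.2}.

Implicit Types t : pell_family.
Let cc t := (sval t).1.
Let sgt t := (sval t).2.1.1.
Let ht t := (sval t).2.1.2.
Let taut t := (sval t).2.2.

Let HT t : pell n k g (mid_poly (cc t)) (right_coef (cc t) * left_coef (cc t)) (sgt t) (ht t) (taut t).
Proof. exact: (svalP t). Qed.

(** Polynomials in the coefficients of the curve alone: that the Pell data are regular in this sense
    near each point is the content of [regp_sg], [regp_h] and [regp_tau]. *)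
Definition regular_on (f : pell_family -> C) : Prop :=
  exists P, forall t, f t = eval_at (sval t).1 P.

Lemma regular_ring : fun_ring regular_on.
Proof.
split=> [c|f h [P hP] [Q hQ]|f h [P hP] [Q hQ]].
- by exists (mpoly.mpolyC _ c) => t; rewrite /eval_at mpoly.mevalC.
- by exists (P + Q) => t; rewrite hP hQ /eval_at mpoly.mevalD.
- by exists (P * Q) => t; rewrite hP hQ /eval_at mpoly.mevalM.
Qed.

Let regular_coef m : regular_on (fun t => section_poly (cc t) m).
Proof.
case mD : (insub m : option (monomials D)) => [m'|].
  exists (mpoly.mpolyX C (mpoly.mnm1 (enum_rank m'))) => t.
  by rewrite section_polyE mD /eval_at mpoly.mevalXU enum_rankK.
exists 0 => t; rewrite section_polyE mD /eval_at; exact/esym/mpoly.meval0.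
Qed.

Let regular_mid t0 : regp regular_on t0 (fun t => mid_poly (cc t)).
Proof.
split; first by exists n.+1 => t; exact: size_mid_poly.
move=> i; apply: (reg_fr regular_ring); have [h|h] := ltnP i n.+1.
  have [P hP] := regular_coef (0, i%:Z); exists P => t.
  by rewrite coef_poly h hP.
by exists 0 => t; rewrite coef_poly ltnNge h /= /eval_at; exact/esym/mpoly.meval0.
Qed.

Let regular_e t0 : reg regular_on t0 (fun t => right_coef (cc t) * left_coef (cc t)).
Proof. by apply: (reg_fr regular_ring); apply: (fr_mul regular_ring); exact: regular_coef. Qed.

(** Neighbourhoods of t1 and t2 on which [Q] is constant reach a common line of [A], possibly
    through different vectors of it; the invariance of [Q] under scaling connects these. *)
Lemma family_constant (Q : pell_family -> Prop) (A : set (linear_system D)) L1 L2 t1 t2 :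
    (forall t s la, la != 0 -> cc s = la *: cc t -> sgt s = sgt t -> ht s = la ^+ 2 *: ht t ->
       taut s = la *: taut t -> Q t -> Q s) ->
    (forall t, exists2 f, regular_on f /\ f t != 0 & forall s, f s != 0 -> (Q s <-> Q t)) ->
    irreducible_subset (@zariski_closed C (monomials D)) A -> A `<=` severi D g ->
    A L1 -> A L2 -> cc t1 \in val L1 -> cc t2 \in val L2 ->
  Q t1 -> Q t2.
Proof.
move=> Qsc Qloc irr AS A1 A2 c1 c2 Q1.
have [f1 [[P1 E1] n1] l1] := Qloc t1; have [f2 [[P2 E2] n2] l2] := Qloc t2.
rewrite E1 in n1; rewrite E2 in n2.
have [L [AL H]] := irreducible_meet irr A1 A2 c1 c2 n1 n2.
have [c [cL c0 hc]] := AS _ AL.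
have [_ _ _ [sg [h [tau pc]]]] := severi_curve_pell k'0 hc.
have [[la1 la10 m1] [la2 la20 m2]] := H c cL c0.
have scaled la : la != 0 -> pell n k g (mid_poly (la *: c))
    (right_coef (la *: c) * left_coef (la *: c)) sg (la ^+ 2 *: h) (la *: tau).
  move=> la0; rewrite mid_polyZ right_coefZ left_coefZ mulrACA -expr2.
  exact: pell_scale.
pose s0 : pell_family := exist _ (c, (sg, h, tau)) pc.
pose s1 : pell_family := exist _ (la1 *: c, (sg, la1 ^+ 2 *: h, la1 *: tau)) (scaled _ la10).
pose s2 : pell_family := exist _ (la2 *: c, (sg, la2 ^+ 2 *: h, la2 *: tau)) (scaled _ la20).
have n1' : f1 s1 != 0 by rewrite (E1 s1); exact: m1.
have n2' : f2 s2 != 0 by rewrite (E2 s2); exact: m2.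
have Qs1 : Q s1 by apply: (l1 s1 n1').2.
have Qs0 : Q s0.
  apply: (Qsc s1 s0 la1^-1); rewrite ?invr_eq0 //= /cc /ht /taut /= ?scalerA ?mulVf ?scale1r //.
  by rewrite -exprMn mulVf // expr1n scale1r.
by apply: (l2 s2 n2').1; apply: (Qsc s0 s2 la2).
Qed.

Section Invariants.
Hypotheses (kk' : (k <= k')%N) (g0 : (0 < g)%N).
Let kn : (k < n)%N. Proof. by lia. Qed.
Variables (A : set (linear_system D)) (L1 L2 : linear_system D) (t1 t2 : pell_family).
Hypotheses (irr : irreducible_subset (@zariski_closed C (monomials D)) A) (AS : A `<=` severi D g).
Hypotheses (A1 : A L1) (A2 : A L2) (c1 : cc t1 \in val L1) (c2 : cc t2 \in val L2).

Lemma has_root_constant d m : (0 < d)%N -> (d * m)%N = n -> (g < m)%N ->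
  has_root k g d m (ht t1) (taut t1) -> has_root k g d m (ht t2) (taut t2).
Proof.
move=> d0 dm gm; have gn : (g < n)%N by rewrite -dm; nia.
apply: (@family_constant (fun t => has_root k g d m (ht t) (taut t)) A L1 L2) => //.
  by move=> t s la la0 _ _ -> ->; exact: has_root_scale.
move=> t; have [r|r] := pselect (has_root k g d m (ht t) (taut t)).
  have [f [rf f0] E] := root_near kn gn g0 d0 dm gm regular_ring HT (regular_mid t) (regular_e t) r.
  by exists f => // s fs; split=> // _; exact: E.
have [f [rf f0] E] := no_root_near kn gn g0 d0 dm gm regular_ring HT (regular_mid t) (regular_e t) r.
by exists f => // s fs; split=> // h; case: (E s fs).
Qed.

Lemma has_kappa_constant kappa1 kappa2 : (g < n)%N ->
  has_kappa k (mid_poly (cc t1)) (right_coef (cc t1) * left_coef (cc t1)) (sgt t1) kappa1 ->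
  has_kappa k (mid_poly (cc t2)) (right_coef (cc t2) * left_coef (cc t2)) (sgt t2) kappa2 ->
  kappa1 = kappa2.
Proof.
move=> gn hk1 hk2.
pose hk t kappa := has_kappa k (mid_poly (cc t)) (right_coef (cc t) * left_coef (cc t)) (sgt t) kappa.
have near t kappa : hk t kappa -> exists2 f, regular_on f /\ f t != 0 &
    forall s, f s != 0 -> forall kappa', hk s kappa' -> kappa' = kappa.
  exact: (kappa_near kn gn regular_ring HT (regular_mid t) (regular_e t)).
have ex t : exists kappa, hk t kappa by apply: has_kappa_ex (HT t).
have hk21 : hk t2 kappa1.
  apply: (@family_constant (fun t => hk t kappa1) A L1 L2 t1 t2) => //.
    move=> t s la la0 cE sE _ _; rewrite /hk cE sE mid_polyZ right_coefZ left_coefZ mulrACA -expr2.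
    exact: has_kappa_scale.
  move=> t; have [kap ht0] := ex t; have [f [rf f0] E] := near _ _ ht0.
  exists f => // s fs; have [kap' hs] := ex s; have kE := E _ fs _ hs; split=> h.
    by rewrite (E _ fs _ h).
  by rewrite (E _ f0 _ h) -kE.
have [f [rf f0] E] := near _ _ hk2.
exact: (E t2 f0 kappa1 hk21).
Qed.

End Invariants.
End Families.

(** * Components *)

Section Components.
Variables (R : realType) (k k' g : nat).
Hypotheses (kk' : (k <= k')%N) (k'0 : (0 < k')%N) (g0 : (0 < g)%N).
Local Notation n := (k + k')%N.
Local Notation C := (R[i]).
Local Notation D := (kite R k k').
Local Notation fam := (pell_family R k k' g).

(* The pair of the index of a sublattice and of the parameter kappa. *)
Definition labelled (l : nat * nat) (A : set (linear_system D)) : Prop :=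
  severi_components D g A /\ exists (L : linear_system D) (t : fam), [/\ A L, (sval t).1 \in val L,
    has_root k g l.1 (n %/ l.1) (sval t).2.1.2 (sval t).2.2,
    forall d', (0 < d')%N -> ~~ (d' %| l.1)%N ->
      ~ has_root k g d' (n %/ d') (sval t).2.1.2 (sval t).2.2 &
    odd l.1 -> has_kappa k (mid_poly (sval t).1) (right_coef (sval t).1 * left_coef (sval t).1)
      (sval t).2.1.1 l.2].

Definition good_label (l : nat * nat) : Prop :=
  [/\ (0 < l.1)%N, (l.1 %| n)%N, (l.1 %| 2 * k)%N, (g < n %/ l.1)%N &
    if odd l.1 then [/\ l.2 <= (n %/ l.1).-1 - g, l.2 <= g & odd l.2 = odd ((n %/ l.1).-1 - g)]%N
    else l.2 = 0%N].

Lemma labelled_ex l : good_label l -> exists A, labelled l A.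
Proof.
case: l => d kappa [/= d0 dn dk gm kap].
have dm : (d * (n %/ d))%N = n by rewrite mulnC divnK.
have dK : (d * (2 * k %/ d))%N = (2 * k)%N by rewrite mulnC divnK.
(* This uses k <= k', that is 2 k <= n: the weight x^K of the real construction needs K at most the
   degree m of q. *)
have Km : (2 * k %/ d <= n %/ d)%N by apply: leq_div2r; lia.
have kap' : odd d -> [/\ kappa <= (n %/ d).-1 - g, kappa <= g & odd kappa = odd ((n %/ d).-1 - g)]%N.
  by move=> od; move: kap; rewrite od.
have [p [sg [h [tau [H hr nr hk P0]]]]] := example_ex R dm dK d0 Km g0 gm kap'.
have [c [aE bE pE]] := kite_section k'0 1 1 (eq_leq (pell_size H)).
have Hc : pell n k g (mid_poly c) (right_coef c * left_coef c) sg h tau by rewrite aE bE pE mulr1.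
have hc : severi_curve g c.
  by apply: (pell_severi_curve k'0 aE bE (sg := sg) (h := h) (tau := tau)); rewrite pE.
have c0 : c != 0.
  apply/eqP => z; move/eqP: aE; rewrite z -(scale0r (0 : {ffun monomials D -> C^o})) right_coefZ mul0r.
  by rewrite eq_sym oner_eq0.
have dL : (\dim <[c]> == 1)%N by rewrite dim_vline c0.
pose L : linear_system D := exist _ <[c]>%VS dL.
have SL : severi D g L by exists c; split=> //; exact: memv_line.
have [A cA AL] := component_through (@zariski_closed C (monomials D)) SL.
exists A; split=> //; exists L, (exist _ (c, (sg, h, tau)) Hc); split=> //=.
- exact: memv_line.
- by move=> d' d'0 /nr; exact.
by move=> od; rewrite aE bE pE mulr1; exact: hk.
Qed.

(** A d1-th root at the first point persists at the second one, where only divisors of d2 occur; so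
    d1 divides d2, and conversely. *)
Lemma labelled_inj l1 l2 A : good_label l1 -> good_label l2 -> labelled l1 A -> labelled l2 A -> l1 = l2.
Proof.
case: l1 => d1 kap1; case: l2 => d2 kap2 [/= d10 d1n d1k gm1 k1] [/= d20 d2n d2k gm2 k2].
move=> [cA [L1 [t1 [A1 c1 r1 n1 hk1]]]] [_ [L2 [t2 [A2 c2 r2 n2 hk2]]]].
have [AS irr _] := cA.
have dm1 : (d1 * (n %/ d1))%N = n by rewrite mulnC divnK.
have dm2 : (d2 * (n %/ d2))%N = n by rewrite mulnC divnK.
have gn : (g < n)%N by apply: leq_trans gm1 (leq_div _ _).
have d12 : (d1 %| d2)%N.
  apply: contraT => nd; case: (n2 _ d10 nd).
  exact: (has_root_constant k'0 kk' g0 irr AS A1 A2 c1 c2 d10 dm1 gm1 r1).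
have d21 : (d2 %| d1)%N.
  apply: contraT => nd; case: (n1 _ d20 nd).
  exact: (has_root_constant k'0 kk' g0 irr AS A2 A1 c2 c1 d20 dm2 gm2 r2).
have dd : d1 = d2 by apply/eqP; rewrite eqn_dvd d12 d21.
rewrite -dd in k2 hk2 *; congr pair.
move: k1 k2; case: ifP => [od _ _|_ -> -> //].
exact: (has_kappa_constant k'0 kk' g0 irr AS A1 A2 c1 c2 gn (hk1 od) (hk2 od)).
Qed.

End Components.

Theorem theorem2 (R : realType) (k k' g : nat) (hk : (k <= k')%N)
    (hk' : (0 < k')%N) (hg : (1 <= g)%N) :
  (`I_(sharp R k k' g) #<= severi_components (kite R k k') g)%card.
Proof.
have [S [sS uS SP]] := sharp_labels R k hk' hg.
have good i : (i < size S)%N -> good_label k k' g (nth (0%N, 0%N) S i).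
  move=> iS; have := mem_nth (0%N, 0%N) iS; case: (nth _ _ _) => d kap /SP [h1 h2 h3 h4 h5].
  by split.
have /choice[f fP] : forall i, exists A, (i < size S)%N -> @labelled R k k' g (nth (0%N, 0%N) S i) A.
  move=> i; case: (ltnP i (size S)) => [iS|_]; last by exists set0.
  by have [A hA] := labelled_ex R hk hk' hg (good i iS); exists A.
have finj : {in `I_(size S) &, injective f}.
  move=> i j /set_mem /= iS /set_mem /= jS ff.
  have := labelled_inj hk hk' hg (good i iS) (good j jS) (fP i iS); rewrite ff => /(_ (fP j jS)) /eqP.
  by rewrite nth_uniq // => /eqP.
rewrite -sS; apply: (@card_le_trans _ _ _ (f @` `I_(size S))).
  by have /card_eqPle[] := inj_card_eq finj.
by apply: subset_card_le => A [i iS <-]; case: (fP i iS).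
Qed.
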